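(* Let $\phi\colon H\to G$ be a continuous homomorphism of locally compact groups, and let $$\epsilon=\mathrm{lt}\circ\phi\quad\text{and}\quad\delta=\overline{\mathrm{id}\otimes\pi_\phi}\circ\delta_H$$ be the associated action of $H$ on $C_0(G)$ and coaction of $G$ on $C^*(H)$, respectively. Then there is an isomorphism $$\theta\colon C_0(G)\rtimes_\epsilon H\ \xrightarrow{\ \cong\ }\ C^*(H)\rtimes_\delta G$$ such that $\overline\theta\circ i_{C_0(G)}=j_G$ and $\overline\theta\circ i_H=j_{C^*(H)}$.
   Context: $M(D)$ is the multiplier algebra of $D$; an overline on a nondegenerate homomorphism denotes its canonical extension to multiplier algebras; $\otimes$ is the minimal tensor product; $C^*(G)$ is the full group $C^*$-algebra, and elements of $G$ are identified with their canonical unitaries in $M(C^*(G))$. $\mathrm{lt}$ is left translation: $\mathrm{lt}_s(f)(t)=f(s^{-1}t)$ for $f\in C_0(G)$, $s,t\in G$. $\pi_\phi\colon C^*(H)\to M(C^*(G))$ is the integrated form of $\phi$, and $\delta_H\colon C^*(H)\to M(C^*(H)\otimes C^*(H))$ is the integrated form of $t\mapsto t\otimes t$; so $\overline\delta(t)=t\otimes\phi(t)$ for $t\in H$. A coaction of $G$ on a $C^*$-algebra $A$ is an injective nondegenerate homomorphism $\delta\colon A\to M(A\otimes C^*(G))$ with $\overline{\operatorname{span}}\,\delta(A)(1\otimes C^*(G))=A\otimes C^*(G)$ and $\overline{\delta\otimes\mathrm{id}}\circ\delta=\overline{\mathrm{id}\otimes\delta_G}\circ\delta$. Let $w_G\in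 M(C_0(G)\otimes C^*(G))$ be the unitary given by the bounded strictly continuous function $s\mapsto s\in M(C^*(G))$. A covariant homomorphism of $(A,G,\delta)$ into $M(D)$ is a pair of nondegenerate homomorphisms $\pi\colon A\to M(D)$, $\mu\colon C_0(G)\to M(D)$ with $\overline{\mu\otimes\mathrm{id}}(w_G)(\pi(c)\otimes1)\overline{\mu\otimes\mathrm{id}}(w_G)^*=\overline{\pi\otimes\mathrm{id}}(\delta(c))$ for all $c\in A$. The crossed product $A\rtimes_\delta G$ is the $C^*$-algebra generated by (the products of the images of) a universal covariant homomorphism $(j_A,j_G)$. The crossed product $C_0(G)\rtimes_\epsilon H$ is the full crossed product, with canonical maps $i_{C_0(G)}\colon C_0(G)\to M(C_0(G)\rtimes_\epsilon H)$ and $i_H$, where $i_H$ also denotes its integrated form on $C^*(H)$. *)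

(* Defs.v *)
From HB Require Import structures.
From mathcomp Require Import all_boot all_order all_algebra complex.
From mathcomp Require Import all_classical all_reals all_analysis.
Set Implicit Arguments. Unset Strict Implicit. Unset Printing Implicit Defensive.
Import Order.TTheory GRing.Theory Num.Theory.
Import numFieldNormedType.Exports.
Local Open Scope classical_set_scope.
Local Open Scope ring_scope.

(* R[i] packaged as a numClosedFieldType: the norm topology is only inferred
   from such a carrier. *)
Definition Cx (R : realType) : numClosedFieldType := R[i]%C.

HB.mixin Record isLCGroup G & Topological G & Group G := {
  mulg_continuous : continuous (fun p : G * G => (p.1 * p.2)%g) ;
  invg_continuous : continuous (fun s : G => (s^-1)%g) ;
  lcg_hausdorff : hausdorff_space G ;
  lcg_locally_compact : locally_compact [set: G]
}.

#[short(type="lcGroupType")]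
HB.structure Definition LCGroup := {G of isLCGroup G & Topological G & Group G}.

Section CxTheory.
Context {R : realType}.
Implicit Types z : Cx R.

Definition cabs z : R := complex.Re (`|z| : R[i]%C).

Lemma cabsE z : `|z| = (cabs z)%:C%C :> R[i]%C.
Proof. by rewrite /cabs normc_def. Qed.

Lemma cabs_ge0 z : 0 <= cabs z.
Proof. by rewrite -(@ler0c R) -cabsE normr_ge0. Qed.

Lemma cx_ge0 z : 0 <= z -> z = (complex.Re (z : R[i]%C))%:C%C.
Proof. by move=> z0; rewrite RRe_real// ger0_real. Qed.

Lemma ltCxR (x y : R) : ((x%:C%C : Cx R) < y%:C%C) = (x < y).
Proof. exact: ltcR. Qed.

Lemma leCxR (x y : R) : ((x%:C%C : Cx R) <= y%:C%C) = (x <= y).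
Proof. exact: lecR. Qed.

Lemma cabs_lt z (e : R) : (`|z| < e%:C%C) = (cabs z < e).
Proof. by rewrite (cabsE z) ltCxR. Qed.

Lemma cabs_le z (e : R) : (`|z| <= e%:C%C) = (cabs z <= e).
Proof. by rewrite (cabsE z) leCxR. Qed.

Lemma cx_gt0P (P : Cx R -> Prop) :
  (forall e : R, 0 < e -> P e%:C%C) -> forall e : Cx R, 0 < e -> P e.
Proof.
move=> H e e0; rewrite (cx_ge0 (ltW e0)); apply: H.
by rewrite -ltCxR -(cx_ge0 (ltW e0)).
Qed.

Lemma cabs_Re z : `|complex.Re (z : R[i]%C)| <= cabs z.
Proof. by rewrite -leCxR -cabsE; exact: normc_ge_Re. Qed.

Lemma cabs_Im z : `|complex.Im (z : R[i]%C)| <= cabs z.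
Proof.
case: z => a b; rewrite -leCxR -cabsE normc_def leCxR /= -sqrtr_sqr.
by apply: ler_wsqrtr; rewrite lerDr sqr_ge0.
Qed.

Lemma cabs_ReIm z :
  cabs z <= `|complex.Re (z : R[i]%C)| + `|complex.Im (z : R[i]%C)|.
Proof.
case: z => a b /=; rewrite /cabs normc_def /=.
rewrite -(@ler_pXn2r _ 2%N)// ?nnegrE ?sqrtr_ge0 ?addr_ge0//.
rewrite sqr_sqrtr ?addr_ge0 ?sqr_ge0// sqrrD !(real_normK (num_real _)).
by rewrite addrAC lerDl mulrn_wge0// mulr_ge0.
Qed.

Lemma Cx_complete (F : set_system (Cx R)) :
  ProperFilter F -> cauchy F -> cvg F.
Proof.
move=> FF /cauchy_ballP Fc.
have bd (p : {additive R[i]%C -> R}) : (forall z : Cx R, `|p z| <= cabs z) ->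
    cvg ((fun z : Cx R => p (z : R[i]%C)) @ F).
  move=> pb; apply: cauchy_cvg; apply/cauchy_ballP => e e0 /=.
  have /Fc : 0 < (e%:C%C : Cx R) by rewrite (ltCxR 0).
  case=> -[A B] /= [FA FB] AB; exists (p @` A, p @` B) => /=.
    split; rewrite /nbhs /=; first by apply: filterS FA => z Az; exists z.
    by apply: filterS FB => z Bz; exists z.
  move=> [_ _] /= [[a Aa <-] [b Bb <-]].
  have := AB (a, b) (conj Aa Bb); rewrite -!ball_normE /= => abe.
  by rewrite -raddfB (le_lt_trans (pb _))// -cabs_lt.
have /cvg_ex[a Fa] := bd _ cabs_Re.
have /cvg_ex[b Fb] := bd _ cabs_Im.
apply/cvg_ex; exists ((a +i* b)%C : Cx R).
apply/cvgrPdist_lt; apply: cx_gt0P => e e0.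
have e2 : 0 < e / 2 by rewrite divr_gt0.
move/cvgrPdist_lt : Fa => /(_ _ e2) Fa; move/cvgrPdist_lt : Fb => /(_ _ e2) Fb.
near=> z; rewrite cabs_lt (le_lt_trans (cabs_ReIm _))//.
rewrite [ltRHS]splitr ltrD//; [near: z|near: z].
  by apply: filterS Fa => -[].
by apply: filterS Fb => -[].
Unshelve. all: by end_near. Qed.

End CxTheory.

Section C0.
Context (R : realType) (G : lcGroupType).
Implicit Types f g : G -> Cx R.

(* f vanishes at infinity *)
Definition vanishes f :=
  forall e : Cx R, 0 < e ->
    exists K : set G, compact K /\ forall s, ~ K s -> `|f s| < e.

Definition C0_pred : {pred G -> Cx R} :=
  fun f => `[< continuous f /\ vanishes f >].

Lemma C0_submod_closed : submod_closed C0_pred.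
Proof.
split=> [|a f g /asboolP[cf vf] /asboolP[cg vg]]; apply/asboolP; split.
- by move=> s; exact: cst_continuous.
- by move=> e e0; exists set0; split=> [|s _]; [exact: compact0|rewrite normr0].
- by move=> s; apply: cvgD; [apply: cvgZ; [exact: cvg_cst|exact: cf]|exact: cg].
- move=> e e0; have a0 : 0 < `|a| + 1 by rewrite ltr_wpDl.
  have e1 : 0 < e / 2 / (`|a| + 1) by rewrite !divr_gt0.
  have e2 : 0 < e / 2 by rewrite divr_gt0.
  have [K [cK fK]] := vf _ e1; have [L [cL gL]] := vg _ e2.
  exists (K `|` L); split; first exact: compactU.
  move=> s /not_orP[Ks Ls]; rewrite /GRing.add /= (le_lt_trans (ler_normD _ _))//.
  rewrite [ltRHS]splitr ltr_leD ?(ltW (gL _ Ls))//.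
  rewrite normrZ (@le_lt_trans _ _ ((`|a| + 1) * `|f s|))//.
    by rewrite ler_wpM2r// lerDl.
  by rewrite mulrC -ltr_pdivlMr// fK.
Qed.

HB.instance Definition _ := GRing.isSubmodClosed.Build _ _ C0_pred C0_submod_closed.

Record C0 := MkC0 { C0_fun :> G -> Cx R ; C0_funP : C0_fun \in C0_pred }.

HB.instance Definition _ := [isSub for C0_fun].
HB.instance Definition _ := [Choice of C0 by <:].
HB.instance Definition _ := [SubChoice_isSubLmodule of C0 by <:].

Lemma C0_cont (f : C0) : continuous f.
Proof. by have /asboolP[] := C0_funP f. Qed.

Lemma C0_van (f : C0) : vanishes f.
Proof. by have /asboolP[] := C0_funP f. Qed.

Lemma cabs_continuous : continuous (@cabs R).
Proof.
move=> z; apply: (iffRL (@cvgrPdist_lt _ _ _ _ (nbhs_filter z) _ _)) => e e0.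
have h (u v : Cx R) : cabs u <= cabs v + cabs (u - v).
  have := ler_normD v (u - v); rewrite addrC subrK.
  by rewrite (cabsE u) (cabsE v) (cabsE (u - v)) -rmorphD leCxR.
have hs u v : cabs (u - v) = cabs (v - u) by rewrite /cabs distrC.
have e1 : 0 < (e%:C%C : Cx R) by rewrite (ltCxR 0).
apply: (@filterS _ _ (nbhs_filter z) _ _ _ (nbhsx_ballx z _ e1)) => y; rewrite -ball_normE /= cabs_lt.
apply: le_lt_trans; rewrite ler_norml lerBlDl h andbT.
by rewrite lerBrDl lerBlDr hs h.
Qed.

Lemma C0_bounded (f : C0) : exists M, forall s, cabs (f s) <= M.
Proof.
have [K [cK fK]] := C0_van f ltr01.
have cc : {within K, continuous (fun s => cabs (f s))}.
  apply: continuous_subspaceT => s; apply: continuous_comp; first exact: C0_cont.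
  exact: cabs_continuous.
have [M [_ MP]] := compact_bounded (continuous_compact cc cK).
exists (`|M| + 1) => s; have [Ks|/fK] := pselect (K s); last first.
  rewrite (_ : 1 = (1%:C)%C)// cabs_lt => /ltW/le_trans; apply.
  by rewrite lerDr.
apply: le_trans (ler_norm _) _; apply: MP; last by exists s.
by rewrite (le_lt_trans (ler_norm _))// ltrDl.
Qed.

(* The supremum norm; as elsewhere, norms take their values in Cx R. *)
Definition C0_norm (f : C0) : Cx R := (sup (range (cabs \o f)))%:C%C.

Lemma C0_has_sup (f : C0) : has_sup (range (cabs \o f)).
Proof.
split; first by exists (cabs (f 1%g)); exists 1%g.
by have [M fM] := C0_bounded f; exists M => _ [s _ <-]; exact: fM.
Qed.

Lemma C0_norm_le (f : C0) (c : Cx R) :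
  C0_norm f <= c <-> forall s, `|f s| <= c.
Proof.
split=> [fc s|fc].
  apply: le_trans fc; rewrite (cabsE (f s)) leCxR.
  by apply: ub_le_sup; [have [] := C0_has_sup f|exists s].
have c0 : 0 <= c := le_trans (normr_ge0 _) (fc 1%g).
rewrite (cx_ge0 c0) leCxR; apply: ge_sup; first by have [] := C0_has_sup f.
by move=> _ [s _ <-]; rewrite -cabs_le -(cx_ge0 c0).
Qed.

Lemma C0_ler_norm (f : C0) s : `|f s| <= C0_norm f.
Proof. by move: s; apply/C0_norm_le. Qed.

Lemma C0_normD (f g : C0) : C0_norm (f + g) <= C0_norm f + C0_norm g.
Proof.
apply/C0_norm_le => s; apply: le_trans (ler_normD _ _) _.
by rewrite lerD// C0_ler_norm.
Qed.

Lemma C0_normZ (a : Cx R) (f : C0) : C0_norm (a *: f) = `|a| * C0_norm f.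
Proof.
apply/eqP; rewrite eq_le; apply/andP; split.
  apply/C0_norm_le => s; rewrite [X in `|X|](_ : _ = a *: f s)// normrZ.
  by rewrite ler_wpM2l// C0_ler_norm.
have [->|a0] := eqVneq a 0.
  by rewrite normr0 mul0r (le_trans _ (C0_ler_norm _ 1%g)).
rewrite mulrC -ler_pdivlMr ?normr_gt0//; apply/C0_norm_le => s.
rewrite ler_pdivlMr ?normr_gt0// mulrC -normrZ.
exact: (C0_ler_norm (a *: f) s).
Qed.

Lemma C0_norm0_eq0 (f : C0) : C0_norm f = 0 -> f = 0.
Proof.
move=> f0; apply/val_inj/funext => s; apply/normr0_eq0/eqP.
by rewrite eq_le normr_ge0 andbT -f0 C0_ler_norm.
Qed.

HB.instance Definition _ :=
  Lmodule_isNormed.Build (Cx R) C0 C0_normD C0_normZ C0_norm0_eq0.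

Lemma C0_complete (F : set_system C0) : ProperFilter F -> cauchy F -> cvg F.
Proof.
move=> FF /cauchy_ballP Fc.
have Fs s : cvg ((fun f : C0 => f s) @ F).
  apply: Cx_complete; apply/cauchy_ballP => e e0 /=.
  have [[A B] /= [FA FB] AB] := Fc _ e0.
  exists ((fun f : C0 => f s) @` A, (fun f : C0 => f s) @` B) => /=.
    split; rewrite /nbhs /=; first by apply: filterS FA => z Az; exists z.
    by apply: filterS FB => z Bz; exists z.
  move=> [_ _] /= [[a Aa <-] [b Bb <-]].
  have := AB (a, b) (conj Aa Bb); rewrite -!ball_normE /=.
  by apply: le_lt_trans; exact: (C0_ler_norm (a - b) s).
pose g s := lim ((fun f : C0 => f s) @ F).
have gF (e : Cx R) : 0 < e ->
    \forall f \near F, forall s, `|g s - (f : C0) s| <= e.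
  move=> e0; have [[A B] /= [FA FB] AB] := Fc _ e0.
  apply: filterS FA => f Af s.
  apply/ler_addgt0Pr => d d0.
  have : \forall h \near F, `|g s - (h : C0) s| < d.
    by have /cvgrPdist_lt := Fs s; apply.
  move=> /(filterI FB)/filter_ex[h [Bh gh]].
  rewrite (le_trans (ler_distD (h s) _ _))// addrC lerD ?(ltW gh)//.
  have := AB (f, h) (conj Af Bh); rewrite -ball_normE /= => /ltW.
  by apply: le_trans; rewrite distrC; exact: (C0_ler_norm (f - h) s).
have gC : g \in C0_pred.
  apply/asboolP; split.
    move=> s; apply/cvgrPdist_lt => e e0.
    have e3 : 0 < e / 3 by rewrite divr_gt0.
    have [f fg] := filter_ex (gF _ e3).
    have /cvgrPdist_lt /(_ _ e3) := C0_cont (f := f) (x := s).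
    apply: filterS => t fst.
    rewrite (le_lt_trans (ler_distD (f s) _ _))//.
    rewrite (_ : e = e / 3 + (e / 3 + e / 3)); last first.
      by rewrite -!mulrDl -mulr2n -mulrS -[e *+ 3]mulr_natr mulfK// pnatr_eq0.
    rewrite ler_ltD//.
    rewrite (le_lt_trans (ler_distD (f t) _ _))// ltr_leD//.
    by rewrite distrC; exact: fg.
  move=> e e0; have e2 : 0 < e / 2 by rewrite divr_gt0.
  have [f fg] := filter_ex (gF _ e2); have [K [cK fK]] := C0_van f e2.
  exists K; split=> // s /fK fs.
  rewrite -[g s](subrK (f s)) (le_lt_trans (ler_normD _ _))//.
  by rewrite [ltRHS]splitr ler_ltD.
apply/cvg_ex; exists (MkC0 gC); apply/cvgrPdist_le => e e0.
by apply: filterS (gF _ e0) => f fg; apply/C0_norm_le.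
Qed.

HB.instance Definition _ := Uniform_isComplete.Build C0 C0_complete.

Lemma C0_mulP (f g : C0) : (fun s => f s * g s) \in C0_pred.
Proof.
apply/asboolP; split=> [s|e e0].
  by apply: cvgM; exact: C0_cont.
have M0 : 0 < C0_norm f + 1 by rewrite ltr_wpDl// (le_trans _ (C0_ler_norm f 1%g)).
have [K [cK gK]] := C0_van g (divr_gt0 e0 M0); exists K; split=> // s /gK gs.
rewrite normrM (@le_lt_trans _ _ ((C0_norm f + 1) * `|g s|))//.
  by rewrite ler_wpM2r// (le_trans (C0_ler_norm f s))// lerDl.
by rewrite mulrC -ltr_pdivlMr.
Qed.

Lemma C0_conjP (f : C0) : (fun s => Num.conj (f s)) \in C0_pred.
Proof.
apply/asboolP; split=> [s|e /(C0_van f)[K [cK fK]]]; last first.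
  by exists K; split=> // s /fK; rewrite norm_conjC.
apply/cvgrPdist_lt => e e0.
have /cvgrPdist_lt /(_ _ e0) := C0_cont (f := f) (x := s).
by apply: filterS => t; rewrite -rmorphB norm_conjC.
Qed.

Lemma C0_ltP (t : G) (f : C0) : (fun s => f (t^-1 * s)%g) \in C0_pred.
Proof.
have ct (u : G) : continuous (fun s : G => (u * s)%g).
  move=> s; apply: (@continuous_comp _ _ _ (fun s : G => (u, s))
    (fun p : G * G => (p.1 * p.2)%g) s).
    by apply: cvg_pair; [exact: cvg_cst|exact: cvg_id].
  exact: mulg_continuous.
apply/asboolP; split=> [s|e /(C0_van f)[K [cK fK]]].
  by apply: (@continuous_comp _ _ _ (fun s => (t^-1 * s)%g) f); [exact: ct|exact: C0_cont].
exists ((fun s => (t * s)%g) @` K); split.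
  by apply: continuous_compact cK; apply: continuous_subspaceT => s; exact: ct.
by move=> s nK; apply: fK => Ks; apply: nK; exists (t^-1 * s)%g; rewrite ?mulVKg.
Qed.

Definition C0_mul (f g : C0) : C0 := MkC0 (C0_mulP f g).
Definition C0_conj (f : C0) : C0 := MkC0 (C0_conjP f).
Definition C0_lt (t : G) (f : C0) : C0 := MkC0 (C0_ltP t f).

End C0.


Reserved Notation "x ** y" (at level 40, left associativity).

Record cstarAlg (R : realType) := CStarAlg {
  cs_sort :> completeNormedModType (Cx R) ;
  cs_mul : cs_sort -> cs_sort -> cs_sort ;
  cs_star : cs_sort -> cs_sort ;
  cs_mulA : forall x y z, cs_mul x (cs_mul y z) = cs_mul (cs_mul x y) z ;
  cs_mulDl : forall (a : Cx R) x y z,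
    cs_mul (a *: x + y) z = a *: cs_mul x z + cs_mul y z ;
  cs_mulDr : forall (a : Cx R) x y z,
    cs_mul z (a *: x + y) = a *: cs_mul z x + cs_mul z y ;
  cs_starK : forall x, cs_star (cs_star x) = x ;
  cs_starM : forall x y, cs_star (cs_mul x y) = cs_mul (cs_star y) (cs_star x) ;
  cs_starD : forall (a : Cx R) x y,
    cs_star (a *: x + y) = Num.conj a *: cs_star x + cs_star y ;
  cs_normM : forall x y, `|cs_mul x y| <= `|x| * `|y| ;
  cs_norm_star : forall x, `|cs_mul (cs_star x) x| = `|x| ^+ 2
}.

Arguments cs_mul {R c}.
Arguments cs_star {R c}.
Notation "x ** y" := (cs_mul x y) : ring_scope.

Section CstarTheory.
Context {R : realType} {A : cstarAlg R}.
Implicit Types (x y z : A) (a : Cx R).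

Lemma cs_mul0x x : 0 ** x = 0.
Proof.
have := cs_mulDl 1 0 0 x; rewrite !scale1r addr0 => /esym/eqP.
by rewrite addrC -subr_eq0 addrK => /eqP.
Qed.

Lemma cs_mulx0 x : x ** 0 = 0.
Proof.
have := cs_mulDr 1 0 0 x; rewrite !scale1r addr0 => /esym/eqP.
by rewrite addrC -subr_eq0 addrK => /eqP.
Qed.

Lemma cs_mulxD z x y : z ** (x + y) = z ** x + z ** y.
Proof. by have := cs_mulDr 1 x y z; rewrite !scale1r. Qed.

Lemma cs_mulDx z x y : (x + y) ** z = x ** z + y ** z.
Proof. by have := cs_mulDl 1 x y z; rewrite !scale1r. Qed.

Lemma cs_mulxZ a x y : x ** (a *: y) = a *: (x ** y).
Proof. by have := cs_mulDr a y 0 x; rewrite !addr0 cs_mulx0 addr0. Qed.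

Lemma cs_mulZx a x y : (a *: x) ** y = a *: (x ** y).
Proof. by have := cs_mulDl a x 0 y; rewrite !addr0 cs_mul0x addr0. Qed.

Lemma cs_left_faithful x y : (forall a : A, a ** x = a ** y) -> x = y.
Proof.
move=> axy; apply/eqP; rewrite -subr_eq0 -normr_eq0 -sqrf_eq0.
rewrite -cs_norm_star cs_mulxD -[- y]scaleN1r cs_mulxZ -axy !scaleN1r subrr.
by rewrite normr0.
Qed.

Lemma cs_right_faithful x y : (forall a : A, x ** a = y ** a) -> x = y.
Proof.
move=> xya; rewrite -[x]cs_starK -[y]cs_starK; congr cs_star.
by apply: cs_left_faithful => a; rewrite -[a]cs_starK -!cs_starM xya.
Qed.

End CstarTheory.

Section C0_cstar.
Context (R : realType) (G : lcGroupType).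
Implicit Types f g h : C0 R G.

Lemma C0_norm_mul f g : `|C0_mul f g| <= `|f| * `|g|.
Proof.
apply/C0_norm_le => s; rewrite normrM ler_pM//; exact: C0_ler_norm.
Qed.

Lemma C0_norm_star f : `|C0_mul (C0_conj f) f| = `|f| ^+ 2.
Proof.
have ns s : `|C0_mul (C0_conj f) f s| = `|f s| ^+ 2.
  by rewrite /= normrM norm_conjC expr2.
apply/eqP; rewrite eq_le; apply/andP; split.
  by apply/C0_norm_le => s; rewrite ns lerXn2r ?nnegrE//; exact: C0_ler_norm.
rewrite -[leRHS]sqrtCK lerXn2r ?nnegrE ?sqrtC_ge0//; apply/C0_norm_le => s.
rewrite -(@ler_pXn2r _ 2%N)// ?nnegrE ?sqrtC_ge0// sqrtCK -ns.
exact: C0_ler_norm.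
Qed.

Lemma C0_lin (a : Cx R) f g s : (a *: f + g) s = a * f s + g s.
Proof. by []. Qed.

Lemma C0_eq f g : (forall s, f s = g s) -> f = g.
Proof. by move=> fg; apply/val_inj/funext. Qed.

Definition C0_cstar : cstarAlg R.
Proof.
apply: (@CStarAlg R (C0 R G) (@C0_mul R G) (@C0_conj R G)).
- by move=> f g h; apply: C0_eq => s; rewrite /= mulrA.
- move=> a f g h; apply: C0_eq => s.
  change ((a * f s + g s) * h s = a * (f s * h s) + g s * h s).
  by rewrite mulrDl mulrA.
- move=> a f g h; apply: C0_eq => s.
  change (h s * (a * f s + g s) = a * (h s * f s) + h s * g s).
  by rewrite mulrDr mulrCA.
- by move=> f; apply: C0_eq => s; rewrite /= conjCK.
- by move=> f g; apply: C0_eq => s; rewrite /= rmorphM mulrC.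
- move=> a f g; apply: C0_eq => s.
  change (Num.conj (a * f s + g s) = Num.conj a * Num.conj (f s) + Num.conj (g s)).
  by rewrite rmorphD rmorphM.
- exact: C0_norm_mul.
- exact: C0_norm_star.
Defined.

End C0_cstar.


(* A multiplier is a double centralizer in the sense of Busby: linearity,
   boundedness and the module identities of ml and mr follow from mP. *)
Record mult (R : realType) (D : cstarAlg R) := Mult {
  ml : D -> D ;
  mr : D -> D ;
  mP : forall a b, a ** ml b = mr a ** b
}.

Section Mult.
Context {R : realType} {D : cstarAlg R}.
Implicit Types (m n p : mult D) (a b : D).

HB.instance Definition _ := gen_eqMixin (mult D).
HB.instance Definition _ := gen_choiceMixin (mult D).

Lemma mult_eq m n : (forall a, ml m a = ml n a) -> (forall a, mr m a = mr n a) ->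
  m = n.
Proof.
case: m n => l r H [l' r' H'] /= /funext e1 /funext e2; subst.
by congr Mult; exact: Prop_irrelevance.
Qed.

Lemma madd_subproof m n a b :
  a ** (ml m b + ml n b) = (mr m a + mr n a) ** b.
Proof. by rewrite cs_mulxD cs_mulDx !mP. Qed.
Definition madd m n := Mult (madd_subproof m n).

Lemma mscale_subproof (c : Cx R) m a b :
  a ** (c *: ml m b) = (c *: mr m a) ** b.
Proof. by rewrite cs_mulxZ cs_mulZx mP. Qed.
Definition mscale c m := Mult (mscale_subproof c m).

Lemma mzero_subproof a b : a ** (0 : D) = (0 : D) ** b.
Proof. by rewrite cs_mulx0 cs_mul0x. Qed.
Definition mzero := Mult mzero_subproof.

Lemma mone_subproof a b : a ** b = a ** b. Proof. by []. Qed.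
Definition mone := @Mult R D id id mone_subproof.

Lemma mmul_subproof m n a b : a ** ml m (ml n b) = mr n (mr m a) ** b.
Proof. by rewrite !mP. Qed.
Definition mmul m n := Mult (mmul_subproof m n).

Lemma mstar_subproof m a b :
  a ** cs_star (mr m (cs_star b)) = cs_star (ml m (cs_star a)) ** b.
Proof.
by rewrite -[LHS]cs_starK cs_starM cs_starK -mP cs_starM cs_starK.
Qed.
Definition mstar m := Mult (mstar_subproof m).

Lemma membed_subproof (d a b : D) : a ** (d ** b) = (a ** d) ** b.
Proof. by rewrite cs_mulA. Qed.
(* The canonical embedding of D into M(D). *)
Definition membed d := Mult (membed_subproof d).

Fact maddA : associative madd.
Proof. by move=> m n p; apply: mult_eq => a /=; rewrite addrA. Qed.
Fact maddC : commutative madd.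
Proof. by move=> m n; apply: mult_eq => a /=; rewrite addrC. Qed.
Fact madd0 : left_id mzero madd.
Proof. by move=> m; apply: mult_eq => a /=; rewrite add0r. Qed.
Fact maddN : left_inverse mzero (mscale (-1)) madd.
Proof. by move=> m; apply: mult_eq => a /=; rewrite scaleN1r addNr. Qed.

HB.instance Definition _ :=
  GRing.isZmodule.Build (mult D) maddA maddC madd0 maddN.

Lemma ml_linear m : linear (ml m).
Proof.
move=> c x y; apply: cs_left_faithful => a.
by rewrite cs_mulxD cs_mulxZ !mP cs_mulxD cs_mulxZ.
Qed.

Lemma mr_linear m : linear (mr m).
Proof.
move=> c x y; apply: cs_right_faithful => b.
by rewrite cs_mulDx cs_mulZx -!mP cs_mulDx cs_mulZx.
Qed.

Fact mmulA : associative mmul.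
Proof. by move=> m n p; apply: mult_eq. Qed.
Fact mmul1 : left_id mone mmul.
Proof. by move=> m; apply: mult_eq. Qed.
Fact mmulr1 : right_id mone mmul.
Proof. by move=> m; apply: mult_eq. Qed.
Fact mmulDl : left_distributive mmul +%R.
Proof.
move=> m n p; apply: mult_eq => a //=.
by have := mr_linear p 1 (mr m a) (mr n a); rewrite !scale1r.
Qed.
Fact mmulDr : right_distributive mmul +%R.
Proof.
move=> m n p; apply: mult_eq => a //=.
by have := ml_linear m 1 (ml n a) (ml p a); rewrite !scale1r.
Qed.

HB.instance Definition _ :=
  GRing.Zmodule_isPzRing.Build (mult D) mmulA mmul1 mmulr1 mmulDl mmulDr.

Fact mscaleA c d m : mscale c (mscale d m) = mscale (c * d) m.
Proof. by apply: mult_eq => a /=; rewrite scalerA. Qed.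
Fact mscale1 : left_id 1 mscale.
Proof. by move=> m; apply: mult_eq => a /=; rewrite scale1r. Qed.
Fact mscaleDr : right_distributive mscale +%R.
Proof. by move=> c m n; apply: mult_eq => a /=; rewrite scalerDr. Qed.
Fact mscaleDl m c d : mscale (c + d) m = mscale c m + mscale d m.
Proof. by apply: mult_eq => a /=; rewrite scalerDl. Qed.

HB.instance Definition _ :=
  GRing.Zmodule_isLmodule.Build (Cx R) (mult D) mscaleA mscale1 mscaleDr mscaleDl.

End Mult.

Section Density.
Context {R : realType}.

Definition lspan (V : lmodType (Cx R)) (S : set V) : set V :=
  [set x | exists n (c : 'I_n -> Cx R) (v : 'I_n -> V),
    (forall i, S (v i)) /\ x = \sum_i c i *: v i].

Definition total (V : normedModType (Cx R)) (S : set V) : Prop :=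
  closure (lspan S) = [set: V].

(* The C*-subalgebra generated by S is all of A. *)
Definition generates (A : cstarAlg R) (S : set A) : Prop :=
  forall B : set A, closed B ->
    (forall (c : Cx R) x y, B x -> B y -> B (c *: x + y)) ->
    (forall x y, B x -> B y -> B (x ** y)) ->
    (forall x, B x -> B (cs_star x)) ->
    S `<=` B -> B = [set: A].

End Density.

Section Hom.
Context {R : realType}.
Implicit Types A B D : cstarAlg R.

Definition is_hom A D (pi : A -> mult D) : Prop :=
  [/\ linear pi,
      forall a b, pi (a ** b) = pi a * pi b &
      forall a, pi (cs_star a) = mstar (pi a)].

Definition nondeg_hom A D (pi : A -> mult D) : Prop :=
  is_hom pi /\ total [set x | exists a d, x = ml (pi a) d].

(* The canonical extension of a nondegenerate pi to M(A): the unique n with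
   n (pi(a) d) = pi(m a) d for all a and d. Here and below xget selects the
   unique object with a property; its default value is never reached for
   nondegenerate homomorphisms and unitary_homs. *)
Definition mext A D (pi : A -> mult D) (m : mult A) : mult D :=
  xget 0 [set n | forall a, n * pi a = pi (ml m a)].

Definition star_iso A B (theta : A -> B) : Prop :=
  [/\ linear theta,
      forall a b, theta (a ** b) = theta a ** theta b,
      forall a, theta (cs_star a) = cs_star (theta a) &
      bijective theta].

Definition is_unitary D (u : mult D) : Prop :=
  mstar u * u = 1 /\ u * mstar u = 1.

(* Strictly continuous homomorphisms of G into the unitary group of M(D). *)
Definition unitary_hom (G : lcGroupType) D (U : G -> mult D) : Prop :=
  [/\ forall s t, U (s * t)%g = U s * U t,
      forall s, is_unitary (U s) &
      forall d, continuous (fun s => ml (U s) d) /\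
                continuous (fun s => mr (U s) d)].

End Hom.


Record hilbert (R : realType) := Hilbert {
  h_sort :> completeNormedModType (Cx R) ;
  ip : h_sort -> h_sort -> Cx R ;
  ip_linear : forall (a : Cx R) x y z, ip (a *: x + y) z = a * ip x z + ip y z ;
  ip_conj : forall x y, ip y x = Num.conj (ip x y) ;
  ip_norm : forall x, ip x x = `|x| ^+ 2
}.

Section Tensor.
Context {R : realType}.
Implicit Types (A B D E : cstarAlg R) (H K : hilbert R).

Definition is_rep A H (rho : A -> H -> H) : Prop :=
  [/\ forall (c : Cx R) a b x, rho (c *: a + b) x = c *: rho a x + rho b x,
      forall a, linear (rho a) /\ exists M : Cx R, forall x, `|rho a x| <= M * `|x|,
      forall a b x, rho (a ** b) x = rho a (rho b x),
      forall a x y, ip (rho a x) y = ip x (rho (cs_star a) y) &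
      total [set y | exists a x, y = rho a x]].

(* The squared norm of \sum_i x i (x) y i in the Hilbert space tensor product
   of H and K. *)
Definition tensor_norm2 H K (I : finType) (x : I -> H) (y : I -> K) : Cx R :=
  \sum_i \sum_j ip (x i) (x j) * ip (y i) (y j).

(* The norm of \sum_i rho (a i) (x) sigma (b i) on the Hilbert space tensor
   product of H and K is at most c; vectors of the algebraic tensor product
   suffice. *)
Definition tensor_op_le A B H K (rho : A -> H -> H) (sigma : B -> K -> K)
    n (a : 'I_n -> A) (b : 'I_n -> B) (c : Cx R) : Prop :=
  forall m (x : 'I_m -> H) (y : 'I_m -> K),
    tensor_norm2 (fun p : 'I_n * 'I_m => rho (a p.1) (x p.2))
                 (fun p : 'I_n * 'I_m => sigma (b p.1) (y p.2))
    <= c ^+ 2 * tensor_norm2 x y.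

(* The completion of the algebraic tensor product of A and B in the spatial
   norm, the supremum of the norms of (rho (x) sigma)(z) over all pairs of
   representations. *)
Record min_tensor A B := MinTensor {
  mt_alg :> cstarAlg R ;
  pure : A -> B -> mt_alg ;
  pure_linl : forall (c : Cx R) a a' b,
    pure (c *: a + a') b = c *: pure a b + pure a' b ;
  pure_linr : forall (c : Cx R) a b b',
    pure a (c *: b + b') = c *: pure a b + pure a b' ;
  pure_mul : forall a a' b b', pure a b ** pure a' b' = pure (a ** a') (b ** b') ;
  pure_star : forall a b, cs_star (pure a b) = pure (cs_star a) (cs_star b) ;
  pure_total : total [set z | exists a b, z = pure a b] ;
  pure_norm : forall n (a : 'I_n -> A) (b : 'I_n -> B) (c : Cx R), 0 <= c ->
    (`|\sum_i pure (a i) (b i)| <= c <->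
     forall H K (rho : A -> H -> H) (sigma : B -> K -> K),
       is_rep rho -> is_rep sigma -> tensor_op_le rho sigma a b c)
}.

Context (T : forall A B, min_tensor A B).

(* m (x) n in M(A (x) B); determined by its left action on elementary tensors. *)
Definition mtensor A B (m : mult A) (n : mult B) : mult (T A B) :=
  xget 0 [set k | forall a b,
    ml k (pure (T A B) a b) = pure (T A B) (ml m a) (ml n b)].

(* pi (x) rho, a homomorphism into M(D (x) E) *)
Definition hom_tensor A B D E (pi : A -> mult D) (rho : B -> mult E) :
    T A B -> mult (T D E) :=
  xget (fun=> 0) [set F | is_hom F /\
    forall a b, F (pure (T A B) a b) = mtensor (pi a) (rho b)].

End Tensor.

Arguments mtensor {R} T {A B} m n.
Arguments hom_tensor {R} T {A B D E} pi rho.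


Section Haar.
Context {R : realType} {G : lcGroupType}.
Implicit Types f g : G -> Cx R.

Definition Cc f : Prop :=
  continuous f /\ exists K, compact K /\ forall s, ~ K s -> f s = 0.

(* A left Haar measure, as a positive linear functional on C_c(G), together with
   its modular function. *)
Record haar := Haar {
  hint : (G -> Cx R) -> Cx R ;
  modular : G -> Cx R ;
  hint_linear : forall (a : Cx R) f g, Cc f -> Cc g ->
    hint (fun s => a * f s + g s) = a * hint f + hint g ;
  hint_ge0 : forall f, Cc f -> (forall s, 0 <= f s) -> 0 <= hint f ;
  hint_neq0 : exists f, Cc f /\ hint f != 0 ;
  hint_left : forall t f, Cc f -> hint (fun s => f (t * s)%g) = hint f ;
  modular_gt0 : forall t, 0 < modular t ;
  hint_right : forall t f, Cc f ->
    modular t * hint (fun s => f (s * t)%g) = hint f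
}.

Context (mu : haar).

Definition norm1 f : Cx R := hint mu (fun s => `|f s|).

Definition conv f g : G -> Cx R :=
  fun t => hint mu (fun s => f s * g (s^-1 * t)%g).

Definition invol f : G -> Cx R :=
  fun s => modular mu (s^-1)%g * Num.conj (f (s^-1)%g).

(* *-homomorphisms of the convolution algebra C_c(G), contractive for the
   L^1-norm, into a C*-algebra: these are the *-homomorphisms of L^1(G). *)
Definition L1_hom (D : cstarAlg R) (psi : (G -> Cx R) -> D) : Prop :=
  [/\ forall (a : Cx R) f g, Cc f -> Cc g ->
        psi (fun s => a * f s + g s) = a *: psi f + psi g,
      forall f g, Cc f -> Cc g -> psi (conv f g) = psi f ** psi g,
      forall f, Cc f -> psi (invol f) = cs_star (psi f) &
      forall f, Cc f -> `|psi f| <= norm1 f].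

(* The enveloping C*-algebra of L^1(G): the completion of C_c(G) in the largest
   C*-seminorm dominated by the L^1-norm. *)
Record group_cstar := GroupCstar {
  gc_alg :> cstarAlg R ;
  gc_map : (G -> Cx R) -> gc_alg ;
  gc_hom : L1_hom gc_map ;
  gc_dense : closure (gc_map @` Cc) = [set: gc_alg] ;
  gc_max : forall (D : cstarAlg R) (psi : (G -> Cx R) -> D),
    L1_hom psi -> forall f, Cc f -> `|psi f| <= `|gc_map f|
}.

Context (C : group_cstar).

(* The canonical unitary of s in M(C*(G)). *)
Definition gunit (s : G) : mult C :=
  xget 0 [set u | forall f, Cc f ->
    ml u (gc_map C f) = gc_map C (fun t => f (s^-1 * t)%g)].

(* The integrated form of U: the unique nondegenerate homomorphism of C*(G)
   whose extension to M(C*(G)) restricts to U on G. *)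
Definition integrated (D : cstarAlg R) (U : G -> mult D) : C -> mult D :=
  xget (fun=> 0) [set pi | nondeg_hom pi /\ forall s, mext pi (gunit s) = U s].

End Haar.

Arguments haar R G : clear implicits.
Arguments gunit {R G mu} C s.
Arguments integrated {R G mu} C {D} U.


Section ActionCrossedProduct.
Context {R : realType} {H : lcGroupType} {mu : haar R H} (CH : group_cstar mu).
Context {A : cstarAlg R} (alpha : H -> A -> A).

Definition covariant (D : cstarAlg R) (pi : A -> mult D) (U : H -> mult D) : Prop :=
  [/\ nondeg_hom pi, unitary_hom U &
      forall t a, pi (alpha t a) = U t * pi a * mstar (U t)].

(* (B, iA, iH) is the full crossed product of A by alpha, as the universal
   covariant homomorphism; integrated CH iH is the integrated form of iH. *)
Definition is_crossed_product (B : cstarAlg R) (iA : A -> mult B) (iH : H -> mult B) :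
    Prop :=
  [/\ covariant iA iH,
      forall (D : cstarAlg R) (pi : A -> mult D) (U : H -> mult D), covariant pi U ->
        exists Phi : B -> mult D, nondeg_hom Phi /\
          (forall a, mext Phi (iA a) = pi a) /\ (forall t, mext Phi (iH t) = U t),
      forall a c, exists b, iA a * integrated CH iH c = membed b &
      total [set b | exists a c, membed b = iA a * integrated CH iH c]].

End ActionCrossedProduct.

Section CoactionCrossedProduct.
Context {R : realType} (T : forall A B : cstarAlg R, min_tensor A B).
Context {G : lcGroupType} {mu : haar R G} (CG : group_cstar mu).

(* Evaluation at s tensored with the identity of C*(G). *)
Definition ev_tensor (s : G) : T (C0_cstar R G) CG -> mult CG :=
  xget (fun=> 0) [set F | is_hom F /\
    forall (f : C0 R G) c, F (pure (T (C0_cstar R G) CG) f c) = membed (f s *: c)].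

(* The multiplier of C_0(G) (x) C*(G) given by the function s |-> s, under the
   identification of M(C_0(G) (x) C*(G)) with the bounded strictly continuous
   functions G -> M(C*(G)); its value at s is the image under ev_tensor s. *)
Definition wG : mult (T (C0_cstar R G) CG) :=
  xget 0 [set w | forall s, mext (ev_tensor s) w = gunit CG s].

Context {A : cstarAlg R} (delta : A -> mult (T A CG)).

Definition coaction_covariant (D : cstarAlg R) (pi : A -> mult D)
    (nu : C0_cstar R G -> mult D) : Prop :=
  let W := mext (hom_tensor T nu (@membed R CG)) wG in
  [/\ nondeg_hom pi, nondeg_hom nu &
      forall c, W * mtensor T (pi c) 1 * mstar W =
                mext (hom_tensor T pi (@membed R CG)) (delta c)].

(* (E, jA, jG) is the crossed product of A by delta: E is the C*-algebra
   generated by the products jA(a) jG(f) of a universal covariant homomorphism. *)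
Definition is_coaction_crossed_product (E : cstarAlg R) (jA : A -> mult E)
    (jG : C0_cstar R G -> mult E) : Prop :=
  [/\ coaction_covariant jA jG,
      forall (D : cstarAlg R) (pi : A -> mult D) (nu : C0_cstar R G -> mult D),
        coaction_covariant pi nu ->
        exists Phi : E -> mult D, nondeg_hom Phi /\
          (forall a, mext Phi (jA a) = pi a) /\ (forall f, mext Phi (jG f) = nu f),
      forall a f, exists e, jA a * jG f = membed e &
      generates [set e | exists a f, membed e = jA a * jG f]].

End CoactionCrossedProduct.

Arguments ev_tensor {R} T {G mu} CG s.
Arguments wG {R} T {G mu} CG.
Arguments coaction_covariant {R} T {G mu} CG {A} delta {D} pi nu.
Arguments is_coaction_crossed_product {R} T {G mu} CG {A} delta {E} jA jG.

Section Associated.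
Context {R : realType} (T : forall A B : cstarAlg R, min_tensor A B).
Context {H G : lcGroupType} {muH : haar R H} {muG : haar R G}.
Context (CH : group_cstar muH) (CG : group_cstar muG) (phi : H -> G).

Definition assoc_action (t : H) (f : C0_cstar R G) : C0_cstar R G :=
  C0_lt (phi t) f.

Definition delta_group : CH -> mult (T CH CH) :=
  integrated CH (fun t => mtensor T (gunit CH t) (gunit CH t)).

Definition pi_phi : CH -> mult CG := integrated CH (fun t => gunit CG (phi t)).

Definition assoc_coaction (c : CH) : mult (T CH CG) :=
  mext (hom_tensor T (@membed R CH) pi_phi) (delta_group c).

End Associated.

Arguments delta_group {R} T {H muH} CH c.
Arguments pi_phi {R H G muH muG} CH CG phi c.
Arguments assoc_coaction {R} T {H G muH muG} CH CG phi c.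

(* Main.v *)
From Pilot Require Import Defs.
From HB Require Import structures.
From mathcomp Require Import all_boot all_order all_algebra complex.
From mathcomp Require Import all_classical all_reals all_analysis.
From mathcomp Require Import ring lra.
Import Pilot.Defs.
Set Implicit Arguments. Unset Strict Implicit. Unset Printing Implicit Defensive.
Import Order.TTheory GRing.Theory Num.Theory.
Import numFieldNormedType.Exports.
Local Open Scope classical_set_scope.
Local Open Scope ring_scope.

(** Write W = (nu (x) id)(w_G) for a nondegenerate homomorphism nu of C_0(G) into
    M(D), and let U be a strictly continuous unitary homomorphism of H into M(D)
    with integrated form pi. Then (pi, nu) is covariant for the coaction delta iff
    W (U_t (x) 1) W^* = U_t (x) phi(t) for all t, since both sides of the
    covariance condition are nondegenerate in c and hence determined by their
    values on H. On the other hand the homomorphisms Ad U_t o nu and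
    nu o lt_{phi(t)} send w_G to (U_t (x) 1) W (U_t (x) 1)^* and
    (1 (x) phi(t)^* ) W respectively, and nu is determined by W: slicing W with
    coefficients of the regular representation of G gives nu on a dense subset of
    C_0(G). Hence (nu, U) is covariant for the action iff the same identity holds.
    So both crossed products are universal for the same pairs, and the two
    homomorphisms given by universality are inverse to each other. *)

(** Spectral theory is replaced by algebra: positive means being the square of a self-adjoint
    operator, roots come from a power series, and order estimates yield norm bounds. One device
    recurs. If $\|m\|\le t$, the defect $k=(t^2-m^*m)^{1/2}$ turns the bound into the identity
    $m^*m+k^*k=t^2$. An identity survives homomorphisms and tensoring, so maps prescribed on vectors
    such as $\pi(a)d$ or $a\otimes b$ extend with control of the norm. The spatial norm is specified
    by all pairs of representations. To read norms of a single factor off it, representations must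
    be plentiful; Hahn-Banach, states and GNS serve this purpose and give evaluations and slice
    maps. With them $C_0(G)\otimes D$ becomes $C_0(G,D)$, where $w_G$ is built and computed
    pointwise. The regular representation suffices for recovering nu, although $C^*(G)$ is the full
    algebra: only coefficients that span a dense subspace of $C_0(G)$ are needed, not a faithful
    representation. *)

Section Cabs.
Context {R : realType}.
Implicit Types (z w : Cx R).

Lemma Cx_eqP z w : z = w <->
  complex.Re (z : R[i]%C) = complex.Re (w : R[i]%C) /\
  complex.Im (z : R[i]%C) = complex.Im (w : R[i]%C).
Proof.
split=> [->//|]; case: z w => a b [c d] /= [-> ->] //.
Qed.

Lemma cabsC (r : R) : cabs (r%:C%C : Cx R) = `|r|.
Proof. by rewrite /cabs normc_def /= expr0n addr0 sqrtr_sqr. Qed.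

Lemma cabs0 : cabs (0 : Cx R) = 0.
Proof. by rewrite (cabsC 0) normr0. Qed.

Lemma cabs1 : cabs (1 : Cx R) = 1.
Proof. by rewrite (cabsC 1) normr1. Qed.

Lemma realC_inj (r s : R) : (r%:C%C : Cx R) = s%:C%C -> r = s.
Proof. by move=> /(congr1 (fun z : Cx R => complex.Re (z : R[i]%C))). Qed.

Lemma realCM (r s : R) : ((r * s)%:C%C : Cx R) = r%:C%C * s%:C%C.
Proof. exact: rmorphM. Qed.

Lemma realCD (r s : R) : ((r + s)%:C%C : Cx R) = r%:C%C + s%:C%C.
Proof. exact: rmorphD. Qed.

Lemma realCB (r s : R) : ((r - s)%:C%C : Cx R) = r%:C%C - s%:C%C.
Proof. exact: rmorphB. Qed.

Lemma realCX (r : R) n : ((r ^+ n)%:C%C : Cx R) = r%:C%C ^+ n.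
Proof. exact: rmorphXn. Qed.

Lemma conj_realC (r : R) : Num.conj (r%:C%C : Cx R) = r%:C%C.
Proof. exact: conjc_real. Qed.

Lemma cconjM z w : Num.conj (z * w) = Num.conj z * Num.conj w.
Proof. exact: rmorphM. Qed.

Lemma cconjD z w : Num.conj (z + w) = Num.conj z + Num.conj w.
Proof. exact: rmorphD. Qed.

Lemma cconjN z : Num.conj (- z) = - Num.conj z.
Proof. exact: rmorphN. Qed.

Lemma realCN (r : R) : ((- r)%:C%C : Cx R) = - r%:C%C.
Proof. exact: rmorphN. Qed.

Lemma cabsM z w : cabs (z * w) = cabs z * cabs w.
Proof. by apply: realC_inj; rewrite realCM -!cabsE normrM. Qed.

Lemma cabsD z w : cabs (z + w) <= cabs z + cabs w.
Proof. by rewrite -leCxR realCD -!cabsE ler_normD. Qed.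

Lemma cabsN z : cabs (- z) = cabs z.
Proof. by rewrite /cabs normrN. Qed.

Lemma cabs_conj z : cabs (Num.conj z) = cabs z.
Proof. by rewrite /cabs norm_conjC. Qed.

Lemma cabs_eq0 z : cabs z = 0 -> z = 0.
Proof. by move=> z0; apply/normr0_eq0; rewrite (cabsE z) z0. Qed.

Lemma conj_mulC z : z * Num.conj z = ((cabs z) ^+ 2)%:C%C.
Proof. by rewrite -normCK (cabsE z) realCX. Qed.

End Cabs.

(** * Real-valued norms, spans and density *)

Section RealNorm.
Context {R : realType}.

Definition rnorm (V : normedModType (Cx R)) (x : V) : R :=
  complex.Re (`|x| : R[i]%C).

Context {V : normedModType (Cx R)}.
Implicit Types (x y z : V).

Lemma rnormE x : `|x| = (rnorm x)%:C%C :> Cx R.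
Proof. exact: cx_ge0 (normr_ge0 x). Qed.

Lemma rnorm_ge0 x : 0 <= rnorm x.
Proof. rewrite -(leCxR 0) -rnormE; exact: normr_ge0. Qed.

Lemma rnorm0 : rnorm (0 : V) = 0.
Proof. by rewrite /rnorm normr0. Qed.

Lemma rnorm_eq0 x : rnorm x = 0 -> x = 0.
Proof. by move=> x0; apply/normr0_eq0; rewrite rnormE x0. Qed.

Lemma rnormD x y : rnorm (x + y) <= rnorm x + rnorm y.
Proof. by rewrite -leCxR realCD -!rnormE ler_normD. Qed.

Lemma rnormN x : rnorm (- x) = rnorm x.
Proof. by rewrite /rnorm normrN. Qed.

Lemma rnormZ a x : rnorm (a *: x) = cabs a * rnorm x.
Proof. by apply: realC_inj; rewrite realCM -!cabsE -!rnormE normrZ. Qed.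

Lemma rnormB x y : rnorm (x - y) = rnorm (y - x).
Proof. by rewrite -opprB rnormN. Qed.

Lemma rnorm_tri y x z : rnorm (x - z) <= rnorm (x - y) + rnorm (y - z).
Proof. by rewrite (_ : x - z = (x - y) + (y - z)) ?rnormD// addrA subrK. Qed.

Lemma rnorm_leD x y : rnorm x <= rnorm y + rnorm (x - y).
Proof. by rewrite -{1}(subrK y x) addrC rnormD. Qed.

Lemma rnorm_sum (I : Type) (r : seq I) (P : pred I) (F : I -> V) :
  rnorm (\sum_(i <- r | P i) F i) <= \sum_(i <- r | P i) rnorm (F i).
Proof.
elim/big_rec2 : _ => [|i y x _ xy]; first by rewrite rnorm0.
by rewrite (le_trans (rnormD _ _))// lerD2l.
Qed.

(** The factor [C] may have any size and sign, so later estimates can end with whatever constant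
    they accumulate instead of rescaling [e] in advance. *)
Lemma eps_le (a b C : R) : (forall e : R, 0 < e -> a <= b + e * C) -> a <= b.
Proof.
move=> h; rewrite leNgt; apply/negP => ba.
have C0 : 0 < `|C| + 1 by rewrite ltr_wpDl.
have e0 : 0 < (a - b) / (2 * (`|C| + 1)) by rewrite divr_gt0 ?mulr_gt0// subr_gt0.
have := h _ e0.
have : (a - b) / (2 * (`|C| + 1)) * C <= (a - b) / 2.
  rewrite invfM !mulrA -[leRHS]mulr1 -mulrA ler_wpM2l//.
    by rewrite divr_ge0// subr_ge0 ltW.
  by rewrite mulrC ler_pdivrMr// mul1r (le_trans (ler_norm C))// lerDl.
lra.
Qed.

Lemma eps_eq (C : R) x y : (forall e : R, 0 < e -> rnorm (x - y) <= e * C) -> x = y.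
Proof.
move=> h; apply/eqP; rewrite -subr_eq0; apply/eqP/rnorm_eq0/eqP.
rewrite eq_le rnorm_ge0 andbT; apply: (@eps_le _ _ C) => e e0.
by rewrite add0r; exact: h.
Qed.

Lemma closureP (S : set V) x :
  closure S x <-> forall e : R, 0 < e -> exists2 y, S y & rnorm (x - y) < e.
Proof.
split=> [cS e e0|h].
  have e1 : 0 < (e%:C%C : Cx R) by rewrite (ltCxR 0).
  have [y [Sy]] := cS _ (nbhsx_ballx x _ e1).
  by rewrite -ball_normE /= rnormE ltCxR => xy; exists y.
move=> B /nbhs_ballP[e /= e0 eB].
have e1 : 0 < complex.Re (e : R[i]%C) by rewrite -(ltCxR 0) -(cx_ge0 (ltW e0)).
have [y Sy xy] := h _ e1; exists y; split => //; apply: eB.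
by rewrite -ball_normE /= rnormE (cx_ge0 (ltW e0)) ltCxR.
Qed.

Lemma closedP (S : set V) :
  (forall x, (forall e : R, 0 < e -> exists2 y, S y & rnorm (x - y) < e) -> S x) ->
  closed S.
Proof. by move=> h x /closureP; exact: h. Qed.

Lemma totalP (S : set V) : total S <->
  forall x (e : R), 0 < e -> exists2 y, lspan S y & rnorm (x - y) < e.
Proof.
split=> [h x e e0|h].
  have /closureP cx : closure (lspan S) x by rewrite h.
  exact: cx.
by apply/seteqP; split => // x _; apply/closureP; exact: h.
Qed.

End RealNorm.

Section Lspan.
Context {R : realType} {V : lmodType (Cx R)}.
Implicit Types (S : set V) (x y : V).

Lemma lspan0 S : lspan S 0.
Proof.
by exists 0%N, (fun=> 0), (fun=> 0); split; [case|rewrite big_ord0].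
Qed.

Lemma lspan_lin S (a : Cx R) x y : lspan S x -> lspan S y -> lspan S (a *: x + y).
Proof.
move=> [n [c [v [Sv ->]]]] [m [d [w [Sw ->]]]].
exists (n + m)%N,
  (fun i : 'I_(n + m) => match fintype.split i with inl j => a * c j | inr j => d j end),
  (fun i : 'I_(n + m) => match fintype.split i with inl j => v j | inr j => w j end); split.
  by move=> i; case: fintype.split.
rewrite big_split_ord /= scaler_sumr; congr (_ + _); apply: eq_bigr => i _.
  by rewrite (unsplitK (inl _ i)) scalerA.
by rewrite (unsplitK (inr _ i)).
Qed.

Lemma lspan_in S x : S x -> lspan S x.
Proof.
move=> Sx; exists 1%N, (fun=> 1), (fun=> x); split => //.
by rewrite big_ord1 scale1r.
Qed.

Lemma lspan_ind S (P : V -> Prop) : P 0 ->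
  (forall a x y, S x -> P y -> P (a *: x + y)) -> lspan S `<=` P.
Proof.
move=> P0 PS x [n [c [v [Sv ->]]]].
by elim/big_rec : _ => // i y _ Py; exact: PS.
Qed.

Lemma lspan_sub S (P : V -> Prop) : P 0 ->
  (forall a x y, P x -> P y -> P (a *: x + y)) -> S `<=` P -> lspan S `<=` P.
Proof.
by move=> P0 PS SP; apply: lspan_ind => // a x y Sx Py; apply: PS => //; exact: SP.
Qed.

End Lspan.

Section Lspan2.
Context {R : realType}.

Lemma lspan_map (V W : lmodType (Cx R)) (f : V -> W) (S : set V) (S' : set W) x :
  linear f -> (forall v, S v -> lspan S' (f v)) -> lspan S x -> lspan S' (f x).
Proof.
move=> lf fS; move: x; apply: lspan_ind => [|a x y Sx Sy].
  have := lf (-1) 0 0; rewrite !scaleN1r !oppr0 addr0 addNr => ->; exact: lspan0.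
by rewrite lf; apply: lspan_lin => //; exact: fS.
Qed.

Lemma linear0f (V W : lmodType (Cx R)) (f : V -> W) : linear f -> f 0 = 0.
Proof. by move=> lf; have := lf (-1) 0 0; rewrite !scaleN1r !oppr0 addr0 addNr. Qed.

Lemma linearDf (V W : lmodType (Cx R)) (f : V -> W) x y :
  linear f -> f (x + y) = f x + f y.
Proof. by move=> lf; have := lf 1 x y; rewrite !scale1r. Qed.

Lemma linearZf (V W : lmodType (Cx R)) (f : V -> W) a x :
  linear f -> f (a *: x) = a *: f x.
Proof. by move=> lf; have := lf a x 0; rewrite !addr0 (linear0f lf) addr0. Qed.

Lemma linearNf (V W : lmodType (Cx R)) (f : V -> W) x :
  linear f -> f (- x) = - f x.
Proof. by move=> lf; rewrite -scaleN1r (linearZf _ _ lf) scaleN1r. Qed.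

Lemma linearBf (V W : lmodType (Cx R)) (f : V -> W) x y :
  linear f -> f (x - y) = f x - f y.
Proof. by move=> lf; rewrite (linearDf _ _ lf) (linearNf _ lf). Qed.

Lemma linear_sumf (V W : lmodType (Cx R)) (f : V -> W) (I : Type) (r : seq I)
    (P : pred I) (F : I -> V) : linear f ->
  f (\sum_(i <- r | P i) F i) = \sum_(i <- r | P i) f (F i).
Proof.
move=> lf; elim/big_rec2 : _ => [|i y x _ <-]; first exact: linear0f.
exact: linearDf.
Qed.

Lemma totalS (V : normedModType (Cx R)) (S S' : set V) :
  S `<=` S' -> total S -> total S'.
Proof.
move=> SS /totalP h; apply/totalP => x e e0; have [y Sy xy] := h x e e0.
exists y => //; have := @lspan_map V V id S S' y (fun _ _ _ => erefl); apply => //.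
by move=> v /SS/lspan_in.
Qed.

(** Induction over a combination of elements of [S]: each new term gets half of the allowed error,
    divided by [cabs a + 1] to absorb its coefficient. It serves to shrink total sets step by
    step. *)
Lemma total_trans (V : normedModType (Cx R)) (S S' : set V) : total S ->
  (forall x, S x -> forall e : R, 0 < e ->
     exists2 y, lspan S' y & rnorm (x - y) < e) -> total S'.
Proof.
move=> /totalP tS SS'; apply/totalP => x e e0.
have e2 : 0 < e / 2 by rewrite divr_gt0.
have [y Sy xy] := tS x _ e2.
suff [z Sz yz] : exists2 z, lspan S' z & rnorm (y - z) < e / 2.
  by exists z => //; have := rnorm_tri y x z; lra.
move: y Sy {xy} (e / 2) e2; apply: lspan_ind => [d d0|a u v Su IH d d0].
  by exists 0; [exact: lspan0|rewrite subrr rnorm0].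
have d2 : 0 < d / 2 by rewrite divr_gt0.
have [v' Sv vv] := IH _ d2.
have a0 : 0 < cabs a + 1 by have := cabs_ge0 a; lra.
have [u' Su' uu] := SS' u Su _ (divr_gt0 d2 a0).
exists (a *: u' + v'); first exact: lspan_lin.
rewrite opprD addrACA -scalerBr (le_lt_trans (rnormD _ _))// rnormZ.
suff : cabs a * rnorm (u - u') <= d / 2 by lra.
rewrite (@le_trans _ _ ((cabs a + 1) * rnorm (u - u')))//.
  by rewrite ler_wpM2r ?rnorm_ge0// lerDl.
by rewrite mulrC -ler_pdivlMr// ltW.
Qed.

(** Many identities below are checked only on elementary tensors, on images of $C_c$ or on vectors
    $\pi(a)d$; this lemma carries them to the whole space, with crude bounds [M] and [N]. *)
Lemma total_eq (V W : normedModType (Cx R)) (S : set V) (f g : V -> W) (M N : R) :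
  linear f -> linear g ->
  (forall x, rnorm (f x) <= M * rnorm x) -> (forall x, rnorm (g x) <= N * rnorm x) ->
  total S -> (forall x, S x -> f x = g x) -> f =1 g.
Proof.
move=> lf lg fM gN /totalP tS fg x; apply: (@eps_eq _ _ (`|M| + `|N|)) => e e0.
have [y Sy xy] := tS x e e0.
have fgy : f y = g y.
  move: y Sy {xy}; apply: lspan_ind => [|a u v Su IH].
    by rewrite !linear0f.
  by rewrite lf lg fg// IH.
rewrite (le_trans (rnorm_tri (f y) _ _))// {2}fgy -(linearBf _ _ lf) -(linearBf _ _ lg).
rewrite mulrDr lerD//; rewrite mulrC.
  rewrite (le_trans (fM _))// (le_trans (_ : _ <= `|M| * rnorm (x - y)))//.
    by rewrite ler_wpM2r ?rnorm_ge0// ler_norm.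
  by rewrite ler_wpM2l// ltW.
rewrite (le_trans (gN _))// rnormB (le_trans (_ : _ <= `|N| * rnorm (x - y)))//.
  by rewrite ler_wpM2r ?rnorm_ge0// ler_norm.
by rewrite ler_wpM2l// ltW.
Qed.

End Lspan2.

(** * Limits and extension by density *)

Section Completeness.
Context {R : realType}.

Definition tends (V : normedModType (Cx R)) (u : nat -> V) (l : V) :=
  forall e : R, 0 < e -> exists N, forall n, (N <= n)%N -> rnorm (u n - l) < e.

Definition cauchyseq (V : normedModType (Cx R)) (u : nat -> V) :=
  forall e : R, 0 < e -> exists N, forall n m, (N <= n)%N -> (N <= m)%N ->
    rnorm (u n - u m) < e.

Lemma cauchyseq_tends (V : completeNormedModType (Cx R)) (u : nat -> V) :
  cauchyseq u -> exists l, tends u l.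
Proof.
move=> cu; have : cvg (u @ \oo).
  apply: cauchy_cvg; apply/cauchy_ballP => e e0 /=.
  have e1 : 0 < complex.Re (e : R[i]%C) by rewrite -(ltCxR 0) -(cx_ge0 (ltW e0)).
  have [N Nu] := cu _ e1.
  exists ([set u n | n in [set n | (N <= n)%N]], [set u n | n in [set n | (N <= n)%N]]) => /=.
    by split; exists N => // n /= Nn; exists n.
  move=> [_ _] /= [[n Nn <-] [m Nm <-]]; rewrite -ball_normE /=.
  by rewrite rnormE (cx_ge0 (ltW e0)) ltCxR; exact: Nu.
move=> /cvg_ex[l ul]; exists l => e e0.
have e1 : 0 < (e%:C%C : Cx R) by rewrite (ltCxR 0).
have /cvgrPdist_lt /(_ _ e1) [N _ Nu] := ul.
by exists N => n Nn; have := Nu n Nn; rewrite rnormE ltCxR rnormB.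
Qed.

Lemma invn_small (e : R) : 0 < e -> exists N, forall n, (N <= n)%N -> n.+1%:R^-1 < e.
Proof.
move=> e0; exists (Num.truncn (e^-1)) => n Nn.
rewrite invf_plt ?posrE//; apply: lt_le_trans (truncnS_gt _) _.
by rewrite ler_nat ltnS.
Qed.

Lemma eps_choice (A : Type) (P : R -> A -> Prop) :
  (forall e : R, 0 < e -> exists a, P e a) ->
  exists u : nat -> A, forall n, P n.+1%:R^-1 (u n).
Proof.
move=> h; have /choice[u hu] : forall n : nat, exists a, P n.+1%:R^-1 a.
  by move=> n; apply: h; rewrite invr_gt0.
by exists u.
Qed.

(** Read [P e v] as: [v] is right up to [e]. The limit comes from choices at $1/(n+1)$, but the
    conclusion holds for every [v] with [P e v], so no sequence has to be mentioned later. *)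
Lemma approx_limit (V : completeNormedModType (Cx R)) (P : R -> V -> Prop) (C : R) :
  (forall e : R, 0 < e -> exists v, P e v) ->
  (forall (e d : R) v w, 0 < e -> 0 < d -> P e v -> P d w -> rnorm (v - w) <= C * (e + d)) ->
  exists l, forall (e : R) v, 0 < e -> P e v -> rnorm (v - l) <= C * e.
Proof.
move=> ex cl; have [u Pu] := eps_choice ex.
have C0 : 0 <= C.
  have := cl _ _ _ _ _ _ (Pu 0%N) (Pu 0%N); rewrite !invr_gt0 ltr01 => /(_ isT isT).
  by rewrite subrr rnorm0 pmulr_lge0// invr1 addr_gt0.
have C1 : 0 < C + 1 by lra.
have i0 n : 0 < (n.+1%:R : R)^-1 by rewrite invr_gt0.
have cu : cauchyseq u.
  move=> e e0; have e1 : 0 < e / (C + 1) / 2 by rewrite !divr_gt0.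
  have [N Ns] := invn_small e1; exists N => n m /Ns nN /Ns mN.
  rewrite (le_lt_trans (cl _ _ _ _ _ _ (Pu n) (Pu m)))//.
  rewrite (@le_lt_trans _ _ ((C + 1) * (n.+1%:R^-1 + m.+1%:R^-1)))//.
    by rewrite ler_wpM2r ?lerDl// ltW// addr_gt0.
  by rewrite mulrC -ltr_pdivlMr// [ltRHS]splitr ltrD.
have [l ul] := cauchyseq_tends cu; exists l => e v e0 Pv.
apply: (@eps_le _ _ _ (C + 1)) => d d0.
have [N Nl] := ul d d0; have [N' Ns] := invn_small d0.
have := Nl _ (leq_maxl N N'); have := Ns _ (leq_maxr N N').
set n := maxn N N' => + und; pose i : R := n.+1%:R^-1; rewrite -/i => nd.
have h1 : rnorm (v - u n) <= C * (e + i) := cl _ _ _ _ e0 (i0 n) Pv (Pu n).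
have h2 := rnorm_tri (u n) v l.
have h3 : C * i <= C * d by rewrite ler_wpM2l// ltW.
move: h1; rewrite mulrDr; clearbody i; lra.
Qed.

(** The map is given as a relation. The bound on the span of [S] contains well-definedness: a
    combination with first coordinate 0 has second coordinate 0. *)
Lemma extend_by_density (X : normedModType (Cx R)) (Y : completeNormedModType (Cx R))
    (S : set (X * Y)) (M : R) : 0 <= M ->
  (forall p, lspan S p -> rnorm p.2 <= M * rnorm p.1) ->
  total [set p.1 | p in S] ->
  exists f : X -> Y, [/\ linear f, forall x, rnorm (f x) <= M * rnorm x &
    forall x y, S (x, y) -> f x = y].
Proof.
move=> M0 SM /totalP tS.
have ex (x : X) (e : R) : 0 < e -> exists p, lspan S p /\ rnorm (x - p.1) < e.
  move=> e0; have [y Sy xy] := tS x e e0.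
  suff [p Sp py] : exists2 p, lspan S p & p.1 = y by exists p; rewrite py.
  move: y Sy {xy}; apply: lspan_ind => [|a _ y [p Sp <-] [q Sq qy]].
    by exists 0 => //; exact: lspan0.
  by exists (a *: p + q); [apply: lspan_lin => //; exact: lspan_in|rewrite /= qy].
have lB (p q : X * Y) : lspan S p -> lspan S q -> lspan S (p - q).
  by move=> Sp Sq; rewrite addrC -scaleN1r; exact: lspan_lin.
have Rel (x : X) : exists y : Y, forall e p, 0 < e -> lspan S p ->
    rnorm (x - p.1) < e -> rnorm (p.2 - y) <= M * e.
  pose P e (v : Y) := exists p, [/\ lspan S p, rnorm (x - p.1) < e & v = p.2].
  have [e e0|e d v w e0 d0 [p [Sp pe ->]] [q [Sq qd ->]]|l Pl] :=
      @approx_limit Y P M.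
    by have [p [Sp pe]] := ex x e e0; exists p.2, p.
  - rewrite (le_trans (SM _ (lB _ _ Sp Sq)))// ler_wpM2l//=.
    have := rnorm_tri x p.1 q.1; rewrite (rnormB p.1 x); lra.
  - by exists l => e p e0 Sp xp; apply: Pl => //; exists p.
have [f fP] := choice Rel.
have lf : linear f.
  move=> a x y; apply: (@eps_eq _ _ (M * 4)) => e e0.
  have a0 : 0 < cabs a + 1 by have := cabs_ge0 a; lra.
  have ea : 0 < e / (cabs a + 1) by rewrite divr_gt0.
  have [p [Sp xp]] := ex x _ ea; have [q [Sq yq]] := ex y e e0.
  have h1 := fP _ _ _ ea Sp xp; have h2 := fP _ _ _ e0 Sq yq.
  have le : cabs a * (e / (cabs a + 1)) <= e.
    by rewrite mulrCA ger_pMr// ler_pdivrMr// mul1r lerDl.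
  have h3 : rnorm (a *: x + y - (a *: p + q).1) < 2 * e.
    rewrite /= opprD addrACA -scalerBr (le_lt_trans (rnormD _ _))// rnormZ.
    have : cabs a * rnorm (x - p.1) <= e.
      by apply: le_trans le; rewrite ler_wpM2l ?cabs_ge0// ltW.
    lra.
  have e2 : 0 < 2 * e by lra.
  have := fP _ _ _ e2 (lspan_lin a Sp Sq) h3.
  move=> h4; rewrite (le_trans (rnorm_tri (a *: p + q).2 _ _))// rnormB.
  have h5 : rnorm ((a *: p + q).2 - (a *: f x + f y)) <= M * (2 * e).
    rewrite /= opprD addrACA -scalerBr (le_trans (rnormD _ _))// rnormZ.
    have : cabs a * rnorm (p.2 - f x) <= M * e.
      rewrite (@le_trans _ _ (cabs a * (M * (e / (cabs a + 1)))))//.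
        by rewrite ler_wpM2l ?cabs_ge0.
      by rewrite mulrCA ler_wpM2l.
    lra.
  by rewrite (le_trans (lerD h4 h5))//; lra.
exists f; split => //.
  move=> x; apply: (@eps_le _ _ _ (2 * M)) => e e0.
  have [p [Sp xp]] := ex x e e0; have h := fP _ _ _ e0 Sp xp.
  have h1 := SM _ Sp; have h2 := rnorm_leD (f x) p.2; rewrite rnormB in h2.
  have h3 := rnorm_leD p.1 x; rewrite rnormB in h3.
  have : M * rnorm p.1 <= M * (rnorm x + e).
    by rewrite ler_wpM2l//; lra.
  lra.
move=> x y Sxy; apply: (@eps_eq _ _ M) => e e0; rewrite rnormB mulrC.
by apply: (fP x e (x, y)) => //; [exact: lspan_in|rewrite /= subrr rnorm0].
Qed.

End Completeness.

(** * Adjointable operators *)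

Section UniformBoundedness.
Context {R : realType}.

(** Nested balls take the place of Baire's theorem: without a common bound, every ball contains a
    smaller one on which some [F i] has values of norm at least [n], and the limit of the centres
    contradicts pointwise boundedness. *)
Lemma uniform_boundedness (I : Type) (X : completeNormedModType (Cx R))
    (Y : normedModType (Cx R)) (F : I -> X -> Y) :
  (forall i, linear (F i)) ->
  (forall i, exists M : R, forall x, rnorm (F i x) <= M * rnorm x) ->
  (forall x, exists M : R, forall i, rnorm (F i x) <= M) ->
  exists2 M : R, 0 <= M & forall i x, rnorm (F i x) <= M * rnorm x.
Proof.
move=> lF bF pF; apply: contrapT => nb.
have big (M : R) : 0 <= M -> exists i x, M * rnorm x < rnorm (F i x).
  move=> M0; apply: contrapT => h; apply: nb; exists M => // i x.
  by rewrite leNgt; apply/negP => hx; apply: h; exists i, x.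
have step (n : nat) (c : X * R) : 0 < c.2 -> exists c' : X * R,
    [/\ 0 < c'.2, c'.2 <= c.2 / 2, rnorm (c'.1 - c.1) <= c.2 / 2 &
     exists i, forall y, rnorm (y - c'.1) <= c'.2 -> n%:R <= rnorm (F i y)].
  case: c => x r /= r0.
  have M0 : 0 <= 4 * n.+1%:R / r by rewrite divr_ge0 ?mulr_ge0// ltW.
  have [i [z zM]] := big _ M0; have [Mi FMi] := bF i.
  have z0 : 0 < rnorm z.
    rewrite lt_neqAle rnorm_ge0 andbT; apply/eqP => z0; move: zM.
    by rewrite -z0 (rnorm_eq0 (esym z0)) (linear0f (lF i)) rnorm0 mulr0 ltxx.
  have rz : 0 < r / 2 / rnorm z by rewrite !divr_gt0.
  pose w := ((r / 2 / rnorm z)%:C%C : Cx R) *: z.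
  have wr : rnorm w = r / 2.
    by rewrite rnormZ cabsC gtr0_norm// divfK// gt_eqF.
  have Fw : 2 * n.+1%:R < rnorm (F i w).
    rewrite (linearZf _ _ (lF i)) rnormZ cabsC gtr0_norm//.
    move: zM; rewrite mulrAC ltr_pdivrMr// => zM.
    by rewrite mulrAC ltr_pdivlMr//; lra.
  (* Since $F_i(x+w)-F_i(x-w)=2F_iw$ is large, $F_i$ is large at one of the two points. *)
  have [x' [xx' Fx']] : exists x', rnorm (x' - x) <= r / 2 /\ n.+1%:R < rnorm (F i x').
    have [h|h] := ltP n.+1%:R (rnorm (F i (x + w))).
      by exists (x + w); rewrite addrAC subrr add0r wr.
    exists (x - w); rewrite addrAC subrr add0r rnormN wr; split => //.
    have e2 : (2%:C%C : Cx R) *: F i w = F i (x + w) - F i (x - w).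
      rewrite (linearDf _ _ (lF i)) (linearBf _ _ (lF i)) opprB addrC addrA subrK.
      by rewrite (_ : 2%:C%C = 2%:R :> Cx R) ?rmorph_nat// scaler_nat mulr2n.
    have := rnormD (F i (x + w)) (- F i (x - w)).
    rewrite -e2 rnormZ cabsC rnormN ger0_norm//.
    by have : (0 : R) < n.+1%:R by []; move: h Fw; lra.
  have M1 : 0 < `|Mi| + 1 by rewrite ltr_wpDl.
  (* Within radius $1/(|M_i|+1)$ the values of [F i] vary by at most 1, so a norm above [n.+1] at
     the centre stays above [n]. *)
  exists (x', Num.min (r / 2) (`|Mi| + 1)^-1); split => //=.
  - by rewrite lt_min divr_gt0//= invr_gt0.
  - by rewrite ge_min lexx.
  exists i => y; rewrite le_min => /andP[_ yx].
  have := rnorm_leD (F i x') (F i y); rewrite -(linearBf _ _ (lF i)).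
  have h1 : rnorm (F i (x' - y)) <= 1.
    rewrite (le_trans (FMi _))// rnormB.
    rewrite (@le_trans _ _ ((`|Mi| + 1) * (`|Mi| + 1)^-1))//; last first.
      by rewrite divff// gt_eqF.
    rewrite (@le_trans _ _ ((`|Mi| + 1) * rnorm (y - x')))//.
      by rewrite ler_wpM2r ?rnorm_ge0// (le_trans (ler_norm _))// lerDl.
    by rewrite ler_wpM2l// ltW.
  by move: Fx'; rewrite -natr1; lra.
have /choice[f fP] : forall q : nat * (X * R), exists c', 0 < q.2.2 ->
    [/\ 0 < c'.2, c'.2 <= q.2.2 / 2, rnorm (c'.1 - q.2.1) <= q.2.2 / 2 &
     exists i, forall y, rnorm (y - c'.1) <= c'.2 -> q.1%:R <= rnorm (F i y)].
  move=> [n c]; have [/= c0|c0] := pselect (0 < c.2); last by exists c.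
  by have [c' h] := step n c c0; exists c'.
pose u := fix u n := if n is m.+1 then f (m, u m) else (0 : X, 1 : R).
have u0 n : 0 < (u n).2 by elim: n => [|n IH] //=; have [] := fP (n, u n) IH.
have uS n := fP (n, u n) (u0 n).
(* Distance travelled plus current radius never exceeds the radius at stage [n], so all later
   centres, and their limit, stay in that ball. *)
have ui n m : rnorm ((u (n + m)%N).1 - (u n).1) + (u (n + m)%N).2 <= (u n).2.
  elim: m => [|m IH]; first by rewrite addn0 subrr rnorm0 add0r.
  rewrite addnS; have [_ h1 h2 _] := uS (n + m)%N; move: h1 h2 => /=.
  have := rnorm_tri (u (n + m)%N).1 (u (n + m).+1).1 (u n).1 => /=.
  by move: IH; lra.
have us n : (u n).2 <= n.+1%:R^-1.
  elim: n => [|n IH]; first by rewrite invr1.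
  have [_ h _ _] := uS n; apply: (le_trans h).
  rewrite ler_pdivrMr// (le_trans IH)// ler_pdivlMl// ler_pdivrMr//.
  by rewrite -!natr1; have : (0 : R) <= n%:R by []; lra.
have cu : cauchyseq (fun n => (u n).1).
  move=> e e0; have [N Nu] := invn_small (divr_gt0 e0 (ltr0n R 2)).
  exists N => n m Nn Nm.
  have h1 : (u N).2 < e / 2 := le_lt_trans (us N) (Nu N (leqnn N)).
  have h2 := ui N (n - N)%N; have h3 := ui N (m - N)%N; rewrite !subnKC// in h2 h3.
  have h4 := rnorm_tri (u N).1 (u n).1 (u m).1; rewrite (rnormB (u N).1 (u m).1) in h4.
  have := u0 n; have := u0 m; lra.
have [l ul] := cauchyseq_tends cu.
have [M lM] := pF l.
have [i iP] : exists i, (Num.truncn M).+1%:R <= rnorm (F i l).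
  set n := (Num.truncn M).+1; have [_ _ _ [i iP]] := uS n; exists i; apply: iP; rewrite -[f _]/(u n.+1).
  apply: (@eps_le _ _ _ 1) => e e0; have [N Nl] := ul e e0.
  have h1 := Nl (n.+1 + N)%N (leq_addl _ _); have h2 := ui n.+1 N.
  have h3 := rnorm_tri (u (n.+1 + N)%N).1 l (u n.+1).1.
  rewrite (rnormB l (u (n.+1 + N)%N).1) in h3; have h4 := u0 (n.+1 + N)%N; lra.
have := lM i; rewrite leNgt => /negP; apply.
by apply: lt_le_trans iP; rewrite truncnS_gt.
Qed.

End UniformBoundedness.

(* Adjointable operators on a Banach space with a C*-valued or scalar inner
   product: [x^* ** y] on a C*-algebra gives its multipliers, the inner product
   of a Hilbert space gives the bounded operators. *)
Record innerform (R : realType) (X : completeNormedModType (Cx R))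
    (Y : normedModType (Cx R)) := InnerForm {
  fm :> X -> X -> Y ;
  fm_lin : forall x, linear (fm x) ;
  fm_conj : forall (a : Cx R) x y z,
    fm (a *: x + y) z = Num.conj a *: fm x z + fm y z ;
  fm_bound : forall x y, rnorm (fm x y) <= rnorm x * rnorm y ;
  fm_norm : forall x, rnorm (fm x x) = rnorm x ^+ 2
}.

(** Linearity and boundedness are not fields: both follow from the adjoint relation. *)
Record adj (R : realType) (X : completeNormedModType (Cx R))
    (Y : normedModType (Cx R)) (f : innerform X Y) := Adj {
  afun :> X -> X ;
  astar : X -> X ;
  adjP : forall x y, f (afun x) y = f x (astar y) ;
  adjP' : forall x y, f (astar x) y = f x (afun y)
}.

Section AdjAlgebra.
Context {R : realType} {X : completeNormedModType (Cx R)}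
  {Y : normedModType (Cx R)} {f : innerform X Y}.
Implicit Types (S T : adj f) (x y z : X).

HB.instance Definition _ := gen_eqMixin (adj f).
HB.instance Definition _ := gen_choiceMixin (adj f).

Lemma fm_inj x y : (forall z, f z x = f z y) -> x = y.
Proof.
move=> fxy; apply/eqP; rewrite -subr_eq0; apply/eqP/rnorm_eq0/eqP.
rewrite -sqrf_eq0 -(fm_norm f); apply/eqP.
by rewrite (linearBf _ _ (fm_lin f _)) fxy subrr rnorm0.
Qed.

Lemma fm0l z : f 0 z = 0.
Proof.
by have := fm_conj f (-1) 0 0 z; rewrite scaleN1r oppr0 addr0 rmorphN1 scaleN1r addNr.
Qed.

Lemma fm_injl x y : (forall z, f x z = f y z) -> x = y.
Proof.
move=> fxy; apply/eqP; rewrite -subr_eq0; apply/eqP/rnorm_eq0/eqP.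
rewrite -sqrf_eq0 -(fm_norm f); apply/eqP.
have -> : f (x - y) (x - y) = f ((-1) *: y + x) (x - y) by rewrite scaleN1r addrC.
by rewrite fm_conj rmorphN1 scaleN1r fxy addNr rnorm0.
Qed.

Lemma adj_eq S T : afun S =1 afun T -> S = T.
Proof.
move=> ST; have ST' : astar S =1 astar T.
  by move=> x; apply: fm_inj => z; rewrite -!adjP ST.
case: S T ST ST' => a b P P' [a' b' Q Q'] /= /funext e1 /funext e2; subst.
by congr Adj; exact: Prop_irrelevance.
Qed.

Lemma afun_linear T : linear T.
Proof.
move=> a x y; apply: fm_inj => z.
by rewrite (fm_lin f) -!adjP' (fm_lin f).
Qed.

Definition aswap T : adj f := Adj (adjP' T) (adjP T).

(** Hellinger-Toeplitz: the maps $x\mapsto f(y,Tx)$ with $\|y\|\le1$ are each bounded through the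
    adjoint, and pointwise by $\|Tx\|$, hence uniformly bounded; then $y=Tx/\|Tx\|$ is inserted. *)
Lemma afun_bounded T : exists2 M : R, 0 <= M & forall x, rnorm (T x) <= M * rnorm x.
Proof.
pose I := {y0 : X | rnorm y0 <= 1}.
have [i|i|x|M M0 MP] := @uniform_boundedness R I X Y (fun i x => f (sval i) (T x)).
- by move=> a x y; rewrite afun_linear (fm_lin f).
- exists (rnorm (astar T (sval i))) => x; rewrite -adjP'; exact: fm_bound.
- exists (rnorm (T x)) => -[y /= y1]; rewrite (le_trans (fm_bound f _ _))//.
  by rewrite ler_piMl ?rnorm_ge0.
exists M => // x; have [T0|T0] := eqVneq (T x) 0.
  by rewrite T0 rnorm0 mulr_ge0 ?rnorm_ge0.
have n0 : 0 < rnorm (T x).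
  by rewrite lt_neqAle rnorm_ge0 andbT eq_sym; apply: contra_neq T0; exact: rnorm_eq0.
pose c : Cx R := ((rnorm (T x))^-1)%:C%C.
have y1 : rnorm (c *: T x) <= 1.
  by rewrite rnormZ cabsC ger0_norm ?invr_ge0 ?rnorm_ge0// mulVf// gt_eqF.
have := MP (exist (fun y0 : X => is_true (rnorm y0 <= 1)) _ y1) x; rewrite /= -[c *: T x]addr0 fm_conj fm0l addr0.
rewrite rnormZ cabs_conj cabsC ger0_norm ?invr_ge0 ?rnorm_ge0// fm_norm.
by rewrite expr2 mulKf// gt_eqF.
Qed.

Definition opnorm T : R := sup [set rnorm (T x) | x in [set x | rnorm x <= 1]].

Lemma opnorm_has_sup T :
  has_sup [set rnorm (T x) | x in [set x | rnorm x <= 1]].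
Proof.
split; first by exists (rnorm (T 0)), 0 => //=; rewrite rnorm0.
have [M M0 TM] := afun_bounded T; exists M => _ [x x1 <-].
by rewrite (le_trans (TM x))// ler_piMr.
Qed.

Lemma opnorm_ge0 T : 0 <= opnorm T.
Proof.
apply: le_trans (rnorm_ge0 (T 0)) _; apply: ub_le_sup.
  by have [] := opnorm_has_sup T.
by exists 0 => //=; rewrite rnorm0.
Qed.

Lemma opnormP T x : rnorm (T x) <= opnorm T * rnorm x.
Proof.
have [->|x0] := eqVneq x 0.
  by rewrite (linear0f (afun_linear T)) !rnorm0 mulr0.
have n0 : 0 < rnorm x.
  by rewrite lt_neqAle rnorm_ge0 andbT eq_sym; apply: contra_neq x0; exact: rnorm_eq0.
pose c : Cx R := ((rnorm x)^-1)%:C%C.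
rewrite -ler_pdivrMr//; apply: ub_le_sup; first by have [] := opnorm_has_sup T.
exists (c *: x) => /=.
  by rewrite rnormZ cabsC ger0_norm ?invr_ge0 ?rnorm_ge0// mulVf// gt_eqF.
rewrite (linearZf _ _ (afun_linear T)) rnormZ cabsC mulrC ger0_norm//.
by rewrite invr_ge0 rnorm_ge0.
Qed.

Lemma opnorm_le T (c : R) : 0 <= c ->
  (forall x, rnorm (T x) <= c * rnorm x) -> opnorm T <= c.
Proof.
move=> c0 Tc; apply: ge_sup; first by have [] := opnorm_has_sup T.
by move=> _ [x x1 <-]; rewrite (le_trans (Tc x))// ler_piMr.
Qed.

Fact add_adjP S T x y : f (S x + T x) y = f x (astar S y + astar T y).
Proof.
by rewrite -[S x]scale1r fm_conj rmorph1 scale1r (linearDf _ _ (fm_lin f _)) !adjP.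
Qed.
Fact add_adjP' S T x y : f (astar S x + astar T x) y = f x (S y + T y).
Proof.
by rewrite -[astar S x]scale1r fm_conj rmorph1 scale1r (linearDf _ _ (fm_lin f _)) !adjP'.
Qed.
Definition aadd S T : adj f := Adj (add_adjP S T) (add_adjP' S T).

Lemma fmZl (a : Cx R) x y : f (a *: x) y = Num.conj a *: f x y.
Proof. by rewrite -[a *: x]addr0 fm_conj fm0l addr0. Qed.

Fact scale_adjP (a : Cx R) T x y : f (a *: T x) y = f x (Num.conj a *: astar T y).
Proof. by rewrite fmZl (linearZf _ _ (fm_lin f _)) adjP. Qed.
Fact scale_adjP' (a : Cx R) T x y : f (Num.conj a *: astar T x) y = f x (a *: T y).
Proof. by rewrite fmZl conjCK (linearZf _ _ (fm_lin f _)) adjP'. Qed.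
Definition ascale a T : adj f := Adj (scale_adjP a T) (scale_adjP' a T).

Fact zero_adjP x y : f 0 y = f x 0.
Proof. by rewrite fm0l (linear0f (fm_lin f _)). Qed.
Definition azero : adj f := Adj zero_adjP zero_adjP.

Fact one_adjP x y : f x y = f x y. Proof. by []. Qed.
Definition aone : adj f := @Adj _ _ _ f id id one_adjP one_adjP.

Fact mul_adjP S T x y : f (S (T x)) y = f x (astar T (astar S y)).
Proof. by rewrite !adjP. Qed.
Fact mul_adjP' S T x y : f (astar T (astar S x)) y = f x (S (T y)).
Proof. by rewrite !adjP'. Qed.
Definition amul S T : adj f := Adj (mul_adjP S T) (mul_adjP' S T).

Fact aaddA : associative aadd.
Proof. by move=> S T U; apply: adj_eq => x /=; rewrite addrA. Qed.
Fact aaddC : commutative aadd.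
Proof. by move=> S T; apply: adj_eq => x /=; rewrite addrC. Qed.
Fact aadd0 : left_id azero aadd.
Proof. by move=> S; apply: adj_eq => x /=; rewrite add0r. Qed.
Fact aaddN : left_inverse azero (ascale (-1)) aadd.
Proof. by move=> S; apply: adj_eq => x /=; rewrite scaleN1r addNr. Qed.

HB.instance Definition _ :=
  GRing.isZmodule.Build (adj f) aaddA aaddC aadd0 aaddN.

Fact ascaleA a b T : ascale a (ascale b T) = ascale (a * b) T.
Proof. by apply: adj_eq => x /=; rewrite scalerA. Qed.
Fact ascale1 : left_id 1 ascale.
Proof. by move=> T; apply: adj_eq => x /=; rewrite scale1r. Qed.
Fact ascaleDr : right_distributive ascale +%R.
Proof. by move=> a S T; apply: adj_eq => x /=; rewrite scalerDr. Qed.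
Fact ascaleDl T a b : ascale (a + b) T = ascale a T + ascale b T.
Proof. by apply: adj_eq => x /=; rewrite scalerDl. Qed.

HB.instance Definition _ := GRing.Zmodule_isLmodule.Build (Cx R) (adj f)
  ascaleA ascale1 ascaleDr ascaleDl.

Lemma afunD S T x : (S + T) x = S x + T x. Proof. by []. Qed.
Lemma afunZ (a : Cx R) T x : (a *: T) x = a *: T x. Proof. by []. Qed.
Lemma afunN T x : (- T) x = - T x. Proof. exact: scaleN1r. Qed.
Lemma afunB S T x : (S - T) x = S x - T x. Proof. by rewrite afunD afunN. Qed.
Definition anorm T : Cx R := (opnorm T)%:C%C.

Fact anormD S T : anorm (S + T) <= anorm S + anorm T.
Proof.
rewrite /anorm -realCD leCxR; apply: opnorm_le; first by rewrite addr_ge0 ?opnorm_ge0.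
by move=> x; rewrite mulrDl (le_trans (rnormD _ _))// lerD// opnormP.
Qed.

Fact anormZ (a : Cx R) T : anorm (a *: T) = `|a| * anorm T.
Proof.
rewrite /anorm (cabsE a) -realCM; congr (_ %:C)%C; apply/eqP; rewrite eq_le.
have le (b : Cx R) (S : adj f) : opnorm (b *: S) <= cabs b * opnorm S.
  apply: opnorm_le; first by rewrite mulr_ge0 ?opnorm_ge0 ?cabs_ge0.
  by move=> x; rewrite afunZ rnormZ -mulrA ler_wpM2l ?cabs_ge0 ?opnormP.
rewrite le/=; have [->|a0] := eqVneq a 0.
  by rewrite cabs0 mul0r opnorm_ge0.
have ca : 0 < cabs a.
  by rewrite lt_neqAle cabs_ge0 andbT eq_sym; apply: contra_neq a0; exact: cabs_eq0.
have := le a^-1 (a *: T); rewrite scalerA mulVf// scale1r.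
suff -> : cabs a^-1 = (cabs a)^-1 by rewrite ler_pdivlMl.
have ca1 : cabs a != 0 by rewrite gt_eqF.
by apply: (mulfI ca1); rewrite -cabsM divff// divff// cabs1.
Qed.

Fact anorm0_eq0 T : anorm T = 0 -> T = 0.
Proof.
move=> T0; apply: adj_eq => x; apply/rnorm_eq0/eqP; rewrite eq_le rnorm_ge0 andbT.
by rewrite (le_trans (opnormP T x))// (realC_inj T0) mul0r.
Qed.

HB.instance Definition _ :=
  Lmodule_isNormed.Build (Cx R) (adj f) anormD anormZ anorm0_eq0.

Lemma rnorm_adj T : rnorm T = opnorm T.
Proof. by apply: realC_inj; rewrite -rnormE. Qed.

Lemma rnorm_afun T x : rnorm (T x) <= rnorm T * rnorm x.
Proof. by rewrite rnorm_adj opnormP. Qed.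

Lemma rnorm_adj_le T (c : R) : 0 <= c ->
  (forall x, rnorm (T x) <= c * rnorm x) -> rnorm T <= c.
Proof. by rewrite rnorm_adj; exact: opnorm_le. Qed.

Lemma rnorm_amul S T : rnorm (amul S T) <= rnorm S * rnorm T.
Proof.
apply: rnorm_adj_le; first by rewrite mulr_ge0 ?rnorm_ge0.
move=> x; rewrite -mulrA (le_trans (rnorm_afun S (T x)))//.
by rewrite ler_wpM2l ?rnorm_ge0 ?rnorm_afun.
Qed.

Lemma rnorm_aswap_mul T : rnorm T ^+ 2 <= rnorm (amul (aswap T) T).
Proof.
rewrite -[leRHS]sqr_sqrtr ?rnorm_ge0// lerXn2r ?nnegrE ?rnorm_ge0 ?sqrtr_ge0//.
apply: rnorm_adj_le => [|x]; first exact: sqrtr_ge0.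
rewrite -(@ler_pXn2r _ 2%N)// ?nnegrE ?rnorm_ge0 ?mulr_ge0 ?sqrtr_ge0 ?rnorm_ge0//.
rewrite exprMn sqr_sqrtr ?rnorm_ge0// -(fm_norm f) adjP.
rewrite (le_trans (fm_bound f _ _))// expr2 mulrCA ler_wpM2l ?rnorm_ge0//.
exact: (rnorm_afun (amul (aswap T) T)).
Qed.

Lemma rnorm_aswap T : rnorm (aswap T) = rnorm T.
Proof.
have le S : rnorm S <= rnorm (aswap S).
  have [->|S0] := eqVneq (rnorm S) 0; first exact: rnorm_ge0.
  have S1 : 0 < rnorm S by rewrite lt_neqAle eq_sym S0 rnorm_ge0.
  rewrite -(ler_pM2r S1) -expr2 (le_trans (rnorm_aswap_mul S))//.
  exact: rnorm_amul.
by apply/eqP; rewrite eq_le; apply/andP; split; [exact: (le (aswap T))|exact: le].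
Qed.

Lemma rnorm_aswap_mulE T : rnorm (amul (aswap T) T) = rnorm T ^+ 2.
Proof.
apply/eqP; rewrite eq_le rnorm_aswap_mul andbT.
by rewrite (le_trans (rnorm_amul _ _))// rnorm_aswap expr2.
Qed.

End AdjAlgebra.

Section AdjComplete.
Context {R : realType} {X : completeNormedModType (Cx R)}
  {Y : normedModType (Cx R)} {f : innerform X Y}.

(* A limit of adjointable operators is built from the pointwise limits of the
   operators and of their adjoints. *)
Lemma adj_complete (F : set_system (adj f)) : ProperFilter F -> cauchy F -> cvg F.
Proof.
move=> FF /cauchy_ballP Fc.
have cau (e : R) : 0 < e -> exists T : adj f,
    F [set S | rnorm (S - T) <= e].
  move=> e0; have e1 : 0 < (e%:C%C : Cx R) by rewrite (ltCxR 0).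
  have [[A B] /= [FA FB] AB] := Fc _ e1.
  have [T BT] := filter_ex FB; exists T; apply: filterS FA => S AS /=.
  have := AB (S, T) (conj AS BT); rewrite -ball_normE /= rnormE ltCxR.
  exact: ltW.
have cl (e d : R) S T : F [set U | rnorm (U - S) <= e] ->
    F [set U | rnorm (U - T) <= d] -> rnorm (S - T) <= e + d.
  move=> FS FT; have [U [/= US UT]] := filter_ex (filterI FS FT).
  by rewrite (le_trans (rnorm_tri U _ _))// lerD// rnormB.
have pl (g : adj f -> X -> X) : (forall S T x, rnorm (g S x - g T x) <= rnorm (S - T) * rnorm x) ->
    exists h : X -> X, forall (e : R) T, 0 < e -> F [set U | rnorm (U - T) <= e] ->
      forall x, rnorm (g T x - h x) <= e * rnorm x.
  move=> gl; have /choice[h hP] : forall x, exists y, forall (e : R) T, 0 < e ->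
      F [set U | rnorm (U - T) <= e] -> rnorm (g T x - y) <= rnorm x * e.
    move=> x; pose P (e : R) v := exists2 T, F [set U | rnorm (U - T) <= e] & v = g T x.
    have [e e0|e d v w e0 d0 [S FS ->] [T FT ->]|l lP] := @approx_limit R X P (rnorm x).
    - by have [T FT] := cau e e0; exists (g T x), T.
    - rewrite (le_trans (gl _ _ _))// mulrC ler_wpM2l ?rnorm_ge0//; exact: cl.
    - by exists l => e T e0 FT; apply: lP => //; exists T.
  by exists h => e T e0 FT x; rewrite mulrC; exact: hP.
have [|h hP] := pl (@afun R X Y f).
  by move=> S T x; rewrite -afunB rnorm_afun.
have [|k kP] := pl (@astar R X Y f).
  move=> S T x; rewrite -(rnorm_aswap (S - T)).
  suff -> : astar S x - astar T x = aswap (S - T) x by exact: rnorm_afun.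
  rewrite -[S - T]/(aadd S (ascale (-1) T)) /=.
  by rewrite rmorphN1 scaleN1r.
have hkP x y : f (h x) y = f x (k y).
  apply: (@eps_eq _ _ (2 * (rnorm x * rnorm y))) => e e0.
  have [T FT] := cau e e0.
  rewrite (le_trans (rnorm_tri (f (T x) y) _ _))// {2}adjP.
  rewrite -(linearBf _ _ (fm_lin f _)).
  have -> : f (h x) y - f (T x) y = f (h x - T x) y.
    rewrite [h x - T x]addrC -[- T x]scaleN1r fm_conj rmorphN1 scaleN1r addrC //.
  have h1 : rnorm (f (h x - T x) y) <= e * rnorm x * rnorm y.
    rewrite (le_trans (fm_bound f _ _))// ler_wpM2r ?rnorm_ge0// rnormB.
    exact: hP.
  have h2 := le_trans (fm_bound f _ _) (ler_wpM2l (rnorm_ge0 x) (kP e T e0 FT y)).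
  by lra.
have hkP' x y : f (k x) y = f x (h y).
  apply: (@eps_eq _ _ (2 * (rnorm x * rnorm y))) => e e0.
  have [T FT] := cau e e0.
  rewrite (le_trans (rnorm_tri (f (astar T x) y) _ _))// {2}adjP'.
  rewrite -(linearBf _ _ (fm_lin f _)).
  have -> : f (k x) y - f (astar T x) y = f (k x - astar T x) y.
    rewrite [k x - astar T x]addrC -[- astar T x]scaleN1r fm_conj rmorphN1 scaleN1r addrC //.
  have h1 : rnorm (f (k x - astar T x) y) <= e * rnorm x * rnorm y.
    rewrite (le_trans (fm_bound f _ _))// ler_wpM2r ?rnorm_ge0// rnormB.
    exact: kP.
  have h2 := le_trans (fm_bound f _ _) (ler_wpM2l (rnorm_ge0 x) (hP e T e0 FT y)).
  by lra.
apply/cvg_ex; exists (Adj hkP hkP'); apply/cvgrPdist_le.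
apply: cx_gt0P => e e0; have e2 : 0 < e / 2 by rewrite divr_gt0.
have [T FT] := cau _ e2; apply: (filterS _ FT) => U /= UT.
rewrite rnormE leCxR (le_trans (rnorm_tri T _ _))// [leRHS]splitr lerD//; last first.
  by rewrite rnormB.
apply: rnorm_adj_le; first exact: ltW.
by move=> x; rewrite afunB /= rnormB; exact: (hP _ _ e2 FT).
Qed.

HB.instance Definition _ := Uniform_isComplete.Build (adj f) adj_complete.

Definition adj_cstar : cstarAlg R.
Proof.
apply: (@CStarAlg R (adj f) (@amul R X Y f) (@aswap R X Y f)).
- by move=> S T U; apply: adj_eq.
- by move=> a S T U; apply: adj_eq.
- by move=> a S T U; apply: adj_eq => x /=; exact: afun_linear.
- by move=> T; exact: adj_eq.
- by move=> S T; apply: adj_eq.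
- by move=> a S T; apply: adj_eq.
- by move=> S T; rewrite !rnormE -realCM leCxR rnorm_amul.
- by move=> T; rewrite !rnormE -realCX; congr (_ %:C)%C; exact: rnorm_aswap_mulE.
Defined.

End AdjComplete.
Arguments adj_cstar {R X Y} f.

Section CstarNorm.
Context {R : realType} {A : cstarAlg R}.
Implicit Types x y z : A.

Lemma cs_rnormM x y : rnorm (x ** y) <= rnorm x * rnorm y.
Proof. by rewrite -leCxR realCM -!rnormE cs_normM. Qed.

Lemma cs_rnorm_star_mul x : rnorm (cs_star x ** x) = rnorm x ^+ 2.
Proof. by apply: realC_inj; rewrite realCX -!rnormE cs_norm_star. Qed.

Lemma cs_rnorm_star x : rnorm (cs_star x) = rnorm x.
Proof.
have le y : rnorm y <= rnorm (cs_star y).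
  have [->|y0] := eqVneq (rnorm y) 0; first exact: rnorm_ge0.
  have y1 : 0 < rnorm y by rewrite lt_neqAle eq_sym y0 rnorm_ge0.
  by rewrite -(ler_pM2r y1) -expr2 -cs_rnorm_star_mul cs_rnormM.
by apply/eqP; rewrite eq_le le andbT -{2}(cs_starK x) le.
Qed.

Lemma cs_starD1 x y : cs_star (x + y) = cs_star x + cs_star y.
Proof. by have := cs_starD 1 x y; rewrite rmorph1 !scale1r. Qed.

Lemma cs_star0 : cs_star (0 : A) = 0.
Proof. by apply: rnorm_eq0; rewrite cs_rnorm_star rnorm0. Qed.

Lemma cs_starZ (a : Cx R) x : cs_star (a *: x) = Num.conj a *: cs_star x.
Proof. by have := cs_starD a x 0; rewrite !addr0 cs_star0 addr0. Qed.

Lemma cs_starN x : cs_star (- x) = - cs_star x.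
Proof. by rewrite -scaleN1r cs_starZ rmorphN1 scaleN1r. Qed.

Lemma cs_starB x y : cs_star (x - y) = cs_star x - cs_star y.
Proof. by rewrite cs_starD1 cs_starN. Qed.

Lemma cs_mulxN x y : x ** (- y) = - (x ** y).
Proof. by rewrite -scaleN1r cs_mulxZ scaleN1r. Qed.

Lemma cs_mulNx x y : (- x) ** y = - (x ** y).
Proof. by rewrite -scaleN1r cs_mulZx scaleN1r. Qed.

Lemma cs_mulxB z x y : z ** (x - y) = z ** x - z ** y.
Proof. by rewrite cs_mulxD cs_mulxN. Qed.

Lemma cs_mulBx z x y : (x - y) ** z = x ** z - y ** z.
Proof. by rewrite cs_mulDx cs_mulNx. Qed.

End CstarNorm.

Section Tends.
Context {R : realType}.

Lemma tends_uniq (V : normedModType (Cx R)) (u : nat -> V) l m :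
  tends u l -> tends u m -> l = m.
Proof.
move=> ul um; apply: (@eps_eq _ _ 2) => e e0.
have [N Nl] := ul e e0; have [N' Nm] := um e e0.
have := Nl _ (leq_maxl N N'); have := Nm _ (leq_maxr N N').
have := rnorm_tri (u (maxn N N')) l m; rewrite (rnormB l (u _)); lra.
Qed.

Lemma tends_cst (V : normedModType (Cx R)) (l : V) : tends (fun=> l) l.
Proof. by move=> e e0; exists 0%N => n _; rewrite subrr rnorm0. Qed.

Lemma tends_lip (V W : normedModType (Cx R)) (f : V -> W) (M : R) (u : nat -> V) l :
  (forall x y, rnorm (f x - f y) <= M * rnorm (x - y)) ->
  tends u l -> tends (f \o u) (f l).
Proof.
move=> fM ul e e0; have M0 : 0 < `|M| + 1 by rewrite ltr_wpDl.
have [N Nu] := ul _ (divr_gt0 e0 M0); exists N => n /Nu.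
rewrite ltr_pdivlMr// mulrC => h; apply: le_lt_trans h.
rewrite (le_trans (fM _ _))// ler_wpM2r ?rnorm_ge0//.
by rewrite (le_trans (ler_norm M))// lerDl.
Qed.

Lemma tends_lin (V W : normedModType (Cx R)) (f : V -> W) (M : R) (u : nat -> V) l :
  linear f -> (forall x, rnorm (f x) <= M * rnorm x) ->
  tends u l -> tends (f \o u) (f l).
Proof. by move=> lf fM; apply: (@tends_lip _ _ _ M) => x y; rewrite -(linearBf _ _ lf). Qed.

Lemma tends_rnorm_le (V : normedModType (Cx R)) (u : nat -> V) l (c : R) :
  tends u l -> (forall n, rnorm (u n) <= c) -> rnorm l <= c.
Proof.
move=> ul uc; apply: (@eps_le _ _ _ 1) => e e0; have [N Nl] := ul e e0.
have := Nl N (leqnn N); have := uc N; have := rnorm_leD l (u N).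
rewrite (rnormB l (u N)); lra.
Qed.

End Tends.

(** * Square roots by a power series *)

Section SquareRoot.
Context {R : realType} {A : cstarAlg R}.
Implicit Types x y z : A.

(* Partial sums of the power series of 1 - sqrt (1 - x): the coefficients are
   nonnegative, so the sequence started at x in A is dominated, increments
   included, by the sequence started at 1 in R. *)
Fixpoint sqrt_seq x (n : nat) : A :=
  if n is m.+1 then (2^-1)%:C%C *: (x + sqrt_seq x m ** sqrt_seq x m) else 0.

Fixpoint sqrt_bound (n : nat) : R :=
  if n is m.+1 then (1 + sqrt_bound m ^+ 2) / 2 else 0.

Lemma sqrt_bound01 n : 0 <= sqrt_bound n <= 1.
Proof. by elim: n => [|n /andP[h1 h2]] /=; [rewrite lexx ler01|nra]. Qed.

Lemma sqrt_boundS n : sqrt_bound n <= sqrt_bound n.+1.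
Proof. by have := sqr_ge0 (sqrt_bound n - 1); rewrite /=; nra. Qed.

Lemma sqrt_bound_mono n m : (n <= m)%N -> sqrt_bound n <= sqrt_bound m.
Proof.
move=> /subnKC <-; elim: (m - n)%N => [|k IH]; first by rewrite addn0.
by rewrite addnS (le_trans IH)// sqrt_boundS.
Qed.

Lemma sqrt_seq_norm x n : rnorm x <= 1 -> rnorm (sqrt_seq x n) <= sqrt_bound n.
Proof.
move=> x1; elim: n => [|n IH] /=; first by rewrite rnorm0.
rewrite rnormZ cabsC ger0_norm ?invr_ge0//.
have h1 := rnormD x (sqrt_seq x n ** sqrt_seq x n).
have h2 := cs_rnormM (sqrt_seq x n) (sqrt_seq x n).
have := rnorm_ge0 (sqrt_seq x n); nra.
Qed.

(** The difference of squares is split as $b^2-c^2=b(b-c)+(b-c)c$, which needs no commutation and is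
    majorized term by term by the same expression in [sqrt_bound]. *)
Lemma sqrt_seq_incr x n : rnorm x <= 1 ->
  rnorm (sqrt_seq x n.+1 - sqrt_seq x n) <= sqrt_bound n.+1 - sqrt_bound n.
Proof.
move=> x1; elim: n => [|n IH].
  rewrite /= cs_mul0x addr0 subr0 rnormZ cabsC ger0_norm ?invr_ge0//.
  by rewrite expr0n addr0 subr0; lra.
rewrite [X in rnorm (X - _)]/= [X in rnorm (_ - X)]/= -scalerBr opprD addrACA subrr add0r.
set b := sqrt_seq x n.+1; set c := sqrt_seq x n.
have -> : b ** b - c ** c = b ** (b - c) + (b - c) ** c.
  by rewrite cs_mulxB cs_mulBx addrA subrK.
rewrite rnormZ cabsC ger0_norm ?invr_ge0//.
have h1 := rnormD (b ** (b - c)) ((b - c) ** c).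
have h2 := cs_rnormM b (b - c); have h3 := cs_rnormM (b - c) c.
have h4 : rnorm b <= sqrt_bound n.+1 := sqrt_seq_norm n.+1 x1.
have h5 : rnorm c <= sqrt_bound n := sqrt_seq_norm n x1.
have h6 := rnorm_ge0 b; have h7 := rnorm_ge0 c; have h8 := rnorm_ge0 (b - c).
rewrite -/b -/c in IH.
have -> : sqrt_bound n.+2 - sqrt_bound n.+1 =
    2^-1 * ((sqrt_bound n.+1 + sqrt_bound n) * (sqrt_bound n.+1 - sqrt_bound n)).
  have E1 : sqrt_bound n.+2 = (1 + sqrt_bound n.+1 ^+ 2) / 2 by [].
  have E2 : sqrt_bound n.+1 = (1 + sqrt_bound n ^+ 2) / 2 by [].
  by rewrite E1; move: (sqrt_bound n.+1) (sqrt_bound n) E2 => B C; lra.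
rewrite ler_pM2l ?invr_gt0//.
have : (rnorm b + rnorm c) * rnorm (b - c) <=
  (sqrt_bound n.+1 + sqrt_bound n) * (sqrt_bound n.+1 - sqrt_bound n).
  by rewrite ler_pM// ?lerD// addr_ge0.
rewrite mulrDl [rnorm c * _]mulrC; lra.
Qed.

Lemma sqrt_seq_dist x n m : rnorm x <= 1 -> (n <= m)%N ->
  rnorm (sqrt_seq x m - sqrt_seq x n) <= sqrt_bound m - sqrt_bound n.
Proof.
move=> x1 /subnKC <-; elim: (m - n)%N => [|k IH].
  by rewrite addn0 !subrr rnorm0.
rewrite addnS (le_trans (rnorm_tri (sqrt_seq x (n + k)) _ _))//.
have := sqrt_seq_incr (n + k) x1; lra.
Qed.

(** The scalar sequence increases and is bounded by 1; its closeness to its supremum controls all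
    later increments in [A]. *)
Lemma sqrt_seq_cauchy x : rnorm x <= 1 -> cauchyseq (sqrt_seq x).
Proof.
move=> x1 e e0.
have hs : has_sup (range sqrt_bound).
  split; first by exists (sqrt_bound 0), 0%N.
  by exists 1 => _ [n _ <-]; case/andP: (sqrt_bound01 n).
have [_ [N _ <-] Ne] := sup_adherent e0 hs.
have ub n : sqrt_bound n <= sup (range sqrt_bound).
  by apply: ub_le_sup; [case: hs|exists n].
exists N => n m Nn Nm; wlog nm : n m Nn Nm / (n <= m)%N.
  by move=> wl; case/orP : (leq_total n m) => /wl; [|rewrite rnormB]; apply.
rewrite rnormB (le_lt_trans (sqrt_seq_dist x1 nm))//.
have := ub m; have := sqrt_bound_mono Nn; lra.
Qed.

(** The equation is $(1-b)^2=1-x$, expanded so as to make sense without a unit. Self-adjointness and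
    commutation hold for every iterate and pass to the limit. *)
Lemma one_minus_sqrt x : rnorm x <= 1 -> exists b : A, [/\ rnorm b <= 1,
  b + b = x + b ** b, cs_star x = x -> cs_star b = b &
  forall y, x ** y = y ** x -> b ** y = y ** b].
Proof.
move=> x1; have [b bl] := cauchyseq_tends (sqrt_seq_cauchy x1); exists b.
have b1 : rnorm b <= 1.
  apply: tends_rnorm_le bl _ => n; apply: le_trans (sqrt_seq_norm n x1) _.
  by case/andP: (sqrt_bound01 n).
split=> //.
- apply: (@eps_eq _ _ 4) => e e0; have [N Nb] := bl e e0.
  have h1 := Nb N (leqnn N); have h2 := Nb N.+1 (leqnSn N).
  set c := sqrt_seq x N in h1; set d := sqrt_seq x N.+1 in h2.
  have dE : d + d = x + c ** c.
    rewrite /d /= -/c -scalerDl -realCD (_ : 2^-1 + 2^-1 = 1) ?scale1r//.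
    by rewrite -mulr2n -[2^-1 *+ 2]mulr_natr mulVf.
  (* Subtracting the recursion $2d=x+c^2$ leaves only the distances of [b] to the two iterates [c]
     and [d]. *)
  have -> : b + b - (x + b ** b) = ((b - d) + (b - d)) + (c ** (c - b) + (c - b) ** b).
    have -> : c ** (c - b) + (c - b) ** b = c ** c - b ** b.
      by rewrite cs_mulxB cs_mulBx addrA subrK.
    have -> : b - d + (b - d) = b + b - (x + c ** c) by rewrite addrACA -opprD dE.
    by rewrite !opprD !addrA subrK.
  have h3 := rnormD ((b - d) + (b - d)) (c ** (c - b) + (c - b) ** b).
  have h4 := rnormD (b - d) (b - d); have h5 := rnormD (c ** (c - b)) ((c - b) ** b).
  have h6 := cs_rnormM c (c - b); have h7 := cs_rnormM (c - b) b.
  rewrite rnormB in h2.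
  have c1 : rnorm c <= 1.
    by apply: le_trans (sqrt_seq_norm N x1) _; case/andP: (sqrt_bound01 N).
  have := rnorm_ge0 c; have := rnorm_ge0 b; have := rnorm_ge0 (c - b); nra.
- move=> xs; apply: (@tends_uniq _ _ (sqrt_seq x)) => //.
  have cs n : cs_star (sqrt_seq x n) = sqrt_seq x n.
    elim: n => [|n IH]; first exact: cs_star0.
    by rewrite /= cs_starZ conj_realC cs_starD1 xs cs_starM IH.
  have := @tends_lip _ _ _ (@cs_star R A) 1 _ _ _ bl.
  have -> : cs_star \o sqrt_seq x = sqrt_seq x by apply/funext => n; exact: cs.
  by apply => y z; rewrite mul1r -cs_starB cs_rnorm_star.
- move=> y xy; apply/eqP; rewrite -subr_eq0; apply/eqP.
  have cy n : sqrt_seq x n ** y - y ** sqrt_seq x n = 0.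
    apply/eqP; rewrite subr_eq0; apply/eqP.
    elim: n => [|n IH]; first by rewrite cs_mul0x cs_mulx0.
    by rewrite /= cs_mulZx cs_mulxZ cs_mulDx cs_mulxD xy -cs_mulA IH !cs_mulA IH.
  have := @tends_lin _ _ _ (fun z => z ** y - y ** z) (2 * rnorm y) _ _ _ _ bl.
  rewrite (_ : _ \o _ = fun=> 0); last by apply/funext => n; exact: cy.
  move=> h; apply: (tends_uniq (h _ _)).
  + by move=> a u v; rewrite cs_mulDl cs_mulDr scalerBr opprD addrACA.
  + move=> z; rewrite (le_trans (rnormD _ _))// rnormN.
    by have := cs_rnormM z y; have := cs_rnormM y z; lra.
  + exact: tends_cst.
Qed.

End SquareRoot.

(** * Positive operators *)

Section AdjRing.
Context {R : realType} {X : completeNormedModType (Cx R)}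
  {Y : normedModType (Cx R)} {f : innerform X Y}.
Implicit Types (x y z : adj f).

Fact amulA : associative (@amul R X Y f).
Proof. by move=> x y z; exact: adj_eq. Qed.
Fact amul1 : left_id (@aone R X Y f) (@amul R X Y f).
Proof. by move=> x; exact: adj_eq. Qed.
Fact amulr1 : right_id (@aone R X Y f) (@amul R X Y f).
Proof. by move=> x; exact: adj_eq. Qed.
Fact amulDl : left_distributive (@amul R X Y f) +%R.
Proof. by move=> x y z; exact: adj_eq. Qed.
Fact amulDr : right_distributive (@amul R X Y f) +%R.
Proof. by move=> x y z; apply: adj_eq => v; exact: linearDf (afun_linear x). Qed.

HB.instance Definition _ :=
  GRing.Zmodule_isPzRing.Build (adj f) amulA amul1 amulr1 amulDl amulDr.

Lemma aswapK x : aswap (aswap x) = x. Proof. exact: adj_eq. Qed.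
Lemma aswapM x y : aswap (x * y) = aswap y * aswap x. Proof. exact: adj_eq. Qed.
Lemma aswapD x y : aswap (x + y) = aswap x + aswap y. Proof. exact: adj_eq. Qed.
Lemma aswapZ (a : Cx R) x : aswap (a *: x) = Num.conj a *: aswap x.
Proof. exact: adj_eq. Qed.
Lemma aswapN x : aswap (- x) = - aswap x.
Proof. by rewrite -scaleN1r aswapZ rmorphN1 scaleN1r. Qed.
Lemma aswapB x y : aswap (x - y) = aswap x - aswap y.
Proof. by rewrite aswapD aswapN. Qed.
Lemma aswap1 : aswap (1 : adj f) = 1. Proof. exact: adj_eq. Qed.
Lemma aswapX x n : aswap x = x -> aswap (x ^+ n) = x ^+ n.
Proof.
by move=> xs; elim: n => [|n IH]; [exact: aswap1|rewrite exprS aswapM IH xs -exprSr exprS].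
Qed.
Lemma ascaleAl (a : Cx R) x y : (a *: x) * y = a *: (x * y). Proof. exact: adj_eq. Qed.
Lemma ascaleAr (a : Cx R) x y : x * (a *: y) = a *: (x * y).
Proof. by apply: adj_eq => v; exact: linearZf (afun_linear x). Qed.
Lemma arnormM x y : rnorm (x * y) <= rnorm x * rnorm y.
Proof. exact: rnorm_amul. Qed.
Lemma arnorm_star x : rnorm (aswap x * x) = rnorm x ^+ 2.
Proof. exact: rnorm_aswap_mulE. Qed.
Lemma arnorm_sq x : aswap x = x -> rnorm (x * x) = rnorm x ^+ 2.
Proof. by move=> {1}<-; exact: arnorm_star. Qed.
Lemma arnorm1 : rnorm (1 : adj f) <= 1.
Proof. by apply: rnorm_adj_le => // v; rewrite mul1r. Qed.

Lemma acomm_scale1 (a : Cx R) x : GRing.comm x (a *: (1 : adj f) : adj f).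
Proof. by rewrite /GRing.comm ascaleAr ascaleAl mulr1 mul1r. Qed.

End AdjRing.

Section Positive.
Context {R : realType} {X : completeNormedModType (Cx R)}
  {Y : normedModType (Cx R)} {f : innerform X Y}.
Implicit Types (x y z a b h k : adj f) (t r : R).

(** Squares of self-adjoint elements stand in for elements of nonnegative spectrum. That sums and
    all $x^*x$ are of this form is proved in [posD] and [pos_star_mul]. *)
Definition pos x := exists2 h, aswap h = h & x = h * h.

Local Notation "t %:1" := ((t%:C%C : Cx R) *: (1 : adj f)) (at level 2).

Lemma rnorm_real t : 0 <= t -> rnorm (t%:1) <= t.
Proof. by move=> t0; rewrite rnormZ cabsC ger0_norm// ler_piMr// arnorm1. Qed.

Lemma pos_star x : pos x -> aswap x = x.
Proof. by move=> [h hs ->]; rewrite aswapM hs. Qed.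

Lemma pos_sq h : aswap h = h -> pos (h * h).
Proof. by move=> hs; exists h. Qed.

Lemma posZ t x : 0 <= t -> pos x -> pos ((t%:C%C : Cx R) *: x).
Proof.
move=> t0 [h hs ->]; exists (((Num.sqrt t)%:C%C : Cx R) *: h).
  by rewrite aswapZ conj_realC hs.
by rewrite ascaleAl ascaleAr scalerA -realCM -(expr2 (Num.sqrt t)) sqr_sqrtr.
Qed.

(* [h + i k] is normal, and its self-adjoint part is dominated by its norm. *)
Lemma comm_sq_mono h k : aswap h = h -> aswap k = k -> h * k = k * h ->
  rnorm h ^+ 2 <= rnorm (h * h + k * k).
Proof.
move=> hs ks hk; pose i : Cx R := 'i%C.
have ii : i * i = -1 by exact: sqr_i.
have ci : Num.conj i = - i.
  by apply/Cx_eqP; rewrite /= oppr0.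
pose V := h + i *: k.
have Vs : aswap V = h - i *: k by rewrite aswapD aswapZ hs ks ci scaleNr.
have VV : aswap V * V = h * h + k * k.
  rewrite Vs mulrBl !mulrDr !ascaleAl !ascaleAr hk opprD addrA addrK.
  by rewrite !scalerA ii scaleN1r opprK.
rewrite -VV arnorm_star lerXn2r ?nnegrE ?rnorm_ge0//.
have : rnorm ((2%:C%C : Cx R) *: h) <= rnorm V + rnorm (aswap V).
  suff -> : (2%:C%C : Cx R) *: h = V + aswap V by exact: rnormD.
  rewrite Vs addrACA subrr addr0 (_ : 2%:C%C = 2%:R :> Cx R) ?rmorph_nat//.
  by rewrite scaler_nat mulr2n.
by rewrite rnorm_aswap rnormZ cabsC ger0_norm//; lra.
Qed.

Lemma sqrt_ball x : aswap x = x -> rnorm (1 - x) <= 1 -> exists h,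
  [/\ aswap h = h, x = h * h, rnorm (1 - h) <= 1 &
      forall y, GRing.comm x y -> GRing.comm h y].
Proof.
move=> xs x1; have [b [b1 bE bs bc]] := @one_minus_sqrt R (adj_cstar f) (1 - x) x1.
have {}bE : b + b = (1 - x) + b * b := bE.
have {}bs : aswap b = b by apply: bs; rewrite [cs_star _]aswapB aswap1 xs.
exists (1 - b); split.
- by rewrite aswapB aswap1 bs.
- rewrite mulrBl mul1r mulrBr mulr1 opprB addrACA -opprD bE.
  by rewrite [1 - x + _]addrAC opprB addrC subrK.
- by rewrite subKr.
move=> y xy.
have /bc by_ : @cs_mul R (adj_cstar f) (1 - x) y = @cs_mul R (adj_cstar f) y (1 - x).
  by rewrite -[LHS]/((1 - x) * y) -[RHS]/(y * (1 - x)) mulrBl mulrBr mul1r mulr1 xy.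
by rewrite /GRing.comm mulrBl mulrBr mul1r mulr1 -[b * y]/(@cs_mul R (adj_cstar f) b y) by_.
Qed.

(** The root $k$ of $1-h^2$ commutes with $h$, and $k^2+h^2=1$, so [comm_sq_mono] bounds
    $\|k\|^2=\|1-h^2\|$ by 1. *)
Lemma one_minus_sq h : aswap h = h -> rnorm h <= 1 ->
  rnorm (1 - h * h) <= 1 /\ pos (1 - h * h).
Proof.
move=> hs h1; have xs : aswap (1 - h * h) = 1 - h * h.
  by rewrite aswapB aswap1 aswapM hs.
have x1 : rnorm (1 - (1 - h * h)) <= 1.
  by rewrite subKr (arnorm_sq hs) exprn_ile1// rnorm_ge0.
have [k [ks kE _ kc]] := sqrt_ball xs x1; split; last by exists k.
have hk : k * h = h * k.
  by apply: kc; rewrite /GRing.comm mulrBl mulrBr mul1r mulr1 mulrA.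
have := comm_sq_mono ks hs hk; rewrite -kE subrK kE (arnorm_sq ks) => /le_trans; apply.
exact: arnorm1.
Qed.

Lemma pos_ball x : pos x -> rnorm x <= 1 -> rnorm (1 - x) <= 1 /\ pos (1 - x).
Proof.
move=> [h hs ->]; rewrite (arnorm_sq hs) => h1; apply: one_minus_sq => //.
by rewrite -(@ler_pXn2r _ 2%N)// ?nnegrE ?rnorm_ge0// expr1n.
Qed.

Lemma posZK t x : 0 < t -> pos (((t^-1)%:C%C : Cx R) *: x) -> pos x.
Proof.
move=> t0 /(posZ (ltW t0)); rewrite scalerA -realCM divff ?gt_eqF//.
by rewrite scale1r.
Qed.

(** With [pos_sub] this gives a norm criterion for positivity, $\|t-x\|\le t$. Unlike the definition
    by squares it is visibly stable under sums, whence [posD]. *)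
Lemma pos_of_ball t x : aswap x = x -> 0 < t -> rnorm (t%:1 - x) <= t -> pos x.
Proof.
move=> xs t0 xt; apply: (posZK t0).
have [||h [hs -> _ _]] := @sqrt_ball (((t^-1)%:C%C : Cx R) *: x); last by exists h.
  by rewrite aswapZ conj_realC xs.
have -> : 1 - ((t^-1)%:C%C : Cx R) *: x = ((t^-1)%:C%C : Cx R) *: (t%:1 - x).
  by rewrite scalerBr scalerA -realCM mulVf ?gt_eqF// scale1r.
rewrite rnormZ cabsC gtr0_norm ?invr_gt0//.
by rewrite ler_pdivrMl// mulr1.
Qed.

Lemma pos_sub t x : pos x -> 0 < t -> rnorm x <= t ->
  rnorm (t%:1 - x) <= t /\ pos (t%:1 - x).
Proof.
move=> px t0 xt.
have ti : 0 <= t^-1 by rewrite invr_ge0 ltW.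
have [|h1 h2] := pos_ball (posZ ti px).
  by rewrite rnormZ cabsC ger0_norm// ler_pdivrMl// mulr1.
have E : t%:1 - x = (t%:C%C : Cx R) *: (1 - ((t^-1)%:C%C : Cx R) *: x).
  by rewrite scalerBr scalerA -realCM divff ?gt_eqF// scale1r.
rewrite E; split; last exact: posZ (ltW t0) h2.
by rewrite rnormZ cabsC gtr0_norm// ler_piMr// ltW.
Qed.

(** Division by $\|x\|+1$ brings [x] into the range of the power series. The last clause, that the
    root commutes with whatever commutes with [x], replaces functional calculus for commuting
    elements. *)
Lemma pos_sqrt x : pos x -> exists h, [/\ aswap h = h, x = h * h, pos h &
  forall y, GRing.comm x y -> GRing.comm h y].
Proof.
move=> px; pose t := rnorm x + 1; have t0 : 0 < t by rewrite ltr_wpDl ?rnorm_ge0.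
have s0 : 0 < Num.sqrt t by rewrite sqrtr_gt0.
have ti : 0 <= t^-1 by rewrite invr_ge0 ltW.
pose x' := ((t^-1)%:C%C : Cx R) *: x.
have x'1 : rnorm x' <= 1.
  by rewrite rnormZ cabsC ger0_norm// ler_pdivrMl// mulr1 lerDl.
have px' : pos x' := posZ ti px.
have [h [hs hE h1 hc]] := sqrt_ball (pos_star px') (pos_ball px' x'1).1.
exists (((Num.sqrt t)%:C%C : Cx R) *: h); split.
- by rewrite aswapZ conj_realC hs.
- rewrite ascaleAl ascaleAr scalerA -realCM -(expr2 (Num.sqrt t)) sqr_sqrtr ?ltW//.
  by rewrite -hE scalerA -realCM divff ?gt_eqF// scale1r.
- apply: posZ; first exact: ltW.
  by apply: (pos_of_ball hs ltr01); rewrite scale1r.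
move=> y xy; rewrite /GRing.comm ascaleAl ascaleAr hc//.
by rewrite /GRing.comm ascaleAl ascaleAr xy.
Qed.

Lemma posD x y : pos x -> pos y -> pos (x + y).
Proof.
move=> px py; pose t := rnorm x + rnorm y + 1.
have t0 : 0 < t by rewrite ltr_wpDl ?addr_ge0 ?rnorm_ge0.
have tx : rnorm x <= t by rewrite /t; have := rnorm_ge0 y; lra.
have ty : rnorm y <= t by rewrite /t; have := rnorm_ge0 x; lra.
have [h1 _] := pos_sub px t0 tx; have [h2 _] := pos_sub py t0 ty.
apply: (@pos_of_ball (t + t)); first by rewrite aswapD !pos_star.
  by rewrite addr_gt0.
rewrite realCD scalerDl opprD addrACA (le_trans (rnormD _ _))//.
exact: lerD.
Qed.

Lemma pos0 : pos 0.
Proof. by exists 0; [exact: adj_eq|rewrite mulr0]. Qed.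

Lemma pos_sum (I : Type) (r : seq I) (P : pred I) (F : I -> adj f) :
  (forall i, P i -> pos (F i)) -> pos (\sum_(i <- r | P i) F i).
Proof. by move=> pF; apply: big_ind => //; [exact: pos0|exact: posD]. Qed.

Lemma pos_le_real t x : 0 <= t -> pos x -> pos (t%:1 - x) -> rnorm x <= t.
Proof.
move=> t0 [h hs xE] pk; have [k [ks kE _ kc]] := pos_sqrt pk.
have kh : k * h = h * k.
  by apply: kc; rewrite /GRing.comm xE mulrBl mulrBr ascaleAl ascaleAr mul1r mulr1 mulrA.
have := comm_sq_mono hs ks (esym kh); rewrite -kE -xE addrC subrK => hh.
by rewrite xE (arnorm_sq hs) (le_trans hh)// rnorm_real.
Qed.

Lemma pos_mono x y : pos x -> pos (y - x) -> rnorm x <= rnorm y.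
Proof.
move=> px pyx; apply: (@eps_le _ _ _ 1) => e e0; rewrite mulr1.
have py : pos y by rewrite -(subrK x y); exact: posD.
(* The slack [e] keeps the scalar strictly positive even when [y] is 0, as [pos_sub] demands. *)
have t0 : 0 < rnorm y + e by rewrite ltr_wpDl ?rnorm_ge0.
have [|_ p1] := @pos_sub (rnorm y + e) y py t0; first by rewrite lerDl ltW.
apply: pos_le_real => //; first exact: ltW.
by rewrite -(subrK y (_%:1)) -addrA; exact: posD.
Qed.

Lemma pos_commM x y : pos x -> pos y -> GRing.comm x y -> pos (x * y).
Proof.
move=> px py xy.
have [h [hs hE _ hc]] := pos_sqrt px; have [k [ks kE _ kc]] := pos_sqrt py.
have hk : h * k = k * h by apply/esym/kc/esym/hc.
exists (h * k); first by rewrite aswapM hs ks hk.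
by rewrite hE kE -!mulrA; congr (h * _); rewrite !mulrA hk.
Qed.

(* If y <> 0, let t = |y|^2 and p = - y^* y; then q = y y^* is positive as well,
   being p plus the positive y y^* + y^* y. In
   y^* (t - q) y = - p (t + p) the left side has norm at most t^2, the right
   side norm at least |2 p^2| = 2 t^2. *)
Lemma neg_star_mul y : pos (- (aswap y * y)) -> y = 0.
Proof.
set p := - _ => pp.
have [t0|t0] := eqVneq (rnorm y) 0; first exact: rnorm_eq0.
have {}t0 : 0 < rnorm y ^+ 2 by rewrite exprn_gt0// lt_neqAle eq_sym t0 rnorm_ge0.
set t := rnorm y ^+ 2 in t0.
pose i : Cx R := 'i%C.
have ii : i * i = -1 by exact: sqr_i.
have ci : Num.conj i = - i by apply/Cx_eqP; rewrite /= oppr0.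
pose q := y * aswap y.
have pq : pos (q - p).
  pose r := y + aswap y; pose s := i *: (y - aswap y).
  have rs : aswap r = r by rewrite aswapD aswapK addrC.
  have ss : aswap s = s.
    by rewrite aswapZ aswapB aswapK ci scaleNr -scalerN opprB.
  suff E : (2%:C%C : Cx R) *: (q - p) = r * r + s * s.
    apply: (@posZK 2^-1); first by rewrite invr_gt0.
    by rewrite invrK E; apply: posD; exact: pos_sq.
  rewrite /r /s ascaleAl ascaleAr scalerA ii scaleN1r /p opprK.
  rewrite (_ : 2%:C%C = 2%:R :> Cx R) ?rmorph_nat// scaler_nat mulr2n.
  rewrite !(mulrDl, mulrDr) !mulrN !mulNr !opprD !opprK -/q.
  rewrite [RHS]addrACA (addrACA (y * y)) subrr add0r.
  by rewrite (addrACA (aswap y * y) (aswap y * aswap y)) subrr addr0 addrACA.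
have pq' : pos q by rewrite -(subrK p q); exact: posD.
have qt : rnorm q = t by rewrite /t -(rnorm_aswap y) -arnorm_star aswapK.
have pt : rnorm p = t by rewrite rnormN arnorm_star.
have [tq _] : rnorm (t%:1 - q) <= t /\ pos (t%:1 - q).
  by apply: pos_sub => //; rewrite qt.
have [_ tp] : rnorm (t%:1 - p) <= t /\ pos (t%:1 - p).
  by apply: pos_sub => //; rewrite pt.
have E : aswap y * (t%:1 - q) * y = - (p * (t%:1 + p)).
  rewrite mulrBr mulrBl mulrDr ascaleAr ascaleAl mulr1 opprD ascaleAr mulr1.
  rewrite -scalerN opprK; congr (_ + _).
  by rewrite /q /p mulrNN !mulrA.
have up : rnorm (p * (t%:1 + p)) <= t ^+ 2.
  rewrite -rnormN -E (le_trans (arnormM _ _))//.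
  rewrite (@le_trans _ _ (rnorm y * t * rnorm y))//.
    rewrite ler_wpM2r ?rnorm_ge0// (le_trans (arnormM _ _))//.
    by rewrite rnorm_aswap ler_wpM2l ?rnorm_ge0.
  by rewrite mulrAC -expr2 -/t expr2.
have lo : rnorm ((2%:C%C : Cx R) *: (p * p)) <= rnorm (p * (t%:1 + p)).
  apply: pos_mono; first by apply: posZ => //; exact: pos_commM.
  have -> : p * (t%:1 + p) - (2%:C%C : Cx R) *: (p * p) = p * (t%:1 - p).
    rewrite mulrDr mulrBr (_ : 2%:C%C = 2%:R :> Cx R) ?rmorph_nat//.
    by rewrite scaler_nat mulr2n opprD addrA addrK.
  apply: pos_commM => //.
  by apply: commrB => //; exact: acomm_scale1.
move: lo; rewrite rnormZ cabsC ger0_norm// (arnorm_sq (pos_star pp)) pt => lo.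
exfalso; move: (le_trans lo up) (exprn_gt0 2 t0); move: (t ^+ 2) => u; lra.
Qed.

(* With a = x^* x, c = |a| and n = c - a, the element y = x n satisfies
   y^* y = - c n^2. *)
Lemma pos_star_mul x : pos (aswap x * x).
Proof.
set a := _ * _; have as_ : aswap a = a by rewrite aswapM aswapK.
have [c [cs cE pc cc]] := pos_sqrt (pos_sq as_).
have ca : c * a = a * c by apply: cc; rewrite /GRing.comm mulrA.
pose n := c - a; have ns : aswap n = n by rewrite aswapB cs as_.
have cn : c * n = n * c by rewrite mulrBr mulrBl ca.
have an : a * n = - (c * n) by rewrite !mulrBr cE ca opprB.
have [g [gs gE _ gc]] := pos_sqrt pc.
have gn : g * n = n * g by apply: gc.
have y0 : x * n = 0.
  apply: neg_star_mul; exists (g * n); first by rewrite aswapM ns gs gn.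
  rewrite aswapM ns -mulrA (mulrA (aswap x)) -/a an mulrN opprK.
  by rewrite {1}gn gE -!mulrA.
have an0 : a * n = 0 by rewrite /a -mulrA y0 mulr0.
have cn0 : c * n = 0 by apply: oppr_inj; rewrite -an oppr0.
have n0 : n = 0.
  have : rnorm n ^+ 2 = 0.
    by rewrite -(arnorm_sq ns) {1}/n mulrBl cn0 an0 subrr rnorm0.
  by move=> /eqP; rewrite sqrf_eq0 => /eqP; exact: rnorm_eq0.
by move: n0 => /eqP; rewrite subr_eq0 => /eqP <-.
Qed.

Lemma pos_conj x y : pos x -> pos (aswap y * x * y).
Proof.
move=> [h hs ->]; have := pos_star_mul (h * y).
by rewrite aswapM hs !mulrA.
Qed.

Lemma pos_sqnorm_sub x t : rnorm x <= t -> pos ((t ^+ 2)%:1 - aswap x * x).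
Proof.
move=> xt; have t0 : 0 <= t := le_trans (rnorm_ge0 x) xt.
have [t00|t1] := eqVneq t 0.
  have -> : x = 0 by apply: rnorm_eq0; apply/eqP; rewrite eq_le rnorm_ge0 andbT -t00.
  by rewrite mulr0 subr0 t00 expr0n scale0r; exact: pos0.
apply: (pos_sub (pos_star_mul x) _ _).2.
  by rewrite exprn_gt0// lt_neqAle eq_sym t1.
by rewrite arnorm_star lerXn2r ?nnegrE ?rnorm_ge0.
Qed.

End Positive.

(** * Multipliers and nondegenerate homomorphisms *)

Section StarHom.
Context {R : realType} {A : cstarAlg R} {X : completeNormedModType (Cx R)}
  {Y : normedModType (Cx R)} {f : innerform X Y}.

(* For a self-adjoint a in the unit ball take b with (1 - b)^2 = 1 - a^2; then
   rho a and 1 - rho b commute and their squares add up to 1. *)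
Lemma star_hom_contractive (rho : A -> adj f) : linear rho ->
  (forall a b, rho (a ** b) = rho a * rho b) ->
  (forall a, rho (cs_star a) = aswap (rho a)) ->
  forall a, rnorm (rho a) <= rnorm a.
Proof.
move=> lr mr sr.
have unit_ball a : cs_star a = a -> rnorm a <= 1 -> rnorm (rho a) <= 1.
  move=> as_ a1; have aa1 : rnorm (a ** a) <= 1.
    by rewrite (le_trans (cs_rnormM _ _))// mulr_ile1 ?rnorm_ge0.
  have [b [_ bE bs bc]] := one_minus_sqrt aa1.
  have sa : aswap (rho a) = rho a by rewrite -sr as_.
  have sb : aswap (1 - rho b) = 1 - rho b.
    by rewrite aswapB aswap1 -sr bs// cs_starM as_.
  have ab : rho a * (1 - rho b) = (1 - rho b) * rho a.
    rewrite mulrBr mulrBl mulr1 mul1r -!mr; congr (_ - rho _).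
    by apply/esym/bc; rewrite cs_mulA.
  have := comm_sq_mono sa sb ab.
  have -> : rho a * rho a + (1 - rho b) * (1 - rho b) = 1.
    have -> : rho a * rho a = rho b + rho b - rho b * rho b.
      by rewrite -!mr -(linearDf _ _ lr) bE (linearDf _ _ lr) addrK.
    rewrite mulrBl mul1r mulrBr mulr1 opprB (addrACA 1) -opprD.
    by rewrite [LHS]addrC addrA subrK addrK.
  by move/le_trans => /(_ _ arnorm1); rewrite expr_le1// rnorm_ge0.
have sa a : cs_star a = a -> rnorm (rho a) <= rnorm a.
  move=> as_; apply: (@eps_le _ _ _ 1) => e e0; rewrite mulr1.
  have t0 : 0 < rnorm a + e by rewrite ltr_wpDl ?rnorm_ge0.
  set t := rnorm a + e in t0 *.
  have := unit_ball (((t^-1)%:C%C : Cx R) *: a); rewrite cs_starZ conj_realC as_.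
  rewrite (linearZf _ _ lr) !rnormZ cabsC gtr0_norm ?invr_gt0// !ler_pdivrMl// !mulr1.
  by apply => //; rewrite /t lerDl ltW.
move=> a; rewrite -(@ler_pXn2r _ 2%N)// ?nnegrE ?rnorm_ge0//.
rewrite -arnorm_star -sr -mr -cs_rnorm_star_mul; apply: sa.
by rewrite cs_starM cs_starK.
Qed.

End StarHom.

Section MultForm.
Context {R : realType}.

Section Form.
Context (D : cstarAlg R).

Fact mform_lin (x : D) : linear (fun y => cs_star x ** y).
Proof. by move=> a y z; rewrite cs_mulDr. Qed.
Fact mform_conj (a : Cx R) (x y z : D) :
  cs_star (a *: x + y) ** z = Num.conj a *: (cs_star x ** z) + cs_star y ** z.
Proof. by rewrite cs_starD cs_mulDl. Qed.
Fact mform_bound (x y : D) : rnorm (cs_star x ** y) <= rnorm x * rnorm y.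
Proof. by rewrite -(cs_rnorm_star x) cs_rnormM. Qed.
Definition mform : innerform D D :=
  InnerForm mform_lin mform_conj mform_bound (@cs_rnorm_star_mul R D).

End Form.

Context {D : cstarAlg R}.
Implicit Types (m n : mult D) (a b d : D).

Lemma mult_eqml m n : ml m =1 ml n -> m = n.
Proof.
move=> mn; apply: mult_eq => // a; apply: cs_right_faithful => b.
by rewrite -!mP mn.
Qed.

Lemma ml_mulA m a b : ml m (a ** b) = ml m a ** b.
Proof. by apply: cs_left_faithful => c; rewrite mP !cs_mulA mP. Qed.

Lemma mmulE m n d : ml (m * n) d = ml m (ml n d). Proof. by []. Qed.
Lemma mone_E d : ml (1 : mult D) d = d. Proof. by []. Qed.
Lemma maddE m n d : ml (m + n) d = ml m d + ml n d. Proof. by []. Qed.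
Lemma mscaleE (c : Cx R) m d : ml (c *: m) d = c *: ml m d. Proof. by []. Qed.
Lemma membedE a d : ml (membed a) d = a ** d. Proof. by []. Qed.

Lemma mstar_form m a b : cs_star (ml m a) ** b = cs_star a ** ml (mstar m) b.
Proof. by rewrite mP /= cs_starK. Qed.

Lemma mstarK m : mstar (mstar m) = m.
Proof. by apply: mult_eqml => d /=; rewrite !cs_starK. Qed.

Lemma mstar_form' m a b : cs_star (ml (mstar m) a) ** b = cs_star a ** ml m b.
Proof. by rewrite mstar_form mstarK. Qed.

Lemma mstarM m n : mstar (m * n) = mstar n * mstar m.
Proof. by apply: mult_eqml => d /=; rewrite !cs_starK. Qed.

Lemma mstar1 : mstar (1 : mult D) = 1.
Proof. by apply: mult_eqml => d /=; rewrite cs_starK. Qed.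

Lemma membedM a b : membed (a ** b) = membed a * membed b.
Proof. by apply: mult_eqml => d /=; rewrite cs_mulA. Qed.

Lemma membed_star a : membed (cs_star a) = mstar (membed a).
Proof. by apply: mult_eqml => d /=; rewrite cs_starM cs_starK. Qed.

Lemma membed_linear : linear (@membed R D).
Proof. by move=> c a b; apply: mult_eqml => d /=; rewrite cs_mulDl. Qed.

Lemma membed_inj : injective (@membed R D).
Proof.
by move=> a b ab; apply: cs_right_faithful => d; rewrite -!membedE ab.
Qed.

Lemma mmul_membed m a : m * membed a = membed (ml m a).
Proof. by apply: mult_eqml => d /=; rewrite ml_mulA. Qed.

Definition toA m : adj (mform D) :=
  @Adj R D D (mform D) (ml m) (ml (mstar m)) (mstar_form m) (mstar_form' m).

Fact ofA_subproof (T : adj (mform D)) a b :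
  a ** T b = cs_star (aswap T (cs_star a)) ** b.
Proof. by have := adjP' T (cs_star a) b; rewrite /= cs_starK. Qed.
Definition ofA (T : adj (mform D)) : mult D := Mult (ofA_subproof T).

Lemma ofAK : cancel ofA toA. Proof. by move=> T; exact: adj_eq. Qed.
Lemma toAK : cancel toA ofA. Proof. by move=> m; exact: mult_eqml. Qed.
Lemma toA_linear : linear toA. Proof. by move=> c m n; exact: adj_eq. Qed.
Lemma toAM m n : toA (m * n) = toA m * toA n. Proof. exact: adj_eq. Qed.
Lemma toA1 : toA 1 = 1. Proof. exact: adj_eq. Qed.
Lemma toA_star m : toA (mstar m) = aswap (toA m). Proof. exact: adj_eq. Qed.
Lemma ofA_linear : linear ofA. Proof. by move=> c S T; exact: mult_eqml. Qed.
Lemma ofAM S T : ofA (S * T) = ofA S * ofA T. Proof. exact: mult_eqml. Qed.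
Lemma ofA_star T : ofA (aswap T) = mstar (ofA T).
Proof. by apply: (can_inj toAK); rewrite toA_star !ofAK. Qed.

Definition mnorm m := rnorm (toA m).

Lemma mnorm_ge0 m : 0 <= mnorm m. Proof. exact: rnorm_ge0. Qed.
Lemma rnorm_ml m d : rnorm (ml m d) <= mnorm m * rnorm d.
Proof. exact: (rnorm_afun (toA m)). Qed.

Lemma mnorm_le m (c : R) : 0 <= c ->
  (forall d, rnorm (ml m d) <= c * rnorm d) -> mnorm m <= c.
Proof. by move=> c0 h; apply: (@rnorm_adj_le _ _ _ _ (toA m)). Qed.

Lemma mnorm_membed a : mnorm (membed a) = rnorm a.
Proof.
apply/eqP; rewrite eq_le; apply/andP; split.
  by apply: mnorm_le; [exact: rnorm_ge0|move=> d; exact: cs_rnormM].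
have [->|a0] := eqVneq (rnorm a) 0; first exact: mnorm_ge0.
have a1 : 0 < rnorm a by rewrite lt_neqAle eq_sym a0 rnorm_ge0.
have := rnorm_ml (membed a) (cs_star a).
rewrite membedE -{1}(cs_starK a) cs_rnorm_star_mul cs_rnorm_star expr2.
by rewrite ler_pM2r.
Qed.

(** Positivity was developed in a unital ring of operators; elements of [D] are moved there by the
    isometric left multiplication [L]. *)
Lemma cs_sq_mono (t : R) (x y z : D) : 0 <= t ->
  cs_star x ** x + cs_star y ** y = ((t ^+ 2)%:C%C : Cx R) *: (cs_star z ** z) ->
  rnorm x <= t * rnorm z.
Proof.
move=> t0 xyz; rewrite -(@ler_pXn2r _ 2%N)// ?nnegrE ?mulr_ge0 ?rnorm_ge0//.
pose L d := toA (membed d).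
have LE d : aswap (L d) * L d = L (cs_star d ** d).
  by rewrite /L membedM toAM membed_star toA_star.
have Ln d : rnorm (L d) = rnorm d by exact: mnorm_membed.
have -> : (t * rnorm z) ^+ 2 = rnorm (((t ^+ 2)%:C%C : Cx R) *: (cs_star z ** z)).
  by rewrite rnormZ cabsC ger0_norm ?exprn_ge0// cs_rnorm_star_mul exprMn.
rewrite -xyz -cs_rnorm_star_mul -[leLHS]Ln -[leRHS]Ln -!LE.
apply: pos_mono; first exact: pos_star_mul.
rewrite (_ : L (_ + _) = aswap (L x) * L x + aswap (L y) * L y).
  by rewrite addrC addKr; exact: pos_star_mul.
by rewrite !LE /L -(linearDf _ _ toA_linear) -(linearDf _ _ membed_linear).
Qed.

(** Here $k=(t^2-m^*m)^{1/2}$ is the defect of [m]. An equality between products, unlike a norm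
    inequality, can be transported through homomorphisms and tensors, and this is what bounds the
    maps defined on spans below. *)
Lemma mult_dilate m (t : R) : mnorm m <= t -> exists k : mult D, forall a b,
  cs_star (ml m a) ** ml m b + cs_star (ml k a) ** ml k b =
  ((t ^+ 2)%:C%C : Cx R) *: (cs_star a ** b).
Proof.
move=> mt; have [h hs hE] := pos_sqnorm_sub mt.
exists (ofA h) => a b.
have E : aswap (toA m) * toA m + h * h = ((t ^+ 2)%:C%C : Cx R) *: (1 : adj (mform D)).
  by rewrite -hE addrC subrK.
rewrite mstar_form; have -> : cs_star (h a) ** h b = cs_star a ** h (h b).
  by have := adjP h a (h b); rewrite /= -{3}hs.
rewrite -cs_mulxD -[X in _ ** X]/((aswap (toA m) * toA m + h * h) b) E.
by rewrite /= cs_mulxZ.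
Qed.

(** For $\|d\|\le1$ the element is $u=1-(1-d^*d)^n$, a polynomial in $d^*d$ without constant term.
    Such elements do the work of an approximate unit. *)
Lemma local_unit d (e : R) : 0 < e ->
  exists u : D, rnorm u <= 1 /\ rnorm (d - d ** u) <= e.
Proof.
wlog d1 : d e / rnorm d <= 1 => [wl e0|e0].
  have t0 : 0 < rnorm d + 1 by rewrite ltr_wpDl ?rnorm_ge0.
  have [||u [u1 du]] := wl ((((rnorm d + 1)^-1)%:C%C : Cx R) *: d) (e / (rnorm d + 1)).
  - by rewrite rnormZ cabsC gtr0_norm ?invr_gt0// ler_pdivrMl// mulr1 lerDl.
  - exact: divr_gt0.
  exists u; split => //; move: du; rewrite cs_mulZx -scalerBr rnormZ cabsC.
  by rewrite gtr0_norm ?invr_gt0// mulrC ler_pM2r// invr_gt0.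
pose L d := toA (membed d).
have LB a b : L (a - b) = L a - L b.
  by rewrite /L (linearBf _ _ membed_linear) (linearBf _ _ toA_linear).
have LD a b : L (a + b) = L a + L b.
  by rewrite /L (linearDf _ _ membed_linear) (linearDf _ _ toA_linear).
have LM a b : L (a ** b) = L a * L b by rewrite /L membedM toAM.
have Ln a : rnorm (L a) = rnorm a by exact: mnorm_membed.
pose p := aswap (L d) * L d; have pp : pos p := pos_star_mul _.
have p1 : rnorm p <= 1 by rewrite arnorm_star Ln exprn_ile1// rnorm_ge0.
pose q := 1 - p; have [q1 pq] : rnorm q <= 1 /\ pos q := pos_ball pp p1.
have qp : GRing.comm q p by rewrite /GRing.comm mulrBl mulrBr mul1r mulr1.
have qnp (n : nat) : GRing.comm (q ^+ n) p by apply/commr_sym/commrX/commr_sym.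
have pqn (n : nat) : pos (q ^+ n).
  elim: n => [|n IH]; first by exists 1; [exact: aswap1|rewrite mulr1].
  by rewrite exprS; apply: pos_commM => //; exact: commrX.
have qn1 (n : nat) : rnorm (q ^+ n) <= 1.
  elim: n => [|n IH]; first exact: arnorm1.
  by rewrite exprS (le_trans (arnormM _ _))// mulr_ile1 ?rnorm_ge0.
(* The unit lies in the ambient ring only, but $1-q^n$ comes from [D]; the recursion is
   $u_{n+1}=p+u_n-pu_n$. *)
have un (n : nat) : exists u, 1 - q ^+ n = L u.
  elim: n => [|n [u uE]].
    by exists 0; rewrite subrr /L (linear0f membed_linear) (linear0f toA_linear).
  exists (cs_star d ** d + u - cs_star d ** d ** u).
  have pE : p = L (cs_star d ** d) by rewrite LM /L membed_star toA_star.
  rewrite LB LD (LM _ u) -pE.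
  rewrite -uE exprS {1}/q mulrBl mul1r opprB mulrBr mulr1 opprB.
  by rewrite [p + _]addrC addrACA subrr addr0 addrA addrAC.
(* This is $1-q^m=\sum_{j<m}q^jp\ge m\,q^mp$, hence $\|q^mp\|\le1/m$. Passing from $m$ to $m+1$ adds
   the positive term $(m+1)q^mp^2$. *)
have main (m : nat) : pos (1 - q ^+ m - (m%:R%:C%C : Cx R) *: (q ^+ m * p)).
  elim: m => [|m IH]; first by rewrite expr0 subrr scale0r subr0; exact: pos0.
  have -> : 1 - q ^+ m.+1 - (m.+1%:R%:C%C : Cx R) *: (q ^+ m.+1 * p) =
      (1 - q ^+ m - (m%:R%:C%C : Cx R) *: (q ^+ m * p)) +
      (m.+1%:R%:C%C : Cx R) *: (q ^+ m * (p * p)).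
    have -> : q ^+ m.+1 = q ^+ m - q ^+ m * p by rewrite exprSr /q mulrBr mulr1.
    rewrite mulrBl scalerBr -(mulrA _ p p) (opprB (q ^+ m)) addrA (addrAC 1).
    rewrite -natr1 realCD (scalerDl (q ^+ m * p)) scale1r.
    by rewrite opprB addrCA opprD addrACA subrr addr0 addrC.
  apply: posD => //; apply: posZ => //; apply: pos_commM => //.
    by apply: pos_commM.
  by apply: commrM.
have [N Nl] := invn_small (exprn_gt0 2 e0); have {}Nl := Nl N (leqnn N).
have [u uE] := un N.+1; exists u; split.
  by rewrite -Ln -uE; have [] := pos_ball (pqn N.+1) (qn1 N.+1).
rewrite -(@ler_pXn2r _ 2%N)// ?nnegrE ?rnorm_ge0 ?(ltW e0)// -Ln LB LM.
rewrite (_ : L d - L d * L u = L d * q ^+ N.+1); last first.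
  by rewrite -uE mulrBr mulr1 subKr.
(* With $n=N+1$, $\|d-du\|^2=\|q^{n}pq^{n}\|=\|q^{2n}p\|$. *)
rewrite -arnorm_star aswapM (aswapX _ (pos_star pq)) mulrA -(mulrA _ (aswap (L d))) -/p.
rewrite -mulrA -(qnp N.+1) mulrA -exprD; set m := (N.+1 + N.+1)%N.
apply: ltW; apply: le_lt_trans Nl.
have m0 : (0 : R) < N.+1%:R by [].
rewrite -(ler_pM2l m0) divff ?gt_eqF//.
rewrite (@le_trans _ _ (m%:R * rnorm (q ^+ m * p)))//.
  by rewrite ler_wpM2r ?rnorm_ge0// ler_nat leq_addr.
have : rnorm ((m%:R%:C%C : Cx R) *: (q ^+ m * p)) <= rnorm (1 - q ^+ m).
  apply: pos_mono; last exact: main.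
  by apply: posZ => //; apply: pos_commM.
rewrite rnormZ cabsC ger0_norm// => /le_trans; apply.
by have [] := pos_ball (pqn m) (qn1 m).
Qed.

Lemma total_mul : total [set x : D | exists a d, x = a ** d].
Proof.
apply/totalP => x e e0; have e2 : 0 < e / 2 by rewrite divr_gt0.
have [u [_ xu]] := local_unit x e2; exists (x ** u).
  by apply: lspan_in; exists x, u.
by rewrite (le_lt_trans xu)// ltr_pdivrMr// ltr_pMr// ltr1n.
Qed.

Lemma membed_nondeg : nondeg_hom (@membed R D).
Proof.
split; last exact: total_mul.
by split; [exact: membed_linear|exact: membedM|exact: membed_star].
Qed.

End MultForm.

Section Dilation.
Context {R : realType}.

(* If (v, w) is, up to the factor t, an isometric image of u for a form in which
   squares are monotone, then u i |-> v i extends to the span with norm <= t. *)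
Lemma dilation_bound (X : completeNormedModType (Cx R)) (Y : normedModType (Cx R))
    (f : innerform X Y) (I : Type) (u v w : I -> X) (t : R) :
  (forall x y z, f x x + f y y = ((t ^+ 2)%:C%C : Cx R) *: f z z ->
     rnorm x <= t * rnorm z) ->
  (forall i j, f (v i) (v j) + f (w i) (w j) = ((t ^+ 2)%:C%C : Cx R) *: f (u i) (u j)) ->
  forall p : X * X, lspan [set (u i, v i) | i in [set: I]] p ->
    rnorm p.2 <= t * rnorm p.1.
Proof.
move=> fmono uvw p Sp.
pose S3 : set (X * X * X) := [set (u i, v i, w i) | i in [set: I]].
have [q [Sq q1]] : exists q, lspan S3 q /\ q.1 = p.
  move: p Sp; apply: lspan_ind => [|a p1 p2 [i _ <-] [q [Sq <-]]].
    by exists 0; split => //; exact: lspan0.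
  exists (a *: (u i, v i, w i) + q); split => //.
  by apply: lspan_lin => //; apply: lspan_in; exists i.
rewrite -q1; apply: (fmono _ q.2).
have key1 i (r : X * X * X) : lspan S3 r ->
    f (v i) r.1.2 + f (w i) r.2 = ((t ^+ 2)%:C%C : Cx R) *: f (u i) r.1.1.
  move: r; apply: lspan_ind => [|a _ r [j _ <-] IH] /=.
    by rewrite !(linear0f (fm_lin f _)) addr0 scaler0.
  by rewrite !(fm_lin f) addrACA IH -scalerDr uvw scalerDr !scalerA [a * _]mulrC.
have key (r s : X * X * X) : lspan S3 r -> lspan S3 s ->
    f r.1.2 s.1.2 + f r.2 s.2 = ((t ^+ 2)%:C%C : Cx R) *: f r.1.1 s.1.1.
  move=> Sr Ss; move: r Sr; apply: lspan_ind => [|a _ r [i _ <-] IH] /=.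
    by rewrite !fm0l addr0 scaler0.
  by rewrite !fm_conj addrACA IH -scalerDr (key1 _ _ Ss) scalerDr !scalerA [_ * Num.conj a]mulrC.
exact: key.
Qed.

End Dilation.

Section MultExtend.
Context {R : realType} {D : cstarAlg R}.
Implicit Types (m n : mult D) (x y : D).

Lemma mult_total_eq (S : set D) m n : total S ->
  (forall x, S x -> ml m x = ml n x) -> m = n.
Proof.
move=> tS mn; apply: mult_eqml; apply: (total_eq (ml_linear m) (ml_linear n)) tS mn.
- exact: rnorm_ml.
- exact: rnorm_ml.
Qed.

Lemma mult_of_pair (S : set D) (g h : D -> D) (M N : R) : total S ->
  linear g -> linear h ->
  (forall x, rnorm (g x) <= M * rnorm x) -> (forall x, rnorm (h x) <= N * rnorm x) ->
  (forall x y, S x -> S y -> cs_star (g x) ** y = cs_star x ** h y) ->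
  exists m, ml m =1 g /\ ml (mstar m) =1 h.
Proof.
move=> tS lg lh gM hN gh.
have step1 y : S y -> forall x, cs_star (g x) ** y = cs_star x ** h y.
  (* Applying the star makes both sides linear in [x], so that the total set [S] can be used one
     variable at a time. *)
  move=> Sy x; apply: (can_inj (@cs_starK R D)); rewrite !cs_starM !cs_starK.
  move: x; apply: (@total_eq _ _ _ S _ _ (rnorm y * M) (rnorm (h y))) => //.
  - by move=> a x z; rewrite lg cs_mulDr.
  - by move=> a x z; rewrite cs_mulDr.
  - move=> x; rewrite (le_trans (cs_rnormM _ _))// cs_rnorm_star -mulrA.
    by rewrite ler_wpM2l ?rnorm_ge0.
  - by move=> x; rewrite (le_trans (cs_rnormM _ _))// cs_rnorm_star.
  - move=> x Sx; apply: (can_inj (@cs_starK R D)); rewrite !cs_starM !cs_starK.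
    exact: gh.
have step2 x y : cs_star (g x) ** y = cs_star x ** h y.
  move: y; apply: (@total_eq _ _ _ S _ _ (rnorm (g x)) (rnorm x * N)) => //.
  - by move=> a y z; rewrite cs_mulDr.
  - by move=> a y z; rewrite lh cs_mulDr.
  - by move=> y; rewrite (le_trans (cs_rnormM _ _))// cs_rnorm_star.
  - move=> y; rewrite (le_trans (cs_rnormM _ _))// cs_rnorm_star -mulrA.
    by rewrite ler_wpM2l ?rnorm_ge0.
  - by move=> y Sy; exact: step1.
have step3 x y : cs_star (h x) ** y = cs_star x ** g y.
  by apply: (can_inj (@cs_starK R D)); rewrite !cs_starM !cs_starK step2.
exists (ofA (@Adj _ _ _ (mform D) g h step2 step3)); split => //.
by move=> x; rewrite -ofA_star.
Qed.

(** The defects [w] and [w'] bound the maps $u_i\mapsto v_i$ and $u_i\mapsto v'_i$; the last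
    relation makes the two extensions adjoint to each other. The multipliers in [mext_ex],
    [mtensorl_ex] and [gunit_ex] arise this way. *)
Lemma mult_extend (I : Type) (u v v' w w' : I -> D) (t t' : R) : 0 <= t -> 0 <= t' ->
  total (range u) ->
  (forall i j, cs_star (v i) ** v j + cs_star (w i) ** w j =
     ((t ^+ 2)%:C%C : Cx R) *: (cs_star (u i) ** u j)) ->
  (forall i j, cs_star (v' i) ** v' j + cs_star (w' i) ** w' j =
     ((t' ^+ 2)%:C%C : Cx R) *: (cs_star (u i) ** u j)) ->
  (forall i j, cs_star (v i) ** u j = cs_star (u i) ** v' j) ->
  exists m, (forall i, ml m (u i) = v i) /\ (forall i, ml (mstar m) (u i) = v' i).
Proof.
move=> t0 t0' tu uvw uvw' uv.
have ext (r : R) (a b : I -> D) : 0 <= r ->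
    (forall i j, cs_star (a i) ** a j + cs_star (b i) ** b j =
      ((r ^+ 2)%:C%C : Cx R) *: (cs_star (u i) ** u j)) ->
    exists g : D -> D, [/\ linear g, forall x, rnorm (g x) <= r * rnorm x &
      forall i, g (u i) = a i].
  move=> r0 uab.
  have [||g [lg gM gu]] :=
      @extend_by_density _ D D [set (u i, a i) | i in [set: I]] r r0.
  - exact: (@dilation_bound R D D (mform D) I u a b r
      (fun x y z => @cs_sq_mono R D r x y z r0) uab).
  - apply: totalS tu => _ [i _ <-]; exists (u i, a i) => //; by exists i.
  - by exists g; split => // i; apply: gu; exists i.
have [g [lg gM gu]] := ext t v w t0 uvw.
have [h [lh hM hu]] := ext t' v' w' t0' uvw'.
have [|m [mg mh]] := @mult_of_pair (range u) g h t t' tu lg lh gM hM.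
  by move=> _ _ [i _ <-] [j _ <-]; rewrite gu hu.
by exists m; split => i; rewrite ?mg ?mh.
Qed.

End MultExtend.

Section NondegHom.
Context {R : realType}.
Implicit Types A B D E : cstarAlg R.

Lemma hom_contract A D (pi : A -> mult D) a : is_hom pi -> mnorm (pi a) <= rnorm a.
Proof.
move=> [lp mp sp]; apply: (@star_hom_contractive _ _ _ _ _ (toA \o pi)).
- by move=> c x y; rewrite /= lp toA_linear.
- by move=> x y; rewrite /= mp toAM.
- by move=> x; rewrite /= sp toA_star.
Qed.

Lemma rnorm_hom A D (pi : A -> mult D) a d : is_hom pi ->
  rnorm (ml (pi a) d) <= rnorm a * rnorm d.
Proof.
move=> hp; rewrite (le_trans (rnorm_ml _ _))//.
by rewrite ler_wpM2r ?rnorm_ge0 ?hom_contract.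
Qed.

Lemma hom_form A D (pi : A -> mult D) a b x y : is_hom pi ->
  cs_star (ml (pi a) x) ** ml (pi b) y = cs_star x ** ml (pi (cs_star a ** b)) y.
Proof. by move=> [_ mp sp]; rewrite mstar_form -sp mp. Qed.

Lemma hom_eval_linear A D (pi : A -> mult D) d : is_hom pi ->
  linear (fun a => ml (pi a) d).
Proof. by move=> [lp _ _] c a b; rewrite lp. Qed.

Lemma hom_total_eq A D (pi rho : A -> mult D) (S : set A) : is_hom pi -> is_hom rho ->
  total S -> (forall a, S a -> pi a = rho a) -> pi =1 rho.
Proof.
move=> hp hr tS pr a; apply: mult_eqml => d; move: a.
apply: (total_eq (hom_eval_linear d hp) (hom_eval_linear d hr)) tS _.
- by move=> a; rewrite mulrC; exact: rnorm_hom.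
- by move=> a; rewrite mulrC; exact: rnorm_hom.
- by move=> a Sa /=; rewrite pr.
Qed.

Section Mext.
Context {A D : cstarAlg R} (pi : A -> mult D) (npi : nondeg_hom pi).
Let hpi : is_hom pi := (proj1 npi).

Lemma nondeg_inj (m n : mult D) : (forall a, m * pi a = n * pi a) -> m = n.
Proof.
move=> mn; apply: (mult_total_eq npi.2) => _ [a [d ->]].
by rewrite -!mmulE mn.
Qed.

Lemma nondeg_injl (m n : mult D) : (forall a, pi a * m = pi a * n) -> m = n.
Proof.
move=> mn; rewrite -(mstarK m) -(mstarK n); congr mstar; apply: nondeg_inj => a.
have [_ _ sp] := hpi; rewrite -(cs_starK a) sp.
by rewrite -!mstarM mn.
Qed.

(** The rule $\pi(a)d\mapsto\pi(ma)d$ is bounded because [hom_form] gathers the inner products of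
    such vectors into $\pi(a^*b)$, where the defect identity of [m] can be applied. *)
Lemma mext_ex (m : mult A) : exists n, forall a, n * pi a = pi (ml m a).
Proof.
have [k kE] := mult_dilate (lexx (mnorm m)).
have [k' kE'] := mult_dilate (lexx (mnorm (mstar m))).
pose ev (u : mult A) (p : A * D) := ml (pi (ml u p.1)) p.2.
have evE (u u' : mult A) (t : R) : (forall a b,
    cs_star (ml u a) ** ml u b + cs_star (ml u' a) ** ml u' b =
    ((t ^+ 2)%:C%C : Cx R) *: (cs_star a ** b)) ->
    forall p q, cs_star (ev u p) ** ev u q + cs_star (ev u' p) ** ev u' q =
    ((t ^+ 2)%:C%C : Cx R) *: (cs_star (ev 1 p) ** ev 1 q).
  move=> uE p q; rewrite /ev !(hom_form _ _ _ _ hpi) -cs_mulxD -maddE.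
  have [lp _ _] := hpi.
  by rewrite -(linearDf _ _ lp) uE (linearZf _ _ lp) -cs_mulxZ.
have [||n [nE _]] := mult_extend (mnorm_ge0 m) (mnorm_ge0 (mstar m)) _ (evE _ _ _ kE)
    (evE _ _ _ kE') _.
- apply: totalS npi.2 => _ [a [d ->]]; by exists (a, d).
- by move=> p q; rewrite /ev !(hom_form _ _ _ _ hpi) mstar_form.
by exists n => a; apply: mult_eqml => d; exact: (nE (a, d)).
Qed.

Lemma mextP (m : mult A) a : mext pi m * pi a = pi (ml m a).
Proof.
have [n nE] := mext_ex m; rewrite /mext.
by case: xgetP => [n' -> //|/(_ n)]; exact.
Qed.

Lemma mext_uniq (m : mult A) (n : mult D) :
  (forall a, n * pi a = pi (ml m a)) -> mext pi m = n.
Proof. by move=> nE; apply: nondeg_inj => a; rewrite mextP nE. Qed.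

Lemma mext_membed a : mext pi (membed a) = pi a.
Proof. by have [_ mp _] := hpi; apply: mext_uniq => b; rewrite -mp. Qed.

Lemma mextM m n : mext pi (m * n) = mext pi m * mext pi n.
Proof. by apply: mext_uniq => a; rewrite -mulrA !mextP. Qed.

Lemma mext1 : mext pi 1 = 1.
Proof. by apply: mext_uniq => a; rewrite mul1r. Qed.

Lemma mext_linear : linear (mext pi).
Proof.
move=> c m n; apply: mext_uniq => a; apply: mult_eqml => d.
have [lp _ _] := hpi.
by rewrite mmulE maddE mscaleE -!mmulE !mextP -mscaleE -maddE -lp.
Qed.

Lemma mext_star m : mext pi (mstar m) = mstar (mext pi m).
Proof.
have [_ mp sp] := hpi; apply: mext_uniq => a; apply: nondeg_injl => b.
rewrite -mp mulrA -(cs_starK b) sp -mstarM mextP -sp -mp; congr pi.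
by rewrite mstar_form.
Qed.

Lemma mext_unitary m : is_unitary m -> is_unitary (mext pi m).
Proof. by move=> [h1 h2]; split; rewrite -mext_star -mextM ?h1 ?h2 mext1. Qed.

End Mext.

Lemma mext_comp_hom A D E (pi : A -> mult D) (F : D -> mult E) :
  nondeg_hom pi -> nondeg_hom F -> nondeg_hom (mext F \o pi).
Proof.
move=> np nF; have [[lp mp sp] tp] := np; split.
  split=> [c a b|a b|a] /=.
  - by rewrite lp (mext_linear nF).
  - by rewrite mp (mextM nF).
  - by rewrite sp (mext_star nF).
apply: (total_trans nF.2) => _ [d [e ->]] r r0.
have M0 : 0 < rnorm e + 1 by rewrite ltr_wpDl ?rnorm_ge0.
have /totalP /(_ d _ (divr_gt0 r0 M0)) [d' Sd' dd'] := tp.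
exists (ml (F d') e); last first.
  have [lF _ _] := nF.1.
  have -> : ml (F d) e - ml (F d') e = ml (F (d - d')) e.
    by rewrite (linearBf _ _ (hom_eval_linear e nF.1)).
  rewrite (le_lt_trans (rnorm_hom _ _ nF.1))//.
  rewrite ltr_pdivlMr// in dd'; apply: le_lt_trans dd'.
  by rewrite ler_wpM2l ?rnorm_ge0// lerDl.
have := lspan_map (hom_eval_linear e nF.1); apply; last exact: Sd'.
move=> _ [a [x ->]]; apply: lspan_in; exists a, (ml (F x) e) => /=.
by rewrite -mmulE (mextP nF).
Qed.

Lemma mext_comp A D E (pi : A -> mult D) (F : D -> mult E) m :
  nondeg_hom pi -> nondeg_hom F ->
  mext (mext F \o pi) m = mext F (mext pi m).
Proof.
move=> np nF; apply: (mext_uniq (mext_comp_hom np nF)) => a /=.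
by rewrite -(mextM nF) (mextP np).
Qed.

Lemma mext_id D (m : mult D) : mext (@membed R D) m = m.
Proof.
by apply: (mext_uniq (@membed_nondeg R D)) => a; rewrite mmul_membed.
Qed.

End NondegHom.

(** * Tensor products *)

Section Mtensor.
Context {R : realType} (T : forall A B : cstarAlg R, min_tensor A B).
Context {A B : cstarAlg R}.
Local Notation AB := (T A B).
Local Notation "a [x] b" := (pure (T A B) a b) (at level 35).
Implicit Types (a c : A) (b d : B) (m : mult A) (n : mult B).

Lemma pure_lin_l b : linear (fun a => a [x] b).
Proof. by move=> c x y; exact: pure_linl. Qed.

Lemma pure_lin_r a : linear (fun b => a [x] b).
Proof. by move=> c x y; exact: pure_linr. Qed.

Lemma pureDl a c b : (a + c) [x] b = a [x] b + c [x] b.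
Proof. exact: (linearDf _ _ (pure_lin_l b)). Qed.
Lemma pureDr a b d : a [x] (b + d) = a [x] b + a [x] d.
Proof. exact: (linearDf _ _ (pure_lin_r a)). Qed.
Lemma pureZl (k : Cx R) a b : (k *: a) [x] b = k *: (a [x] b).
Proof. exact: (linearZf _ _ (pure_lin_l b)). Qed.
Lemma pureZr (k : Cx R) a b : a [x] (k *: b) = k *: (a [x] b).
Proof. exact: (linearZf _ _ (pure_lin_r a)). Qed.
Lemma pureBl a c b : (a - c) [x] b = a [x] b - c [x] b.
Proof. exact: (linearBf _ _ (pure_lin_l b)). Qed.
Lemma pureBr a b d : a [x] (b - d) = a [x] b - a [x] d.
Proof. exact: (linearBf _ _ (pure_lin_r a)). Qed.

Lemma pure_range_total : total (range (fun p : A * B => p.1 [x] p.2)).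
Proof. by apply: totalS (pure_total AB) => _ [a [b ->]]; exists (a, b). Qed.

Lemma mult_pure_eq (k l : mult AB) :
  (forall a b, ml k (a [x] b) = ml l (a [x] b)) -> k = l.
Proof. by move=> kl; apply: (mult_total_eq (pure_total AB)) => _ [a [b ->]]. Qed.

Lemma pure_form a b c d :
  cs_star (a [x] b) ** (c [x] d) = (cs_star a ** c) [x] (cs_star b ** d).
Proof. by rewrite pure_star pure_mul. Qed.

(** As in [mext_ex], with $a\otimes b$ in place of $\pi(a)d$: products of elementary tensors see the
    defect of [m] in the first leg only, so no representation enters. *)
Lemma mtensorl_ex m : exists k : mult AB, forall a b, ml k (a [x] b) = ml m a [x] b.
Proof.
have [k kE] := mult_dilate (lexx (mnorm m)).
have [k' kE'] := mult_dilate (lexx (mnorm (mstar m))).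
pose ev (u : mult A) (p : A * B) := ml u p.1 [x] p.2.
have evE (u u' : mult A) (t : R) : (forall a c,
    cs_star (ml u a) ** ml u c + cs_star (ml u' a) ** ml u' c =
    ((t ^+ 2)%:C%C : Cx R) *: (cs_star a ** c)) ->
    forall p q, cs_star (ev u p) ** ev u q + cs_star (ev u' p) ** ev u' q =
    ((t ^+ 2)%:C%C : Cx R) *: (cs_star (ev 1 p) ** ev 1 q).
  move=> uE p q; rewrite /ev !pure_form -pureDl uE.
  exact: pureZl.
have [||l [lE _]] := mult_extend (mnorm_ge0 m) (mnorm_ge0 (mstar m)) _ (evE _ _ _ kE)
    (evE _ _ _ kE') _.
- exact: pure_range_total.
- by move=> p q; rewrite /ev !pure_form mstar_form.
by exists l => a b; exact: (lE (a, b)).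
Qed.

Lemma mtensorr_ex n : exists k : mult AB, forall a b, ml k (a [x] b) = a [x] ml n b.
Proof.
have [k kE] := mult_dilate (lexx (mnorm n)).
have [k' kE'] := mult_dilate (lexx (mnorm (mstar n))).
pose ev (u : mult B) (p : A * B) := p.1 [x] ml u p.2.
have evE (u u' : mult B) (t : R) : (forall b d,
    cs_star (ml u b) ** ml u d + cs_star (ml u' b) ** ml u' d =
    ((t ^+ 2)%:C%C : Cx R) *: (cs_star b ** d)) ->
    forall p q, cs_star (ev u p) ** ev u q + cs_star (ev u' p) ** ev u' q =
    ((t ^+ 2)%:C%C : Cx R) *: (cs_star (ev 1 p) ** ev 1 q).
  move=> uE p q; rewrite /ev !pure_form -pureDr uE.
  exact: pureZr.
have [||l [lE _]] := mult_extend (mnorm_ge0 n) (mnorm_ge0 (mstar n)) _ (evE _ _ _ kE)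
    (evE _ _ _ kE') _.
- exact: pure_range_total.
- by move=> p q; rewrite /ev !pure_form mstar_form.
by exists l => a b; exact: (lE (a, b)).
Qed.

(** A multiplier with the selecting property exists, namely $(m\otimes1)(1\otimes n)$, built one leg
    at a time. *)
Lemma mtensorP m n a b : ml (mtensor T m n) (a [x] b) = ml m a [x] ml n b.
Proof.
have [k kE] := mtensorl_ex m; have [l lE] := mtensorr_ex n; rewrite /mtensor.
case: xgetP => [x _ ->//|/(_ (k * l))]; case => c d.
by rewrite mmulE lE kE.
Qed.

Lemma mtensor_uniq m n (k : mult AB) :
  (forall a b, ml k (a [x] b) = ml m a [x] ml n b) -> mtensor T m n = k.
Proof. by move=> kE; apply: mult_pure_eq => a b; rewrite mtensorP kE. Qed.

Lemma mtensorM m m' n n' :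
  mtensor T m n * mtensor T m' n' = mtensor T (m * m') (n * n').
Proof. by apply: mult_pure_eq => a b; rewrite mmulE !mtensorP. Qed.

Lemma mtensor1 : mtensor T (1 : mult A) (1 : mult B) = 1.
Proof. by apply: mtensor_uniq. Qed.

Lemma mtensor_star m n : mstar (mtensor T m n) = mtensor T (mstar m) (mstar n).
Proof.
apply/esym/mtensor_uniq => a b; apply: cs_left_faithful => z.
rewrite -(cs_starK z) -mstar_form.
move: (cs_star z) => {}z; apply: (can_inj (@cs_starK R _)); rewrite !cs_starM !cs_starK.
move: z; apply: (total_eq _ _ _ _ (pure_total AB)).
- by move=> c x y; rewrite ml_linear cs_mulDr.
- by move=> c x y; rewrite cs_mulDr.
- move=> z; rewrite (le_trans (cs_rnormM _ _))//.
  rewrite (le_trans (ler_wpM2l (rnorm_ge0 _) (rnorm_ml _ z)))// mulrA; exact: lexx.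
- by move=> z; exact: cs_rnormM.
- by move=> _ [c [d ->]]; rewrite mtensorP !pure_form !mstar_form'.
Qed.

Lemma mtensor_linl n : linear (fun m => mtensor T m n).
Proof.
move=> c m m'; apply: mult_pure_eq => a b.
by rewrite maddE mscaleE !mtensorP -pure_linl.
Qed.

Lemma mtensor_linr m : linear (fun n => mtensor T m n).
Proof.
move=> c n n'; apply: mult_pure_eq => a b.
by rewrite maddE mscaleE !mtensorP -pure_linr.
Qed.

Lemma mtensor_membed a b : mtensor T (membed a) (membed b) = membed (a [x] b).
Proof. by apply: mtensor_uniq => c d; rewrite !membedE pure_mul. Qed.

Lemma mtensor_unitary m n : is_unitary m -> is_unitary n -> is_unitary (mtensor T m n).
Proof.
by move=> [h1 h2] [k1 k2]; split; rewrite mtensor_star mtensorM ?h1 ?h2 ?k1 ?k2 mtensor1.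
Qed.

Lemma unitary_isometry (D : cstarAlg R) (u : mult D) (x : D) : is_unitary u -> rnorm (ml u x) = rnorm x.
Proof.
move=> [uu _]; apply/eqP; rewrite -(@eqrXn2 _ 2%N)// ?rnorm_ge0// -!cs_rnorm_star_mul.
by rewrite mstar_form -mmulE uu.
Qed.

(** The multipliers of [A] form the C*-algebra [adj_cstar (mform A)], and $m\mapsto m\otimes1$ is a
    star homomorphism on it, hence contractive. *)
Lemma mnorm_mtensorl m : mnorm (mtensor T m (1 : mult B)) <= mnorm m.
Proof.
pose rho := fun x : adj_cstar (mform A) => toA (mtensor T (ofA x) (1 : mult B)).
have := @star_hom_contractive _ (adj_cstar (mform A)) _ _ _ rho.
move=> /(_ _ _ _ (toA m)); rewrite /rho /= toAK; apply.
- by move=> c x y; rewrite /= ofA_linear mtensor_linl toA_linear.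
- by move=> x y; rewrite /= ofAM -toAM mtensorM mulr1.
- by move=> x; rewrite /= ofA_star -toA_star mtensor_star mstar1.
Qed.

Lemma mnorm_mtensorr n : mnorm (mtensor T (1 : mult A) n) <= mnorm n.
Proof.
pose rho := fun x : adj_cstar (mform B) => toA (mtensor T (1 : mult A) (ofA x)).
have := @star_hom_contractive _ (adj_cstar (mform B)) _ _ _ rho.
move=> /(_ _ _ _ (toA n)); rewrite /rho /= toAK; apply.
- by move=> c x y; rewrite /= ofA_linear mtensor_linr toA_linear.
- by move=> x y; rewrite /= ofAM -toAM mtensorM mulr1.
- by move=> x; rewrite /= ofA_star -toA_star mtensor_star mstar1.
Qed.

(** The estimate comes from the factorization $a\otimes b=(a\otimes1)(1\otimes b)$ among multipliers
    rather than from representations. *)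
Lemma rnorm_pure a b : rnorm (a [x] b) <= rnorm a * rnorm b.
Proof.
rewrite -mnorm_membed -mtensor_membed -[membed a]mulr1 -[membed b]mul1r -mtensorM.
rewrite /mnorm toAM (le_trans (arnormM _ _))//.
rewrite -(mnorm_membed a) -(mnorm_membed b) ler_pM ?rnorm_ge0//.
  exact: mnorm_mtensorl.
exact: mnorm_mtensorr.
Qed.

Lemma total_pure (S : set A) (S' : set B) : total S -> total S' ->
  total [set z | exists a b, [/\ S a, S' b & z = a [x] b]].
Proof.
move=> tS tS'.
have M1 (x : R) : 0 <= x -> 0 < x + 1 by move=> x0; rewrite ltr_wpDl.
have t1 : total [set z | exists a b, S a /\ z = a [x] b].
  apply: (total_trans (pure_total AB)) => _ [a [b ->]] e e0.
  have /totalP /(_ a _ (divr_gt0 e0 (M1 _ (rnorm_ge0 b)))) [a' Sa' aa] := tS.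
  exists (a' [x] b).
    have := lspan_map (pure_lin_l b); apply; last exact: Sa'.
    by move=> v Sv; apply: lspan_in; exists v, b.
  rewrite -pureBl (le_lt_trans (rnorm_pure _ _))//.
  rewrite ltr_pdivlMr ?M1 ?rnorm_ge0// in aa; apply: le_lt_trans aa.
  by rewrite ler_wpM2l ?rnorm_ge0// lerDl.
apply: (total_trans t1) => _ [a [b [Sa ->]]] e e0.
have /totalP /(_ b _ (divr_gt0 e0 (M1 _ (rnorm_ge0 a)))) [b' Sb' bb] := tS'.
exists (a [x] b').
  have := lspan_map (pure_lin_r a); apply; last exact: Sb'.
  by move=> v Sv; apply: lspan_in; exists a, v.
rewrite -pureBr (le_lt_trans (rnorm_pure _ _))//.
rewrite ltr_pdivlMr ?M1 ?rnorm_ge0// in bb; apply: le_lt_trans bb.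
by rewrite mulrC ler_wpM2l ?rnorm_ge0// lerDl.
Qed.

Lemma mtensorl_nondeg (D : cstarAlg R) (pi : D -> mult A) : nondeg_hom pi ->
  nondeg_hom (fun x => mtensor T (pi x) (1 : mult B)).
Proof.
move=> [[lp mp sp] tp]; split.
  split.
  - by move=> c x y; rewrite lp mtensor_linl.
  - by move=> x y; rewrite mp mtensorM mulr1.
  - by move=> x; rewrite sp mtensor_star mstar1.
apply: totalS (total_pure tp (@total_mul R B)) => _ [a [b [[d [x ->]] _ ->]]].
by exists d, (x [x] b); rewrite mtensorP.
Qed.

Lemma mext_mtensorl (D : cstarAlg R) (pi : D -> mult A) (m : mult D) : nondeg_hom pi ->
  mext (fun x => mtensor T (pi x) (1 : mult B)) m = mtensor T (mext pi m) 1.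
Proof.
move=> np; apply: mext_uniq => [|x]; first exact: mtensorl_nondeg.
by rewrite mtensorM (mextP np) mulr1.
Qed.

End Mtensor.

(** * Inner products, representations and the spatial norm *)

Section SemiInner.
Context {R : realType} {V : lmodType (Cx R)} (s : V -> V -> Cx R).
Hypothesis s_lin : forall (a : Cx R) x y z, s (a *: x + y) z = a * s x z + s y z.
Hypothesis s_conj : forall x y, s y x = Num.conj (s x y).
Hypothesis s_ge0 : forall x, 0 <= s x x.

Definition snorm2 x : R := complex.Re (s x x : R[i]%C).

Lemma snorm2E x : s x x = (snorm2 x)%:C%C.
Proof. exact: cx_ge0. Qed.

Lemma snorm2_ge0 x : 0 <= snorm2 x.
Proof. by rewrite -(leCxR 0) -snorm2E s_ge0. Qed.

Lemma semi_cauchy_schwarz x y : cabs (s x y) ^+ 2 <= snorm2 x * snorm2 y.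
Proof.
set C := cabs (s x y) ^+ 2.
have C0 : 0 <= C by rewrite exprn_ge0 ?cabs_ge0.
have s0 z : s 0 z = 0 by have := s_lin (-1) 0 0 z; rewrite scaleN1r oppr0 addr0 mulN1r addNr.
have sZ (a : Cx R) u z : s (a *: u) z = a * s u z by have := s_lin a u 0 z; rewrite !addr0 s0 addr0.
have sD u v z : s (u + v) z = s u z + s v z by have := s_lin 1 u v z; rewrite scale1r mul1r.
have sDr u v z : s z (u + v) = s z u + s z v by rewrite (s_conj (u + v)) (s_conj u z) (s_conj v z) sD rmorphD.
have sZr (a : Cx R) u z : s z (a *: u) = Num.conj a * s z u.
  by rewrite (s_conj (a *: u)) (s_conj u z) sZ rmorphM.
have q (t : R) : 0 <= snorm2 x - 2 * t * C + t ^+ 2 * C * snorm2 y.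
  (* With this phase both cross terms of the form at $x+ay$ are real and equal to $-tC$. *)
  pose a : Cx R := - (t%:C%C * s x y).
  suff <- : snorm2 (x + a *: y) = snorm2 x - 2 * t * C + t ^+ 2 * C * snorm2 y.
    exact: snorm2_ge0.
  apply: realC_inj; rewrite -snorm2E sD !sDr !sZ !sZr !snorm2E.
  have cc : s x y * Num.conj (s x y) = C%:C%C by rewrite conj_mulC.
  have -> : Num.conj a * s x y = - (t * C)%:C%C.
    by rewrite /a cconjN cconjM conj_realC mulNr -mulrA [Num.conj _ * _]mulrC cc realCM.
  have -> : a * s y x = - (t * C)%:C%C.
    by rewrite s_conj /a mulNr -mulrA cc realCM.
  have -> : a * (Num.conj a * (snorm2 y)%:C%C) = (t ^+ 2 * C * snorm2 y)%:C%C.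
    rewrite mulrA /a cconjN cconjM conj_realC mulrNN mulrACA cc -!realCM.
    by rewrite expr2.
  rewrite -addrA addrA !realCD -!addrA; congr (_ + _); rewrite addrA; congr (_ + _).
  by rewrite -realCN -!realCD; congr (_ %:C)%C; ring.
(* For a null vector [y] the polynomial is affine in [t], and a large [t] would make it negative if
   $C>0$. *)
have [y0|y0] := eqVneq (snorm2 y) 0.
  rewrite y0 mulr0 leNgt; apply/negP => C1.
  have := q ((snorm2 x + 1) / (2 * C)); rewrite y0 mulr0 addr0.
  have -> : 2 * ((snorm2 x + 1) / (2 * C)) * C = snorm2 x + 1 by field; rewrite gt_eqF.
  lra.
have y1 : 0 < snorm2 y by rewrite lt_neqAle eq_sym y0 snorm2_ge0.
have := q (snorm2 y)^-1; have -> : (snorm2 y)^-1 ^+ 2 * C * snorm2 y = (snorm2 y)^-1 * C.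
  by field.
rewrite -ler_pdivrMr//; rewrite [C / _]mulrC; lra.
Qed.

End SemiInner.

Section Hilbert.
Context {R : realType}.
Implicit Types H K : hilbert R.

Section Ip.
Context {H : hilbert R}.
Implicit Types x y z : H.

Lemma ip0l z : ip 0 z = 0 :> Cx R.
Proof. by have := ip_linear (-1) 0 0 z; rewrite scaleN1r oppr0 addr0 mulN1r addNr. Qed.
Lemma ipZl (a : Cx R) x z : ip (a *: x) z = a * ip x z.
Proof. by have := ip_linear a x 0 z; rewrite !addr0 ip0l addr0. Qed.
Lemma ipDl x y z : ip (x + y) z = ip x z + ip y z.
Proof. by have := ip_linear 1 x y z; rewrite scale1r mul1r. Qed.
Lemma ipDr x y z : ip z (x + y) = ip z x + ip z y.
Proof. by rewrite (ip_conj (x + y)) (ip_conj x z) (ip_conj y z) ipDl rmorphD. Qed.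
Lemma ipZr (a : Cx R) x z : ip z (a *: x) = Num.conj a * ip z x.
Proof. by rewrite (ip_conj (a *: x)) (ip_conj x z) ipZl rmorphM. Qed.
Lemma ip0r z : ip z 0 = 0 :> Cx R.
Proof. by rewrite ip_conj ip0l rmorph0. Qed.
Lemma ipBl x y z : ip (x - y) z = ip x z - ip y z.
Proof. by rewrite -scaleN1r ipDl ipZl mulN1r. Qed.
Lemma ipBr x y z : ip z (x - y) = ip z x - ip z y.
Proof. by rewrite -scaleN1r ipDr ipZr cconjN conjC1 mulN1r. Qed.
Lemma ip_suml (I : Type) (r : seq I) (F : I -> H) z :
  ip (\sum_(i <- r) F i) z = \sum_(i <- r) ip (F i) z.
Proof. by elim/big_rec2 : _ => [|i y x _ <-]; [exact: ip0l|exact: ipDl]. Qed.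
Lemma ip_sumr (I : Type) (r : seq I) (F : I -> H) z :
  ip z (\sum_(i <- r) F i) = \sum_(i <- r) ip z (F i).
Proof. by elim/big_rec2 : _ => [|i y x _ <-]; [exact: ip0r|exact: ipDr]. Qed.

Lemma ip_rnorm x : ip x x = (rnorm x ^+ 2)%:C%C :> Cx R.
Proof. by rewrite ip_norm rnormE realCX. Qed.

Lemma cauchy_schwarz x y : cabs (ip x y) <= rnorm x * rnorm y.
Proof.
rewrite -(@ler_pXn2r _ 2%N)// ?nnegrE ?mulr_ge0 ?cabs_ge0 ?rnorm_ge0//.
have ge0 z : 0 <= ip z z :> Cx R.
  by rewrite ip_rnorm (leCxR 0) exprn_ge0 ?rnorm_ge0.
have := @semi_cauchy_schwarz _ _ _ (@ip_linear R H) (@ip_conj R H) ge0 x y.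
by rewrite /snorm2 !ip_rnorm /= exprMn.
Qed.

End Ip.

Section HForm.
Context (H : hilbert R).
Local Notation C := (Cx R : normedModType (Cx R)).

Lemma rnormC (z : C) : rnorm z = cabs z. Proof. by []. Qed.

Fact hform_lin (x : H) : linear (fun y : H => ip y x : C).
Proof. by move=> a y z; rewrite ip_linear. Qed.
Fact hform_conj (a : Cx R) (x y z : H) :
  ip z (a *: x + y) = Num.conj a *: (ip z x : C) + ip z y :> C.
Proof. by rewrite ipDr ipZr. Qed.
Fact hform_bound (x y : H) : rnorm (ip y x : C) <= rnorm x * rnorm y.
Proof. by rewrite mulrC; exact: cauchy_schwarz. Qed.
Fact hform_norm (x : H) : rnorm (ip x x : C) = rnorm x ^+ 2.
Proof. by rewrite rnormC ip_rnorm cabsC ger0_norm// exprn_ge0 ?rnorm_ge0. Qed.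

Definition hform : innerform H C :=
  @InnerForm R H C (fun x y => ip y x) hform_lin hform_conj hform_bound hform_norm.

Lemma hform_mono (t : R) (x y z : H) : 0 <= t ->
  hform x x + hform y y = ((t ^+ 2)%:C%C : Cx R) *: hform z z ->
  rnorm x <= t * rnorm z.
Proof.
move=> t0 h; have E : rnorm x ^+ 2 + rnorm y ^+ 2 = (t * rnorm z) ^+ 2.
  by apply: realC_inj; rewrite exprMn realCD (realCM (t ^+ 2)) -!ip_rnorm; exact: h.
rewrite -(@ler_pXn2r _ 2%N)// ?nnegrE ?mulr_ge0 ?rnorm_ge0// -E lerDl.
by rewrite exprn_ge0 ?rnorm_ge0.
Qed.

End HForm.

Section TensorNorm.
Context {H K : hilbert R}.

Let tn2 (I : Type) (s : seq I) (x : I -> H) (y : I -> K) : Cx R :=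
  \sum_(i <- s) \sum_(j <- s) ip (x i) (x j) * ip (y i) (y j).

(** Pythagoras in the Hilbert tensor product, which is never constructed: the second leg is split
    into its component along the unit vector [e] and the rest. *)
Let tn2_proj (I : Type) (s : seq I) (x : I -> H) (y : I -> K) (e : K) :
  ip e e = 1 :> Cx R ->
  tn2 s x y = tn2 s x (fun i => y i - ip (y i) e *: e) +
    (rnorm (\sum_(i <- s) ip (y i) e *: x i) ^+ 2)%:C%C.
Proof.
move=> e1; rewrite -ip_rnorm ip_suml -big_split; apply: eq_bigr => i _.
rewrite ip_sumr -big_split; apply: eq_bigr => j _ /=.
rewrite !(ipBl, ipBr, ipZl, ipZr) e1 mulr1 -!(ip_conj (y j) e).
by ring.
Qed.

(** A Gram-Schmidt induction: projecting off the direction of $y_{i_0}$ leaves a square and makes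
    that index vanish. Lists replace the finite type so that the index can then be dropped. *)
Lemma tensor_norm2_ge0 (I : finType) (x : I -> H) (y : I -> K) : 0 <= tensor_norm2 x y.
Proof.
rewrite (_ : tensor_norm2 x y = tn2 (index_enum I) x y)//.
move: (index_enum I) y; elim=> [|i0 s IH] y; first by rewrite /tn2 big_nil.
have drop y' : y' i0 = 0 -> tn2 (i0 :: s) x y' = tn2 s x y'.
  move=> y0; rewrite /tn2 big_cons big1 ?add0r => [|j _].
    by apply: eq_bigr => i _; rewrite big_cons y0 ip0r mulr0 add0r.
  by rewrite y0 ip0l mulr0.
have [y0|y0] := eqVneq (y i0) 0; first by rewrite drop.
have n0 : rnorm (y i0) != 0 by apply: contra_neq y0; exact: rnorm_eq0.
pose e := ((rnorm (y i0))^-1%:C%C : Cx R) *: y i0.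
have e1 : ip e e = 1 :> Cx R.
  rewrite ipZl ipZr conj_realC ip_rnorm -!realCM expr2 mulKf// mulVf//.
rewrite (tn2_proj _ _ _ e1) addr_ge0 ?(leCxR 0) ?exprn_ge0 ?rnorm_ge0// drop ?IH//.
have -> : ip (y i0) e = (rnorm (y i0))%:C%C :> Cx R.
  by rewrite /e ipZr conj_realC ip_rnorm -realCM expr2 mulKf.
by rewrite /e scalerA -realCM divff// scale1r subrr.
Qed.

(** Up to the factor $\|h\|$, contracting the second leg against [h] gives the component along
    $h/\|h\|$ that [tn2_proj] splits off; the remainder is nonnegative. *)
Lemma tensor_norm2_slice (I : finType) (x : I -> H) (y : I -> K) (h : K) :
  (rnorm (\sum_i ip (y i) h *: x i) ^+ 2)%:C%C <=
  (rnorm h ^+ 2)%:C%C * tensor_norm2 x y.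
Proof.
have [->|h0] := eqVneq h 0.
  by rewrite rnorm0 expr0n mul0r big1 ?rnorm0 ?expr0n// => i _; rewrite ip0r scale0r.
have n0 : rnorm h != 0 by apply: contra_neq h0; exact: rnorm_eq0.
pose e := ((rnorm h)^-1%:C%C : Cx R) *: h.
have e1 : ip e e = 1 :> Cx R.
  by rewrite ipZl ipZr conj_realC ip_rnorm -!realCM expr2 mulKf// mulVf.
have -> : tensor_norm2 x y = tn2 (index_enum I) x y by [].
rewrite (tn2_proj _ _ _ e1) mulrDr.
have -> : \sum_i ip (y i) h *: x i = (rnorm h)%:C%C *: \sum_i ip (y i) e *: x i.
  rewrite scaler_sumr; apply: eq_bigr => i _.
  by rewrite scalerA /e ipZr conj_realC mulrA -realCM divff// mul1r.
rewrite rnormZ cabsC ger0_norm ?rnorm_ge0// exprMn realCM lerDr mulr_ge0//.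
  by rewrite (leCxR 0) exprn_ge0 ?rnorm_ge0.
exact: (tensor_norm2_ge0 x (fun i => y i - ip (y i) e *: e)).
Qed.

Lemma tensor_norm2_reindex (I J : finType) (h : J -> I) (x : I -> H) (y : I -> K) :
  bijective h -> tensor_norm2 (x \o h) (y \o h) = tensor_norm2 x y.
Proof.
move=> bh; rewrite /tensor_norm2 (reindex h)/=; last exact: onW_bij.
by apply: eq_bigr => i _; rewrite (reindex h)//=; exact: onW_bij.
Qed.

End TensorNorm.

End Hilbert.

Section Reps.
Context {R : realType}.
Implicit Types (A B D E : cstarAlg R) (H K : hilbert R).
Local Notation C := (Cx R : normedModType (Cx R)).

(** Representations are built below by extension from a total family, so the algebraic identities
    are at first available only there. *)
Lemma is_rep_dense (A : cstarAlg R) (H : hilbert R) (I : Type) (e : I -> H)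
    (rho : A -> H -> H) (N : A -> R) :
  total (range e) -> (forall a, linear (rho a)) ->
  (forall a x, rnorm (rho a x) <= N a * rnorm x) ->
  (forall (c : Cx R) a b i, rho (c *: a + b) (e i) = c *: rho a (e i) + rho b (e i)) ->
  (forall a b i, rho (a ** b) (e i) = rho a (rho b (e i))) ->
  (forall a i j, ip (rho a (e i)) (e j) = ip (e i) (rho (cs_star a) (e j)) :> Cx R) ->
  total [set y | exists a x, y = rho a x] -> is_rep rho.
Proof.
move=> te rl rN rD rM rS tr; split => //.
- move=> c a b; apply: (total_eq (rl _) _ (rN _) _ te) => [|x|_ [i _ <-]].
  + move=> k x y; rewrite !rl !scalerDr !scalerA [c * k]mulrC -!addrA; congr (_ + _).
    by rewrite addrCA.
  + rewrite (le_trans (rnormD _ _))// rnormZ.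
    rewrite (le_trans (lerD (ler_wpM2l (cabs_ge0 c) (rN a x)) (rN b x)))//.
    by rewrite mulrA -mulrDl; exact: lexx.
  + exact: rD.
- move=> a; split => //; exists (N a)%:C%C => x.
  by rewrite !rnormE -realCM leCxR.
- move=> a b; apply: (total_eq (rl _) _ (rN _) _ te) => [|x|_ [i _ <-]].
  + by move=> k x y; rewrite !rl.
  + rewrite (le_trans (rN _ _))// (@le_trans _ _ (`|N a| * (N b * rnorm x)))//.
      rewrite (@le_trans _ _ (`|N a| * rnorm (rho b x)))//.
        by rewrite ler_wpM2r ?rnorm_ge0// ler_norm.
      by rewrite ler_wpM2l.
    by rewrite mulrA; exact: lexx.
  + exact: rM.
- move=> a x y.
  have step1 j : forall x0, ip (rho a x0) (e j) = ip x0 (rho (cs_star a) (e j)) :> C.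
    apply: (@total_eq _ _ C _ _ _ (N a * rnorm (e j))
        (rnorm (rho (cs_star a) (e j))) _ _ _ _ te).
    + by move=> k u v; rewrite rl ip_linear.
    + by move=> k u v; rewrite ip_linear.
    + move=> u; rewrite rnormC (le_trans (cauchy_schwarz _ _))// mulrAC.
      by rewrite ler_wpM2r ?rnorm_ge0.
    + by move=> u; rewrite rnormC mulrC cauchy_schwarz.
    + by move=> _ [i _ <-]; exact: rS.
  rewrite ip_conj [RHS]ip_conj; congr Num.conj; move: y.
  apply: (@total_eq _ _ C _ _ _ (rnorm (rho a x)) (N (cs_star a) * rnorm x) _ _ _ _ te).
  + by move=> k u v; rewrite ip_linear.
  + by move=> k u v; rewrite rl ip_linear.
  + by move=> u; rewrite rnormC mulrC cauchy_schwarz.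
  + move=> u; rewrite rnormC (le_trans (cauchy_schwarz _ _))// mulrAC.
    by rewrite ler_wpM2r ?rnorm_ge0.
  + by move=> _ [j _ <-]; rewrite ip_conj [RHS]ip_conj step1.
Qed.

Section Rep.
Context {D : cstarAlg R} {H : hilbert R} (rho : D -> H -> H) (rrho : is_rep rho).

Let rho_mul : forall a b x, rho (a ** b) x = rho a (rho b x). Proof. by case: rrho. Qed.
Let rho_star : forall a x y, ip (rho a x) y = ip x (rho (cs_star a) y) :> Cx R.
Proof. by case: rrho. Qed.

Lemma rep_linear_l x : linear (fun d => rho d x).
Proof. by case: rrho => + _ _ _ _ c a b => /(_ c a b x). Qed.

Lemma rep_form a b x y : ip (rho a x) (rho b y) = ip x (rho (cs_star a ** b) y) :> Cx R.
Proof. by rewrite rho_star rho_mul. Qed.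

Fact rep_adjP d x y : hform H (rho d x) y = hform H x (rho (cs_star d) y).
Proof. by rewrite /= -[d in LHS]cs_starK -rho_star. Qed.
Fact rep_adjP' d x y : hform H (rho (cs_star d) x) y = hform H x (rho d y).
Proof. by rewrite /= rho_star. Qed.
Definition rep_adj d : adj (hform H) :=
  @Adj _ _ _ (hform H) (rho d) (rho (cs_star d)) (rep_adjP d) (rep_adjP' d).

Lemma rep_contract d x : rnorm (rho d x) <= rnorm d * rnorm x.
Proof.
rewrite (le_trans (rnorm_afun (rep_adj d) x))// ler_wpM2r ?rnorm_ge0//.
apply: (@star_hom_contractive _ _ _ _ _ rep_adj).
- by move=> c a b; apply: adj_eq => y /=; rewrite rep_linear_l.
- by move=> a b; apply: adj_eq => y /=; rewrite rho_mul.
- by move=> a; exact: adj_eq.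
Qed.

Lemma rep_mult_ext (m : mult D) : exists g : H -> H, [/\ linear g,
  forall x, rnorm (g x) <= mnorm m * rnorm x &
  forall d x, g (rho d x) = rho (ml m d) x].
Proof.
have [k kE] := mult_dilate (lexx (mnorm m)).
pose ev (u : mult D) (p : D * H) := rho (ml u p.1) p.2.
have [||g [lg gM gE]] := @extend_by_density _ H H
    [set (ev 1 i, ev m i) | i in [set: D * H]] (mnorm m) (mnorm_ge0 m).
- apply: (@dilation_bound R H C (hform H) _ (ev 1) (ev m) (ev k) (mnorm m)).
    by move=> x y z; apply: hform_mono; exact: mnorm_ge0.
  move=> [a x] [b y]; rewrite /ev /= !rep_form -ipDr -(linearDf _ _ (rep_linear_l _)).
  by rewrite kE (linearZf _ _ (rep_linear_l _)) ipZr conj_realC.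
- case: rrho => _ _ _ _; apply: totalS => _ [a [x ->]].
  by exists (rho a x, ev m (a, x)) => //; exists (a, x).
by exists g; split => // d x; apply: gE; exists (d, x).
Qed.

(** Since $\rho$ extends to multipliers, precomposition with a nondegenerate homomorphism stays
    inside the class of representations that defines the spatial norm. This makes that norm
    functorial. *)
Lemma rep_comp (A : cstarAlg R) (pi : A -> mult D) : nondeg_hom pi ->
  exists rho' : A -> H -> H, is_rep rho' /\
    forall a d x, rho' a (rho d x) = rho (ml (pi a) d) x.
Proof.
move=> [[lp mp sp] tp].
have /choice[rho' r'P] : forall a, exists g : H -> H, [/\ linear g,
    forall x, rnorm (g x) <= mnorm (pi a) * rnorm x &
    forall d x, g (rho d x) = rho (ml (pi a) d) x].
  by move=> a; exact: rep_mult_ext.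
have r'l a : linear (rho' a) by case: (r'P a).
have r'M a x : rnorm (rho' a x) <= mnorm (pi a) * rnorm x by case: (r'P a).
have r'E a d x : rho' a (rho d x) = rho (ml (pi a) d) x by case: (r'P a).
have tH : total [set y | exists a x, y = rho a x] by case: rrho.
exists rho'; split => //.
apply: (@is_rep_dense _ _ _ (fun p : D * H => rho p.1 p.2) _ (fun a => mnorm (pi a))) => //.
- by apply: totalS tH => _ [d [x ->]]; exists (d, x).
- by move=> c a b [d x]; rewrite !r'E lp maddE mscaleE rep_linear_l.
- by move=> a b [d x]; rewrite !r'E mp.
- by move=> a [d x] [d' y]; rewrite !r'E !rep_form mstar_form sp.
- apply: (total_trans tH) => _ [d [x ->]] e e0.
  have M0 : 0 < rnorm x + 1 by rewrite ltr_wpDl ?rnorm_ge0.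
  have /totalP /(_ d _ (divr_gt0 e0 M0)) [d' Sd' dd'] := tp.
  exists (rho d' x).
    have := lspan_map (rep_linear_l x); apply; last exact: Sd'.
    by move=> _ [a [u ->]]; apply: lspan_in; exists a, (rho u x).
  rewrite -(linearBf _ _ (rep_linear_l x)) (le_lt_trans (rep_contract _ _))//.
  rewrite ltr_pdivlMr// in dd'; apply: le_lt_trans dd'.
  by rewrite ler_wpM2l ?rnorm_ge0// lerDl.
Qed.

End Rep.

Section PureNorm.
Context (T : forall A B : cstarAlg R, min_tensor A B).
Context {A B : cstarAlg R}.
Local Notation "a [x] b" := (pure (T A B) a b) (at level 35).

Lemma lspan_pure (V : lmodType (Cx R)) (F : A -> B -> V) (p : T A B * V) :
  (forall b, linear (F^~ b)) ->
  lspan [set (ab.1 [x] ab.2, F ab.1 ab.2) | ab in [set: A * B]] p ->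
  exists n (a : 'I_n -> A) (b : 'I_n -> B),
    p.1 = \sum_i a i [x] b i /\ p.2 = \sum_i F (a i) (b i).
Proof.
move=> lF [n [c [v [Sv ->]]]].
have /choice[ab abE] : forall i, exists ab : A * B,
    (ab.1 [x] ab.2, F ab.1 ab.2) = v i by move=> i; have [ab _ abv] := Sv i; exists ab.
exists n, (fun i => c i *: (ab i).1), (fun i => (ab i).2); split.
  rewrite (raddf_sum fst); apply: eq_bigr => i _.
  by rewrite -abE /= pureZl.
rewrite (raddf_sum snd); apply: eq_bigr => i _.
by rewrite -abE /= (linearZf _ _ (lF _)).
Qed.

Let enum_pair (I : finType) n (p : 'I_#|I| * 'I_n) : I * 'I_n := (enum_val p.1, p.2).

Let enum_pair_bij (I : finType) n : bijective (@enum_pair I n).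
Proof.
exists (fun p => (enum_rank p.1, p.2)) => -[i k]; rewrite /enum_pair /=.
  by rewrite enum_valK.
by rewrite enum_rankK.
Qed.

Lemma rnorm_pure_le (I : finType) (a : I -> A) (b : I -> B) (c : R) : 0 <= c ->
  (forall H K (rho : A -> H -> H) (sigma : B -> K -> K), is_rep rho -> is_rep sigma ->
    forall m (x : 'I_m -> H) (y : 'I_m -> K),
    tensor_norm2 (fun p : I * 'I_m => rho (a p.1) (x p.2))
                 (fun p : I * 'I_m => sigma (b p.1) (y p.2))
    <= (c ^+ 2)%:C%C * tensor_norm2 x y) ->
  rnorm (\sum_i a i [x] b i) <= c.
Proof.
move=> c0 h; rewrite -leCxR -rnormE.
have -> : \sum_i a i [x] b i = \sum_(k < #|I|) a (enum_val k) [x] b (enum_val k).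
  by rewrite (reindex (@enum_val I I))//; apply: onW_bij; exact: enum_val_bij.
apply/(pure_norm (T A B) (a \o enum_val) (b \o enum_val)); first by rewrite (leCxR 0).
move=> H K rho sigma rr rs m x y; rewrite -realCX; apply: le_trans (h _ _ _ _ rr rs m x y).
by rewrite -(tensor_norm2_reindex _ _ (@enum_pair_bij I m)).
Qed.

Lemma tensor_norm2_le (I J : finType) (a : I -> A) (b : I -> B) H K
    (rho : A -> H -> H) (sigma : B -> K -> K) (x : J -> H) (y : J -> K) :
  is_rep rho -> is_rep sigma ->
  tensor_norm2 (fun p : I * J => rho (a p.1) (x p.2))
               (fun p : I * J => sigma (b p.1) (y p.2))
  <= (rnorm (\sum_i a i [x] b i) ^+ 2)%:C%C * tensor_norm2 x y.
Proof.
move=> rr rs; set c := rnorm _.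
have cE : c = rnorm (\sum_(k < #|I|) a (enum_val k) [x] b (enum_val k)).
  congr rnorm; rewrite (reindex (@enum_val I I))//; apply: onW_bij.
  exact: enum_val_bij.
have c0 : 0 <= (c%:C%C : Cx R) by rewrite (leCxR 0) rnorm_ge0.
have h : `|\sum_(k < #|I|) a (enum_val k) [x] b (enum_val k)| <= (c%:C%C : Cx R).
  by rewrite rnormE -cE lexx.
have {}h := iffLR (pure_norm (T A B) (a \o enum_val) (b \o enum_val) c0) h.
have := h _ _ _ _ rr rs _ (x \o @enum_val J J) (y \o @enum_val J J).
rewrite realCX (tensor_norm2_reindex x y (@enum_val_bij J)).
pose g (p : 'I_#|I| * 'I_#|J|) : I * J := (enum_val p.1, enum_val p.2).
have bg : bijective g.
  exists (fun p => (enum_rank p.1, enum_rank p.2)) => -[i k]; rewrite /g /=.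
    by rewrite !enum_valK.
  by rewrite !enum_rankK.
by rewrite -(tensor_norm2_reindex _ _ bg).
Qed.

End PureNorm.
End Reps.

Section HomTensor.
Context {R : realType} (T : forall A B : cstarAlg R, min_tensor A B).
Local Notation "a [x] b" := (pure (T _ _) a b) (at level 35).

(** A crude bound [M] provides continuity; the wanted bound [N] need then be tested only on the span
    of [S]. *)
Lemma bounded_dense (X Y : normedModType (Cx R)) (f : X -> Y) (S : set X) (M N : R) :
  linear f -> (forall x, rnorm (f x) <= M * rnorm x) -> 0 <= N -> total S ->
  (forall x, lspan S x -> rnorm (f x) <= N * rnorm x) ->
  forall x, rnorm (f x) <= N * rnorm x.
Proof.
move=> lf fM N0 /totalP tS fN x; apply: (@eps_le _ _ _ (`|M| + N)) => e e0.
have [y Sy xy] := tS x e e0.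
have h1 := rnorm_leD (f x) (f y); rewrite -(linearBf _ _ lf) in h1.
have h2 := fN y Sy; have h3 := rnorm_leD y x; rewrite rnormB in h3.
have h4 : N * rnorm y <= N * (rnorm x + e) by rewrite ler_wpM2l//; lra.
have h5 : rnorm (f (x - y)) <= `|M| * e.
  rewrite (le_trans (fM _))// (@le_trans _ _ (`|M| * rnorm (x - y)))//.
    by rewrite ler_wpM2r ?rnorm_ge0// ler_norm.
  by rewrite ler_wpM2l// ltW.
lra.
Qed.

Lemma lspan_pure1 (A B : cstarAlg R) (z : T A B) :
  lspan [set z | exists a b, z = a [x] b] z ->
  exists n (a : 'I_n -> A) (b : 'I_n -> B), z = \sum_i a i [x] b i.
Proof.
move=> [n [c [v [Sv ->]]]].
have /choice[ab abE] : forall i, exists ab : A * B, ab.1 [x] ab.2 = v i.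
  by move=> i; have [a [b ->]] := Sv i; exists (a, b).
exists n, (fun i => c i *: (ab i).1), (fun i => (ab i).2).
by apply: eq_bigr => i _; rewrite -abE /= pureZl.
Qed.

Context {A B D E : cstarAlg R} (pi : A -> mult D) (rho : B -> mult E).
Hypotheses (npi : nondeg_hom pi) (nrho : nondeg_hom rho).

Let hpi : is_hom pi := proj1 npi.
Let hrho : is_hom rho := proj1 nrho.

(* Composing representations of D and E with pi and rho gives representations of
   A and B, so the norm of the left side is controlled by that of A (x) B. *)
Lemma hom_tensor_bound n m (a : 'I_n -> A) (b : 'I_n -> B) (d : 'I_m -> D) (e : 'I_m -> E) :
  rnorm (\sum_(p : 'I_n * 'I_m) ml (pi (a p.1)) (d p.2) [x] ml (rho (b p.1)) (e p.2)) <=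
  rnorm (\sum_i a i [x] b i) * rnorm (\sum_k d k [x] e k).
Proof.
apply: rnorm_pure_le => [|H K s t rs rt l x y]; first by rewrite mulr_ge0 ?rnorm_ge0.
have [s' [rs' s'E]] := rep_comp rs npi; have [t' [rt' t'E]] := rep_comp rt nrho.
pose h (q : 'I_n * 'I_m * 'I_l) := (q.1.1, (q.1.2, q.2)).
have bh : bijective h.
  by exists (fun q => (q.1, q.2.1, q.2.2)) => [[[i j] k]|[i [j k]]].
pose u (p : 'I_m * 'I_l) := s (d p.1) (x p.2).
pose v (p : 'I_m * 'I_l) := t (e p.1) (y p.2).
have -> : tensor_norm2 (fun p : 'I_n * 'I_m * 'I_l => s (ml (pi (a p.1.1)) (d p.1.2)) (x p.2))
      (fun p => t (ml (rho (b p.1.1)) (e p.1.2)) (y p.2)) =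
    tensor_norm2 (fun p => s' (a p.1) (u p.2)) (fun p => t' (b p.1) (v p.2)).
  rewrite -(tensor_norm2_reindex _ _ bh); congr tensor_norm2; apply/funext => p.
    by rewrite /u /= s'E.
  by rewrite /v /= t'E.
apply: le_trans (tensor_norm2_le T a b u v rs' rt') _.
set X := rnorm _; set Y := rnorm (\sum_k _).
rewrite exprMn (realCM (X ^+ 2)) -mulrA ler_wpM2l ?(leCxR 0) ?exprn_ge0 ?rnorm_ge0//.
exact: tensor_norm2_le.
Qed.

(** Values are taken in the complete space [adj (mform (T D E))], so a bounded definition on sums of
    elementary tensors extends. The operator norm bound is [hom_tensor_bound], tested on sums of
    elementary tensors of the target. *)
Lemma hom_tensor_ex : exists F : T A B -> mult (T D E), is_hom F /\
  forall a b, F (a [x] b) = mtensor T (pi a) (rho b).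
Proof.
pose G a b : adj (mform (T D E)) := toA (mtensor T (pi a) (rho b)).
have lG b : linear (G^~ b).
  move=> c x y; rewrite /G; have [lp _ _] := hpi.
  by rewrite lp mtensor_linl toA_linear.
have [||F [lF FM FE]] := @extend_by_density _ (T A B) (adj (mform (T D E)))
    [set (ab.1 [x] ab.2, G ab.1 ab.2) | ab in [set: A * B]] 1 ler01.
- move=> p /(lspan_pure lG)[n [a [b [p1 p2]]]]; rewrite mul1r.
  apply: rnorm_adj_le; first exact: rnorm_ge0.
  apply: (bounded_dense (afun_linear _) (rnorm_afun _) (rnorm_ge0 _) (pure_total (T D E))).
  move=> z /lspan_pure1[m [d [e zE]]]; rewrite p1 p2 zE.
  apply: le_trans _ (hom_tensor_bound a b d e); rewrite le_eqVlt; apply/orP; left; apply/eqP.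
  congr rnorm; rewrite (linear_sumf _ _ _ (afun_linear _)).
  rewrite -(pair_bigA _ (fun i k => ml (pi (a i)) (d k) [x] ml (rho (b i)) (e k)))/= exchange_big.
  apply: eq_bigr => k _.
  have -> (r : seq 'I_n) (y : T D E) : (\sum_(i <- r) G (a i) (b i)) y = \sum_(i <- r) G (a i) (b i) y.
    by elim/big_rec2 : _ => // i z1 z2 _ <-.
  by apply: eq_bigr => i _; rewrite /G /= mtensorP.
- apply: totalS (pure_total (T A B)) => _ [a [b ->]].
  by exists (a [x] b, G a b) => //; exists (a, b).
have {}FE a b : F (a [x] b) = G a b by apply: FE; exists (a, b).
have FX x d : rnorm (F x d) <= rnorm d * rnorm x.
  rewrite mulrC (le_trans (rnorm_afun _ _))// ler_wpM2r ?rnorm_ge0//.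
  by rewrite (le_trans (FM x))// mul1r.
have [lp mp sp] := hpi; have [lr mr sr] := hrho.
exists (ofA \o F); split; last by move=> a b /=; rewrite FE toAK.
split=> [c x y|x y|x] /=.
- by rewrite lF ofA_linear.
- rewrite -ofAM; congr ofA; move: y.
  apply: (@total_eq _ _ _ _ _ _ (rnorm x) (rnorm (F x)) _ _ _ _ (pure_total (T A B))).
  + by move=> c u v; rewrite cs_mulDr lF.
  + by move=> c u v; rewrite lF mulrDr ascaleAr.
  + by move=> u; rewrite (le_trans (FM _))// mul1r cs_rnormM.
  + move=> u; rewrite (le_trans (arnormM _ _))// ler_wpM2l ?rnorm_ge0//.
    by have := FM u; rewrite mul1r.
  move=> _ [a [b ->]]; move: x.
  apply: (@total_eq _ _ _ _ _ _ (rnorm (a [x] b)) (rnorm (F (a [x] b))) _ _ _ _ (pure_total (T A B))).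
  + by move=> c u v; rewrite cs_mulDl lF.
  + by move=> c u v; rewrite lF mulrDl ascaleAl.
  + by move=> u; rewrite (le_trans (FM _))// mul1r mulrC cs_rnormM.
  + move=> u; rewrite (le_trans (arnormM _ _))// mulrC ler_wpM2l ?rnorm_ge0//.
    by have := FM u; rewrite mul1r.
  by move=> _ [c [d ->]]; rewrite pure_mul !FE /G -toAM mtensorM mp mr.
- rewrite -ofA_star; congr ofA; rewrite -[LHS]aswapK; congr aswap; move: x.
  apply: (@total_eq _ _ _ _ _ _ 1 1 _ _ _ _ (pure_total (T A B))) => //.
  + move=> c u v; rewrite cs_starD lF aswapD aswapZ conjCK //.
  + by move=> u; rewrite (rnorm_aswap (F _)) (le_trans (FM _))// cs_rnorm_star.
  + by move=> _ [a [b ->]]; rewrite pure_star !FE /G -toA_star mtensor_star sp sr !mstarK.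
Qed.

Lemma hom_tensorP : is_hom (hom_tensor T pi rho) /\
  forall a b, hom_tensor T pi rho (a [x] b) = mtensor T (pi a) (rho b).
Proof.
have [F hF] := hom_tensor_ex; rewrite /hom_tensor.
by case: xgetP => [G -> //|/(_ F)].
Qed.

Lemma hom_tensor_pure a b : hom_tensor T pi rho (a [x] b) = mtensor T (pi a) (rho b).
Proof. by case: hom_tensorP. Qed.

Lemma hom_tensor_uniq (F : T A B -> mult (T D E)) : is_hom F ->
  (forall a b, F (a [x] b) = mtensor T (pi a) (rho b)) -> F = hom_tensor T pi rho.
Proof.
move=> hF FE; apply/funext; have [hG GE] := hom_tensorP.
apply: (hom_total_eq hF hG (pure_total (T A B))) => _ [a [b ->]].
by rewrite FE GE.
Qed.

Lemma hom_tensor_nondeg : nondeg_hom (hom_tensor T pi rho).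
Proof.
split; first by case: hom_tensorP.
apply: totalS (total_pure T npi.2 nrho.2) => _ [_ [_ [[a [d ->]] [b [e ->]] ->]]].
by exists (a [x] b), (d [x] e); rewrite hom_tensor_pure mtensorP.
Qed.

Lemma mext_hom_tensor (m : mult A) (n : mult B) :
  mext (hom_tensor T pi rho) (mtensor T m n) = mtensor T (mext pi m) (mext rho n).
Proof.
have nF := hom_tensor_nondeg; apply: (mext_uniq nF).
move=> z; apply: mult_eqml => x; move: z.
apply: (@total_eq _ _ _ _ _ _ (mnorm (mtensor T (mext pi m) (mext rho n)) * rnorm x)
    (mnorm (mtensor T m n) * rnorm x) _ _ _ _ (pure_total (T A B))).
- by move=> c u v; rewrite !mmulE (hom_eval_linear x nF.1) ml_linear.
- by move=> c u v; rewrite ml_linear (hom_eval_linear x nF.1).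
- move=> u; rewrite mmulE (le_trans (rnorm_ml _ _))// -mulrA ler_wpM2l ?mnorm_ge0//.
  by rewrite mulrC rnorm_hom//; exact: nF.1.
- move=> u; rewrite (le_trans (rnorm_hom _ _ nF.1))// mulrAC ler_wpM2r ?rnorm_ge0//.
  exact: rnorm_ml.
- move=> _ [a [b ->]]; rewrite mtensorP !hom_tensor_pure mtensorM.
  by rewrite (mextP npi) (mextP nrho).
Qed.

End HomTensor.

(** * Hahn-Banach and the GNS construction *)

Section HahnBanach.
Context {R : realType} {V : lmodType (Cx R)}.
Implicit Types (p q : V -> R) (x y a : V).

Definition sublinear p : Prop := (forall x y, p (x + y) <= p x + p y) /\
  (forall (t : R) x, 0 <= t -> p ((t%:C%C : Cx R) *: x) = t * p x).

Lemma sublinear0 p : sublinear p -> p 0 = 0.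
Proof. by move=> [_ /(_ 0 0 (lexx 0))]; rewrite scaler0 mul0r. Qed.

Lemma sublinearN p x : sublinear p -> - p (- x) <= p x.
Proof.
move=> sp; rewrite lerNl -subr_ge0 opprK; case: (sp) => + _ => /(_ (- x) x).
by rewrite addNr (sublinear0 sp).
Qed.

(* The largest functional below q of the form x |-> inf_t q (x + t a) - t q a;
   it takes the value - q a at - a. *)
Definition sub_shift q a x : R :=
  inf [set q (x + (t%:C%C : Cx R) *: a) - t * q a | t in [set t : R | 0 <= t]].

Lemma sub_shift_lb q a x : sublinear q -> lbound
  [set q (x + (t%:C%C : Cx R) *: a) - t * q a | t in [set t : R | 0 <= t]] (- q (- x)).
Proof.
move=> sq _ [t /= t0 <-]; have [qD qZ] := sq.
have := qD (x + (t%:C%C : Cx R) *: a) (- x); rewrite addrAC subrr add0r qZ//; lra.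
Qed.

Lemma sub_shift_le q a x (t : R) : sublinear q -> 0 <= t ->
  sub_shift q a x <= q (x + (t%:C%C : Cx R) *: a) - t * q a.
Proof.
move=> sq t0; apply: ge_inf; last by exists t.
by exists (- q (- x)); exact: sub_shift_lb.
Qed.

Lemma sub_shift_ge q a x (c : R) : sublinear q ->
  (forall t : R, 0 <= t -> c <= q (x + (t%:C%C : Cx R) *: a) - t * q a) ->
  c <= sub_shift q a x.
Proof.
move=> sq h; apply: lb_le_inf; first by exists (q (x + (0%:C%C : Cx R) *: a) - 0 * q a), 0 => /=.
by move=> _ [t /= t0 <-]; exact: h.
Qed.

Lemma sub_shift_leq q a x : sublinear q -> sub_shift q a x <= q x.
Proof.
move=> sq; have := sub_shift_le a x sq (lexx 0).
by rewrite scale0r addr0 mul0r subr0.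
Qed.

Lemma sub_shift_sublinear q a : sublinear q -> sublinear (sub_shift q a).
Proof.
move=> sq; have [qD qZ] := sq; split=> [x y|t x].
  rewrite -lerBlDr; apply: sub_shift_ge => // s s0.
  rewrite lerBlDl -lerBlDr; apply: sub_shift_ge => // t t0.
  rewrite lerBlDr (le_trans (sub_shift_le _ _ sq (addr_ge0 s0 t0)))//.
  rewrite realCD scalerDl addrACA mulrDl.
  have := qD (x + (s%:C%C : Cx R) *: a) (y + (t%:C%C : Cx R) *: a); lra.
have half (r : R) z : 0 < r -> sub_shift q a ((r%:C%C : Cx R) *: z) <= r * sub_shift q a z.
  move=> r0; rewrite mulrC -ler_pdivrMr//; apply: sub_shift_ge => // s s0.
  rewrite ler_pdivrMr// (le_trans (@sub_shift_le _ _ _ (r * s) sq _))//.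
    by rewrite mulr_ge0// ltW.
  by rewrite realCM -scalerA -scalerDr qZ ?(ltW r0)// -mulrA -mulrBr mulrC.
rewrite le_eqVlt => /orP[/eqP <-|t0].
  rewrite scale0r mul0r; apply/eqP; rewrite eq_le; apply/andP; split.
    by rewrite (le_trans (sub_shift_leq _ _ sq))// (sublinear0 sq).
  by apply: sub_shift_ge => // s s0; rewrite add0r qZ// subrr.
apply/eqP; rewrite eq_le half//=.
have := half t^-1 ((t%:C%C : Cx R) *: x); rewrite invr_gt0 => /(_ t0).
by rewrite scalerA -realCM mulVf ?gt_eqF// scale1r ler_pdivlMl.
Qed.

(** A minimal sublinear functional is linear: minimality forces [sub_shift q b] to equal [q] for
    every [b]. Starting below [sub_shift p a], whose value at $-a$ is at most $-p(a)$, gives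
    equality at [a]. Partially defined functionals never occur. *)
Lemma hahn_banach p a : sublinear p -> exists f : V -> R,
  [/\ forall x y, f (x + y) = f x + f y,
      forall (t : R) x, f ((t%:C%C : Cx R) *: x) = t * f x,
      forall x, f x <= p x & f a = p a].
Proof.
move=> sp; pose p' := sub_shift p a.
have sp' : sublinear p' := sub_shift_sublinear a sp.
pose T := {q : V -> R | sublinear q /\ forall x, q x <= p' x}.
(* The order is reversed, since [Zorn] yields maximal elements. *)
pose le (q r : T) : bool := `[< forall x, sval r x <= sval q x >].
have [|||A tA|[q [sq qp']] qmin] := @Zorn T le.
- by move=> q; apply/asboolP.
- by move=> q r s /asboolP h1 /asboolP h2; apply/asboolP => x; exact: le_trans (h2 x) (h1 x).
- move=> [q hq] [r hr] /asboolP h1 /asboolP h2.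
  have qr : q = r by apply/funext => x; apply/eqP; rewrite eq_le (h1 x) (h2 x).
  by subst r; congr exist; exact: Prop_irrelevance.
(* The empty chain is bounded by [p'], a nonempty one by its pointwise infimum, which is finite
   because every member is at least $-p'(-x)$ at [x]. *)
- have [[q0 Aq0]|nA] := pselect (exists q : T, A q); last first.
    exists (exist _ p' (conj sp' (fun x => lexx _))) => s As.
    by exfalso; apply: nA; exists s.
  pose I x := [set sval u x | u in A].
  have Ilb x : lbound (I x) (- p' (- x)).
    move=> _ [q Aq <-]; have [sq qp] := svalP q.
    by rewrite (le_trans _ (sublinearN x sq))// lerN2.
  have Ile x (q : T) : A q -> inf (I x) <= sval q x.
    by move=> Aq; apply: ge_inf; [exists (- p' (- x)); exact: Ilb|exists q].
  have Ige x (c : R) : (forall u, A u -> c <= sval u x) -> c <= inf (I x).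
    move=> h; apply: lb_le_inf; first by exists (sval q0 x), q0.
    by move=> _ [q Aq <-]; exact: h.
  have sI : sublinear (fun x => inf (I x)).
    split=> [x y|t x t0].
      rewrite -lerBlDr; apply: (Ige) => q Aq; rewrite lerBlDl -lerBlDr.
      apply: (Ige) => r Ar; rewrite lerBlDr.
      have [/asboolP qr|/asboolP rq] := tA _ _ Aq Ar.
        rewrite (le_trans (Ile _ _ Ar))// (le_trans ((svalP r).1.1 x y))//.
        by rewrite addrC lerD2l qr.
      rewrite (le_trans (Ile _ _ Aq))// (le_trans ((svalP q).1.1 x y))//.
      by rewrite addrC lerD2r rq.
    have Iq (q : T) : sval q ((t%:C%C : Cx R) *: x) = t * sval q x by exact: (svalP q).1.2.
    move: t0; rewrite le_eqVlt => /orP[/eqP t0|t0].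
      apply/eqP; rewrite eq_le -t0 mul0r; apply/andP; split.
        by rewrite (le_trans (Ile _ _ Aq0))// t0 Iq -t0 mul0r.
      by apply: (Ige) => q Aq; rewrite t0 Iq -t0 mul0r.
    apply/eqP; rewrite eq_le; apply/andP; split.
      rewrite -ler_pdivrMl//; apply: (Ige) => q Aq.
      by rewrite ler_pdivrMl// -Iq Ile.
    by apply: (Ige) => q Aq; rewrite Iq ler_pM2l// Ile.
  have Ip' x : inf (I x) <= p' x by rewrite (le_trans (Ile _ _ Aq0))// (svalP q0).2.
  exists (exist (fun q : V -> R => sublinear q /\ forall x, q x <= p' x) _ (conj sI Ip')) => s As; apply/asboolP => x /=; exact: Ile.
have {}qmin b x : sub_shift q b x = q x.
  have s1 := sub_shift_sublinear b sq.
  have s2 z : sub_shift q b z <= p' z by exact: le_trans (sub_shift_leq _ _ sq) (qp' z).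
  pose q' : T := exist (fun q : V -> R => sublinear q /\ forall x, q x <= p' x) _ (conj s1 s2).
  apply: (congr1 (fun u : T => sval u x) (qmin q' _)).
  by apply/asboolP => z /=; exact: sub_shift_leq.
have qD x y : q (x + y) = q x + q y.
  apply/eqP; rewrite eq_le sq.1 /=; have := sub_shift_le y x sq ler01.
  by rewrite qmin scale1r mul1r lerBrDr.
have qN x : q (- x) = - q x.
  by apply/eqP; rewrite -addr_eq0 -qD addNr (sublinear0 sq).
exists q; split => // [t x|x|].
- have [t0|t0] := leP 0 t; first exact: sq.2.
  rewrite -[x in LHS]opprK scalerN -scaleNr -realCN sq.2 ?oppr_ge0 ?ltW//.
  by rewrite qN mulrNN.
- exact: le_trans (qp' x) (sub_shift_leq _ _ sp).
apply/eqP; rewrite eq_le; apply/andP; split.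
  exact: le_trans (qp' a) (sub_shift_leq _ _ sp).
have := le_trans (qp' (- a)) (sub_shift_le a (- a) sp ler01).
by rewrite scale1r addNr (sublinear0 sp) mul1r sub0r qN lerN2.
Qed.

End HahnBanach.

HB.instance Definition _ (R : realType) :=
  Uniform_isComplete.Build (Cx R) (@Cx_complete R).

(** The form may be degenerate; the completion below also divides out its null vectors. *)
Record prehilbert (R : realType) := PreHilbert {
  ph_sort :> lmodType (Cx R) ;
  ph_form : ph_sort -> ph_sort -> Cx R ;
  ph_lin : forall (a : Cx R) x y z,
    ph_form (a *: x + y) z = a * ph_form x z + ph_form y z ;
  ph_conj : forall x y, ph_form y x = Num.conj (ph_form x y) ;
  ph_ge0 : forall x, 0 <= ph_form x x
}.

(* The completion consists of the conjugate-linear functionals on V that are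
   limits, for the dual norm, of the functionals x |-> <x, .>. *)
Section Completion.
Context {R : realType} (V : prehilbert R).
Implicit Types (x y z : V).
Local Notation s := (@ph_form R V).

Definition phnorm x : R := Num.sqrt (snorm2 s x).

Lemma phnorm_ge0 x : 0 <= phnorm x. Proof. exact: sqrtr_ge0. Qed.

Lemma ph_formE x : s x x = (phnorm x ^+ 2)%:C%C.
Proof.
by rewrite sqr_sqrtr ?(snorm2_ge0 (@ph_ge0 R V))// -(snorm2E (@ph_ge0 R V)).
Qed.

Lemma ph_cauchy_schwarz x y : cabs (s x y) <= phnorm x * phnorm y.
Proof.
rewrite -(@ler_pXn2r _ 2%N)// ?nnegrE ?mulr_ge0 ?cabs_ge0 ?phnorm_ge0//.
rewrite exprMn !sqr_sqrtr ?(snorm2_ge0 (@ph_ge0 R V))//.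
exact: (semi_cauchy_schwarz (@ph_lin R V) (@ph_conj R V) (@ph_ge0 R V)).
Qed.

Lemma ph_linr (a : Cx R) x y z : s z (a *: x + y) = Num.conj a * s z x + s z y.
Proof. by rewrite ph_conj ph_lin cconjD cconjM -!ph_conj. Qed.

Lemma ph0l z : s 0 z = 0.
Proof. by have := @ph_lin _ V (-1) 0 0 z; rewrite scaleN1r oppr0 addr0 mulN1r addNr. Qed.

Lemma phZl (a : Cx R) x z : s (a *: x) z = a * s x z.
Proof. by have := @ph_lin _ V a x 0 z; rewrite !addr0 ph0l addr0. Qed.

Lemma phZr (a : Cx R) x z : s z (a *: x) = Num.conj a * s z x.
Proof. by rewrite (ph_conj (a *: x)) (ph_conj x z) phZl cconjM. Qed.

Lemma phnormZ (a : Cx R) x : phnorm (a *: x) = cabs a * phnorm x.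
Proof.
apply/eqP; rewrite -(@eqrXn2 _ 2%N)// ?mulr_ge0 ?cabs_ge0 ?phnorm_ge0//; apply/eqP.
apply: realC_inj; rewrite -ph_formE phZl phZr mulrA conj_mulC ph_formE exprMn.
by rewrite -realCM.
Qed.

Definition hc_pred : {pred V -> Cx R} := fun xi => `[< forall e : R, 0 < e ->
  exists x, forall y, cabs (xi y - s x y) <= e * phnorm y >].

Lemma hc_submod_closed : submod_closed hc_pred.
Proof.
split=> [|a f g /asboolP hf /asboolP hg]; apply/asboolP => e e0.
  by exists 0 => y; rewrite ph0l subrr cabs0 mulr_ge0 ?phnorm_ge0 ?ltW.
have a0 : 0 < cabs a + 1 by rewrite ltr_wpDl ?cabs_ge0.
have e2 : 0 < e / 2 by rewrite divr_gt0.
have [x xf] := hf _ (divr_gt0 e2 a0); have [z zg] := hg _ e2.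
exists (a *: x + z) => y; rewrite ph_lin.
have -> : (a *: f + g) y - (a * s x y + s z y) = a * (f y - s x y) + (g y - s z y).
  by rewrite mulrBr addrACA -opprD.
rewrite (le_trans (cabsD _ _))// [e]splitr mulrDl lerD// cabsM.
rewrite (@le_trans _ _ ((cabs a + 1) * cabs (f y - s x y)))//.
  by rewrite ler_wpM2r ?cabs_ge0// lerDl.
by rewrite -ler_pdivlMl// mulrA [_^-1 * _]mulrC.
Qed.

HB.instance Definition _ := GRing.isSubmodClosed.Build _ _ hc_pred hc_submod_closed.

Record hcomp := MkHC { hc_fun :> V -> Cx R ; hc_funP : hc_fun \in hc_pred }.

HB.instance Definition _ := [isSub for hc_fun].
HB.instance Definition _ := [Choice of hcomp by <:].
HB.instance Definition _ := [SubChoice_isSubLmodule of hcomp by <:].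

Implicit Types (f g : hcomp).

Lemma hcP f (e : R) : 0 < e -> exists x, forall y, cabs (f y - s x y) <= e * phnorm y.
Proof. by move=> e0; have /asboolP/(_ e e0) := hc_funP f. Qed.

Lemma hc_eq f g : f =1 g -> f = g.
Proof. by move=> fg; apply/val_inj/funext. Qed.

Lemma hcD f g y : (f + g) y = f y + g y. Proof. by []. Qed.
Lemma hcB f g y : (f - g) y = f y - g y. Proof. by []. Qed.
Lemma hcZ (a : Cx R) f y : (a *: f) y = a * f y. Proof. by []. Qed.

(** Membership in [hc_pred] demands only approximation by the functionals $\langle x,\cdot\rangle$;
    their conjugate homogeneity passes to the limit. *)
Lemma hc_conj f (a : Cx R) y : f (a *: y) = Num.conj a * f y.
Proof.
apply/eqP; rewrite -subr_eq0; apply/eqP/cabs_eq0/eqP; rewrite eq_le cabs_ge0 andbT.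
apply: (@eps_le _ _ _ (2 * (cabs a * phnorm y))) => e e0; rewrite add0r.
have [x xf] := hcP f e0; have h1 := xf (a *: y); have h2 := xf y.
have -> : f (a *: y) - Num.conj a * f y =
    (f (a *: y) - s x (a *: y)) - Num.conj a * (f y - s x y).
  by rewrite phZr mulrBr opprB addrA subrK.
rewrite (le_trans (cabsD _ _))// cabsN cabsM cabs_conj.
rewrite phnormZ in h1; have := ler_wpM2l (cabs_ge0 a) h2; lra.
Qed.

Lemma hc_bounded f : exists M : R, forall y, cabs (f y) <= M * phnorm y.
Proof.
have [x xf] := hcP f ltr01; exists (1 + phnorm x) => y.
have := xf y; have := cabsD (f y - s x y) (s x y); rewrite subrK.
by have := ph_cauchy_schwarz x y; lra.
Qed.

Definition hc_rnorm f : R := sup [set cabs (f y) | y in [set y | phnorm y <= 1]].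

Lemma hc_has_sup f : has_sup [set cabs (f y) | y in [set y | phnorm y <= 1]].
Proof.
split.
  exists (cabs (f 0)), 0 => //=.
  by rewrite -(scale0r (0 : V)) phnormZ cabs0 mul0r.
have [M fM] := hc_bounded f; exists `|M| => _ [y /= y1 <-].
rewrite (le_trans (fM y))// (@le_trans _ _ (`|M| * phnorm y))//.
  by rewrite ler_wpM2r ?phnorm_ge0// ler_norm.
by rewrite ler_piMr.
Qed.

Lemma hc_rnorm_ge0 f : 0 <= hc_rnorm f.
Proof.
apply: le_trans (cabs_ge0 (f 0)) _; apply: ub_le_sup; first by case: (hc_has_sup f).
by exists 0 => //=; rewrite -(scale0r (0 : V)) phnormZ cabs0 mul0r.
Qed.

Lemma hc_rnormP f y : cabs (f y) <= hc_rnorm f * phnorm y.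
Proof.
have [y0|y0] := eqVneq (phnorm y) 0.
  by have [M /(_ y)] := hc_bounded f; rewrite y0 !mulr0.
have y1 : 0 < phnorm y by rewrite lt_neqAle eq_sym y0 phnorm_ge0.
rewrite -ler_pdivrMr//; apply: ub_le_sup; first by case: (hc_has_sup f).
exists (((phnorm y)^-1%:C%C : Cx R) *: y).
  by rewrite /= phnormZ cabsC ger0_norm ?invr_ge0 ?phnorm_ge0// mulVf.
by rewrite hc_conj conj_realC cabsM cabsC ger0_norm ?invr_ge0 ?phnorm_ge0// mulrC.
Qed.

Lemma hc_rnorm_le f (c : R) : 0 <= c ->
  (forall y, cabs (f y) <= c * phnorm y) -> hc_rnorm f <= c.
Proof.
move=> c0 fc; apply: ge_sup; first by case: (hc_has_sup f).
by move=> _ [y /= y1 <-]; rewrite (le_trans (fc y))// ler_piMr.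
Qed.

Definition hc_norm f : Cx R := (hc_rnorm f)%:C%C.

Fact hc_normD f g : hc_norm (f + g) <= hc_norm f + hc_norm g.
Proof.
rewrite /hc_norm -realCD leCxR; apply: hc_rnorm_le => [|y].
  by rewrite addr_ge0 ?hc_rnorm_ge0.
by rewrite mulrDl hcD (le_trans (cabsD _ _))// lerD// hc_rnormP.
Qed.

Fact hc_normZ (a : Cx R) f : hc_norm (a *: f) = `|a| * hc_norm f.
Proof.
rewrite /hc_norm (cabsE a) -realCM; congr (_ %:C)%C; apply/eqP; rewrite eq_le.
have le (b : Cx R) g : hc_rnorm (b *: g) <= cabs b * hc_rnorm g.
  apply: hc_rnorm_le; first by rewrite mulr_ge0 ?hc_rnorm_ge0 ?cabs_ge0.
  by move=> y; rewrite hcZ cabsM -mulrA ler_wpM2l ?cabs_ge0 ?hc_rnormP.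
rewrite le/=; have [->|a0] := eqVneq a 0.
  by rewrite cabs0 mul0r hc_rnorm_ge0.
have ca : 0 < cabs a.
  by rewrite lt_neqAle cabs_ge0 andbT eq_sym; apply: contra_neq a0; exact: cabs_eq0.
have := le a^-1 (a *: f); rewrite scalerA mulVf// scale1r.
suff -> : cabs a^-1 = (cabs a)^-1 by rewrite ler_pdivlMl.
have ca1 : cabs a != 0 by rewrite gt_eqF.
by apply: (mulfI ca1); rewrite -cabsM divff// divff// cabs1.
Qed.

Fact hc_norm0_eq0 f : hc_norm f = 0 -> f = 0.
Proof.
move=> f0; apply: hc_eq => y; apply/cabs_eq0/eqP; rewrite eq_le cabs_ge0 andbT.
by rewrite (le_trans (hc_rnormP f y))// (realC_inj f0) mul0r.
Qed.

HB.instance Definition _ :=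
  Lmodule_isNormed.Build (Cx R) hcomp hc_normD hc_normZ hc_norm0_eq0.

Lemma rnorm_hcE f : rnorm f = hc_rnorm f.
Proof. by apply: realC_inj; rewrite -rnormE. Qed.

Lemma hc_complete (F : set_system hcomp) : ProperFilter F -> cauchy F -> cvg F.
Proof.
move=> FF /cauchy_ballP Fc.
have cau (e : R) : 0 < e -> exists f, F [set g | rnorm (g - f) <= e].
  move=> e0; have e1 : 0 < (e%:C%C : Cx R) by rewrite (ltCxR 0).
  have [[A B] /= [FA FB] AB] := Fc _ e1.
  have [f Bf] := filter_ex FB; exists f; apply: filterS FA => g Ag /=.
  have := AB (g, f) (conj Ag Bf); rewrite -ball_normE /= rnormE ltCxR.
  exact: ltW.
have cl (e d : R) f g : F [set h | rnorm (h - f) <= e] ->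
    F [set h | rnorm (h - g) <= d] -> rnorm (f - g) <= e + d.
  move=> Ff Fg; have [h [/= hf hg]] := filter_ex (filterI Ff Fg).
  by rewrite (le_trans (rnorm_tri h _ _))// lerD// rnormB.
have /choice[h hP] : forall y, exists c : Cx R, forall (e : R) f, 0 < e ->
    F [set g | rnorm (g - f) <= e] -> cabs (f y - c) <= phnorm y * e.
  move=> y; pose P (e : R) v := exists2 f, F [set g | rnorm (g - f) <= e] & v = f y.
  have [e e0|e d v w e0 d0 [f Ff ->] [g Fg ->]|l lP] :=
      @approx_limit R (Cx R : completeNormedModType (Cx R)) P (phnorm y).
  - by have [f Ff] := cau e e0; exists (f y), f.
  - rewrite rnormC -hcB (le_trans (hc_rnormP _ _))// mulrC ler_wpM2l ?phnorm_ge0//.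
    by rewrite -rnorm_hcE; exact: cl.
  - by exists l => e f e0 Ff; rewrite -rnormC; apply: lP => //; exists f.
have hh : h \in hc_pred.
  apply/asboolP => e e0; have e2 : 0 < e / 2 by rewrite divr_gt0.
  have [f Ff] := cau _ e2; have [x xf] := hcP f e2; exists x => y.
  have h1 := xf y; have h2 := hP y _ _ e2 Ff.
  have -> : h y - s x y = (f y - s x y) - (f y - h y) by rewrite opprB [RHS]addrC addrA subrK.
  by rewrite (le_trans (cabsD _ _))// cabsN; lra.
apply/cvg_ex; exists (MkHC hh); apply/cvgrPdist_le; apply: cx_gt0P => e e0.
have e2 : 0 < e / 2 by rewrite divr_gt0.
have [f Ff] := cau _ e2; apply: (filterS _ Ff) => g /= fg.
rewrite rnormE leCxR (le_trans (rnorm_tri f _ _))// [leRHS]splitr lerD//; last first.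
  by rewrite rnormB.
rewrite rnorm_hcE; apply: hc_rnorm_le; first exact: ltW.
by move=> y; rewrite hcB /= -cabsN opprB mulrC; exact: hP.
Qed.

End Completion.

Section CompletionHilbert.
Context {R : realType} (V : prehilbert R).
Local Notation s := (@ph_form R V).

HB.instance Definition _ := Uniform_isComplete.Build (hcomp V) (@hc_complete R V).

Implicit Types (x y z : V) (f g : hcomp V).

Fact iota_subproof x : s x \in hc_pred (V := V).
Proof.
apply/asboolP => e e0; exists x => y.
by rewrite subrr cabs0 mulr_ge0 ?phnorm_ge0 ?ltW.
Qed.
Definition iota x : hcomp V := MkHC (iota_subproof x).

Lemma iotaE x y : iota x y = s x y. Proof. by []. Qed.

Lemma iota_linear : linear iota.
Proof. by move=> a x y; apply: hc_eq => z; rewrite hcD hcZ !iotaE ph_lin. Qed.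

Lemma rnorm_iota x : rnorm (iota x) = phnorm x.
Proof.
rewrite rnorm_hcE; apply/eqP; rewrite eq_le; apply/andP; split.
  by apply: hc_rnorm_le => [|y]; [exact: phnorm_ge0|exact: ph_cauchy_schwarz].
have [->|x0] := eqVneq (phnorm x) 0; first exact: hc_rnorm_ge0.
have x1 : 0 < phnorm x by rewrite lt_neqAle eq_sym x0 phnorm_ge0.
have := hc_rnormP (iota x) x; rewrite iotaE ph_formE cabsC.
by rewrite ger0_norm ?exprn_ge0 ?phnorm_ge0// expr2 ler_pM2r.
Qed.

Lemma iota_dense f (e : R) : 0 < e -> exists x, rnorm (f - iota x) <= e.
Proof.
move=> e0; have [x xf] := hcP f e0; exists x; rewrite rnorm_hcE.
by apply: hc_rnorm_le; [exact: ltW|move=> y; rewrite hcB iotaE].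
Qed.

Lemma iota_total : total (range iota).
Proof.
apply/totalP => f e e0; have e2 : 0 < e / 2 by rewrite divr_gt0.
have [x fx] := iota_dense f e2; exists (iota x); first by apply: lspan_in; exists x.
by rewrite (le_lt_trans fx)// ltr_pdivrMr// ltr_pMr// ltr1n.
Qed.

(** Since $f(y)$ is to be the inner product of [f] with [y], the functional $g\mapsto\langle
    g,f\rangle$ is prescribed as $\overline{f(y)}$ on the image of [V] and then extended. *)
Lemma hc_functional f : exists G : hcomp V -> Cx R, [/\ linear G,
  forall g, rnorm (G g) <= rnorm f * rnorm g & forall y, G (iota y) = Num.conj (f y)].
Proof.
have [||G [lG GM GE]] := @extend_by_density _ (hcomp V) (Cx R)
    [set (iota y, Num.conj (f y)) | y in [set: V]] (rnorm f) (rnorm_ge0 f).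
- move=> p Sp; suff [y [p1 p2]] : exists y, p.1 = iota y /\ p.2 = Num.conj (f y).
    by rewrite p1 p2 rnormC cabs_conj rnorm_iota rnorm_hcE hc_rnormP.
  move: p Sp; apply: lspan_ind => [|a _ p [y _ <-] [z [p1 p2]]].
    exists 0; rewrite (linear0f iota_linear); split => //=.
    by rewrite -(scale0r (0 : V)) hc_conj !rmorph0 mul0r rmorph0.
  exists (a *: y + z); rewrite iota_linear /= p1 p2; split => //.
  have fD u v : f (u + v) = f u + f v.
    apply/eqP; rewrite -subr_eq0; apply/eqP/cabs_eq0/eqP; rewrite eq_le cabs_ge0 andbT.
    apply: (@eps_le _ _ _ (phnorm (u + v) + (phnorm u + phnorm v))) => e e0.
    have [x xf] := hcP f e0; have h1 := xf (u + v); have h2 := xf u; have h3 := xf v.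
    have -> : f (u + v) - (f u + f v) =
        (f (u + v) - s x (u + v)) - ((f u - s x u) + (f v - s x v)).
      have := ph_linr 1 u v x; rewrite scale1r conjC1 mul1r => ->.
      by rewrite [f u - _ + _]addrACA -opprD opprB addrA subrK.
    rewrite add0r (le_trans (cabsD _ _))// cabsN.
    have := cabsD (f u - s x u) (f v - s x v); lra.
  by rewrite fD hc_conj cconjD cconjM conjCK.
- by apply: totalS iota_total => _ [y _ <-]; exists (iota y, Num.conj (f y)) => //; exists y.
by exists G; split => // y; apply: GE; exists y.
Qed.

Definition hc_ip g f : Cx R := projT1 (cid (hc_functional f)) g.

Lemma hc_ip_linear f : linear (hc_ip^~ f).
Proof. by case: (projT2 (cid (hc_functional f))). Qed.

Lemma hc_ip_bound g f : cabs (hc_ip g f) <= rnorm g * rnorm f.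
Proof. by rewrite mulrC; case: (projT2 (cid (hc_functional f))) => _ + _; exact. Qed.

Lemma hc_ip_iota y f : hc_ip (iota y) f = Num.conj (f y).
Proof. by case: (projT2 (cid (hc_functional f))) => _ _; exact. Qed.

Lemma hc_ip_iotar f y : hc_ip f (iota y) = f y.
Proof.
move: f; apply: (@total_eq _ _ (Cx R) _ _ _ (phnorm y) (phnorm y) _ _ _ _ iota_total).
- exact: hc_ip_linear.
- by [].
- by move=> f; rewrite -rnorm_iota mulrC; exact: hc_ip_bound.
- by move=> f; rewrite rnormC rnorm_hcE mulrC; exact: hc_rnormP.
- by move=> _ [x _ <-]; rewrite hc_ip_iota !iotaE -ph_conj.
Qed.

Lemma hc_ip_conj f g : hc_ip g f = Num.conj (hc_ip f g).
Proof.
move: g; apply: (@total_eq _ _ (Cx R) _ _ _ (rnorm f) (rnorm f) _ _ _ _ iota_total).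
- exact: hc_ip_linear.
- move=> a g h; suff -> : hc_ip f (a *: g + h) = Num.conj a * hc_ip f g + hc_ip f h.
    by rewrite cconjD cconjM conjCK.
  move: f; apply: (@total_eq _ _ (Cx R) _ _ _ (rnorm (a *: g + h))
     (cabs a * rnorm g + rnorm h) _ _ _ _ iota_total).
  + exact: hc_ip_linear.
  + by move=> b u v; rewrite !hc_ip_linear /GRing.scale /=; ring.
  + by move=> u; rewrite mulrC; exact: hc_ip_bound.
  + move=> u; rewrite rnormC (le_trans (cabsD _ _))// cabsM cabs_conj mulrDl -mulrA.
    by rewrite lerD// ?ler_wpM2l ?cabs_ge0// mulrC hc_ip_bound.
  + by move=> _ [y _ <-]; rewrite !hc_ip_iota hcD hcZ cconjD cconjM.
- by move=> g; rewrite mulrC; exact: hc_ip_bound.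
- by move=> g; rewrite rnormC cabs_conj; exact: hc_ip_bound.
- by move=> _ [y _ <-]; rewrite hc_ip_iota hc_ip_iotar.
Qed.

Lemma hc_ip_norm f : hc_ip f f = `|f| ^+ 2.
Proof.
rewrite rnormE -realCX; apply/eqP; rewrite -subr_eq0; apply/eqP/cabs_eq0/eqP.
rewrite eq_le cabs_ge0 andbT.
apply: (@eps_le _ _ _ (1 + 4 * (rnorm f + 1))) => e e0; rewrite add0r.
(* Keeping the approximation within 1 makes the quadratic error linear in [e]. *)
pose d := Num.min e 1; have d0 : 0 < d by rewrite lt_min e0 ltr01.
have [de d1] : d <= e /\ d <= 1 by rewrite !ge_min !lexx orbT.
have [x fx] := iota_dense f d0.
have xf : rnorm (iota x) <= rnorm f + d.
  by have := rnorm_leD (iota x) f; rewrite rnormB; lra.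
have fx' : rnorm f <= rnorm (iota x) + d by have := rnorm_leD f (iota x); lra.
have E : hc_ip f f - (rnorm f ^+ 2)%:C%C = hc_ip (f - iota x) f +
    Num.conj (hc_ip (f - iota x) (iota x)) + ((rnorm (iota x) ^+ 2)%:C%C - (rnorm f ^+ 2)%:C%C).
  rewrite !(linearBf _ _ (hc_ip_linear _)) (hc_ip_iota x f) hc_ip_iotar.
  rewrite hc_ip_iotar iotaE ph_formE rnorm_iota cconjD cconjN conj_realC; ring.
rewrite E (le_trans (cabsD _ _))// -realCB cabsC.
have h1 := cabsD (hc_ip (f - iota x) f) (Num.conj (hc_ip (f - iota x) (iota x))).
rewrite cabs_conj in h1.
have h2 := hc_ip_bound (f - iota x) f; have h3 := hc_ip_bound (f - iota x) (iota x).
have f0 := rnorm_ge0 f; have x0 := rnorm_ge0 (iota x); have fx0 := rnorm_ge0 (f - iota x).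
have h4 : rnorm (f - iota x) * rnorm f <= d * rnorm f by rewrite ler_wpM2r.
have h5 : rnorm (f - iota x) * rnorm (iota x) <= d * (rnorm f + 1).
  by rewrite ler_pM//; lra.
have h6 : `|rnorm (iota x) ^+ 2 - rnorm f ^+ 2| <= d * (2 * rnorm f + 1).
  by rewrite ler_norml; apply/andP; split; nra.
have h7 : d * (4 * rnorm f + 2) <= e * (4 * rnorm f + 2) by rewrite ler_wpM2r//; lra.
nra.
Qed.

Fact hc_ip_lin (a : Cx R) f g h : hc_ip (a *: f + g) h = a * hc_ip f h + hc_ip g h.
Proof. exact: hc_ip_linear. Qed.

Definition completion : hilbert R := @Hilbert R (hcomp V) hc_ip hc_ip_lin
  (fun f g => hc_ip_conj f g) hc_ip_norm.

Lemma ip_iota x y : ip (iota x : completion) (iota y : completion) = s x y.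
Proof. by rewrite /= hc_ip_iotar. Qed.

End CompletionHilbert.

Section States.
Context {R : realType} {X : completeNormedModType (Cx R)}
  {Y : normedModType (Cx R)} {f : innerform X Y}.
Implicit Types x y a : adj f.

Local Notation "t %:1" := ((t%:C%C : Cx R) *: (1 : adj f)) (at level 2).

(** A nonzero operator excludes the zero space, on which [1] would be [0]. *)
Lemma arnorm1E a : a != 0 -> rnorm (1 : adj f) = 1.
Proof.
move=> a0; have n0 : rnorm (1 : adj f) != 0.
  apply: contra_neq a0 => /rnorm_eq0 e; rewrite -[a]mul1r e.
  by apply: adj_eq.
by apply: (mulfI n0); rewrite mulr1 -expr2 -(arnorm_sq (@aswap1 _ _ _ f)) mulr1.
Qed.

(** For $t=\|1+a\|$ the element $t-(1+a)$ is positive, so $a\le t-1$. A functional of norm one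
    attaining its norm at $1+a$ is thereby forced to attain it at both [1] and [a]. *)
Lemma pos_rnorm1D a : a != 0 -> pos a -> 1 + rnorm a <= rnorm (1 + a).
Proof.
move=> a0 pa; have p1 : pos (1 : adj f) by exists 1; [exact: aswap1|rewrite mulr1].
have p1a := posD p1 pa.
have t1 : 1 <= rnorm (1 + a).
  by rewrite -(arnorm1E a0); apply: pos_mono => //; rewrite addrC addKr.
have [_ h] := pos_sub p1a (lt_le_trans ltr01 t1) (lexx _).
set t := rnorm (1 + a) in t1 h *; rewrite addrC -lerBrDr.
apply: pos_le_real => //; first by rewrite subr_ge0.
by rewrite realCB scalerBl scale1r -addrA -opprD.
Qed.

Lemma scaleN1C (V : lmodType (Cx R)) (v : V) : ((-1)%:C%C : Cx R) *: v = - v.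
Proof. by rewrite (_ : (-1)%:C%C = -1 :> Cx R) ?scaleN1r//; exact: rmorphN1. Qed.

Lemma CxReIm (c : Cx R) : c = (complex.Re (c : R[i]%C))%:C%C + (complex.Im (c : R[i]%C))%:C%C * 'i%C.
Proof. by apply/Cx_eqP => /=; split; ring. Qed.

(* Any real functional of norm one attaining its norm at 1 + a is such a state. *)
Lemma state_exists a : a != 0 -> pos a -> exists phi : adj f -> Cx R,
  [/\ linear phi, forall x, phi (aswap x) = Num.conj (phi x),
     forall x, pos x -> 0 <= phi x <= (rnorm x)%:C%C & phi a = (rnorm a)%:C%C].
Proof.
move=> a0 pa.
have [|g [gD gZ gn ga]] := @hahn_banach R (adj f) (@rnorm R (adj f)) (1 + a).
  split=> [x y|t x t0]; first exact: rnormD.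
  by rewrite rnormZ cabsC ger0_norm.
have [g1 gaE] : g 1 = 1 /\ g a = rnorm a.
  have := pos_rnorm1D a0 pa; rewrite -ga gD.
  have := gn a; have := gn 1; rewrite (arnorm1E a0) => h1 h2 h3.
  by split; apply/eqP; rewrite eq_le; apply/andP; split => //; lra.
have gN x : g (- x) = - g x by rewrite -scaleN1C gZ mulN1r.
(* Averaging over the adjoint makes the real functional Hermitian; $h(x)-ih(ix)$ is then its
   complex-linear extension. *)
pose h x := g (x + aswap x) / 2; pose i : Cx R := 'i%C.
have ii : i * i = -1 by exact: sqr_i.
have ci : Num.conj i = - i by apply/Cx_eqP; rewrite /= oppr0.
have hD x y : h (x + y) = h x + h y by rewrite /h aswapD addrACA gD mulrDl.
have hZ (t : R) x : h ((t%:C%C : Cx R) *: x) = t * h x.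
  by rewrite /h aswapZ conj_realC -scalerDr gZ mulrA.
have hN x : h (- x) = - h x by rewrite -scaleN1C hZ mulN1r.
have hs x : h (aswap x) = h x by rewrite /h aswapK addrC.
have hsa x : aswap x = x -> h x = g x.
  by move=> xs; rewrite /h xs gD -mulr2n -[_ *+ 2]mulr_natr mulfK.
pose phi x : Cx R := (h x)%:C%C - i * (h (i *: x))%:C%C.
have phiD x y : phi (x + y) = phi x + phi y.
  by rewrite /phi scalerDr !hD !realCD; ring.
have phiZ (t : R) x : phi ((t%:C%C : Cx R) *: x) = t%:C%C * phi x.
  have E : i *: ((t%:C%C : Cx R) *: x) = (t%:C%C : Cx R) *: (i *: x).
    by rewrite !scalerA mulrC.
  by rewrite /phi E !hZ !realCM; ring.
have phiI x : phi (i *: x) = i * phi x.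
  rewrite /phi scalerA ii scaleN1r hN realCN mulrBr mulrA ii mulrN opprK mulN1r opprK.
  by rewrite addrC.
have gphi x : aswap x = x -> phi x = (g x)%:C%C.
  move=> xs; rewrite /phi hsa// /h aswapZ xs ci scaleNr subrr.
  by rewrite -(scale0r (0 : adj f)) (gZ 0) !mul0r mulr0 subr0.
(* From $\|t-x\|\le t$ with $t=\|x\|$ and $g(1)=1$ follows $t-g(x)\le t$. *)
have gpos x : pos x -> 0 <= g x.
  move=> px; have [x0|x0] := eqVneq (rnorm x) 0.
    by rewrite (rnorm_eq0 x0) -(scale0r (0 : adj f)) (gZ 0) mul0r.
  have x1 : 0 < rnorm x by rewrite lt_neqAle eq_sym x0 rnorm_ge0.
  have [h1 _] := pos_sub px x1 (lexx _).
  by have := le_trans (gn _) h1; rewrite gD gN gZ g1; lra.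
exists phi; split.
- move=> c x y; rewrite phiD [c in LHS]CxReIm scalerDl phiD phiZ -scalerA phiZ phiI.
  have -> : c *: phi x = c * phi x by [].
  by rewrite [in RHS](CxReIm c) mulrDl mulrA.
- move=> x; rewrite /phi hs cconjD cconjN cconjM !conj_realC ci mulNr opprK.
  have -> : h (i *: aswap x) = - h (i *: x).
    by rewrite -[in RHS]hs aswapZ ci scaleNr hN opprK.
  by rewrite realCN mulrN opprK.
- move=> x px; rewrite gphi ?pos_star// leCxR gn andbT (leCxR 0); exact: gpos.
- by rewrite gphi ?pos_star// gaE.
Qed.

End States.

Section GNS.
Context {R : realType} {D : cstarAlg R}.
Implicit Types d x y : D.

Let L d := toA (membed d).
Let L_lin : linear L. Proof. by move=> c x y; rewrite /L membed_linear toA_linear. Qed.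
Let LM x y : L (x ** y) = L x * L y. Proof. by rewrite /L membedM toAM. Qed.
Let L_star x : L (cs_star x) = aswap (L x). Proof. by rewrite /L membed_star toA_star. Qed.
Let L_norm x : rnorm (L x) = rnorm x. Proof. exact: mnorm_membed. Qed.

Section Construction.
Context (phi : adj (mform D) -> Cx R) (phi_lin : linear phi)
  (phi_star : forall u, phi (aswap u) = Num.conj (phi u))
  (phi_pos : forall u, pos u -> 0 <= phi u <= (rnorm u)%:C%C).

Let s x y : Cx R := phi (L (cs_star y ** x)).

Fact gns_lin (c : Cx R) x y z : s (c *: x + y) z = c * s x z + s y z.
Proof. by rewrite /s cs_mulDr L_lin phi_lin. Qed.
Fact gns_conj x y : s y x = Num.conj (s x y).
Proof. by rewrite /s -phi_star -L_star cs_starM cs_starK. Qed.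
Fact gns_ge0 x : 0 <= s x x.
Proof. by rewrite /s LM L_star; case/andP: (phi_pos (pos_star_mul (L x))). Qed.

Definition gns_pre : prehilbert R := PreHilbert gns_lin gns_conj gns_ge0.

Lemma gns_phnorm (t : R) x y : 0 <= t ->
  pos (((t ^+ 2)%:C%C : Cx R) *: (aswap (L y) * L y) - aswap (L x) * L x) ->
  phnorm (x : gns_pre) <= t * phnorm (y : gns_pre).
Proof.
move=> t0 /phi_pos/andP[h _].
rewrite -(@ler_pXn2r _ 2%N)// ?nnegrE ?mulr_ge0 ?phnorm_ge0// exprMn.
rewrite -leCxR (realCM (t ^+ 2)) -!ph_formE -subr_ge0.
suff <- : phi (((t ^+ 2)%:C%C : Cx R) *: (aswap (L y) * L y) - aswap (L x) * L x) =
   (t ^+ 2)%:C%C * ph_form (y : gns_pre) (y : gns_pre) - ph_form (x : gns_pre) (x : gns_pre) by [].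
by rewrite (linearBf _ _ phi_lin) (linearZf _ _ phi_lin) -!L_star -!LM.
Qed.

Lemma gns_phnorm_le x : phnorm (x : gns_pre) <= rnorm x.
Proof.
rewrite -(@ler_pXn2r _ 2%N)// ?nnegrE ?phnorm_ge0 ?rnorm_ge0//.
rewrite -leCxR -ph_formE /= /s LM L_star -(L_norm x) -arnorm_star.
by case/andP: (phi_pos (pos_star_mul (L x))).
Qed.

Let H := completion gns_pre.

Lemma gns_action a : exists g : H -> H, [/\ linear g,
  forall xi, rnorm (g xi) <= rnorm a * rnorm xi &
  forall x, g (iota (x : gns_pre)) = iota (a ** x : gns_pre)].
Proof.
have [||g [lg gM gE]] := @extend_by_density _ H H
    [set (iota (x : gns_pre), iota (a ** x : gns_pre)) | x in [set: D]] (rnorm a) (rnorm_ge0 a).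
- move=> p Sp; suff [y [p1 p2]] : exists y : D, p.1 = iota (y : gns_pre) /\ p.2 = iota (a ** y : gns_pre).
    rewrite p1 p2 !rnorm_iota; apply: gns_phnorm; first exact: rnorm_ge0.
    have := pos_conj (L y) (pos_sqnorm_sub (lexx (rnorm (L a)))).
    rewrite L_norm mulrBr mulrBl ascaleAr ascaleAl mulr1 LM aswapM !mulrA //.
  move: p Sp; apply: lspan_ind => [|c _ p [y _ <-] [z [p1 p2]]].
    by exists 0; rewrite cs_mulx0; split; rewrite (linear0f (@iota_linear _ gns_pre)).
  exists (c *: y + z); rewrite cs_mulDr; split.
    by rewrite /= p1; apply/esym; exact: iota_linear.
  by rewrite /= p2; apply/esym; exact: iota_linear.
- apply: totalS (iota_total gns_pre) => _ [y _ <-].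
  by exists (iota y, iota (a ** y : gns_pre)) => //; exists y.
by exists g; split => // x; apply: gE; exists x.
Qed.

Lemma gns_rep : exists rho : D -> H -> H, is_rep rho /\
  forall a x, rho a (iota (x : gns_pre)) = iota (a ** x : gns_pre).
Proof.
have /choice[rho rhoP] := gns_action.
have rl a : linear (rho a) by case: (rhoP a).
have rN a xi : rnorm (rho a xi) <= rnorm a * rnorm xi by case: (rhoP a).
have rE a x : rho a (iota (x : gns_pre)) = iota (a ** x : gns_pre) by case: (rhoP a).
exists rho; split => //.
apply: (@is_rep_dense R D H gns_pre (fun x : gns_pre => iota x : H) rho
  (fun a : D => rnorm a) (iota_total gns_pre) rl rN).
- by move=> c a b x; rewrite !rE cs_mulDl; exact: iota_linear.
- by move=> a b x; rewrite !rE cs_mulA.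
- move=> a x y; rewrite !rE !ip_iota /= /s cs_mulA cs_starM cs_starK //.
apply: (total_trans (iota_total gns_pre)) => _ [x _ <-] e e0.
have /totalP /(_ x _ e0) [y Sy xy] := @total_mul R D.
exists (iota (y : gns_pre)).
  have := @lspan_map R D (hcomp gns_pre) (fun x : D => iota (x : gns_pre)); apply; last exact: Sy.
    exact: (@iota_linear R gns_pre).
  by move=> _ [a [d ->]]; apply: lspan_in; exists a, (iota (d : gns_pre)); rewrite rE.
rewrite -(linearBf _ _ (@iota_linear _ gns_pre)) rnorm_iota.
exact: le_lt_trans (gns_phnorm_le _) xy.
Qed.

End Construction.

(** The state is chosen to norm $d^*d$, so the class of [d] in its GNS space has norm $\|d\|$. In
    place of the cyclic vector that a unit would supply, the class of a local unit [u] is used, with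
    $du$ close to [d]. *)
Lemma gelfand_naimark d (c : R) : 0 <= c ->
  (forall (H : hilbert R) (rho : D -> H -> H), is_rep rho ->
     forall v, rnorm (rho d v) <= c * rnorm v) -> rnorm d <= c.
Proof.
move=> c0 hc; have [->|d0] := eqVneq d 0; first by rewrite rnorm0.
pose a := aswap (L d) * L d.
have a0 : a != 0.
  apply/eqP => a0; move/eqP: d0; apply; apply: rnorm_eq0; apply/eqP.
  by rewrite -sqrf_eq0 -L_norm -arnorm_star -/a a0 rnorm0.
have [phi [lphi sphi pphi phia]] := state_exists a0 (pos_star_mul (L d)).
have [rho [rrho rhoE]] := gns_rep lphi sphi pphi.
set V := gns_pre lphi sphi pphi in rho rrho rhoE.
have nd : phnorm (d : V) = rnorm d.
  apply/eqP; rewrite -(@eqrXn2 _ 2%N)// ?phnorm_ge0 ?rnorm_ge0//; apply/eqP.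
  by apply: realC_inj; rewrite -ph_formE /= LM L_star -/a phia arnorm_star L_norm.
apply: (@eps_le _ _ _ 1) => e e0; have [u [u1 du]] := local_unit d e0.
have h1 := hc _ _ rrho (iota (u : V)).
rewrite rhoE !rnorm_iota in h1.
have h2 := gns_phnorm_le lphi sphi pphi u.
have h3 := gns_phnorm_le lphi sphi pphi (d - d ** u).
have h4 := rnorm_leD (iota (d : V)) (iota (d ** u : V)).
rewrite -(linearBf _ _ (@iota_linear _ V)) !rnorm_iota nd in h4.
have h5 : c * phnorm (u : V) <= c by rewrite ler_piMr// (le_trans h2).
by move: h1 h2 h3 h4 h5 du; rewrite -/V; lra.
Qed.

End GNS.

(** * Continuous functions and the tensor product of C_0(G) with a C*-algebra *)

Section NormContinuity.
Context {R : realType} {G : topologicalType}.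

Lemma ncontP (X : normedModType (Cx R)) (F : G -> X) : continuous F <->
  forall s (e : R), 0 < e -> nbhs s [set t | rnorm (F t - F s) < e].
Proof.
split=> [cF s e e0|h s].
  have e1 : 0 < (e%:C%C : Cx R) by rewrite (ltCxR 0).
  have /cvgrPdist_lt /(_ _ e1) := cF s; apply: filterS => t.
  by rewrite rnormE ltCxR rnormB.
apply/cvgrPdist_lt; apply: cx_gt0P => e e0; apply: filterS (h s e e0) => t /=.
by rewrite rnormE ltCxR rnormB.
Qed.

Lemma rcontP (F : G -> R) : continuous F <->
  forall s (e : R), 0 < e -> nbhs s [set t | `|F t - F s| < e].
Proof.
split=> [cF s e e0|h s].
  have /cvgrPdist_lt /(_ _ e0) := cF s; apply: filterS => t.
  by rewrite distrC.
by apply/cvgrPdist_lt => e e0; apply: filterS (h s e e0) => t /=; rewrite distrC.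
Qed.

Lemma realC_continuous (F : G -> R) :
  continuous F <-> continuous (fun s => (F s)%:C%C : Cx R).
Proof.
split=> [/rcontP h|/(ncontP (X := Cx R)) h].
  apply/(ncontP (X := Cx R)) => s e e0; apply: filterS (h s e e0) => t /=.
  by rewrite rnormC -realCB cabsC.
apply/rcontP => s e e0; apply: filterS (h s e e0) => t /=.
by rewrite rnormC -realCB cabsC.
Qed.

Lemma uniform_limit_continuous (X : normedModType (Cx R)) (F : G -> X) :
  (forall e : R, 0 < e -> exists2 F' : G -> X, continuous F' &
     forall s, rnorm (F s - F' s) <= e) -> continuous F.
Proof.
move=> h; apply/ncontP => s e e0; have e4 : 0 < e / 4 by rewrite divr_gt0.
have [F' /ncontP cF' FF'] := h _ e4; apply: filterS (cF' s _ e4) => t /= tt.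
have h1 := rnorm_tri (F' t) (F t) (F s); have h2 := rnorm_tri (F' s) (F' t) (F s).
have h3 := FF' t; have h4 := FF' s; rewrite rnormB in h4; lra.
Qed.

End NormContinuity.

(** * Cutoff functions and partitions of unity *)

Section Bumps.
Context {R : realType} {G : lcGroupType}.
Implicit Types (s t : G) (K : set G) (f : G -> R).

Definition RCc f : Prop :=
  continuous f /\ exists K, compact K /\ forall s, ~ K s -> f s = 0.

Lemma compact_nbhs_cover K (V : G -> set G) : compact K ->
  (forall s, K s -> nbhs s (V s)) ->
  exists l : seq G, (forall s, s \in l -> K s) /\
    forall t, K t -> exists2 s, s \in l & V s t.
Proof.
move=> cK KV.
(* Finite families in [K] directed by inclusion: a property holds eventually if it holds for all
   lists containing a given one. The near-covering form of compactness is applied along this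
   filter. *)
pose F : set_system (seq G) := fun S : set (seq G) => (exists2 l0 : seq G, (forall s, s \in l0 -> K s) &
  forall l : seq G, (forall s, s \in l -> K s) -> {subset l0 <= l} -> S l).
have FF : Filter F.
  split.
  - by exists [::].
  - move=> S S' [l lK lS] [l' lK' lS']; exists (l ++ l').
      by move=> s; rewrite mem_cat => /orP[/lK|/lK'].
    move=> l2 h2 sub; split; [apply: lS => //|apply: lS' => //].
      by move=> s sl; apply: sub; rewrite mem_cat sl.
    by move=> s sl; apply: sub; rewrite mem_cat sl orbT.
  - by move=> S S' SS' [l lK lS]; exists l => // l2 h2 sub; apply/SS'/lS.
have /compact_near_coveringP h := cK.
have [x Kx|l lK lP] := h _ F (fun (l : seq G) x => exists2 s, s \in l & V s x) FF.
- exists (V x, [set l : seq G | x \in l]) => /=.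
    split; first exact: KV.
    exists [:: x] => [s|l _]; first by rewrite inE => /eqP ->.
    by apply; rewrite inE.
  by move=> [y l] /= [Vy xl]; exists x.
by exists l; split => // t Kt; exact: (lP l lK (fun _ h => h) t Kt).
Qed.

(** The function is 1 minus a function separating [s] from the complement of the interior of $N\cap
    W$; the compact neighbourhood [W] carries the support. *)
Lemma bump s (N : set G) : nbhs s N -> exists b : G -> R,
  [/\ RCc b, forall t, 0 <= b t <= 1, b s = 1 & forall t, b t != 0 -> N t].
Proof.
move=> sN; have [W sW [cW _]] := @lcg_locally_compact G s Logic.I.
rewrite withinET in sW.
pose O := interior (N `&` W).
have oO : open O := @open_interior _ _.
have Os : O s by exact: filterI.
have crs := @locally_compact_completely_regular G R (@lcg_locally_compact G) (@lcg_hausdorff G).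
have nOs : ~ (~` O) s by move=> /(_ Os).
have /(@uniform_separatorP _ R)[g [cg g01 gs gO]] := crs s _ (open_closedC oO) nOs.
have gO1 t : ~ O t -> g t = 1 by move=> Ot; apply: (gO (g t)); exists t.
exists (fun t => 1 - g t); split.
- split.
    apply/rcontP => t e e0; have /rcontP h := cg; apply: filterS (h t e e0) => u /=.
    by rewrite opprB addrCA addrAC subrr add0r -normrN opprB.
  exists W; split => // t Wt; rewrite gO1 ?subrr// => /interior_subset[_].
  exact: Wt.
- move=> t; have := g01 (g t); rewrite /= in_itv /= => /(_ (ex_intro2 _ _ t Logic.I erefl)).
  by move=> /andP[h1 h2]; apply/andP; lra.
- by rewrite (gs (g s)) ?subr0//; exists s.
- move=> t; have [Ot _|Ot] := pselect (O t).
    by have [] := interior_subset Ot.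
  by rewrite gO1 ?subrr ?eqxx.
Qed.

Lemma RCc_sum (I : Type) (r : seq I) (F : I -> G -> R) :
  (forall i, RCc (F i)) -> RCc (fun t => \sum_(i <- r) F i t).
Proof.
move=> cF; elim: r => [|i r [c [K [cK K0]]]].
  split; first by under eq_fun do rewrite big_nil; move=> s; exact: cvg_cst.
  by exists set0; split => [|s _]; [exact: compact0|rewrite big_nil].
have [ci [Ki [cKi Ki0]]] := cF i; split.
  by under eq_fun do rewrite big_cons; move=> s; apply: cvgD; [exact: ci|exact: c].
exists (Ki `|` K); split; first exact: compactU.
by move=> s /not_orP[k1 k2]; rewrite big_cons Ki0// K0// addr0.
Qed.

Lemma RCcM_l f g : RCc f -> continuous g -> RCc (fun t => f t * g t).
Proof.
move=> [cf [K [cK K0]]] cg; split.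
  by move=> s; apply: cvgM; [exact: cf|exact: cg].
by exists K; split => // s /K0 ->; rewrite mul0r.
Qed.

(* Unnormalized bumps are divided by the maximum of 1 and their sum. *)
Let partition0 K (N : G -> set G) : compact K -> (forall s, K s -> nbhs s (N s)) ->
  exists n (phi : 'I_n -> G -> R) (p : 'I_n -> G),
  [/\ forall j, RCc (phi j), forall j t, 0 <= phi j t, forall j, K (p j),
      forall j t, phi j t != 0 -> N (p j) t &
      (forall t, \sum_j phi j t <= 1) /\ forall t, K t -> \sum_j phi j t = 1].
Proof.
move=> cK KN.
have /choice[b bP] : forall s, exists b : G -> R, K s ->
    [/\ RCc b, forall t, 0 <= b t <= 1, b s = 1 & forall t, b t != 0 -> N s t].
  move=> s; have [Ks|nK] := pselect (K s); last by exists (fun=> 0).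
  by have [b h] := bump (KN s Ks); exists b.
have KV s : K s -> nbhs s [set t | 2^-1 < b s t].
  move=> Ks; have [[cb _] _ b1 _] := bP s Ks.
  have /rcontP /(_ s 2^-1) := cb; rewrite invr_gt0 => /(_ (ltr0n R 2)); apply: filterS => t /=.
  by rewrite b1 ltr_norml; lra.
have [l [lK Kl]] := compact_nbhs_cover cK KV.
pose p (j : 'I_(size l)) := nth 1%g l j.
have pK j : K (p j) by apply: lK; exact: mem_nth.
pose c (j : 'I_(size l)) t := 2 * b (p j) t.
have cc j : RCc (c j).
  have [cb _ _ _] := bP _ (pK j).
  have -> : c j = (fun t => b (p j) t * 2) by apply/funext => t; rewrite /c mulrC.
  by apply: RCcM_l => // t; exact: cvg_cst.
have c0 j t : 0 <= c j t.
  by have [_ /(_ t)/andP[h _] _ _] := bP _ (pK j); rewrite mulr_ge0.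
pose B t := \sum_j c j t.
have cB : continuous B by case: (RCc_sum (index_enum _) cc).
have B1 t : K t -> 1 <= B t.
  move=> Kt; have [s sl st] := Kl t Kt; have sz : (index s l < size l)%N by rewrite index_mem.
  rewrite /B (bigD1 (Ordinal sz))//= (@le_trans _ _ (c (Ordinal sz) t))//.
    by rewrite /c /p /= nth_index//; move: st => /=; lra.
  by rewrite lerDl sumr_ge0.
pose M t := Num.max 1 (B t).
have M1 t : 1 <= M t by rewrite le_max lexx.
have M0 t : 0 < M t by exact: lt_le_trans (M1 t).
have cM : continuous M.
  by move=> t; apply: (@continuous_max _ _ (fun=> 1) B t); [exact: cvg_cst|exact: cB].
have cMi : continuous (fun t => (M t)^-1).
  by move=> t; apply: cvgV; [rewrite gt_eqF|exact: cM].
exists (size l), (fun j t => c j t * (M t)^-1), p; split => //.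
- by move=> j; exact: RCcM_l.
- by move=> j t; rewrite mulr_ge0// invr_ge0 ltW.
- move=> j t; rewrite mulf_eq0 invr_eq0 (gt_eqF (M0 t)) orbF mulf_eq0 pnatr_eq0 /=.
  by have [_ _ _] := bP _ (pK j); apply.
split=> t; first by rewrite -mulr_suml ler_pdivrMr// mul1r le_max lexx orbT.
move=> /B1 Bt; rewrite -mulr_suml -/(B t).
have -> : M t = B t by apply/max_r.
by rewrite divff// gt_eqF// (lt_le_trans ltr01).
Qed.

(** One cutoff [k] serves for all [N], so approximation errors at any fineness are bounded by
    multiples of the same integrable function. It is the sum of a first partition, and later
    partitions are multiplied by it. *)
Lemma partition_of_unity K : compact K -> exists k : G -> R,
  [/\ RCc k, forall t, 0 <= k t <= 1, forall t, K t -> k t = 1 &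
   forall N : G -> set G, (forall s, K s -> nbhs s (N s)) ->
   exists n (phi : 'I_n -> G -> R) (p : 'I_n -> G),
   [/\ forall j, RCc (phi j), forall j t, 0 <= phi j t, forall j, K (p j),
      forall j t, phi j t != 0 -> N (p j) t &
      (forall t, \sum_j phi j t <= k t) /\ forall t, K t -> \sum_j phi j t = 1]].
Proof.
move=> cK; have [|n [phi [p [h1 h2 h3 _ [h5 h6]]]]] := @partition0 K (fun=> setT) cK.
  by move=> s _; exact: filterT.
pose k t := \sum_j phi j t; have ck : RCc k by exact: RCc_sum.
have k01 t : 0 <= k t <= 1 by rewrite h5 andbT sumr_ge0.
exists k; split => // N KN.
have [m [psi [q [g1 g2 g3 g4 [g5 g6]]]]] := partition0 cK KN.
exists m, (fun j t => psi j t * k t), q; split => //.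
- by move=> j; apply: RCcM_l => //; case: ck.
- by move=> j t; rewrite mulr_ge0//; case/andP: (k01 t).
- by move=> j t; rewrite mulf_eq0 negb_or => /andP[/g4].
split=> t; first by rewrite -mulr_suml ler_piMl//; case/andP: (k01 t).
by move=> Kt; rewrite -mulr_suml g6// mul1r; exact: h6.
Qed.

End Bumps.

Section BlockBound.
Context {R : realType} {X : completeNormedModType (Cx R)}
  {Y : normedModType (Cx R)} {f : innerform X Y}.

Local Notation "t %:1" := ((t%:C%C : Cx R) *: (1 : adj f)) (at level 2).

(* Cauchy-Schwarz for the columns (r_j) and (w_j r_j). *)
Lemma block_bound n (r w : 'I_n -> adj f) (c : R) : 0 <= c ->
  (forall j, aswap (r j) = r j) -> (forall j, rnorm (w j) <= c) ->
  pos (1 - \sum_j r j * r j) -> rnorm (\sum_j r j * w j * r j) <= c.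
Proof.
move=> c0 rs wc pS; set S := \sum_j r j * r j in pS; set Z := \sum_j _.
pose W := \sum_j r j * (aswap (w j) * w j) * r j.
have pZ : pos (W - aswap Z * Z).
  have -> : W - aswap Z * Z = \sum_j aswap (w j * r j - r j * Z) * (w j * r j - r j * Z) +
      aswap Z * (1 - S) * Z.
    have -> : \sum_j aswap (w j * r j - r j * Z) * (w j * r j - r j * Z) =
        W - aswap Z * Z - aswap Z * Z + aswap Z * S * Z.
      have sZ : aswap Z = \sum_j r j * aswap (w j) * r j.
        rewrite /Z; elim/big_rec2 : _ => [|j z1 z2 _ <-]; first exact: adj_eq.
        by rewrite aswapD !aswapM rs !mulrA.
      have e1 : aswap Z * Z = \sum_j aswap Z * (r j * w j * r j) by rewrite -mulr_sumr.
      have e2 : aswap Z * Z = \sum_j r j * aswap (w j) * r j * Z.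
        by rewrite -mulr_suml -sZ.
      have e3 : aswap Z * S * Z = \sum_j aswap Z * (r j * r j) * Z.
        by rewrite -mulr_suml -mulr_sumr.
      rewrite e3 {2}e1 e2.
      rewrite /W -!sumrB -big_split; apply: eq_bigr => j _ /=.
      rewrite aswapB !aswapM rs mulrBl !mulrBr !mulrA opprB addrA.
      by rewrite addrAC -!addrA; congr (_ + (_ + _)); rewrite addrC.
    rewrite mulrBr mulr1 mulrBl -!addrA; congr (_ + _).
    by rewrite [aswap Z * S * Z + _]addrC subrK addNr addr0.
  apply: posD; last exact: pos_conj.
  by apply: pos_sum => j _; exact: pos_star_mul.
have pW : pos ((c ^+ 2)%:1 - W).
  have -> : (c ^+ 2)%:1 - W = \sum_j r j * ((c ^+ 2)%:1 - aswap (w j) * w j) * r j +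
      ((c ^+ 2)%:C%C : Cx R) *: (1 - S).
    rewrite scalerBr /S /W scaler_sumr [RHS]addrC -addrA; congr (_ + _).
    rewrite -!sumrN -big_split /=; apply: eq_bigr => j _.
    by rewrite mulrBr mulrBl ascaleAr ascaleAl mulr1 addKr.
  apply: posD; last by apply: posZ => //; rewrite exprn_ge0.
  apply: pos_sum => j _; rewrite -{1}rs; apply: pos_conj.
  exact: pos_sqnorm_sub.
have pWp : pos W.
  apply: pos_sum => j _; rewrite -{1}rs; apply: pos_conj; exact: pos_star_mul.
have h1 : rnorm (aswap Z * Z) <= rnorm W by apply: pos_mono => //; exact: pos_star_mul.
have h2 : rnorm W <= c ^+ 2 by apply: pos_le_real => //; rewrite exprn_ge0.
rewrite -(@ler_pXn2r _ 2%N)// ?nnegrE ?rnorm_ge0// -arnorm_star.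
exact: le_trans h1 h2.
Qed.

End BlockBound.

Section C0Elements.
Context {R : realType} {G : lcGroupType}.
Implicit Types (s t : G) (f g : C0 R G).

Lemma C0_cabs f s : cabs (f s) <= rnorm f.
Proof. by rewrite -cabs_le -rnormE; exact: C0_ler_norm. Qed.

Lemma rnorm_C0_le f (c : R) : (forall s, cabs (f s) <= c) -> rnorm f <= c.
Proof.
move=> fc; rewrite -leCxR -rnormE; apply/C0_norm_le => s.
by rewrite cabs_le.
Qed.

Lemma RCc_C0 (phi : G -> R) : RCc phi -> (fun s => (phi s)%:C%C : Cx R) \in @C0_pred R G.
Proof.
move=> [cphi [K [cK K0]]]; apply/asboolP; split; first exact/realC_continuous.
by move=> e e0; exists K; split => // s /K0 ->; rewrite normr0.
Qed.
Definition C0_of (phi : G -> R) (cphi : RCc phi) : C0 R G := MkC0 (RCc_C0 cphi).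

Lemma RCc_sqrt (phi : G -> R) : RCc phi -> RCc (fun s => Num.sqrt (phi s)).
Proof.
move=> [cphi [K [cK K0]]]; split.
  by move=> s; apply: continuous_comp; [exact: cphi|exact: sqrt_continuous].
by exists K; split => // s /K0 ->; rewrite sqrtr0.
Qed.

Lemma C0_unit_at s : exists f, f s = 1 /\ rnorm f <= 1.
Proof.
have [b [cb b01 b1 _]] := @bump R G s setT filterT.
exists (C0_of cb); split; first by rewrite /= b1.
apply: rnorm_C0_le => t; rewrite /= cabsC ger0_norm; by case/andP: (b01 t).
Qed.

End C0Elements.

Section ScalarHilbert.
Context {R : realType}.

Fact Cip_linear (a x y z : Cx R) : (a *: x + y) * Num.conj z = a * (x * Num.conj z) + y * Num.conj z.
Proof. by rewrite mulrDl -mulrA. Qed.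
Fact Cip_conj (x y : Cx R) : y * Num.conj x = Num.conj (x * Num.conj y).
Proof. by rewrite cconjM conjCK mulrC. Qed.
Fact Cip_norm (x : Cx R) : x * Num.conj x = `|x| ^+ 2.
Proof. by rewrite normCK. Qed.

Definition scalar_hilbert : hilbert R :=
  @Hilbert R (Cx R) (fun x y : Cx R => x * Num.conj y) Cip_linear Cip_conj Cip_norm.

Lemma ev_rep (G : lcGroupType) (s : G) :
  @is_rep R (C0_cstar R G) scalar_hilbert (fun f z => (f : C0 R G) s * z).
Proof.
split.
- by move=> c a b x; rewrite C0_lin mulrDl -mulrA.
- move=> a; split; first by move=> c x y; rewrite mulrDr /GRing.scale /= mulrCA.
  by exists `|(a : C0 R G) s| => x; rewrite normrM.
- by move=> a b x; rewrite mulrA.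
- by move=> a x y /=; rewrite cconjM conjCK mulrCA mulrA.
have [f [f1 _]] := @C0_unit_at R G s.
apply/totalP => x e e0; exists x; last by rewrite subrr rnorm0.
by apply: lspan_in; exists f, x; rewrite f1 mul1r.
Qed.

End ScalarHilbert.

Section PartitionApprox.
Context {R : realType} {G : lcGroupType} {X : normedModType (Cx R)}.

(** Outside [K], where $F(t)$ has norm at most $e$, the sampled values $F(p_j)$ with
    $\varphi_j(t)\ne0$ have norm at most $2e$; hence the constant 3. *)
Lemma partition_approx (F : G -> X) (K : set G) n (phi : 'I_n -> G -> R)
    (p : 'I_n -> G) (e : R) : 0 <= e ->
  (forall t, ~ K t -> rnorm (F t) <= e) ->
  (forall j t, phi j t != 0 -> rnorm (F t - F (p j)) <= e) ->
  (forall j t, 0 <= phi j t) -> (forall t, \sum_j phi j t <= 1) ->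
  (forall t, K t -> \sum_j phi j t = 1) ->
  forall t, rnorm (F t - \sum_j ((phi j t)%:C%C : Cx R) *: F (p j)) <= 3 * e.
Proof.
move=> e0 FK FN phi0 phi1 phiK t.
have phie (M : R) (u : 'I_n -> X) : 0 <= M -> (forall j, phi j t != 0 -> rnorm (u j) <= M) ->
    rnorm (\sum_j ((phi j t)%:C%C : Cx R) *: u j) <= M.
  move=> M0 uM; rewrite (le_trans (rnorm_sum _ _ _))//.
  rewrite (@le_trans _ _ (\sum_j phi j t * M))//; last first.
    by rewrite -mulr_suml ler_piMl.
  apply: ler_sum => j _; rewrite rnormZ cabsC ger0_norm//.
  have [->|h] := eqVneq (phi j t) 0; first by rewrite !mul0r.
  by rewrite ler_wpM2l// uM.
have [Kt|Kt] := pselect (K t).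
  have -> : F t - \sum_j ((phi j t)%:C%C : Cx R) *: F (p j) =
      \sum_j ((phi j t)%:C%C : Cx R) *: (F t - F (p j)).
    rewrite (eq_bigr _ (fun j _ => scalerBr _ _ _)) sumrB -scaler_suml; congr (_ - _).
    have -> : \sum_(j < n) (phi j t)%:C%C = (\sum_j phi j t)%:C%C :> Cx R.
      by rewrite -(rmorph_sum (real_complex R)).
    by rewrite phiK// scale1r.
  by rewrite (le_trans (phie e _ e0 _))//; [move=> j; exact: FN|lra].
rewrite (le_trans (rnormD _ _))// rnormN.
have h1 := FK t Kt.
have h2 : rnorm (\sum_j ((phi j t)%:C%C : Cx R) *: F (p j)) <= 2 * e.
  apply: phie; first by rewrite mulr_ge0.
  move=> j /FN; have := rnorm_leD (F (p j)) (F t); rewrite (rnormB (F (p j))); lra.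
lra.
Qed.

End PartitionApprox.

(** * The tensor product with $C_0(G)$ as an algebra of vector-valued functions *)

Section C0Tensor.
Context {R : realType} (T : forall A B : cstarAlg R, min_tensor A B).
Context {G : lcGroupType} {D : cstarAlg R}.
Local Notation A0 := (C0_cstar R G).
Local Notation AD := (T A0 D).
Local Notation "f [x] d" := (pure (T A0 D) f d) (at level 35).
Implicit Types (s t : G) (f : A0) (d : D) (z : AD).

Let ap (f : A0) (s : G) : Cx R := (f : C0 R G) s.

(** The spatial norm is tested on the character at [s] together with a representation of [D];
    [gelfand_naimark] converts the bounds in all such representations into one for the norm of
    [D]. *)
Lemma ev_bound n (f : 'I_n -> A0) (d : 'I_n -> D) s :
  rnorm (\sum_i ap (f i) s *: d i) <= rnorm (\sum_i f i [x] d i).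
Proof.
apply: gelfand_naimark; first exact: rnorm_ge0.
move=> H sigma rs v; set w := \sum_i _ *: _.
have := @tensor_norm2_le R T A0 D 'I_n 'I_1 f d scalar_hilbert H _ sigma
  (fun=> 1 : Cx R) (fun=> v) (ev_rep s) rs.
have -> : @tensor_norm2 R scalar_hilbert H _ (fun=> 1 : Cx R) (fun _ : 'I_1 => v) = (rnorm v ^+ 2)%:C%C.
  by rewrite /tensor_norm2 !big_ord1 /= conjC1 !mul1r ip_rnorm.
pose h (i : 'I_n) : 'I_n * 'I_1 := (i, ord0).
have bh : bijective h by exists fst => // -[i j] /=; rewrite /h [j]ord1.
rewrite -(tensor_norm2_reindex _ _ bh).
have -> : tensor_norm2 ((fun p : 'I_n * 'I_1 => ap (f p.1) s * 1 : scalar_hilbert) \o h)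
      ((fun p : 'I_n * 'I_1 => sigma (d p.1) v) \o h) = (rnorm (sigma w v) ^+ 2)%:C%C.
  rewrite -ip_rnorm /w (linear_sumf _ _ _ (rep_linear_l rs v)) ip_suml.
  apply: eq_bigr => i _; rewrite ip_sumr; apply: eq_bigr => j _ /=.
  by rewrite !(linearZf _ _ (rep_linear_l rs v)) ipZl ipZr !mulr1 mulrA.
rewrite -realCM leCxR -exprMn ler_pXn2r// ?nnegrE ?rnorm_ge0//.
by rewrite mulr_ge0 ?rnorm_ge0.
Qed.

Lemma ev_ex s : exists ev : AD -> D, [/\ linear ev, forall z, rnorm (ev z) <= rnorm z &
  forall f d, ev (f [x] d) = ap f s *: d].
Proof.
have lF d : linear (fun f : A0 => ap f s *: d).
  by move=> c x y; rewrite /ap C0_lin scalerDl scalerA.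
have [||g [lg gM gE]] := @extend_by_density _ AD D
    [set (fd.1 [x] fd.2, ap fd.1 s *: fd.2) | fd in [set: A0 * D]] 1 ler01.
- move=> p /(@lspan_pure R T A0 D D (fun f d => ap f s *: d) p lF).
  by move=> [n [f [d [-> ->]]]]; rewrite mul1r ev_bound.
- apply: totalS (pure_total AD) => _ [f [d ->]].
  by exists (f [x] d, ap f s *: d) => //; exists (f, d).
exists g; split => // [z|f d]; first by rewrite -[leRHS]mul1r.
by apply: gE; exists (f, d).
Qed.

Definition ev s z : D := projT1 (cid (ev_ex s)) z.

Lemma ev_linear s : linear (ev s).
Proof. by case: (projT2 (cid (ev_ex s))). Qed.
Lemma rnorm_ev s z : rnorm (ev s z) <= rnorm z.
Proof. by case: (projT2 (cid (ev_ex s))) => _ + _; exact. Qed.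
Lemma ev_pure s f d : ev s (f [x] d) = (f : C0 R G) s *: d.
Proof. by case: (projT2 (cid (ev_ex s))) => _ _; exact. Qed.

Lemma evM s z z' : ev s (z ** z') = ev s z ** ev s z'.
Proof.
move: z'; apply: (@total_eq _ _ _ _ _ _ (rnorm z) (rnorm (ev s z)) _ _ _ _ (pure_total AD)).
- by move=> c u v; rewrite cs_mulDr ev_linear.
- by move=> c u v; rewrite ev_linear cs_mulDr.
- by move=> u; rewrite (le_trans (rnorm_ev _ _))// cs_rnormM.
- by move=> u; rewrite (le_trans (cs_rnormM _ _))// ler_wpM2l ?rnorm_ge0 ?rnorm_ev.
move=> _ [f [d ->]]; move: z.
apply: (@total_eq _ _ _ _ _ _ (rnorm (f [x] d)) (rnorm (ev s (f [x] d))) _ _ _ _ (pure_total AD)).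
- by move=> c u v; rewrite cs_mulDl ev_linear.
- by move=> c u v; rewrite ev_linear cs_mulDl.
- by move=> u; rewrite (le_trans (rnorm_ev _ _))// mulrC cs_rnormM.
- by move=> u; rewrite (le_trans (cs_rnormM _ _))// mulrC ler_wpM2l ?rnorm_ge0 ?rnorm_ev.
by move=> _ [g [d' ->]]; rewrite pure_mul !ev_pure cs_mulZx cs_mulxZ scalerA.
Qed.

Lemma ev_star s z : ev s (cs_star z) = cs_star (ev s z).
Proof.
apply: (can_inj (@cs_starK R D)); rewrite cs_starK; move: z.
apply: (@total_eq _ _ _ _ _ _ 1 1 _ _ _ _ (pure_total AD)).
- by move=> c u v; rewrite cs_starD ev_linear cs_starD conjCK.
- exact: ev_linear.
- by move=> u; rewrite mul1r cs_rnorm_star (le_trans (rnorm_ev _ _))// cs_rnorm_star.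
- by move=> u; rewrite mul1r rnorm_ev.
- by move=> _ [f [d ->]]; rewrite pure_star !ev_pure cs_starZ cs_starK /= conjCK.
Qed.

Lemma ev_hom s : is_hom (fun z => membed (ev s z)).
Proof.
split=> [c x y|x y|x]; first by rewrite ev_linear membed_linear.
- by rewrite evM membedM.
- by rewrite ev_star membed_star.
Qed.

Lemma ev_surj s d : exists z, ev s z = d.
Proof.
have [f [f1 _]] := @C0_unit_at R G s.
by exists ((f : A0) [x] d); rewrite ev_pure f1 scale1r.
Qed.

Lemma ev_nondeg s : nondeg_hom (fun z => membed (ev s z)).
Proof.
split; first exact: ev_hom.
apply: totalS (@total_mul R D) => _ [a [d ->]].
by have [z za] := ev_surj s a; exists z, d; rewrite membedE za.
Qed.

(* The elementary tensors are written as R_j W_j R_j for R_j = sqrt (phi j) (x) 1. *)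
Lemma partition_tensor_norm n (phi : 'I_n -> G -> R) (cphi : forall j, RCc (phi j))
    (w : 'I_n -> D) (c : R) : 0 <= c ->
  (forall j t, 0 <= phi j t) -> (forall t, \sum_j phi j t <= 1) ->
  (forall j, rnorm (w j) <= c) ->
  rnorm (\sum_j (C0_of (cphi j) : A0) [x] w j) <= c.
Proof.
move=> c0 phi0 phi1 wc.
pose r j : A0 := C0_of (RCc_sqrt (cphi j)).
pose Rj j := toA (mtensor T (membed (r j)) (1 : mult D)).
pose Wj j := toA (mtensor T (1 : mult A0) (membed (w j))).
have rr j : r j ** r j = C0_of (cphi j).
  by apply: C0_eq => t /=; rewrite -realCM -expr2 sqr_sqrtr.
have rs j : cs_star (r j) = r j by apply: C0_eq => t /=; rewrite conj_realC.
rewrite -mnorm_membed /mnorm.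
have -> : toA (membed (\sum_j (C0_of (cphi j) : A0) [x] w j)) = \sum_j Rj j * Wj j * Rj j.
  rewrite (linear_sumf _ _ _ (@membed_linear R AD)) (linear_sumf _ _ _ toA_linear).
  apply: eq_bigr => j _; rewrite /Rj /Wj -!toAM !mtensorM !mulr1 mul1r.
  by rewrite -membedM rr mtensor_membed.
apply: block_bound => // [j|j|].
- by rewrite /Rj -toA_star mtensor_star mstar1 -membed_star rs.
- by rewrite (le_trans (mnorm_mtensorr T (membed (w j))))// mnorm_membed.
have cS : RCc (fun t => \sum_j phi j t) by exact: RCc_sum.
pose g : A0 := C0_of (RCc_sqrt cS).
have gs : cs_star g = g by apply: C0_eq => t /=; rewrite conj_realC.
have gg : g ** g = \sum_j r j ** r j.
  apply: C0_eq => t; rewrite /= -realCM -expr2 sqr_sqrtr ?sumr_ge0//.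
  have -> : (\sum_j r j ** r j : C0 R G) t = \sum_j ((phi j t)%:C%C : Cx R).
    elim/big_rec2 : _ => // j y x _ <-; rewrite rr.
    by have := C0_lin 1 (C0_of (cphi j)) x t; rewrite scale1r mul1r => ->.
  by rewrite -(rmorph_sum (real_complex R)).
pose h := toA (mtensor T (membed g) (1 : mult D)).
have -> : \sum_j Rj j * Rj j = h * h.
  rewrite /h -toAM mtensorM mulr1 -membedM gg (linear_sumf _ _ _ (@membed_linear R A0)).
  rewrite (linear_sumf _ _ _ (mtensor_linl T 1)) (linear_sumf _ _ _ toA_linear).
  by apply: eq_bigr => j _; rewrite /Rj -toAM mtensorM mulr1 -membedM.
have [||//] := @one_minus_sq _ _ _ _ h.
  by rewrite /h -toA_star mtensor_star mstar1 -membed_star gs.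
rewrite (le_trans (mnorm_mtensorl T (membed g)))// mnorm_membed.
apply: rnorm_C0_le => t; rewrite /= cabsC ger0_norm ?sqrtr_ge0//.
by rewrite -(sqrtr1 R) ler_wsqrtr.
Qed.

End C0Tensor.

Section Vanishing.
Context {R : realType} {G : lcGroupType}.

Definition rvanish (X : normedModType (Cx R)) (F : G -> X) : Prop :=
  forall e : R, 0 < e -> exists K : set G, compact K /\
    forall s, ~ K s -> rnorm (F s) <= e.

Lemma C0_rvanish (f : C0 R G) : rvanish (X := Cx R) f.
Proof.
move=> e e0; have e1 : 0 < (e%:C%C : Cx R) by rewrite (ltCxR 0).
have [K [cK fK]] := C0_van f e1; exists K; split => // s /fK.
by rewrite cabs_lt => /ltW.
Qed.

Lemma rvanishD (X : normedModType (Cx R)) (F F' : G -> X) (a : Cx R) :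
  rvanish F -> rvanish F' -> rvanish (fun s => a *: F s + F' s).
Proof.
move=> vF vF' e e0; have e1 : 0 < e / 2 by rewrite divr_gt0.
have a1 : 0 < cabs a + 1 by have := cabs_ge0 a; lra.
have [K [cK FK]] := vF _ (divr_gt0 e1 a1); have [L [cL FL]] := vF' _ e1.
exists (K `|` L); split; first exact: compactU.
move=> s /not_orP[/FK h1 /FL h2]; rewrite (le_trans (rnormD _ _))// rnormZ.
have : cabs a * rnorm (F s) <= e / 2; last by lra.
rewrite (@le_trans _ _ ((cabs a + 1) * rnorm (F s)))//.
  by rewrite ler_wpM2r ?rnorm_ge0// lerDl.
by rewrite mulrC -ler_pdivlMr.
Qed.

(** A common partition for finitely many functions lets all coefficients of a sum of tensors be
    sampled at the same points. *)
Lemma vanish_partition (X : normedModType (Cx R)) n (F : 'I_n -> G -> X) (e : R) :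
  (forall i, continuous (F i)) -> (forall i, rvanish (F i)) -> 0 < e ->
  exists m (phi : 'I_m -> G -> R) (p : 'I_m -> G),
  [/\ forall j, RCc (phi j), forall j t, 0 <= phi j t, forall t, \sum_j phi j t <= 1 &
    forall i t, rnorm (F i t - \sum_j ((phi j t)%:C%C : Cx R) *: F i (p j)) <= 3 * e].
Proof.
move=> cF vF e0.
have /choice[K KP] : forall i, exists K : set G, compact K /\ forall s, ~ K s -> rnorm (F i s) <= e.
  by move=> i; exact: vF.
pose L := \big[setU/set0]_(i < n) K i.
have cL : compact L.
  by rewrite /L; elim/big_rec : _ => [|i B _ cB]; [exact: compact0|apply: compactU => //; case: (KP i)].
have LK i t : ~ L t -> ~ K i t.
  by move=> Lt Kt; apply: Lt; rewrite /L (bigD1 i)//=; left.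
have [k [_ k01 _ pou]] := @partition_of_unity R G L cL.
have LN s : L s -> nbhs s [set t | forall i, rnorm (F i t - F i s) < e].
  by move=> _; apply: filter_forall => i; have /ncontP h := cF i; exact: h.
have [m [phi [p [h1 h2 h3 h4 [h5 h6]]]]] := pou _ LN; exists m, phi, p.
have h7 t : \sum_j phi j t <= 1 by rewrite (le_trans (h5 t))//; case/andP: (k01 t).
split => // i; apply: (@partition_approx R G X (F i) L) => //; first exact: ltW.
- by move=> t /(LK i) Kt; have [_ h] := KP i; exact: h.
- by move=> j t /h4 /(_ i) /ltW.
Qed.

End Vanishing.

Section C0TensorFaithful.
Context {R : realType} (T : forall A B : cstarAlg R, min_tensor A B).
Context {G : lcGroupType} {D : cstarAlg R}.
Local Notation A0 := (C0_cstar R G).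
Local Notation AD := (T A0 D).
Local Notation "f [x] d" := (pure (T A0 D) f d) (at level 35).
Local Notation ev := (@ev R T G D).
Implicit Types (s t : G) (f : A0) (d : D) (z : AD).

(** Sampling all [f i] on a partition turns the sum into $\sum_j\varphi_j\otimes w_j$ with $w_j$ its
    value at $p_j$, which [partition_tensor_norm] bounds. Together with [rnorm_ev], the spatial norm
    is the supremum norm of the values. *)
Lemma ev_norm_le z (c : R) : (forall s, rnorm (ev s z) <= c) -> rnorm z <= c.
Proof.
have alg n (f : 'I_n -> A0) (d : 'I_n -> D) (c' : R) :
    (forall s, rnorm (\sum_i (f i : C0 R G) s *: d i) <= c') ->
    rnorm (\sum_i f i [x] d i) <= c'.
  move=> fc; have c0 : 0 <= c' by rewrite (le_trans (rnorm_ge0 _) (fc 1%g)).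
  apply: (@eps_le _ _ _ (\sum_i 3 * rnorm (d i))) => e e0.
  have [|||m [phi [p [h1 h2 h3 h4]]]] :=
    @vanish_partition R G (Cx R) n (fun i => (f i : C0 R G)) e.
  - by move=> i; exact: C0_cont.
  - by move=> i; exact: C0_rvanish.
  - exact: e0.
  pose w j : D := \sum_i (f i : C0 R G) (p j) *: d i.
  pose z' : AD := \sum_j (C0_of (h1 j) : A0) [x] w j.
  have h5 : rnorm z' <= c' by apply: partition_tensor_norm => // j; exact: fc.
  have h6 : \sum_i f i [x] d i - z' =
      \sum_i (f i - \sum_j (f i : C0 R G) (p j) *: (C0_of (h1 j) : A0)) [x] d i.
    rewrite /z' (eq_bigr (fun j => \sum_i ((f i : C0 R G) (p j) *: (C0_of (h1 j) : A0)) [x] d i)).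
      rewrite exchange_big -sumrB; apply: eq_bigr => i _.
      by rewrite pureBl (linear_sumf _ _ _ (pure_lin_l T (d i))).
    move=> j _; rewrite (linear_sumf _ _ _ (pure_lin_r T _)); apply: eq_bigr => i _.
    by rewrite pureZl pureZr.
  rewrite (le_trans (rnorm_leD _ z'))// lerD// h6 mulr_sumr (le_trans (rnorm_sum _ _ _))//.
  apply: ler_sum => i _; rewrite (le_trans (rnorm_pure _ _ _))// mulrA.
  rewrite ler_wpM2r ?rnorm_ge0//; apply: rnorm_C0_le => t.
  have := h4 i t; rewrite rnormC mulrC; congr (cabs _ <= _).
  rewrite -[(f i - _ : A0)]/(f i - _ : C0 R G).
  have -> (g g' : C0 R G) : (g - g') t = g t - g' t.
    by rewrite -scaleN1r addrC C0_lin mulN1r addrC.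
  congr (_ - _); elim/big_rec2 : _ => // j y x _ ->.
  by rewrite C0_lin mulrC.
move=> zc; apply: (@eps_le _ _ _ 2) => e e0.
have [y /lspan_pure1[n [f [d yE]]] zy] := proj1 (totalP _) (pure_total AD) z e e0.
have : rnorm y <= c + e.
  rewrite yE; apply: alg => s.
  have -> : \sum_i (f i : C0 R G) s *: d i = ev s y.
    by rewrite yE (linear_sumf _ _ _ (@ev_linear R T G D s)); apply: eq_bigr => i _; rewrite ev_pure.
  rewrite (le_trans (rnorm_leD _ (ev s z)))// lerD// -(linearBf _ _ (@ev_linear R T G D s)).
  by rewrite (le_trans (rnorm_ev _ _))// rnormB ltW.
by have := rnorm_leD z y; lra.
Qed.

Lemma ev_faithful z z' : (forall s, ev s z = ev s z') -> z = z'.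
Proof.
move=> h; apply/subr0_eq/rnorm_eq0/eqP; rewrite eq_le rnorm_ge0 andbT.
by apply: ev_norm_le => s; rewrite (linearBf _ _ (@ev_linear R T G D s)) h subrr rnorm0.
Qed.

Lemma ev_continuous z : continuous (fun s => ev s z).
Proof.
apply: uniform_limit_continuous => e e0.
have [y yl zy] := proj1 (totalP _) (pure_total AD) z e e0.
exists (fun s => ev s y); last first.
  move=> s; rewrite -(linearBf _ _ (@ev_linear R T G D s)).
  by rewrite (le_trans (rnorm_ev _ _))// ltW.
clear zy; move: y yl; apply: lspan_sub.
- under eq_fun do rewrite (linear0f (@ev_linear R T G D _)); move=> s; exact: cvg_cst.
- move=> a x y cx cy; under eq_fun do rewrite ev_linear.
  by move=> s; apply: cvgD; [apply: cvgZr; exact: cx|exact: cy].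
- move=> _ [f [d ->]]; under eq_fun do rewrite ev_pure.
  by move=> s; apply: cvgZl; exact: C0_cont.
Qed.

Lemma ev_rvanish z : rvanish (fun s => ev s z).
Proof.
move=> e e0; have e2 : 0 < e / 2 by rewrite divr_gt0.
have [y yl zy] := proj1 (totalP _) (pure_total AD) z _ e2.
have vy : rvanish (fun s => ev s y).
  clear zy; move: y yl; apply: lspan_sub.
  - move=> c c0; exists set0; split; first exact: compact0.
    by move=> s _; rewrite (linear0f (@ev_linear R T G D _)) rnorm0 ltW.
  - by move=> a x y cx cy; under eq_fun do rewrite ev_linear; exact: rvanishD.
  - move=> _ [f [d ->]] c c0; have d1 : 0 < rnorm d + 1 by have := rnorm_ge0 d; lra.
    have [K [cK fK]] := C0_rvanish f (divr_gt0 c0 d1); exists K; split => // s /fK h.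
    rewrite ev_pure rnormZ (@le_trans _ _ (cabs ((f : C0 R G) s) * (rnorm d + 1)))//.
      by rewrite ler_wpM2l ?cabs_ge0// lerDl.
    by rewrite -ler_pdivlMr.
have [K [cK yK]] := vy _ e2; exists K; split => // s /yK h.
rewrite (le_trans (rnorm_leD _ (ev s y)))// -(linearBf _ _ (@ev_linear R T G D s)).
have := @rnorm_ev R T G D s (z - y); lra.
Qed.

(** Samples of [F] on finer and finer partitions give tensors that are Cauchy by [ev_norm_le]. *)
Lemma ev_onto (F : G -> D) : continuous F -> rvanish F -> exists z, forall s, ev s z = F s.
Proof.
move=> cF vF.
have [||l lP] := @approx_limit R AD (fun e z => forall s, rnorm (ev s z - F s) <= 3 * e) 3.
- move=> e e0.
  have [|||m [phi [p [h1 h2 h3 h4]]]] := @vanish_partition R G D 1 (fun _ => F) e => //.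
  exists (\sum_j (C0_of (h1 j) : A0) [x] F (p j)) => s; rewrite rnormB.
  rewrite (linear_sumf _ _ _ (@ev_linear R T G D s)).
  by under eq_bigr do rewrite ev_pure; exact: (h4 ord0).
- move=> e d v w e0 d0 hv hw; apply: ev_norm_le => s.
  rewrite (linearBf _ _ (@ev_linear R T G D s)) mulrDr.
  have := rnorm_tri (F s) (ev s v) (ev s w); have := hv s; have := hw s.
  by rewrite (rnormB (F s)); lra.
exists l => s; apply: (@eps_eq _ _ 6) => e e0.
have [|||m [phi [p [h1 h2 h3 h4]]]] := @vanish_partition R G D 1 (fun _ => F) e => //.
pose z : AD := \sum_j (C0_of (h1 j) : A0) [x] F (p j).
have zF t : rnorm (ev t z - F t) <= 3 * e.
  rewrite rnormB (linear_sumf _ _ _ (@ev_linear R T G D t)).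
  by under eq_bigr do rewrite ev_pure; exact: (h4 ord0).
have := lP e z e0 zF; have := rnorm_tri (ev s z) (ev s l) (F s); have := zF s.
by have := @rnorm_ev R T G D s (l - z); rewrite (linearBf _ _ (@ev_linear R T G D s)) (rnormB l); lra.
Qed.

Lemma ev_mext s (w : mult AD) (u : mult D) :
  (forall z, ev s (ml w z) = ml u (ev s z)) <-> mext (fun z => membed (ev s z)) w = u.
Proof.
split=> [h|<- z].
  by apply: mext_uniq; [exact: ev_nondeg|move=> z; rewrite h mmul_membed].
apply: membed_inj; rewrite -mmul_membed.
by rewrite (mextP (@ev_nondeg R T G D s) w z).
Qed.

Lemma mult_ev_eq (w w' : mult AD) :
  (forall s, mext (fun z => membed (ev s z)) w = mext (fun z => membed (ev s z)) w') -> w = w'.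
Proof.
move=> h; apply: mult_eqml => z; apply: ev_faithful => s.
rewrite (proj2 (ev_mext s w _) (h s)).
by rewrite (proj2 (ev_mext s w' _) erefl).
Qed.

(** The multiplier acts pointwise: strict continuity and boundedness keep $s\mapsto
    U_s\,\mathrm{ev}_s(z)$ continuous and vanishing at infinity, so [ev_onto] turns it into a
    tensor. The adjoint family gives the adjoint. *)
Lemma strict_mult (U : G -> mult D) : (forall d, continuous (fun s => ml (U s) d)) ->
  (forall d, continuous (fun s => ml (mstar (U s)) d)) -> (forall s, mnorm (U s) <= 1) ->
  exists w : mult AD, forall s, mext (fun z => membed (ev s z)) w = U s.
Proof.
move=> cU cU' U1.
have mstar1 s : mnorm (mstar (U s)) <= 1.
  by rewrite /mnorm toA_star rnorm_aswap; exact: U1.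
have h (V : G -> mult D) : (forall d, continuous (fun s => ml (V s) d)) ->
    (forall s, mnorm (V s) <= 1) ->
    exists g : AD -> AD, [/\ linear g, forall z, rnorm (g z) <= 1 * rnorm z &
      forall s z, ev s (g z) = ml (V s) (ev s z)].
  move=> cV V1; have V1' s d : rnorm (ml (V s) d) <= rnorm d.
    by rewrite (le_trans (rnorm_ml _ _))// ler_piMl ?rnorm_ge0.
  have /choice[g gP] : forall z, exists z', forall s, ev s z' = ml (V s) (ev s z).
    move=> z; apply: ev_onto.
      apply/ncontP => s e e0; have e2 : 0 < e / 2 by rewrite divr_gt0.
      have /ncontP /(_ s _ e2) h1 := cV (ev s z).
      have /ncontP /(_ s _ e2) h2 := @ev_continuous z.
      apply: filterS (filterI h1 h2) => t [/= {}h1 {}h2].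
      have := rnorm_tri (ml (V t) (ev s z)) (ml (V t) (ev t z)) (ml (V s) (ev s z)).
      rewrite -(linearBf _ _ (ml_linear (V t))).
      by have := V1' t (ev t z - ev s z); lra.
    move=> e e0; have [K [cK zK]] := ev_rvanish z e0; exists K; split => // s /zK.
    exact: le_trans.
  exists g; split => //.
  - by move=> a x y; apply: ev_faithful => s; rewrite gP !ev_linear !gP ml_linear.
  - move=> z; rewrite mul1r; apply: ev_norm_le => s; rewrite gP.
    by rewrite (le_trans (V1' _ _))// rnorm_ev.
have [g [lg gM gE]] := h U cU U1; have [g' [lg' gM' gE']] := h _ cU' mstar1.
have [||w [wg _]] := @mult_of_pair R AD setT g g' 1 1 _ lg lg' gM gM'.
- by apply/totalP => x e e0; exists x; [exact: lspan_in|rewrite subrr rnorm0].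
- move=> x y _ _; apply: ev_faithful => s.
  by rewrite !evM !ev_star gE gE' mstar_form.
by exists w => s; apply/ev_mext => z; rewrite wg gE.
Qed.

End C0TensorFaithful.

(** * Haar integrals of vector-valued functions *)

Section RealIntegral.
Context {R : realType} {G : lcGroupType} (mu : haar R G).
Implicit Types (s t : G) (f g : G -> R).

Definition Rint f : R := complex.Re (hint mu (fun s => (f s)%:C%C : Cx R) : R[i]%C).

Lemma RCc_Cc f : RCc f -> Cc (fun s => (f s)%:C%C : Cx R).
Proof.
move=> [cf [K [cK K0]]]; split; first exact/realC_continuous.
by exists K; split => // s /K0 ->.
Qed.

Lemma RCc_lin (a : R) f g : RCc f -> RCc g -> RCc (fun s => a * f s + g s).
Proof.
move=> [cf [K [cK K0]]] [cg [L [cL L0]]]; split.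
  by move=> s; apply: cvgD; [apply: cvgMr; exact: cf|exact: cg].
exists (K `|` L); split; first exact: compactU.
by move=> s /not_orP[/K0 -> /L0 ->]; rewrite mulr0 addr0.
Qed.

Lemma RCc0 : RCc (fun _ : G => 0 : R).
Proof.
by split; [move=> s; exact: cvg_cst|exists set0; split => //; exact: compact0].
Qed.

Lemma RCc_scale (a : R) f : RCc f -> RCc (fun s => a * f s).
Proof. by move=> cf; have := RCc_lin a cf RCc0; under eq_fun do rewrite addr0. Qed.

Lemma RCc_norm f : RCc f -> RCc (fun s => `|f s|).
Proof.
move=> [cf [K [cK K0]]]; split.
  by move=> s; apply: continuous_comp; [exact: cf|exact: norm_continuous].
by exists K; split => // s /K0 ->; rewrite normr0.
Qed.

Lemma Rint_lin (a : R) f g : RCc f -> RCc g ->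
  Rint (fun s => a * f s + g s) = a * Rint f + Rint g.
Proof.
move=> /RCc_Cc cf /RCc_Cc cg; rewrite /Rint.
have := hint_linear mu (a%:C%C) cf cg.
under eq_fun do rewrite -realCM -realCD; move=> ->.
case: (hint mu _) => x y; case: (hint mu _) => z w /=.
by rewrite mul0r subr0.
Qed.

Lemma Rint0 : Rint (fun=> 0) = 0.
Proof.
have := Rint_lin 1 RCc0 RCc0; under eq_fun do rewrite mulr0 addr0.
by move=> /eqP; rewrite mul1r -subr_eq0 opprD addNKr oppr_eq0 => /eqP.
Qed.

Lemma Rint_scale (a : R) f : RCc f -> Rint (fun s => a * f s) = a * Rint f.
Proof.
move=> cf; have := Rint_lin a cf RCc0; rewrite Rint0 addr0 => <-.
by congr Rint; apply/funext => s; rewrite addr0.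
Qed.

Let Rint_pos f : RCc f -> (forall s, 0 <= f s) ->
  0 <= Rint f /\ hint mu (fun s => (f s)%:C%C : Cx R) = (Rint f)%:C%C.
Proof.
move=> /RCc_Cc cf f0; have h : 0 <= hint mu (fun s => (f s)%:C%C : Cx R).
  by apply: hint_ge0 => // s; rewrite (leCxR 0).
split; last exact: cx_ge0.
by rewrite -(leCxR 0) -(cx_ge0 h).
Qed.

Lemma Rint_mono f g : RCc f -> RCc g -> (forall s, f s <= g s) -> Rint f <= Rint g.
Proof.
move=> cf cg fg; have [|h _] := Rint_pos (RCc_lin (-1) cf cg).
  by move=> s; rewrite mulN1r addrC subr_ge0.
by move: h; rewrite Rint_lin// mulN1r addrC subr_ge0.
Qed.

Lemma Rint_ge0 f : RCc f -> (forall s, 0 <= f s) -> 0 <= Rint f.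
Proof. by move=> cf f0; case: (Rint_pos cf f0). Qed.

(** Realness of the integral is known for nonnegative functions; $f=(f+|f|)-|f|$ reduces to
    these. *)
Lemma hint_real f : RCc f -> hint mu (fun s => (f s)%:C%C : Cx R) = (Rint f)%:C%C.
Proof.
move=> cf; have ca := RCc_norm cf.
have [_ h1] := Rint_pos ca (fun s => normr_ge0 (f s)).
have cs := RCc_lin 1 cf ca.
have [|_ h2] := Rint_pos cs.
  by move=> s; rewrite mul1r; have := ler_norm (- f s); rewrite normrN; lra.
move: h2; rewrite Rint_lin// mul1r realCD -h1.
have := hint_linear mu 1 (RCc_Cc cf) (RCc_Cc ca); rewrite mul1r.
have -> : (fun s => 1 * ((f s)%:C%C : Cx R) + `|f s|%:C%C) =
    (fun s => (1 * f s + `|f s|)%:C%C).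
  by apply/funext => s; rewrite !mul1r realCD.
by move=> -> /addIr.
Qed.

Definition modR t : R := complex.Re (modular mu t : R[i]%C).

Lemma modularE t : modular mu t = (modR t)%:C%C.
Proof. exact/cx_ge0/ltW/modular_gt0. Qed.

Lemma modR_gt0 t : 0 < modR t.
Proof. by rewrite -(ltCxR 0) -modularE modular_gt0. Qed.

Lemma RCc_comp f (h h' : G -> G) : RCc f -> continuous h -> continuous h' ->
  cancel h h' -> RCc (f \o h).
Proof.
move=> [cf [K [cK K0]]] ch ch' hK; split.
  by move=> s; apply: continuous_comp; [exact: ch|exact: cf].
exists (h' @` K); split.
  by apply: continuous_compact cK; exact: continuous_subspaceT.
by move=> s nK; apply: K0 => Ks; apply: nK; exists (h s) => //; rewrite hK.
Qed.

Lemma mulg_left_continuous t : continuous (fun s : G => (t * s)%g).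
Proof.
move=> s; apply: (@continuous_comp _ _ _ (fun s : G => (t, s))
    (fun p : G * G => (p.1 * p.2)%g) s).
  by apply: cvg_pair; [exact: cvg_cst|exact: cvg_id].
exact: mulg_continuous.
Qed.

Lemma mulg_right_continuous t : continuous (fun s : G => (s * t)%g).
Proof.
move=> s; apply: (@continuous_comp _ _ _ (fun s : G => (s, t))
    (fun p : G * G => (p.1 * p.2)%g) s).
  by apply: cvg_pair; [exact: cvg_id|exact: cvg_cst].
exact: mulg_continuous.
Qed.

Lemma RCc_left t f : RCc f -> RCc (fun s => f (t * s)%g).
Proof.
move=> cf; apply: (RCc_comp cf (@mulg_left_continuous t) (@mulg_left_continuous (t^-1)%g)).
exact: mulKg.
Qed.

Lemma RCc_inv f : RCc f -> RCc (fun s => f (s^-1)%g).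
Proof.
by move=> cf; apply: (RCc_comp cf (@invg_continuous G) (@invg_continuous G)); exact: invgK.
Qed.

Lemma Rint_left t f : RCc f -> Rint (fun s => f (t * s)%g) = Rint f.
Proof. by move=> /RCc_Cc cf; rewrite /Rint (hint_left mu t cf). Qed.

Lemma Rint_neq0 : exists2 f, RCc f & Rint f != 0.
Proof.
have [f [[cf [K [cK K0]]] f0]] := hint_neq0 mu.
have re (p : {additive R[i]%C -> R}) : p 0 = 0 -> (forall z : Cx R, `|p z| <= cabs z) ->
    RCc (fun s => p (f s : R[i]%C)).
  move=> p0 pb; split; last by exists K; split => // s /K0 ->; rewrite raddf0.
  apply/rcontP => s e e0; have /(ncontP (X := Cx R)) /(_ s e e0) := cf.
  by apply: filterS => t /= h; rewrite -raddfB (le_lt_trans (pb _)).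
have cu := re (@complex.Re R) erefl (@cabs_Re R).
have cv := re (@complex.Im R) erefl (@cabs_Im R).
have fE : hint mu f = 'i%C * (Rint (fun s => complex.Im (f s : R[i]%C)))%:C%C +
    (Rint (fun s => complex.Re (f s : R[i]%C)))%:C%C.
  rewrite -!hint_real// -(hint_linear mu 'i%C (RCc_Cc cv) (RCc_Cc cu)).
  by congr hint; apply/funext => s; rewrite {1}(CxReIm (f s)) addrC mulrC.
have [u0|] := eqVneq (Rint (fun s => complex.Re (f s : R[i]%C))) 0; last by exists (fun s => complex.Re (f s : R[i]%C)).
exists (fun s => complex.Im (f s : R[i]%C)) => //.
by apply: contra_neq f0 => v0; rewrite fE u0 v0 mulr0 add0r.
Qed.

End RealIntegral.

Section VectorIntegral.
Context {R : realType} {G : lcGroupType} (mu : haar R G).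
Local Notation Rint := (Rint mu).

Definition XCc (X : normedModType (Cx R)) (F : G -> X) : Prop :=
  continuous F /\ exists K : set G, compact K /\ forall s, ~ K s -> F s = 0.

(** Each simple function is paired with its integral, so that linear combinations carry their
    integral along; by [vsimple_norm] it depends on the function alone. *)
Definition vsimple (X : normedModType (Cx R)) : set ((G -> X) * X) :=
  [set p | exists (phi : G -> R) (x : X), RCc phi /\
    p = ((fun t => ((phi t)%:C%C : Cx R) *: x), ((Rint phi)%:C%C : Cx R) *: x)].
Arguments vsimple : clear implicits.

Context {X : completeNormedModType (Cx R)}.
Implicit Types (F : G -> X) (p q : (G -> X) * X) (g : G -> R).

(* Hahn-Banach reduces to the scalar case. *)
Lemma vsimple_norm p g : lspan (vsimple X) p -> RCc g ->
  (forall t, rnorm (p.1 t) <= g t) -> rnorm p.2 <= Rint g.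
Proof.
move=> pS cg pg.
have [|f [fD fZ fle fp]] := @hahn_banach R X (@rnorm R X) p.2.
  split; first exact: rnormD.
  by move=> t x t0; rewrite rnormZ cabsC ger0_norm.
rewrite -fp.
have [cf ->] : RCc (fun t => f (p.1 t)) /\ f p.2 = Rint (fun t => f (p.1 t)).
  have f0 : f 0 = 0 by have := fZ 0 0; rewrite scaler0 mul0r.
  clear pg fp; move: p pS; apply: lspan_ind.
    have -> : (fun t => f ((0 : (G -> X) * X).1 t)) = fun=> 0 by apply/funext => t; exact: f0.
    by split; [exact: RCc0|rewrite Rint0; exact: f0].
  move=> a _ q [phi [x [cphi ->]]] [cq qE] /=.
  have fE t : f (a *: (((phi t)%:C%C : Cx R) *: x) + q.1 t) =
      f (a *: x) * phi t + f (q.1 t).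
    by rewrite scalerA mulrC -scalerA fD fZ mulrC.
  have -> : (fun t => f ((a *: (fun t => ((phi t)%:C%C : Cx R) *: x) + q.1) t)) =
      (fun t => f (a *: x) * phi t + f (q.1 t)).
    by apply/funext => t; exact: fE.
  split; first exact: RCc_lin.
  by rewrite Rint_lin// scalerA mulrC -scalerA fD fZ qE mulrC.
by apply: Rint_mono => // t; exact: le_trans (fle _) (pg t).
Qed.

(** The error is measured against one compactly supported [k] rather than uniformly, so that it can
    be integrated. *)
Lemma XCc_approx F : XCc F -> exists k : G -> R, [/\ RCc k, forall t, 0 <= k t &
  forall e : R, 0 < e -> exists2 p, lspan (vsimple X) p &
    forall t, rnorm (F t - p.1 t) <= e * k t].
Proof.
move=> [cF [K [cK K0]]]; have [k [ck k01 kK pou]] := @partition_of_unity R G K cK.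
exists k; split => // [t|e e0]; first by case/andP: (k01 t).
have KN s : K s -> nbhs s [set t | rnorm (F t - F s) < e].
  by move=> _; have /ncontP h := cF; exact: h.
have [n [phi [q [h1 h2 h3 h4 [h5 h6]]]]] := pou _ KN.
exists ((fun t => \sum_j ((phi j t)%:C%C : Cx R) *: F (q j)),
        \sum_j ((Rint (phi j))%:C%C : Cx R) *: F (q j)).
  elim: (index_enum _) => [|j r IH].
    suff -> : ((fun t => \sum_(j <- [::]) ((phi j t)%:C%C : Cx R) *: F (q j)),
      \sum_(j <- [::]) ((Rint (phi j))%:C%C : Cx R) *: F (q j)) = 0 by exact: lspan0.
    by congr (_, _); [apply/funext => t|]; rewrite big_nil.
  set u := (_, _) in IH.
  have -> : ((fun t => \sum_(j <- j :: r) ((phi j t)%:C%C : Cx R) *: F (q j)),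
      \sum_(j <- j :: r) ((Rint (phi j))%:C%C : Cx R) *: F (q j)) =
     1 *: ((fun t => ((phi j t)%:C%C : Cx R) *: F (q j)), ((Rint (phi j))%:C%C : Cx R) *: F (q j)) + u.
    rewrite scale1r; congr (_, _); last by rewrite big_cons.
    by apply/funext => t; rewrite big_cons.
  by apply: lspan_lin => //; apply: lspan_in; exists (phi j), (F (q j)).
move=> t /=.
have -> : F t - \sum_j ((phi j t)%:C%C : Cx R) *: F (q j) =
    \sum_j ((phi j t)%:C%C : Cx R) *: (F t - F (q j)).
  rewrite (eq_bigr _ (fun j _ => scalerBr _ _ _)) sumrB -scaler_suml; congr (_ - _).
  have [Kt|/K0 ->] := pselect (K t); last by rewrite scaler0.
  have -> : \sum_(j < n) (phi j t)%:C%C = (\sum_j phi j t)%:C%C :> Cx R.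
    by rewrite -(rmorph_sum (real_complex R)).
  by rewrite h6// scale1r.
rewrite (le_trans (rnorm_sum _ _ _))//.
rewrite (@le_trans _ _ (\sum_j e * phi j t))//; last first.
  by rewrite -mulr_sumr ler_wpM2l// ltW.
apply: ler_sum => j _; rewrite rnormZ cabsC ger0_norm// mulrC.
have [->|h] := eqVneq (phi j t) 0; first by rewrite !mulr0.
by rewrite ler_wpM2r// ltW//; exact: h4.
Qed.

(** Quantifying over all simple approximations and all dominating [g] avoids fixing an approximating
    sequence, and is the form in which estimates are made. *)
Definition vint_spec F (l : X) : Prop := forall p g, lspan (vsimple X) p -> RCc g ->
  (forall t, rnorm (F t - p.1 t) <= g t) -> rnorm (l - p.2) <= Rint g.

Definition vint F : X := xget 0 [set l | vint_spec F l].

Lemma vsimpleB p q : lspan (vsimple X) p -> lspan (vsimple X) q -> lspan (vsimple X) (p - q).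
Proof. by move=> hp hq; rewrite -scaleN1r addrC; exact: lspan_lin. Qed.

Lemma vint_ex F : XCc F -> exists l, vint_spec F l.
Proof.
move=> /XCc_approx[k [ck k0 kP]].
have [e|e d v w e0 d0 [p [pS pF ->]] [q [qS qF ->]]|l lP] := @approx_limit R X
  (fun e v => exists p, [/\ lspan (vsimple X) p, forall t, rnorm (F t - p.1 t) <= e * k t &
     v = p.2]) (Rint k).
- by move=> /kP[p pS pF]; exists p.2, p.
- rewrite mulrC -Rint_scale//.
  apply: (vsimple_norm (vsimpleB pS qS)); first exact: RCc_scale.
  move=> t /=; rewrite mulrDl (le_trans (rnorm_tri (F t) _ _))// lerD//.
  by rewrite rnormB.
exists l => p g pS cg pF; apply: (@eps_le _ _ _ (2 * Rint k)) => e e0.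
have [q qS qF] := kP e e0.
have h1 : rnorm (q.2 - l) <= Rint k * e by apply: lP => //; exists q.
have h2 : rnorm (q.2 - p.2) <= e * Rint k + Rint g.
  rewrite -Rint_lin//; apply: (vsimple_norm (vsimpleB qS pS)); first exact: RCc_lin.
  by move=> t /=; rewrite (le_trans (rnorm_tri (F t) _ _))// lerD// rnormB.
have := rnorm_tri q.2 l p.2; rewrite (rnormB l q.2); lra.
Qed.

Lemma vint_specP F : XCc F -> vint_spec F (vint F).
Proof. by move=> /vint_ex h; exact: (xgetPex 0 h). Qed.

Lemma vint_approx F : XCc F -> exists k : G -> R, [/\ RCc k, forall t, 0 <= k t &
  forall e : R, 0 < e -> exists p, [/\ lspan (vsimple X) p,
    forall t, rnorm (F t - p.1 t) <= e * k t & rnorm (vint F - p.2) <= e * Rint k]].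
Proof.
move=> cF; have [k [ck k0 kP]] := XCc_approx cF; exists k; split => // e /kP[p pS pF].
exists p; split => //; rewrite -Rint_scale//.
by apply: vint_specP => //; exact: RCc_scale.
Qed.

Lemma rnorm_vint F g : XCc F -> RCc g -> (forall t, rnorm (F t) <= g t) ->
  rnorm (vint F) <= Rint g.
Proof.
move=> cF cg Fg; have := vint_specP cF (lspan0 _) cg; rewrite subr0; apply.
by move=> t; rewrite subr0.
Qed.

Lemma vint_uniq F l (k : G -> R) : XCc F -> RCc k ->
  (forall e : R, 0 < e -> exists p, [/\ lspan (vsimple X) p,
    forall t, rnorm (F t - p.1 t) <= e * k t & rnorm (l - p.2) <= e * Rint k]) ->
  vint F = l.
Proof.
move=> cF ck h; apply: (@eps_eq _ _ (2 * Rint k)) => e e0.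
have [p [pS pF lp]] := h e e0.
have h1 : rnorm (vint F - p.2) <= e * Rint k.
  by rewrite -Rint_scale//; apply: vint_specP => //; exact: RCc_scale.
by have := rnorm_tri p.2 (vint F) l; rewrite (rnormB p.2 l); lra.
Qed.

Lemma XCc_lin (a : Cx R) F F' : XCc F -> XCc F' -> XCc (fun s => a *: F s + F' s).
Proof.
move=> [cf [K [cK K0]]] [cg [L [cL L0]]]; split.
  by move=> s; apply: cvgD; [apply: cvgZr; exact: cf|exact: cg].
exists (K `|` L); split; first exact: compactU.
by move=> s /not_orP[/K0 -> /L0 ->]; rewrite scaler0 addr0.
Qed.

Lemma vint_lin (a : Cx R) F F' : XCc F -> XCc F' ->
  vint (fun s => a *: F s + F' s) = a *: vint F + vint F'.
Proof.
move=> cF cF'; have [k [ck k0 kP]] := vint_approx cF; have [k' [ck' k0' kP']] := vint_approx cF'.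
apply: (@vint_uniq _ _ (fun t => cabs a * k t + k' t)); first exact: XCc_lin.
  exact: RCc_lin.
move=> e e0; have [p [pS pF ph]] := kP e e0; have [q [qS qF qh]] := kP' e e0.
exists (a *: p + q); split; first exact: lspan_lin.
- move=> t; rewrite -[(a *: p + q).1 t]/(a *: p.1 t + q.1 t) opprD addrACA -scalerBr.
  by rewrite (le_trans (rnormD _ _))// rnormZ mulrDr mulrCA lerD// ler_wpM2l ?cabs_ge0.
- rewrite -[(a *: p + q).2]/(a *: p.2 + q.2) opprD addrACA -scalerBr Rint_lin//.
  by rewrite (le_trans (rnormD _ _))// rnormZ mulrDr mulrCA lerD// ler_wpM2l ?cabs_ge0.
Qed.

(** One change of variables with density [c] covers two cases: left translation with $c=b=1$, and
    inversion with $c(t)=\Delta(t^{-1})$ and $b=1$. *)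
Lemma vint_map (f : G -> G) (c : G -> R) (b : R) F :
  (forall phi, RCc phi -> RCc (fun t => c t * phi (f t)) /\
     b * Rint (fun t => c t * phi (f t)) = Rint phi) ->
  (forall t, 0 <= c t) -> 0 < b ->
  XCc F -> XCc (fun t => ((c t)%:C%C : Cx R) *: F (f t)) ->
  (b%:C%C : Cx R) *: vint (fun t => ((c t)%:C%C : Cx R) *: F (f t)) = vint F.
Proof.
move=> fP c0 b0 cF cF'; have [k [ck k0 kP]] := vint_approx cF.
have [ck' kE] := fP _ ck.
suff -> : vint (fun t => ((c t)%:C%C : Cx R) *: F (f t)) = ((b^-1)%:C%C : Cx R) *: vint F.
  by rewrite scalerA -realCM divff ?scale1r// gt_eqF.
have bE (r : R) : Rint (fun t => c t * k (f t)) = b^-1 * Rint k.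
  by rewrite -kE mulKf// gt_eqF.
apply: (vint_uniq cF' ck') => e e0; have [p [pS pF ph]] := kP e e0.
pose L q : (G -> X) * X := ((fun t => ((c t)%:C%C : Cx R) *: q.1 (f t)), ((b^-1)%:C%C : Cx R) *: q.2).
have LL : linear L.
  move=> a x y; apply: injective_projections; rewrite /=; last first.
    by rewrite scalerDr !scalerA mulrC.
  apply/funext => t; rewrite -[RHS]/(a *: (((c t)%:C%C : Cx R) *: x.1 (f t)) + ((c t)%:C%C : Cx R) *: y.1 (f t)).
  by rewrite scalerDr !scalerA mulrC.
exists (L p); split.
- apply: (lspan_map LL) pS => _ [phi [x [cphi ->]]]; apply: lspan_in.
  have [h1 h2] := fP _ cphi; exists (fun t => c t * phi (f t)), x; split => //.
  congr (_, _); first by apply/funext => t /=; rewrite scalerA realCM.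
  by rewrite /= -h2 scalerA -realCM mulKf// gt_eqF.
- move=> t /=; rewrite -scalerBr rnormZ cabsC ger0_norm// mulrCA ler_wpM2l//.
- rewrite /= -scalerBr rnormZ cabsC ger0_norm ?invr_ge0 ?(ltW b0)// bE// mulrCA.
  by rewrite ler_wpM2l ?invr_ge0// ltW.
Qed.

Lemma XCc_comp F (h h' : G -> G) : XCc F -> continuous h -> continuous h' ->
  cancel h h' -> XCc (F \o h).
Proof.
move=> [cf [K [cK K0]]] ch ch' hK; split.
  by move=> s; apply: continuous_comp; [exact: ch|exact: cf].
exists (h' @` K); split.
  by apply: continuous_compact cK; exact: continuous_subspaceT.
by move=> s nK; apply: K0 => Ks; apply: nK; exists (h s) => //; rewrite hK.
Qed.

Lemma XCc_left t F : XCc F -> XCc (fun s => F (t * s)%g).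
Proof.
move=> cf; apply: (XCc_comp cf (@mulg_left_continuous _ t) (@mulg_left_continuous _ (t^-1)%g)).
exact: mulKg.
Qed.

Lemma XCc_right t F : XCc F -> XCc (fun s => F (s * t)%g).
Proof.
move=> cf; apply: (XCc_comp cf (@mulg_right_continuous _ t) (@mulg_right_continuous _ (t^-1)%g)).
exact: mulgK.
Qed.

Lemma XCc_inv F : XCc F -> XCc (fun s => F (s^-1)%g).
Proof.
by move=> cf; apply: (XCc_comp cf (@invg_continuous G) (@invg_continuous G)); exact: invgK.
Qed.

Lemma XCcZ (c : G -> Cx R) F : continuous c -> XCc F -> XCc (fun s => c s *: F s).
Proof.
move=> cc [cf [K [cK K0]]]; split.
  by move=> s; apply: cvgZ; [exact: cc|exact: cf].
by exists K; split => // s /K0 ->; rewrite scaler0.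
Qed.

Lemma vint_left t F : XCc F -> vint (fun s => F (t * s)%g) = vint F.
Proof.
move=> cF; have fP (phi : G -> R) : RCc phi -> RCc (fun s => 1 * phi (t * s)%g) /\
    1 * Rint (fun s => 1 * phi (t * s)%g) = Rint phi.
  move=> cphi; have -> : (fun s => 1 * phi (t * s)%g) = (fun s => phi (t * s)%g).
    by apply/funext => s; rewrite mul1r.
  by split; [exact: RCc_left|rewrite mul1r Rint_left].
have FE : (fun s => (1%:C%C : Cx R) *: F (t * s)%g) = (fun s => F (t * s)%g).
  by apply/funext => s; rewrite scale1r.
have := @vint_map (fun s => t * s)%g (fun=> 1) 1 F fP (fun=> ler01) ltr01 cF.
by rewrite FE scale1r; apply; exact: XCc_left.
Qed.

End VectorIntegral.
Arguments vsimple : clear implicits.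

Section VectorIntegralLinear.
Context {R : realType} {G : lcGroupType} (mu : haar R G).
Local Notation Rint := (Rint mu).

(* Real-linear maps include the conjugate-linear ones. *)
Definition rlinear (X Y : normedModType (Cx R)) (L : X -> Y) : Prop :=
  (forall x y, L (x + y) = L x + L y) /\
  forall (r : R) x, L ((r%:C%C : Cx R) *: x) = (r%:C%C : Cx R) *: L x.

Lemma linear_rlinear (X Y : normedModType (Cx R)) (L : X -> Y) : linear L -> rlinear L.
Proof. by move=> lL; split=> *; [exact: linearDf|exact: linearZf]. Qed.

Lemma rlinearB (X Y : normedModType (Cx R)) (L : X -> Y) x y : rlinear L ->
  L (x - y) = L x - L y.
Proof.
by move=> [lD lZ]; have := lZ (-1) y; rewrite realCN !scaleN1r lD => ->.
Qed.

Lemma XCc_linear (X Y : normedModType (Cx R)) (L : X -> Y) (M : R) (F : G -> X) :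
  rlinear L -> (forall x, rnorm (L x) <= M * rnorm x) -> XCc F -> XCc (fun s => L (F s)).
Proof.
move=> lL bL [cF [K [cK K0]]]; split.
  apply/ncontP => s e e0; have M0 : 0 < `|M| + 1 by rewrite ltr_wpDl.
  have /ncontP h := cF; apply: filterS (h s _ (divr_gt0 e0 M0)) => t /= ts.
  rewrite -rlinearB// (le_lt_trans (bL _))//.
  rewrite (@le_lt_trans _ _ ((`|M| + 1) * rnorm (F t - F s)))//.
    by rewrite ler_wpM2r ?rnorm_ge0//; have := ler_norm M; lra.
  by rewrite mulrC -ltr_pdivlMr.
exists K; split => // s /K0 ->.
by have := rlinearB 0 0 lL; rewrite !subrr.
Qed.

Lemma vint_linear (X Y : completeNormedModType (Cx R)) (L : X -> Y) (M : R) (F : G -> X) :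
  rlinear L -> (forall x, rnorm (L x) <= M * rnorm x) -> XCc F ->
  vint mu (fun s => L (F s)) = L (vint mu F).
Proof.
move=> lL bL cF; have [k [ck k0 kP]] := vint_approx mu cF.
have M0 : 0 <= `|M| by [].
have bL' x : rnorm (L x) <= `|M| * rnorm x.
  by rewrite (le_trans (bL x))// ler_wpM2r ?rnorm_ge0// ler_norm.
apply: (@vint_uniq _ _ mu _ _ _ (fun t => `|M| * k t)).
- exact: XCc_linear bL cF.
- exact: RCc_scale.
move=> e e0; have [p [pS pF ph]] := kP e e0.
pose L2 (q : (G -> X) * X) : (G -> Y) * Y := (L \o q.1, L q.2).
have [lD lZ] := lL.
exists (L2 p); split.
- clear pF ph; move: p pS; apply: lspan_ind.
    suff -> : L2 0 = 0 by exact: lspan0.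
    have L0 : L 0 = 0 by have := rlinearB 0 0 lL; rewrite !subrr.
    by apply: injective_projections; [apply/funext => t|]; exact: L0.
  move=> a _ y [phi [x [cphi ->]]] yS.
  set s := (X in L2 (a *: X + y)).
  have -> : L2 (a *: s + y) = 1 *: ((fun t => ((phi t)%:C%C : Cx R) *: L (a *: x)),
      ((Rint phi)%:C%C : Cx R) *: L (a *: x)) + L2 y.
    have LE (r : R) z : L (a *: ((r%:C%C : Cx R) *: x) + z) = r%:C%C *: L (a *: x) + L z.
      by rewrite lD scalerA mulrC -scalerA lZ.
    rewrite scale1r; apply: injective_projections; [apply/funext => t|]; exact: LE.
  by apply: lspan_lin => //; apply: lspan_in; exists phi, (L (a *: x)).
- by move=> t /=; rewrite -rlinearB// (le_trans (bL' _))// mulrCA ler_wpM2l.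
- by rewrite /= -rlinearB// (le_trans (bL' _))// Rint_scale// mulrCA ler_wpM2l.
Qed.

(** A scalar function is $i\,v\cdot1+u\cdot1$ with $u,v$ its real and imaginary parts, itself a
    simple combination, so the approximation error is 0. *)
Lemma hint_vint (f : G -> Cx R) : Cc f -> hint mu f = vint mu (X := Cx R) f.
Proof.
move=> cf; have [cf1 [K [cK K0]]] := cf.
have re (p : {additive R[i]%C -> R}) : (forall z : Cx R, `|p z| <= cabs z) ->
    RCc (fun s => p (f s : R[i]%C)).
  move=> pb; split; last by exists K; split => // s /K0 ->; rewrite raddf0.
  apply/rcontP => s e e0; have /(ncontP (X := Cx R)) /(_ s e e0) := cf1.
  by apply: filterS => t /= h; rewrite -raddfB (le_lt_trans (pb _)).
have cu := re (@complex.Re R) (@cabs_Re R).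
have cv := re (@complex.Im R) (@cabs_Im R).
set u := (fun s => complex.Re _) in cu; set v := (fun s => complex.Im _) in cv.
have fE : hint mu f = 'i%C * (Rint v)%:C%C + (Rint u)%:C%C.
  rewrite -!hint_real// -(hint_linear mu 'i%C (RCc_Cc cv) (RCc_Cc cu)).
  by congr hint; apply/funext => s; rewrite {1}(CxReIm (f s)) addrC mulrC.
apply/esym/(@vint_uniq _ _ mu (Cx R) f _ (fun=> 0)) => [//||e e0]; first exact: RCc0.
pose sv : (G -> Cx R) * Cx R := ((fun s => (v s)%:C%C *: (1 : Cx R)), (Rint v)%:C%C *: (1 : Cx R)).
pose su : (G -> Cx R) * Cx R := ((fun s => (u s)%:C%C *: (1 : Cx R)), (Rint u)%:C%C *: (1 : Cx R)).
exists ('i%C *: sv + su); split.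
- by apply: lspan_lin; apply: lspan_in; [exists v, 1|exists u, 1].
- move=> t; rewrite mulr0 (_ : ('i%C *: sv + su).1 t = f t) ?subrr ?rnorm0//.
  rewrite -[LHS]/('i%C * ((v t)%:C%C * 1) + (u t)%:C%C * 1) !mulr1 [RHS](CxReIm (f t)).
  by rewrite addrC mulrC.
- rewrite Rint0 mulr0 (_ : ('i%C *: sv + su).2 = hint mu f) ?subrr ?rnorm0//.
  by rewrite -[LHS]/('i%C * ((Rint v)%:C%C * 1) + (Rint u)%:C%C * 1) !mulr1 fE.
Qed.

End VectorIntegralLinear.

Section LocalSupport.
Context {R : realType} {G : lcGroupType} (mu : haar R G).

(* Jointly continuous families F s, with supports in a common compact set for s
   near any given point. *)
Definition locsupp (S : topologicalType) (X : normedModType (Cx R)) (F : S -> G -> X) : Prop :=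
  continuous (fun p : S * G => F p.1 p.2) /\
  forall s0 : S, exists K : set G, compact K /\ nbhs s0 [set s | forall t, ~ K t -> F s t = 0].

Lemma ncont2P (S : topologicalType) (X : normedModType (Cx R)) (F : S -> G -> X) :
  continuous (fun p : S * G => F p.1 p.2) -> forall s t (e : R), 0 < e ->
  exists A B, [/\ nbhs s A, nbhs t B &
    forall s' t', A s' -> B t' -> rnorm (F s' t' - F s t) < e].
Proof.
move=> cF s t e e0; have e1 : 0 < (e%:C%C : Cx R) by rewrite (ltCxR 0).
have /cvgrPdist_lt /(_ _ e1) [[A B] /= [nA nB] AB] := cF (s, t).
exists A, B; split => // s' t' As Bt; have := AB (s', t') (conj As Bt) => /=.
by rewrite rnormE ltCxR rnormB.
Qed.

(** Continuity at each point $(s_0,t)$ becomes uniform in [t] by compactness of the common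
    support. *)
Lemma locsupp_unif (S : topologicalType) (X : normedModType (Cx R)) (F : S -> G -> X) s0 (e : R) :
  locsupp F -> 0 < e -> nbhs s0 [set s | forall t, rnorm (F s t - F s0 t) < e].
Proof.
move=> [cF sF] e0; have [K [cK KP]] := sF s0.
have e2 : 0 < e / 2 by rewrite divr_gt0.
have /compact_near_coveringP h := cK.
have hn := h S (nbhs s0) (fun s t => rnorm (F s t - F s0 t) < e) (nbhs_filter s0).
have {}hn : nbhs s0 [set s | K `<=` fun t => rnorm (F s t - F s0 t) < e].
  apply: hn => t Kt; have [A [B [nA nB AB]]] := ncont2P cF s0 t e2.
  exists (B, A) => //= -[t' s'] /= [Bt As].
  have h1 := AB _ _ As Bt; have h2 := AB _ _ (nbhs_singleton nA) Bt.
  have := rnorm_tri (F s0 t) (F s' t') (F s0 t'); rewrite (rnormB (F s0 t)); lra.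
apply: filterS (filterI hn KP) => s [/= h1 h2] t.
have [Kt|nK] := pselect (K t); first exact: h1.
by rewrite h2// (nbhs_singleton KP)// subrr rnorm0.
Qed.

Lemma locsupp_XCc (S : topologicalType) (X : normedModType (Cx R)) (F : S -> G -> X) s :
  locsupp F -> XCc (F s).
Proof.
move=> [cF sF]; split.
  apply/ncontP => t e e0; have [A [B [nA nB AB]]] := ncont2P cF s t e0.
  by apply: filterS nB => t' Bt; apply: AB => //; exact: nbhs_singleton.
by have [K [cK /nbhs_singleton KP]] := sF s; exists K.
Qed.

Lemma locsupp_vint (S : topologicalType) (X : completeNormedModType (Cx R)) (F : S -> G -> X) :
  locsupp F -> continuous (fun s => vint mu (F s)).
Proof.
move=> lF; apply/ncontP => s0 e e0; have [_ /(_ s0)[K [cK KP]]] := lF.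
have [k [ck k01 kK _]] := @partition_of_unity R G K cK.
have k0 t : 0 <= k t by case/andP: (k01 t).
have I0 : 0 < Rint mu k + 1 by rewrite ltr_wpDl// Rint_ge0.
have e1 : 0 < e / (Rint mu k + 1) by rewrite divr_gt0.
apply: filterS (filterI (locsupp_unif s0 lF e1) KP) => s [/= h1 h2].
have -> : vint mu (F s) - vint mu (F s0) = vint mu (fun t => F s t - F s0 t).
  have := vint_lin mu (-1) (locsupp_XCc s0 lF) (locsupp_XCc s lF).
  rewrite scaleN1r addrC => <-; congr vint; apply/funext => t.
  by rewrite scaleN1r addrC.
rewrite (@le_lt_trans _ _ (Rint mu (fun t => e / (Rint mu k + 1) * k t)))//; last first.
  rewrite Rint_scale// mulrAC -mulrA gtr_pMr// ltr_pdivrMr// mul1r; lra.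
apply: rnorm_vint; last first.
- move=> t; have [Kt|nK] := pselect (K t); first by rewrite kK// mulr1 ltW.
  rewrite h2// (nbhs_singleton KP)// subrr rnorm0 mulr_ge0// ltW//.
- exact: RCc_scale.
have -> : (fun t => F s t - F s0 t) = (fun t => -1 *: F s0 t + F s t).
  by apply/funext => t; rewrite scaleN1r addrC.
by apply: XCc_lin; exact: locsupp_XCc.
Qed.

Lemma locsupp_comp (X : normedModType (Cx R)) (f : G -> X) (m m' : G -> G -> G) :
  continuous (fun p : G * G => m p.1 p.2) -> continuous (fun p : G * G => m' p.1 p.2) ->
  (forall s t, m' s (m s t) = t) -> XCc f -> locsupp (fun s t => f (m s t)).
Proof.
move=> cm cm' mK [cf [K [cK K0]]]; split.
  by move=> p; apply: (@continuous_comp _ _ _ (fun p : G * G => m p.1 p.2) f p); [exact: cm|exact: cf].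
move=> s0; have [W sW [cW _]] := @lcg_locally_compact G s0 Logic.I.
rewrite withinET in sW.
exists ((fun p : G * G => m' p.1 p.2) @` (W `*` K)); split.
  apply: continuous_compact; first exact: continuous_subspaceT.
  exact: compact_setX.
apply: filterS sW => s Ws t /= nt; apply: K0 => Kt; apply: nt.
by exists (s, m s t) => //=.
Qed.

Lemma locsupp_scale (S : topologicalType) (X : normedModType (Cx R)) (c : S -> G -> Cx R)
    (F : S -> G -> X) : continuous (fun p : S * G => c p.1 p.2) -> locsupp F ->
  locsupp (fun s t => c s t *: F s t).
Proof.
move=> cc [cF sF]; split.
  by move=> p; apply: cvgZ; [exact: cc|exact: cF].
move=> s0; have [K [cK KP]] := sF s0; exists K; split => //.
by apply: filterS KP => s h t /h ->; rewrite scaler0.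
Qed.

Lemma locsupp_cst (S : topologicalType) (X : normedModType (Cx R)) (f : G -> X) :
  XCc f -> locsupp (fun _ : S => f).
Proof.
move=> [cf [K [cK K0]]]; split.
  by move=> p; apply: (@continuous_comp _ _ _ snd f p); [exact: cvg_snd|exact: cf].
by move=> s0; exists K; split => //; apply: filterE => s.
Qed.

Lemma mulg_continuous2 (S : topologicalType) (f g : S -> G) : continuous f -> continuous g ->
  continuous (fun p => f p * g p)%g.
Proof.
move=> cf cg p; apply: (@continuous_comp _ _ _ (fun p => (f p, g p))
    (fun p : G * G => (p.1 * p.2)%g) p); last exact: mulg_continuous.
by apply: cvg_pair; [exact: cf|exact: cg].
Qed.

Lemma invg_continuous2 (S : topologicalType) (f : S -> G) : continuous f ->
  continuous (fun p => (f p)^-1)%g.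
Proof.
by move=> cf p; apply: (@continuous_comp _ _ _ f (fun s => s^-1)%g p); [exact: cf|exact: invg_continuous].
Qed.

Lemma fst_continuous (S S' : topologicalType) : continuous (@fst S S').
Proof. by move=> p; exact: cvg_fst. Qed.
Lemma snd_continuous (S S' : topologicalType) : continuous (@snd S S').
Proof. by move=> p; exact: cvg_snd. Qed.

Lemma locsupp_right (X : normedModType (Cx R)) (f : G -> X) : XCc f ->
  locsupp (fun s t => f (t * s)%g).
Proof.
move=> cf; apply: (locsupp_comp (m' := fun s t => t * s^-1)%g _ _ _ cf).
- by apply: mulg_continuous2; [exact: snd_continuous|exact: fst_continuous].
- apply: mulg_continuous2; [exact: snd_continuous|apply: invg_continuous2; exact: fst_continuous].
- by move=> s t; rewrite mulgK.
Qed.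

Lemma locsupp_left (X : normedModType (Cx R)) (f : G -> X) : XCc f ->
  locsupp (fun s t => f (s^-1 * t)%g).
Proof.
move=> cf; apply: (locsupp_comp (m' := fun s t => s * t)%g _ _ _ cf).
- apply: mulg_continuous2; [apply: invg_continuous2; exact: fst_continuous|exact: snd_continuous].
- by apply: mulg_continuous2; [exact: fst_continuous|exact: snd_continuous].
- by move=> s t; rewrite mulVKg.
Qed.

End LocalSupport.

(** * Modular function, convolution and inversion *)

Section Modular.
Context {R : realType} {G : lcGroupType} (mu : haar R G).
Implicit Types (f g : G -> Cx R).

Lemma Cc_neq0 : exists2 f, Cc f & hint mu f != 0.
Proof. by have [f [cf f0]] := hint_neq0 mu; exists f. Qed.

Lemma Cc_right t f : Cc f -> Cc (fun s => f (s * t)%g).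
Proof. exact: (@XCc_right R G (Cx R)). Qed.

Lemma Cc_left t f : Cc f -> Cc (fun s => f (t * s)%g).
Proof. exact: (@XCc_left R G (Cx R)). Qed.

Lemma modular_neq0 t : modular mu t != 0.
Proof. by rewrite gt_eqF// modular_gt0. Qed.

Lemma modularM s t : modular mu (s * t)%g = modular mu s * modular mu t.
Proof.
have [f cf f0] := Cc_neq0; have h1 := hint_right mu (s * t)%g cf.
have h2 := hint_right mu t cf.
have h3 := hint_right mu s (Cc_right t cf).
have f1 : hint mu (fun r => f (r * (s * t))%g) != 0.
  by apply: contra_neq f0 => e; rewrite -h1 e mulr0.
apply: (mulIf f1); rewrite h1 -h2 -h3 mulrCA mulrA; congr (_ * hint _ _).
by apply/funext => r; rewrite mulgA.
Qed.

Lemma modular1 : modular mu 1%g = 1.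
Proof.
by apply: (mulIf (modular_neq0 1%g)); rewrite -modularM mulg1 mul1r.
Qed.

Lemma modularV t : modular mu (t^-1)%g = (modular mu t)^-1.
Proof.
by apply: (mulIf (modular_neq0 t)); rewrite -modularM mulVg modular1 mulVf ?modular_neq0.
Qed.

(** $\Delta(t)$ is the integral of $f$ divided by that of its right translate, and the latter
    depends continuously on [t]. *)
Lemma modular_continuous : continuous (modular mu).
Proof.
have [f cf f0] := Cc_neq0.
pose h t := vint mu (X := Cx R) (fun s => f (s * t)%g).
have ch : continuous h by apply: locsupp_vint; exact: (@locsupp_right R G (Cx R)).
have hE t : modular mu t * h t = hint mu f.
  by rewrite -[RHS](hint_right mu t cf) (hint_vint mu (Cc_right t cf)).
have h0 t : h t != 0 by apply: contra_neq f0 => e; rewrite -(hE t) e mulr0.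
have -> : modular mu = fun t => hint mu f * (h t)^-1.
  by apply/funext => t; rewrite -(hE t) mulfK.
by move=> t; apply: cvgM; [exact: cvg_cst|apply: cvgV; [exact: h0|exact: ch]].
Qed.

Lemma Cc_inv f : Cc f -> Cc (fun s => modular mu (s^-1)%g * f (s^-1)%g).
Proof.
move=> cf; apply: (@XCcZ R G (Cx R)); last exact: (@XCc_inv R G (Cx R)).
by move=> s; apply: (@continuous_comp _ _ _ (fun s : G => s^-1)%g (modular mu) s);
  [exact: invg_continuous|exact: modular_continuous].
Qed.

Lemma Cc_conj f : Cc f -> Cc (fun s => Num.conj (f s)).
Proof.
move=> [cf [K [cK K0]]]; split; last by exists K; split => // s /K0 ->; rewrite conjC0.
apply/(ncontP (X := Cx R)) => s e e0; have /(ncontP (X := Cx R)) h := cf.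
by apply: filterS (h s e e0) => t /=; rewrite !rnormC -rmorphB cabs_conj.
Qed.

Lemma Cc_invol f : Cc f -> Cc (invol mu f).
Proof. by move=> cf; apply: (Cc_inv (Cc_conj cf)). Qed.

Lemma Cc_C0 f : Cc f -> f \in @C0_pred R G.
Proof.
move=> [cf [K [cK K0]]]; apply/asboolP; split => // e e0.
by exists K; split => // s /K0 ->; rewrite normr0.
Qed.

Lemma Cc_lin (a : Cx R) f g : Cc f -> Cc g -> Cc (fun s => a * f s + g s).
Proof. exact: (@XCc_lin R G (Cx R) a f g). Qed.

Lemma Cc0 : Cc (fun _ : G => 0 : Cx R).
Proof. exact: (RCc_Cc (@RCc0 R G)). Qed.

Lemma hint0 : hint mu (fun=> 0) = 0.
Proof. by rewrite (hint_real mu (@RCc0 R G)) Rint0. Qed.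

Lemma CcM_cont f g : continuous g -> Cc f -> Cc (fun s => g s * f s).
Proof. exact: (@XCcZ R G (Cx R)). Qed.

Lemma hintZ (a : Cx R) f : Cc f -> hint mu (fun s => a * f s) = a * hint mu f.
Proof.
move=> cf; have := hint_linear mu a cf Cc0; rewrite hint0 addr0 => <-.
by congr hint; apply/funext => s; rewrite addr0.
Qed.

End Modular.

Section Convolution.
Context {R : realType} {G : lcGroupType} (mu : haar R G).
Implicit Types (f g : G -> Cx R).
Local Notation Rint := (Rint mu).

Lemma C0_subE (f g : C0 R G) s : (f - g) s = f s - g s.
Proof. by rewrite -scaleN1r addrC C0_lin mulN1r addrC. Qed.

Lemma CcM_l f g : Cc f -> continuous g -> Cc (fun s => f s * g s).
Proof.
move=> cf cg; have -> : (fun s => f s * g s) = (fun s => g s * f s).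
  by apply/funext => s; rewrite mulrC.
exact: CcM_cont.
Qed.

Lemma vint0 (X : completeNormedModType (Cx R)) : vint mu (fun=> 0 : X) = 0.
Proof.
apply/rnorm_eq0/eqP; rewrite eq_le rnorm_ge0 andbT -(Rint0 mu).
apply: rnorm_vint => [|//|t]; last by rewrite rnorm0.
  by split; [move=> s; exact: cvg_cst|exists set0; split => //; exact: compact0].
exact: RCc0.
Qed.

(* The cutoff k stands for a fixed compact support. *)
Definition cc_linear (X : completeNormedModType (Cx R)) (L : (G -> Cx R) -> X) : Prop :=
  (forall (a : Cx R) f g, Cc f -> Cc g -> L (fun s => a * f s + g s) = a *: L f + L g) /\
  forall k : G -> R, RCc k -> exists M : R,
    forall h : C0 R G, rnorm (L (fun s => h s * (k s)%:C%C)) <= M * rnorm h.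

Lemma cc_linearZ (X : completeNormedModType (Cx R)) (L : (G -> Cx R) -> X) (a : Cx R) f :
  cc_linear L -> Cc f -> L (fun s => a * f s) = a *: L f.
Proof.
move=> [lL _] cf; have L0 : L (fun=> 0) = 0.
  have := lL 1 _ _ (@Cc0 R G) (@Cc0 R G); rewrite scale1r.
  under eq_fun do rewrite mulr0 addr0.
  by move=> /eqP; rewrite -subr_eq0 opprD addNKr oppr_eq0 => /eqP.
by rewrite -[RHS]addr0 -L0 -lL//; [congr L; apply/funext => s; rewrite addr0|exact: Cc0].
Qed.

(* The integral over s is taken in C_0(G); L is bounded there after a cutoff. *)
Lemma cc_linear_vint (X : completeNormedModType (Cx R)) (L : (G -> Cx R) -> X)
    (F : G -> G -> Cx R) (K1 K2 : set G) : cc_linear L ->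
  locsupp (X := Cx R) F -> compact K1 -> compact K2 ->
  (forall s t, ~ (K1 s /\ K2 t) -> F s t = 0) ->
  XCc (fun s => L (F s)) /\
  L (fun t => vint mu (X := Cx R) (fun s => F s t)) = vint mu (fun s => L (F s)).
Proof.
move=> [lL bL] lF cK1 cK2 F0.
pose P s : C0 R G := MkC0 (Cc_C0 (locsupp_XCc s lF)).
have cP : XCc P.
  split.
    apply/ncontP => s e e0; have e2 : 0 < e / 2 by rewrite divr_gt0.
    apply: filterS (locsupp_unif s lF e2) => t /= h.
    suff : rnorm (P t - P s) <= e / 2 by lra.
    by apply: rnorm_C0_le => r; rewrite C0_subE /=; exact/ltW/h.
  exists K1; split => // s nK; apply: C0_eq => t /=.
  by apply: F0 => -[].
have [k [ck k01 kK _]] := @partition_of_unity R G K2 cK2.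
have [M LM] := bL k ck.
pose L' (h : C0 R G) : X := L (fun s => h s * (k s)%:C%C).
have cc (h : C0 R G) : Cc (fun s => h s * (k s)%:C%C).
  by apply: CcM_cont; [exact: C0_cont|exact: RCc_Cc].
have lL' : linear L'.
  move=> a x y; rewrite /L' -lL//; congr L; apply/funext => s.
  by rewrite C0_lin mulrDl mulrA.
have LP s : L' (P s) = L (F s).
  congr L; apply/funext => t /=; have [Kt|nK] := pselect (K2 t).
    by rewrite kK// mulr1.
  by rewrite F0 ?mul0r// => -[].
pose Q := vint mu P; have QE t : Q t = vint mu (X := Cx R) (fun s => F s t).
  rewrite -[LHS](@vint_linear R G mu (C0 R G) (Cx R) (fun h : C0 R G => h t) 1 P) //.
  by move=> x; rewrite mul1r; exact: C0_cabs.
have -> : (fun s => L (F s)) = L' \o P by apply/funext => s; rewrite /= LP.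
split; first exact: (XCc_linear (linear_rlinear lL') LM cP).
rewrite (vint_linear mu (linear_rlinear lL') LM cP) -/Q; congr L; apply/funext => t.
rewrite -QE; have [Kt|nK] := pselect (K2 t); first by rewrite kK// mulr1.
rewrite QE; have -> : (fun s => F s t) = fun=> 0.
  by apply/funext => s; apply: F0 => -[].
by rewrite (@vint0 (Cx R)) mul0r.
Qed.

Lemma mul_compact (K L : set G) : compact K -> compact L ->
  compact [set (p.1 * p.2)%g | p in K `*` L].
Proof.
move=> cK cL; apply: continuous_compact; last exact: compact_setX.
by apply: continuous_subspaceT; exact: mulg_continuous.
Qed.

Let conv_cc f g t : Cc f -> Cc g -> Cc (fun s => f s * g (s^-1 * t)%g).
Proof.
move=> cf [cg _]; apply: (@CcM_l f (fun s => g (s^-1 * t)%g) cf) => s.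
apply: (@continuous_comp _ _ _ (fun s => s^-1)%g (fun s => g (s * t)%g) s).
  exact: invg_continuous.
apply: (@continuous_comp _ _ _ (fun s => s * t)%g g); last exact: cg.
exact: mulg_right_continuous.
Qed.

Lemma convE f g t : Cc f -> Cc g ->
  conv mu f g t = vint mu (X := Cx R) (fun s => f s * g (s^-1 * t)%g).
Proof. by move=> cf cg; rewrite /conv hint_vint//; exact: conv_cc. Qed.

(** Viewed as $\int f(s)\,\lambda_sg\,ds$, a convolution passes through every [L] of this kind.
    Multiplicativity of integrated forms ([act_conv]) and the inversion formula [hint_inv] both rest
    on this. *)
Lemma cc_linear_conv (X : completeNormedModType (Cx R)) (L : (G -> Cx R) -> X) f g :
  cc_linear L -> Cc f -> Cc g ->
  XCc (fun s => f s *: L (fun t => g (s^-1 * t)%g)) /\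
  L (conv mu f g) = vint mu (fun s => f s *: L (fun t => g (s^-1 * t)%g)).
Proof.
move=> lL cf cg; have [_ [Kf [cKf Kf0]]] := cf; have [_ [Kg [cKg Kg0]]] := cg.
have lF : locsupp (X := Cx R) (fun s t => f s * g (s^-1 * t)%g).
  apply: (@locsupp_scale R G G (Cx R) (fun s _ => f s)); last exact: (@locsupp_left R G (Cx R)).
  by move=> p; apply: (@continuous_comp _ _ _ fst f p); [exact: cvg_fst|case: cf => + _; apply].
have [|h1 h2] := cc_linear_vint lL lF cKf (mul_compact cKf cKg).
  move=> s t h; have [Ks|/Kf0 ->] := pselect (Kf s); last by rewrite mul0r.
  rewrite Kg0 ?mulr0// => Kt; apply: h; split => //.
  by exists (s, (s^-1 * t)%g) => //=; rewrite mulVKg.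
have E : (fun s => L (fun t => f s * g (s^-1 * t)%g)) =
    (fun s => f s *: L (fun t => g (s^-1 * t)%g)).
  by apply/funext => s; rewrite cc_linearZ//; exact: Cc_left.
rewrite -E; split => //; rewrite -h2; congr L; apply/funext => t; exact: convE.
Qed.

Lemma Cc_conv f g : Cc f -> Cc g -> Cc (conv mu f g).
Proof.
move=> cf cg; have [_ [Kf [cKf Kf0]]] := cf; have [cg1 [Kg [cKg Kg0]]] := cg.
have -> : conv mu f g = fun t => vint mu (X := Cx R) (fun s => f s * g (s^-1 * t)%g).
  by apply/funext => t; exact: convE.
split.
  apply: locsupp_vint.
  have -> : (fun t s => f s * g (s^-1 * t)%g) = (fun t s => g (s^-1 * t)%g * f s).
    by apply/funext => t; apply/funext => s; rewrite mulrC.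
  apply: (@locsupp_scale R G G (Cx R)); last exact: (@locsupp_cst R G G (Cx R)).
  move=> p; apply: (@continuous_comp _ _ _ (fun p : G * G => p.2^-1 * p.1)%g g p); last exact: cg1.
  apply: mulg_continuous2; last exact: fst_continuous.
  apply: invg_continuous2; exact: snd_continuous.
exists [set (p.1 * p.2)%g | p in Kf `*` Kg]; split; first exact: mul_compact.
move=> t nt; rewrite (_ : (fun s => _) = fun=> 0) ?(@vint0 (Cx R))//.
apply/funext => s; have [Ks|/Kf0 ->] := pselect (Kf s); last by rewrite mul0r.
rewrite Kg0 ?mulr0// => Kt; apply: nt.
by exists (s, (s^-1 * t)%g) => //=; rewrite mulVKg.
Qed.

Lemma Cc_cabs f : Cc f -> RCc (fun s => cabs (f s)).
Proof.
move=> [cf [K [cK K0]]]; split; last by exists K; split => // s /K0 ->; rewrite cabs0.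
by move=> s; apply: continuous_comp; [exact: cf|exact: cabs_continuous].
Qed.

Lemma norm1E f : Cc f -> norm1 mu f = (Rint (fun s => cabs (f s)))%:C%C.
Proof. by move=> /Cc_cabs cf; rewrite -hint_real. Qed.

Lemma cc_linear_norm1 (X : completeNormedModType (Cx R)) (L : (G -> Cx R) -> X) :
  (forall (a : Cx R) f g, Cc f -> Cc g -> L (fun s => a * f s + g s) = a *: L f + L g) ->
  (forall f, Cc f -> rnorm (L f) <= Rint (fun s => cabs (f s))) -> cc_linear L.
Proof.
move=> lL bL; split => // k ck; exists (Rint (fun s => `|k s|)) => h.
have cc : Cc (fun s => h s * (k s)%:C%C) by apply: CcM_cont; [exact: C0_cont|exact: RCc_Cc].
have ca := RCc_norm ck.
rewrite (le_trans (bL _ cc))// mulrC -Rint_scale//.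
apply: Rint_mono; [exact: Cc_cabs|exact: RCc_scale|move=> s].
by rewrite cabsM cabsC ler_wpM2r// C0_cabs.
Qed.

Lemma cabs_hint f : Cc f -> cabs (hint mu f) <= Rint (fun s => cabs (f s)).
Proof.
move=> cf; rewrite hint_vint//; apply: (@rnorm_vint R G mu (Cx R)) => //.
exact: Cc_cabs.
Qed.

Let J f := hint mu (fun s => modular mu (s^-1)%g * f (s^-1)%g).

Let J_left t f : Cc f -> J (fun s => f (t^-1 * s)%g) = J f.
Proof.
move=> cf; rewrite /J -(hint_right mu t (Cc_inv mu cf)) -hintZ; last exact: (Cc_right t (Cc_inv mu cf)).
congr hint; apply/funext => s; rewrite invgM modularM !mulrA (modularV mu t).
by rewrite divff ?mul1r// modular_neq0.
Qed.

Let J_right t f : Cc f -> J (fun s => f (s * t)%g) = modular mu (t^-1)%g * J f.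
Proof.
move=> cf; rewrite /J -(hint_left mu (t^-1)%g (Cc_inv mu cf)) -hintZ; last exact: (Cc_left (t^-1)%g (Cc_inv mu cf)).
congr hint; apply/funext => s; rewrite invgM invgK modularM (modularV mu t).
by rewrite [modular mu _ * modular mu t]mulrC !mulrA mulVf ?mul1r// modular_neq0.
Qed.

Let J_cc_linear : cc_linear (X := Cx R) J.
Proof.
split=> [a f g cf cg|k ck].
  rewrite /J -(hint_linear mu a (Cc_inv mu cf) (Cc_inv mu cg)); congr hint.
  by apply/funext => s; rewrite mulrDr mulrCA.
exists (Rint (fun s => cabs (modular mu (s^-1)%g * (k (s^-1)%g)%:C%C))) => h.
have cm := Cc_cabs (Cc_inv mu (RCc_Cc ck)).
have cc : Cc (fun s => h s * (k s)%:C%C) by apply: CcM_cont; [exact: C0_cont|exact: RCc_Cc].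
rewrite rnormC (le_trans (cabs_hint (Cc_inv mu cc)))// mulrC -Rint_scale//.
apply: Rint_mono; [exact: (Cc_cabs (Cc_inv mu cc))|exact: RCc_scale|move=> s].
by rewrite mulrCA (cabsM (h _)) ler_wpM2r ?cabs_ge0// C0_cabs.
Qed.

(* The functional J on the left-hand side is left invariant; evaluating it on
   f * g by integrating out either variable gives I(f) J(g) = J(g) J(f). *)
Lemma hint_inv f : Cc f ->
  hint mu (fun s => modular mu (s^-1)%g * f (s^-1)%g) = hint mu f.
Proof.
move=> cf; rewrite -/(J f).
have [g0 cg0 g00] := Cc_neq0 mu.
(* The substitution defining [J] is an involution, so $J(g)$ is the nonzero integral of [g0]. *)
pose g s := modular mu (s^-1)%g * g0 (s^-1)%g; have cg : Cc g by exact: Cc_inv.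
have Jg : J g != 0.
  suff -> : J g = hint mu g0 by [].
  congr hint; apply/funext => s; rewrite /g invgK mulrA -modularM mulVg modular1.
  by rewrite mul1r.
apply: (mulIf Jg).
have [_ h1] := cc_linear_conv J_cc_linear cf cg.
have h2 : J (conv mu f g) = hint mu f * J g.
  rewrite h1; have -> : (fun s => f s *: J (fun t => g (s^-1 * t)%g)) = fun s => J g * f s.
    by apply/funext => s; rewrite J_left// mulrC.
  have cJ : Cc (fun s => J g * f s).
    by have := Cc_lin (J g) cf (@Cc0 R G); under eq_fun do rewrite addr0.
  by rewrite -(hint_vint mu cJ) (hintZ mu (J g) cf) mulrC.
rewrite -h2; have [_ [Kf [cKf Kf0]]] := cf; have [cg1 [Kg [cKg Kg0]]] := cg.
(* The convolution integrand after the substitution $s\mapsto ts$, so that [t] enters through a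
   right translate of [f]. *)
pose F s t := g (s^-1)%g * f (t * s)%g.
have convF : conv mu f g = fun t => vint mu (X := Cx R) (fun s => F s t).
  apply/funext => t; rewrite /conv -(hint_left mu t (conv_cc t cf cg)) hint_vint; last first.
    exact: (Cc_left t (conv_cc t cf cg)).
  by congr vint; apply/funext => s; rewrite /F invgM -mulgA mulVg mulg1 mulrC.
have lF : locsupp (X := Cx R) F.
  apply: (@locsupp_scale R G G (Cx R) (fun s _ => g (s^-1)%g)); last exact: (@locsupp_right R G (Cx R)).
  move=> p; apply: (@continuous_comp _ _ _ (fun p : G * G => p.1^-1)%g g p); last exact: cg1.
  apply: invg_continuous2; exact: fst_continuous.
have cKi : compact ((fun s => s^-1)%g @` Kg).
  by apply: continuous_compact cKg; apply: continuous_subspaceT; exact: invg_continuous.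
have [|_] := cc_linear_vint J_cc_linear lF cKi (mul_compact cKf cKg).
  move=> s t h; rewrite /F; have [Ks|/Kg0 ->] := pselect (Kg (s^-1)%g); last by rewrite mul0r.
  rewrite Kf0 ?mulr0// => Kt; apply: h; split; first by exists (s^-1)%g; rewrite ?invgK.
  by exists ((t * s)%g, (s^-1)%g) => //=; rewrite mulgK.
rewrite -convF => ->.
have cJ : Cc (fun s => J f * (modular mu (s^-1)%g * g (s^-1)%g)).
  by have := Cc_lin (J f) (Cc_inv mu cg) (@Cc0 R G); under eq_fun do rewrite addr0.
have -> : (fun s => J (F s)) = fun s => J f * (modular mu (s^-1)%g * g (s^-1)%g).
  apply/funext => s; rewrite (cc_linearZ (g (s^-1)%g) J_cc_linear (Cc_right s cf)).
  have mulCC (a b c : Cx R) : a * (b * c) = c * (b * a) by ring.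
  by rewrite (J_right s cf); exact: mulCC.
by rewrite -(hint_vint mu cJ) (hintZ mu (J f) (Cc_inv mu cg)).
Qed.

Lemma Rint_inv (f : G -> R) : RCc f ->
  RCc (fun s => modR mu (s^-1)%g * f (s^-1)%g) /\
  Rint (fun s => modR mu (s^-1)%g * f (s^-1)%g) = Rint f.
Proof.
move=> cf; have cr : RCc (fun s => modR mu (s^-1)%g * f (s^-1)%g).
  have -> : (fun s => modR mu (s^-1)%g * f (s^-1)%g) = (fun s => f (s^-1)%g * modR mu (s^-1)%g).
    by apply/funext => s; rewrite mulrC.
  apply: RCcM_l; first exact: RCc_inv.
  apply/realC_continuous; under eq_fun do rewrite -modularE.
  by move=> s; apply: (@continuous_comp _ _ _ (fun s : G => s^-1)%g (modular mu) s);
    [exact: invg_continuous|exact: modular_continuous].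
split => //; apply: realC_inj; rewrite -!hint_real// -(hint_inv (RCc_Cc cf)).
by congr hint; apply/funext => s; rewrite realCM -modularE.
Qed.

Lemma vint_inv (X : completeNormedModType (Cx R)) (F : G -> X) : XCc F ->
  vint mu (fun s => modular mu (s^-1)%g *: F (s^-1)%g) = vint mu F.
Proof.
move=> cF.
have fP (phi : G -> R) : RCc phi -> RCc (fun s => modR mu (s^-1)%g * phi (s^-1)%g) /\
    1 * Rint (fun s => modR mu (s^-1)%g * phi (s^-1)%g) = Rint phi.
  by move=> cphi; rewrite mul1r; exact: Rint_inv.
have := @vint_map R G mu X (fun s => s^-1)%g (fun s => modR mu (s^-1)%g) 1 F fP
  (fun s => ltW (modR_gt0 mu _)) ltr01 cF.
under eq_fun do rewrite -modularE.
rewrite scale1r; apply; apply: XCcZ; last exact: XCc_inv.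
by move=> s; apply: (@continuous_comp _ _ _ (fun s : G => s^-1)%g (modular mu) s);
  [exact: invg_continuous|exact: modular_continuous].
Qed.

End Convolution.

(** * Unitary representations and group C*-algebras *)

Section UnitaryRep.
Context {R : realType} {G : lcGroupType} (mu : haar R G).
Context {X : completeNormedModType (Cx R)} {Y : completeNormedModType (Cx R)}
  {f : innerform X Y}.
Local Notation Rint := (Rint mu).

Definition unitary_rep (U : G -> adj f) : Prop :=
  [/\ forall s t, U (s * t)%g = U s * U t, forall s, aswap (U s) * U s = 1 &
      forall x, continuous (fun s => U s x)].

Context (U : G -> adj f) (hU : unitary_rep U).

Let UM s t x : U (s * t)%g x = U s (U t x).
Proof. by case: hU => -> . Qed.

Lemma unitary_rep1 : U 1%g = 1.
Proof.
case: hU => hM hu _; rewrite -[LHS]mul1r -(hu 1%g) -mulrA -hM mulg1.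
by rewrite hu.
Qed.

Lemma unitary_rep_star s : aswap (U s) = U (s^-1)%g.
Proof.
case: hU => hM hu _; rewrite -[LHS]mulr1 -unitary_rep1 -(mulgV s) hM mulrA hu.
by rewrite mul1r.
Qed.

Lemma rnorm_unitary_rep s x : rnorm (U s x) <= rnorm x.
Proof.
case: hU => _ hu _.
have h : rnorm (U s) <= 1.
  rewrite -(@ler_pXn2r _ 2%N)// ?nnegrE ?rnorm_ge0// -arnorm_star hu expr1n.
  exact: arnorm1.
by rewrite (le_trans (rnorm_afun _ _))// ler_piMl// rnorm_ge0.
Qed.

Lemma XCc_act (h : G -> Cx R) x : Cc h -> XCc (fun s => h s *: U s x).
Proof.
case: hU => _ _ cU [ch [K [cK K0]]]; split.
  by move=> s; apply: cvgZ; [exact: ch|exact: cU].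
by exists K; split => // s /K0 ->; rewrite scale0r.
Qed.

Definition act (h : G -> Cx R) (x : X) : X := vint mu (fun s => h s *: U s x).

Lemma act_linear h : Cc h -> linear (act h).
Proof.
move=> ch a x y; rewrite /act -vint_lin; [|exact: XCc_act..]; congr vint.
by apply/funext => s; rewrite afun_linear scalerDr !scalerA mulrC.
Qed.

Lemma act_lin a h g x : Cc h -> Cc g ->
  act (fun s => a * h s + g s) x = a *: act h x + act g x.
Proof.
move=> ch cg; rewrite /act -vint_lin; [|exact: XCc_act..]; congr vint.
by apply/funext => s; rewrite scalerDl scalerA.
Qed.

Lemma rnorm_act h x : Cc h -> rnorm (act h x) <= Rint (fun s => cabs (h s)) * rnorm x.
Proof.
move=> ch; rewrite mulrC -Rint_scale; last exact: Cc_cabs.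
apply: rnorm_vint; [exact: XCc_act|apply: RCc_scale; exact: Cc_cabs|move=> s].
by rewrite rnormZ mulrC ler_wpM2r ?cabs_ge0// rnorm_unitary_rep.
Qed.

Lemma act_cc_linear x : cc_linear (fun h => act h x).
Proof.
split=> [a h g|k ck]; first exact: act_lin.
have ca := RCc_norm ck.
exists (Rint (fun s => `|k s|) * rnorm x) => h.
have cc : Cc (fun s => h s * (k s)%:C%C) by apply: CcM_cont; [exact: C0_cont|exact: RCc_Cc].
rewrite (le_trans (rnorm_act x cc))// mulrAC ler_wpM2r ?rnorm_ge0// mulrC -Rint_scale//.
apply: Rint_mono; [exact: Cc_cabs|exact: RCc_scale|move=> s].
by rewrite cabsM cabsC ler_wpM2r// C0_cabs.
Qed.

Lemma act_translate s h x : Cc h -> act (fun t => h (s^-1 * t)%g) x = U s (act h x).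
Proof.
move=> ch; rewrite /act -(vint_linear mu (linear_rlinear (@afun_linear _ _ _ _ (U s))) (rnorm_afun (U s))); last exact: XCc_act.
rewrite -(vint_left mu s (XCc_act x (Cc_left (s^-1)%g ch))); congr vint.
by apply/funext => t; rewrite mulKg UM (linearZf _ _ (@afun_linear _ _ _ _ (U s))).
Qed.

Lemma act_conv h g x : Cc h -> Cc g -> act (conv mu h g) x = act h (act g x).
Proof.
move=> ch cg; have [_ ->] := cc_linear_conv mu (act_cc_linear x) ch cg.
by congr vint; apply/funext => s; rewrite act_translate.
Qed.

(** Inverting the variable of integration produces the factor $\Delta(s^{-1})$, exactly the one in
    [invol]. *)
Lemma act_adj h x y : Cc h -> f (act h x) y = f x (act (invol mu h) y).
Proof.
move=> ch.
rewrite -(vint_linear mu (L := fun z => f z y) (M := rnorm y)); last exact: XCc_act.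
- rewrite -(vint_linear mu (L := f x) (M := rnorm x)); last exact/XCc_act/Cc_invol.
  + rewrite -vint_inv; last first.
      apply: (@XCc_linear R G X Y (fun z => f z y) (rnorm y)); last exact: XCc_act.
        split=> [u v|r u]; first by rewrite -[u]scale1r fm_conj conjC1 !scale1r.
        by rewrite fmZl conj_realC.
      by move=> u; rewrite mulrC fm_bound.
    congr vint; apply/funext => s; rewrite /invol (linearZf _ _ (@fm_lin _ _ _ f x)).
    rewrite fmZl scalerA -(unitary_rep_star s); congr (_ *: _).
    exact: adjP'.
  + exact/linear_rlinear/fm_lin.
  + by move=> u; exact: fm_bound.
- split=> [u v|r u]; first by rewrite -[u]scale1r fm_conj conjC1 !scale1r.
  by rewrite fmZl conj_realC.
- by move=> u; rewrite mulrC fm_bound.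
Qed.

Lemma invol_invol h : invol mu (invol mu h) = h.
Proof.
apply/funext => s; rewrite /invol invgK cconjM conjCK mulrA.
by rewrite (modularE mu s) conj_realC -(modularE mu s) -modularM mulVg modular1 mul1r.
Qed.

Lemma act_hom : exists psi : (G -> Cx R) -> adj_cstar f, L1_hom mu psi /\
  forall h x, Cc h -> (psi h : adj f) x = act h x.
Proof.
have /choice[psi psiE] : forall h, exists T : adj f, Cc h -> forall x, T x = act h x.
  move=> h; have [ch|nc] := pselect (Cc h); last by exists 0.
  have P x y : f (act h x) y = f x (act (invol mu h) y) by exact: act_adj.
  have P' x y : f (act (invol mu h) x) y = f x (act h y).
    by rewrite (act_adj _ _ (Cc_invol mu ch)) invol_invol.
  by exists (Adj P P').
exists psi; split => [|h x ch]; last exact: psiE.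
split.
- move=> a h g ch cg; apply: adj_eq => x; have cc := Cc_lin a ch cg.
  by rewrite afunD afunZ !psiE// act_lin.
- move=> h g ch cg; apply: adj_eq => x; have cc := Cc_conv mu ch cg.
  by rewrite -[RHS]/(psi h (psi g x)) !psiE// act_conv.
- move=> h ch; apply: adj_eq => x; have cc := Cc_invol mu ch; rewrite psiE//.
  apply: (@fm_injl _ _ _ f) => y.
  by rewrite (act_adj _ _ cc) invol_invol -psiE// -[LHS]adjP'.
- move=> h ch; rewrite rnormE (norm1E mu ch) leCxR; apply: rnorm_adj_le.
    by apply: Rint_ge0 => [|s]; [exact: Cc_cabs|exact: cabs_ge0].
  by move=> x; rewrite psiE//; exact: rnorm_act.
Qed.

(** Finitely many left translates of [b] cover the support of any [g] by sets where one of them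
    exceeds $1/2$, so a zero integral of [b] would make every integral vanish. *)
Lemma Rint_gt0 (b : G -> R) : RCc b -> (forall s, 0 <= b s) -> b 1%g = 1 -> 0 < Rint b.
Proof.
move=> cb b0 b1; have [g cg g0] := Rint_neq0 mu.
have [cg1 [K [cK K0]]] := cg.
have KV s : K s -> nbhs s [set t | 2^-1 < b (s^-1 * t)%g].
  move=> _; have [cb' _] : RCc (fun t => b (s^-1 * t)%g) by exact: RCc_left.
  have /rcontP /(_ s 2^-1) := cb'; rewrite invr_gt0 => /(_ (ltr0n R 2)); apply: filterS => t /=.
  by rewrite mulVg b1 ltr_norml; lra.
have [l [lK Kl]] := compact_nbhs_cover cK KV.
have [M gM] : exists M, forall s, `|g s| <= M.
  have [M hM] := C0_bounded (C0_of cg); exists M => s.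
  by have := hM s; rewrite /= cabsC.
have M0 : 0 <= M by exact: le_trans (gM 1%g).
pose B t := \sum_(s <- l) b (s^-1 * t)%g.
have cB : RCc B by apply: RCc_sum => s; exact: RCc_left.
have IB : Rint B = \sum_(s <- l) Rint b.
  rewrite /B; clear Kl lK B cB; elim: l => [|s l IH].
    by rewrite big_nil -[RHS](Rint0 mu); congr Rint; apply/funext => t; rewrite big_nil.
  rewrite big_cons -IH -(Rint_left mu (s^-1)%g cb) -[Rint (fun _ => b _)]mul1r -Rint_lin.
  - by congr Rint; apply/funext => t; rewrite big_cons mul1r.
  - exact: RCc_left.
  - by apply: RCc_sum => r; exact: RCc_left.
have gB t : `|g t| <= 2 * M * B t.
  have B0 : 0 <= B t by apply: sumr_ge0.
  have [Kt|nK] := pselect (K t); last first.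
    by rewrite K0// normr0 mulr_ge0// mulr_ge0.
  have [s sl /= bs] := Kl t Kt; have h : b (s^-1 * t)%g <= B t.
    by rewrite /B (big_rem s)//= lerDl sumr_ge0.
  rewrite (le_trans (gM t))// -[leLHS]mulr1 [2 * M]mulrC -mulrA ler_wpM2l//; lra.
have h1 : Rint (fun t => `|g t|) <= 2 * M * Rint B.
  by rewrite -Rint_scale//; apply: Rint_mono => //; [exact: RCc_norm|exact: RCc_scale].
rewrite lt_neqAle Rint_ge0// andbT; apply/negP => /eqP b00.
have h2 : Rint (fun t => `|g t|) <= 0.
  by rewrite (le_trans h1)// IB -b00 big1 ?mulr0.
move/negP: g0; apply; rewrite -normr_le0 (le_trans _ h2)//.
have cn := RCc_norm cg; rewrite ler_norml lerNl; apply/andP; split; last first.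
  by apply: Rint_mono => // t; exact: ler_norm.
rewrite -mulN1r -Rint_scale//; apply: Rint_mono => //; first exact: RCc_scale.
by move=> t; rewrite mulN1r -normrN ler_norm.
Qed.

Lemma approx_unit (N : set G) : nbhs 1%g N -> exists b : G -> R,
  [/\ RCc b, forall s, 0 <= b s, Rint b = 1 & forall s, b s != 0 -> N s].
Proof.
move=> nN; have [b [cb b01 b1 bN]] := @bump R G 1%g N nN.
have b0 s : 0 <= b s by case/andP: (b01 s).
have I0 := Rint_gt0 cb b0 b1.
exists (fun s => (Rint b)^-1 * b s); split.
- exact: RCc_scale.
- by move=> s; rewrite mulr_ge0// invr_ge0 ltW.
- by rewrite Rint_scale// mulVf// gt_eqF.
- by move=> s; rewrite mulf_eq0 negb_or => /andP[_ /bN].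
Qed.

Lemma vint_near (Z : completeNormedModType (Cx R)) (F : G -> Z) (b : G -> R) (z : Z) (e : R) :
  RCc b -> (forall s, 0 <= b s) -> Rint b = 1 -> continuous F ->
  (forall s, b s != 0 -> rnorm (F s - z) <= e) ->
  rnorm (vint mu (fun s => ((b s)%:C%C : Cx R) *: F s) - z) <= e.
Proof.
move=> cb b0 b1 cF Fz.
have [cb1 [K [cK K0]]] := cb.
have cG (H : G -> Z) : continuous H -> XCc (fun s => ((b s)%:C%C : Cx R) *: H s).
  move=> cH; split; last by exists K; split => // s /K0 ->; rewrite scale0r.
  by move=> s; apply: cvgZ; [exact: (proj1 (realC_continuous b) cb1 s)|exact: cH].
have vz : vint mu (fun s => ((b s)%:C%C : Cx R) *: z) = z.
  have := @vint_linear R G mu (Cx R) Z (fun c : Cx R => c *: z) (rnorm z) (fun s => (b s)%:C%C).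
  move=> ->.
  - by rewrite -hint_vint ?hint_real ?b1 ?scale1r//; exact: RCc_Cc.
  - by apply: (@linear_rlinear R (Cx R) Z) => a x y; rewrite scalerDl scalerA.
  - by move=> x; rewrite rnormZ mulrC.
  - exact: RCc_Cc.
have -> : vint mu (fun s => ((b s)%:C%C : Cx R) *: F s) - z =
    vint mu (fun s => -1 *: (((b s)%:C%C : Cx R) *: z) + ((b s)%:C%C : Cx R) *: F s).
  rewrite vint_lin; [by rewrite scaleN1r vz addrC|apply: cG => s; exact: cvg_cst|exact: cG].
rewrite -[leRHS]mulr1 -b1 -Rint_scale//; apply: rnorm_vint.
- apply: XCc_lin; last exact: cG.
  by apply: cG => s; exact: cvg_cst.
- exact: RCc_scale.
move=> t; rewrite scaleN1r addrC -scalerBr rnormZ cabsC ger0_norm// mulrC.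
by have [->|h] := eqVneq (b t) 0; [rewrite !mulr0|rewrite ler_wpM2r// Fz].
Qed.

Lemma act_approx x (e : R) : 0 < e -> exists h, Cc h /\ rnorm (act h x - x) <= e.
Proof.
move=> e0; have cU : continuous (fun s => U s x) by case: hU.
have /ncontP /(_ 1%g e e0) nN := cU.
have [b [cb b0 b1 bN]] := approx_unit nN.
exists (fun s => (b s)%:C%C); split; first exact: RCc_Cc.
apply: vint_near => // s /bN /=.
by rewrite unitary_rep1 => /ltW.
Qed.

End UnitaryRep.

Section DenseHom.
Context {R : realType} {A D : cstarAlg R}.

Lemma dense_hom (S : set A) (rho : A -> D) (M : R) : linear rho ->
  (forall a, rnorm (rho a) <= M * rnorm a) -> total S ->
  (forall a b, S a -> S b -> rho (a ** b) = rho a ** rho b) ->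
  (forall a, S a -> rho (cs_star a) = cs_star (rho a)) ->
  (forall a b, rho (a ** b) = rho a ** rho b) /\
  (forall a, rho (cs_star a) = cs_star (rho a)).
Proof.
move=> lr bM tS rM rS; have M0 : 0 <= `|M| by [].
have bM' a : rnorm (rho a) <= `|M| * rnorm a.
  by rewrite (le_trans (bM a))// ler_wpM2r ?rnorm_ge0// ler_norm.
split=> [a b|a].
- move: b; apply: (@total_eq _ _ _ S _ _ (`|M| * rnorm a) (rnorm (rho a) * `|M|)) => //.
  + by move=> c u v; rewrite cs_mulDr lr.
  + by move=> c u v; rewrite lr cs_mulDr.
  + by move=> u; rewrite (le_trans (bM' _))// -mulrA ler_wpM2l// cs_rnormM.
  + by move=> u; rewrite (le_trans (cs_rnormM _ _))// -mulrA ler_wpM2l ?rnorm_ge0.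
  move=> b Sb; move: a.
  apply: (@total_eq _ _ _ S _ _ (`|M| * rnorm b) (rnorm (rho b) * `|M|)) => //.
  + by move=> c u v; rewrite cs_mulDl lr.
  + by move=> c u v; rewrite lr cs_mulDl.
  + by move=> u; rewrite (le_trans (bM' _))// -mulrA ler_wpM2l// mulrC cs_rnormM.
  + by move=> u; rewrite (le_trans (cs_rnormM _ _))// mulrC -mulrA ler_wpM2l ?rnorm_ge0.
  by move=> a Sa; exact: rM.
- apply: (can_inj (@cs_starK R D)); rewrite cs_starK; move: a.
  apply: (@total_eq _ _ _ S _ _ `|M| `|M|) => //.
  + by move=> c u v; rewrite cs_starD lr cs_starD conjCK.
  + by move=> u; rewrite cs_rnorm_star (le_trans (bM' _))// cs_rnorm_star.
  + by move=> a Sa; rewrite rS// cs_starK.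
Qed.

(** As $U(s)^*=U(s^{-1})$, the right action is the starred left action at $s^{-1}$. *)
Lemma unitary_hom_mr (G : lcGroupType) (U : G -> mult D) :
  (forall s t, U (s * t)%g = U s * U t) -> (forall s, is_unitary (U s)) ->
  (forall d, continuous (fun s => ml (U s) d)) -> unitary_hom U.
Proof.
move=> UM uU cU; split=> // d; split; first exact: cU.
have U1 : U 1%g = 1.
  have [h _] := uU 1%g; rewrite -[LHS]mul1r -h -mulrA -UM mulg1.
  by [].
have sU s : mstar (U s) = U (s^-1)%g.
  have [h _] := uU s; rewrite -[LHS]mulr1 -U1 -(mulgV s) UM mulrA h.
  by rewrite mul1r.
have -> : (fun s => mr (U s) d) = fun s => cs_star (ml (U (s^-1)%g) (cs_star d)).
  by apply/funext => s; rewrite -sU /= !cs_starK.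
apply/ncontP => s e e0; have /ncontP h : continuous (fun s => ml (U (s^-1)%g) (cs_star d)).
  move=> r; apply: (@continuous_comp _ _ _ (fun s => s^-1)%g (fun s => ml (U s) (cs_star d)) r).
    exact: invg_continuous.
  exact: cU.
by apply: filterS (h s e e0) => t /=; rewrite -cs_starB cs_rnorm_star.
Qed.

End DenseHom.

(** * Group elements as unitary multipliers, and integrated forms *)

Section GroupAlgebra.
Context {R : realType} {G : lcGroupType} {mu : haar R G} (C : group_cstar mu).
Local Notation gc := (gc_map C).
Local Notation Rint := (Rint mu).
Implicit Types (f g h : G -> Cx R).

Lemma gc_lin (a : Cx R) f g : Cc f -> Cc g ->
  gc (fun s => a * f s + g s) = a *: gc f + gc g.
Proof. by case: (gc_hom C) => h _ _ _; exact: h. Qed.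

Lemma gc_conv f g : Cc f -> Cc g -> gc (conv mu f g) = gc f ** gc g.
Proof. by case: (gc_hom C) => _ h _ _; exact: h. Qed.

Lemma gc_invol f : Cc f -> gc (invol mu f) = cs_star (gc f).
Proof. by case: (gc_hom C) => _ _ h _; exact: h. Qed.

Lemma rnorm_gc f : Cc f -> rnorm (gc f) <= Rint (fun s => cabs (f s)).
Proof.
move=> cf; case: (gc_hom C) => _ _ _ /(_ f cf).
by rewrite rnormE (norm1E mu cf) leCxR.
Qed.

Lemma gc_cc_linear : cc_linear gc.
Proof. by apply: (cc_linear_norm1 (mu := mu)); [exact: gc_lin|exact: rnorm_gc]. Qed.

Lemma gc_total : total (gc @` Cc).
Proof.
apply/totalP => x e e0.
have [y Sy xy] : exists2 y, (gc @` Cc) y & rnorm (x - y) < e.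
  by apply: (proj1 (closureP _ _)) => //; rewrite gc_dense.
by exists y => //; exact: lspan_in.
Qed.

(** The image of $C_c$ is already a subspace, so every combination of graph points is again a pair
    [(gc f, psi f)], and [gc_max] is the bound needed for the extension. *)
Lemma gc_extend (D : cstarAlg R) (psi : (G -> Cx R) -> D) : L1_hom mu psi ->
  exists rho : C -> D, [/\ linear rho, forall a b, rho (a ** b) = rho a ** rho b,
    forall a, rho (cs_star a) = cs_star (rho a), forall a, rnorm (rho a) <= rnorm a &
    forall f, Cc f -> rho (gc f) = psi f].
Proof.
move=> hpsi; have [pl pc ps _] := hpsi.
have gc0 (V : lmodType (Cx R)) (F : (G -> Cx R) -> V) : (forall (a : Cx R) f g, Cc f -> Cc g ->
    F (fun s => a * f s + g s) = a *: F f + F g) -> F (fun=> 0) = 0.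
  move=> lF; have := lF 1 _ _ (@Cc0 R G) (@Cc0 R G); rewrite scale1r.
  under eq_fun do rewrite mulr0 addr0.
  by move=> /eqP; rewrite -subr_eq0 opprD addNKr oppr_eq0 => /eqP.
have [||rho [lr br rE]] := @extend_by_density R C D
    [set p | exists f, Cc f /\ p = (gc f, psi f)] 1 ler01.
- move=> p; have : lspan [set p | exists f, Cc f /\ p = (gc f, psi f)] p ->
      exists f, Cc f /\ p = (gc f, psi f).
    apply: (@lspan_sub R _ _ (fun p => exists f, Cc f /\ p = (gc f, psi f))) => //.
      exists (fun=> 0); split; first exact: Cc0.
      by rewrite (gc0 _ _ gc_lin) (gc0 _ _ pl).
    move=> a _ _ [f [cf ->]] [g [cg ->]]; exists (fun s => a * f s + g s).
    by split; [exact: Cc_lin|rewrite gc_lin// pl].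
  move=> h /h[f [cf ->]]; rewrite mul1r -leCxR -!rnormE.
  exact: gc_max.
- apply: totalS gc_total => _ [f cf <-]; exists (gc f, psi f) => //.
  by exists f.
have rhoE f : Cc f -> rho (gc f) = psi f by move=> cf; apply: rE; exists f.
have [||rM rS] := dense_hom lr br gc_total.
- move=> _ _ [f cf <-] [g cg <-]; rewrite -gc_conv// !rhoE//; first exact: pc.
  exact: Cc_conv.
- move=> _ [f cf <-]; rewrite -gc_invol// !rhoE//; first exact: ps.
  exact: Cc_invol.
by exists rho; split => // a; rewrite -[leRHS]mul1r.
Qed.

Lemma act_extend {X Y : completeNormedModType (Cx R)} {f : innerform X Y} (U : G -> adj f) :
  unitary_rep U -> exists rho : C -> adj_cstar f,
  [/\ linear rho, forall a b, rho (a ** b) = rho a ** rho b,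
    forall a, rho (cs_star a) = cs_star (rho a), forall a, rnorm (rho a) <= rnorm a &
    forall h x, Cc h -> (rho (gc h) : adj f) x = act mu U h x].
Proof.
move=> hU; have [psi [hpsi psiE]] := act_hom mu hU.
have [rho [r1 r2 r3 r4 r5]] := gc_extend hpsi.
by exists rho; split => // h x ch; rewrite r5// psiE.
Qed.

Lemma cc_linear_continuous (X : completeNormedModType (Cx R)) (L : (G -> Cx R) -> X)
    (F : G -> G -> Cx R) : cc_linear L -> locsupp (X := Cx R) F ->
  continuous (fun s => L (F s)).
Proof.
move=> [lL bL] lF; apply/ncontP => s0 e e0; have [_ /(_ s0)[K [cK KP]]] := lF.
have [k [ck k01 kK _]] := @partition_of_unity R G K cK.
have [M LM] := bL k ck.
have M0 : 0 < `|M| + 1 by rewrite ltr_wpDl.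
have e1 : 0 < e / (`|M| + 1) / 2 by rewrite !divr_gt0.
apply: filterS (filterI (locsupp_unif s0 lF e1) KP) => s [/= h1 h2].
have cF r : Cc (F r) := locsupp_XCc r lF.
pose h : C0 R G := MkC0 (Cc_C0 (Cc_lin (-1) (cF s0) (cF s))).
have -> : L (F s) - L (F s0) = L (fun t => h t * (k t)%:C%C).
  rewrite addrC -scaleN1r -lL//; congr L; apply/funext => t /=.
  have [Kt|nK] := pselect (K t); first by rewrite kK// mulr1.
  by rewrite h2// (nbhs_singleton KP)// mulr0 addr0 mul0r.
rewrite (le_lt_trans (LM h))//.
have hb : rnorm h <= e / (`|M| + 1) / 2.
  by apply: rnorm_C0_le => t /=; rewrite mulN1r addrC; exact/ltW/h1.
rewrite (@le_lt_trans _ _ ((`|M| + 1) * (e / (`|M| + 1) / 2)))//; last first.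
  by rewrite !mulrA [_ * e]mulrC mulfK ?gt_eqF//; lra.
rewrite (@le_trans _ _ ((`|M| + 1) * rnorm h))//; last by rewrite ler_wpM2l// ltW.
by rewrite ler_wpM2r ?rnorm_ge0//; have := ler_norm M; lra.
Qed.

Let lam (s : G) f : G -> Cx R := fun t => f (s^-1 * t)%g.

Let Cc_lam s f : Cc f -> Cc (lam s f).
Proof. exact: Cc_left. Qed.

(** Translations by [s] and $s^{-1}$ are adjoint for the algebra-valued form $\langle
    f,g\rangle=f^{*}\star g$. Substituting $r\mapsto rs$ produces a modular factor that cancels
    against the one in [invol]. *)
Let lam_form s f g : Cc f -> Cc g ->
  conv mu (invol mu (lam s f)) g = conv mu (invol mu f) (lam (s^-1)%g g).
Proof.
move=> cf cg; apply/funext => t; rewrite /conv.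
have cc : Cc (fun r => invol mu f r * lam (s^-1)%g g (r^-1 * t)%g).
  apply: CcM_l; first exact: Cc_invol.
  have [cl _] := Cc_lam (s^-1)%g cg.
  move=> r; apply: (@continuous_comp _ _ _ (fun s => s^-1)%g (fun s => lam _ g (s * t)%g) r).
    exact: invg_continuous.
  by apply: (@continuous_comp _ _ _ (fun s => s * t)%g (lam _ g)); [exact: mulg_right_continuous|exact: cl].
rewrite -(hint_right mu s cc) -(hintZ mu _ (Cc_right s cc)).
congr hint; apply/funext => r; rewrite /invol /lam invgM invgK !mulgA mulgV mul1g.
by rewrite modularM (modularV mu s) !mulrA divff ?mul1r// modular_neq0.
Qed.

Lemma gunit_ex (s : G) : exists u : mult C,
  (forall f, Cc f -> ml u (gc f) = gc (fun t => f (s^-1 * t)%g)) /\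
  forall f, Cc f -> ml (mstar u) (gc f) = gc (fun t => f (s * t)%g).
Proof.
pose I := {f : G -> Cx R | Cc f}.
have lamK r f : lam (r^-1)%g (lam r f) = f.
  by apply/funext => t; rewrite /lam invgK mulKg.
have form r (i j : I) : cs_star (gc (lam r (sval i))) ** gc (sval j) =
    cs_star (gc (sval i)) ** gc (lam (r^-1)%g (sval j)).
  case: i j => f cf [g cg] /=; rewrite -!gc_invol//; last exact: Cc_lam.
  rewrite -!gc_conv//; [|exact: Cc_invol|exact: Cc_lam|exact/Cc_invol/Cc_lam].
  by rewrite lam_form.
(* Translation is isometric for this form, so the defect family handed to [mult_extend] is 0. *)
have form2 r (i j : I) : cs_star (gc (lam r (sval i))) ** gc (lam r (sval j)) +
    cs_star (0 : C) ** 0 = ((1 ^+ 2)%:C%C : Cx R) *: (cs_star (gc (sval i)) ** gc (sval j)).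
  rewrite cs_mulx0 addr0 expr1n scale1r; have := form r i (exist _ _ (Cc_lam r (svalP j))).
  by rewrite /= => ->; rewrite lamK.
have tI : total (range (fun i : I => gc (sval i))).
  by apply: totalS gc_total => _ [f cf <-]; exists (exist _ f cf).
have [|m [m1 m2]] := @mult_extend R C I (fun i => gc (sval i))
  (fun i => gc (lam s (sval i))) (fun i => gc (lam (s^-1)%g (sval i))) (fun=> 0) (fun=> 0)
  1 1 ler01 ler01 tI (form2 s) (form2 (s^-1)%g).
  by move=> i j; exact: form.
exists m; split=> f cf; first exact: (m1 (exist _ f cf)).
by rewrite (m2 (exist _ f cf)) /lam /= invgK.
Qed.

Lemma gunitP (s : G) f : Cc f -> ml (gunit C s) (gc f) = gc (fun t => f (s^-1 * t)%g).
Proof.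
move: f; apply: (@xgetPex _ 0 [set u : mult C | forall f, Cc f ->
    ml u (gc f) = gc (fun t => f (s^-1 * t)%g)]).
by have [u [hu _]] := gunit_ex s; exists u.
Qed.

Let gc_mult_eq (m n : mult C) : (forall f, Cc f -> ml m (gc f) = ml n (gc f)) -> m = n.
Proof. by move=> h; apply: (mult_total_eq gc_total) => _ [f cf <-]; exact: h. Qed.

Lemma gunit_hom : unitary_hom (gunit C).
Proof.
have gM s t : gunit C (s * t)%g = gunit C s * gunit C t.
  apply: gc_mult_eq => f cf; rewrite mmulE !gunitP//; last exact: (Cc_left (t^-1)%g cf).
  by congr gc; apply/funext => r; rewrite invgM mulgA.
have g1 : gunit C 1%g = 1.
  apply: gc_mult_eq => f cf; rewrite gunitP// mone_E.
  by congr gc; apply/funext => r; rewrite invg1 mul1g.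
have gS s : mstar (gunit C s) = gunit C (s^-1)%g.
  have [u [hu hu']] := gunit_ex s; apply: gc_mult_eq => f cf.
  have -> : gunit C s = u by apply: gc_mult_eq => g cg; rewrite gunitP// hu.
  by rewrite hu'// gunitP// invgK.
have gU s : is_unitary (gunit C s).
  by split; rewrite gS -gM ?mulVg ?mulgV.
apply: unitary_hom_mr => // d.
apply: uniform_limit_continuous => e e0.
have [y Sy xy] : exists2 y, (gc @` Cc) y & rnorm (d - y) < e.
  by apply: (proj1 (closureP _ _)) => //; rewrite gc_dense.
exists (fun s => ml (gunit C s) y); last first.
  by move=> s; rewrite -(linearBf _ _ (ml_linear _)) unitary_isometry// ltW.
case: Sy xy => f cf <- _.
have -> : (fun s => ml (gunit C s) (gc f)) = fun s => gc (fun t => f (s^-1 * t)%g).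
  by apply/funext => s; rewrite gunitP.
apply: (cc_linear_continuous gc_cc_linear).
exact: (@locsupp_left R G (Cx R)).
Qed.

Section Integrated.
Context {D : cstarAlg R} (U : G -> mult D) (hU : unitary_hom U).

Lemma unitary_hom_rep : unitary_rep (fun s => toA (U s)).
Proof.
case: hU => UM uU cU; split=> [s t|s|x].
- by rewrite UM toAM.
- by have [h _] := uU s; rewrite -toA_star -toAM h toA1.
- by case: (cU x).
Qed.

Lemma integrated_ex : exists pi : C -> mult D, nondeg_hom pi /\ forall s, mext pi (gunit C s) = U s.
Proof.
have [rho [r1 r2 r3 r4 r5]] := act_extend unitary_hom_rep.
pose pi (c : C) : mult D := ofA (rho c).
have hpi : is_hom pi.
  split=> [c a b|a b|a]; first by rewrite /pi r1 ofA_linear.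
  - by rewrite /pi r2 -ofAM.
  - by rewrite /pi r3 -ofA_star.
have piE h x : Cc h -> ml (pi (gc h)) x = act mu (fun s => toA (U s)) h x.
  by move=> ch; rewrite -r5.
have npi : nondeg_hom pi.
  split=> //; apply/totalP => x e e0; have e2 : 0 < e / 2 by rewrite divr_gt0.
  have [h [ch hx]] := act_approx mu unitary_hom_rep x e2.
  exists (ml (pi (gc h)) x); last by rewrite piE// rnormB; lra.
  by apply: lspan_in; exists (gc h), x.
exists pi; split=> // s; apply: mext_uniq => // a; apply: mult_eqml => d.
rewrite mmulE; move: a.
have b1 u : rnorm (ml (U s) u) <= rnorm u.
  exact: (rnorm_unitary_rep unitary_hom_rep s u).
apply: (@total_eq _ _ _ (gc @` Cc) _ _ (rnorm d) (rnorm d)) => //.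
- by move=> c u v; rewrite (hom_eval_linear d hpi) ml_linear.
- by move=> c u v; rewrite ml_linear (hom_eval_linear d hpi).
- by move=> a; rewrite (le_trans (b1 _))// mulrC rnorm_hom.
- move=> a; rewrite (le_trans (rnorm_hom _ _ hpi))// mulrC unitary_isometry//.
  by case: gunit_hom.
- exact: gc_total.
move=> _ [f cf <-]; rewrite gunitP// !piE//; last exact: (Cc_left (s^-1)%g cf).
by rewrite (act_translate mu unitary_hom_rep).
Qed.

Lemma integratedP : nondeg_hom (integrated C U) /\
  forall s, mext (integrated C U) (gunit C s) = U s.
Proof.
exact: (@xgetPex _ _ [set pi : C -> mult D | nondeg_hom pi /\ forall s, mext pi (gunit C s) = U s]
  integrated_ex).
Qed.

(* The product g * h is the integral of g(s) (s h), and pi commutes with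
   integrals. *)
Lemma nondeg_gunit_act (pi : C -> mult D) : nondeg_hom pi ->
  (forall s, mext pi (gunit C s) = U s) -> forall g c d, Cc g ->
  ml (pi (gc g)) (ml (pi c) d) = act mu (fun s => toA (U s)) g (ml (pi c) d).
Proof.
move=> npi piU g c d cg; have hpi := proj1 npi; move: c.
apply: (@total_eq _ _ _ (gc @` Cc) _ _ (rnorm (gc g) * rnorm d) (Rint (fun s => cabs (g s)) * rnorm d)).
- by move=> a u v; rewrite (hom_eval_linear d hpi) ml_linear.
- by move=> a u v; rewrite (hom_eval_linear d hpi) (act_linear mu unitary_hom_rep cg).
- move=> u; rewrite (le_trans (rnorm_hom _ _ hpi))// -mulrA ler_wpM2l ?rnorm_ge0//.
  by rewrite mulrC rnorm_hom.
- move=> u; rewrite (le_trans (rnorm_act mu unitary_hom_rep _ cg))// -mulrA.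
  rewrite ler_wpM2l//; last by rewrite mulrC rnorm_hom.
  by apply: Rint_ge0 => [|s]; [exact: Cc_cabs|exact: cabs_ge0].
- exact: gc_total.
move=> _ [h ch <-].
have -> : ml (pi (gc g)) (ml (pi (gc h)) d) = ml (pi (gc (conv mu g h))) d.
  by rewrite gc_conv//; case: hpi => _ -> _.
have [cv ->] := cc_linear_conv mu gc_cc_linear cg ch.
rewrite -(vint_linear mu (L := fun a => ml (pi a) d) (M := rnorm d)) //.
- congr vint; apply/funext => s; rewrite (linearZf _ _ (hom_eval_linear d hpi)).
  by rewrite -gunitP// -(mextP npi) piU.
- exact/linear_rlinear/hom_eval_linear.
- by move=> a; rewrite mulrC rnorm_hom.
Qed.

(** By [nondeg_gunit_act] any such homomorphism is integration against [U] on the vectors $\pi(c)d$,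
    which are total. Nondegenerate homomorphisms of $C^*(G)$ can therefore be compared on group
    elements. *)
Lemma nondeg_gunit_uniq (pi rho : C -> mult D) : nondeg_hom pi -> nondeg_hom rho ->
  (forall s, mext pi (gunit C s) = U s) -> (forall s, mext rho (gunit C s) = U s) -> pi =1 rho.
Proof.
have [r [r1 r2 r3 r4 r5]] := act_extend unitary_hom_rep.
suff h (nu : C -> mult D) : nondeg_hom nu -> (forall s, mext nu (gunit C s) = U s) ->
    forall g, Cc g -> nu (gc g) = ofA (r (gc g)).
  move=> npi nrho piU rhoU; apply: (hom_total_eq (proj1 npi) (proj1 nrho) gc_total).
  by move=> _ [g cg <-]; rewrite (h pi)// (h rho).
move=> nnu nuU g cg; apply: (mult_total_eq (proj2 nnu)) => _ [c [d ->]].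
by rewrite nondeg_gunit_act//= r5.
Qed.

End Integrated.
End GroupAlgebra.

(** * The canonical unitary and its slices *)

Section CanonicalUnitary.
Context {R : realType} (T : forall A B : cstarAlg R, min_tensor A B).
Context {G : lcGroupType} {mu : haar R G} (CG : group_cstar mu).
Local Notation A0 := (C0_cstar R G).
Local Notation ev := (@ev R T G CG).
Local Notation evm s := (fun z : T A0 CG => membed (ev s z)).

(** Replaces the homomorphism selected by [xget] with the concrete evaluation, for which
    computations are possible. *)
Lemma ev_tensorE s : ev_tensor T CG s = evm s.
Proof.
have [hF Fp] : is_hom (ev_tensor T CG s) /\ forall (f : C0 R G) c,
    ev_tensor T CG s (pure (T A0 CG) f c) = membed (f s *: c).
  apply: (@xgetPex _ _ [set F | is_hom F /\
    forall (f : C0 R G) c, F (pure (T (C0_cstar R G) CG) f c) = membed (f s *: c)]).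
  by exists (evm s); split; [exact: ev_hom|move=> f c; rewrite ev_pure].
apply/funext; apply: (hom_total_eq hF (@ev_hom R T G CG s) (pure_total (T A0 CG))).
by move=> _ [f [c ->]]; rewrite Fp ev_pure.
Qed.

(** Strict continuity of [gunit] lets [strict_mult] produce a multiplier of the kind that [wG]
    selects. *)
Lemma wG_ev s : mext (evm s) (wG T CG) = gunit CG s.
Proof.
rewrite -ev_tensorE; move: s.
apply: (@xgetPex _ _ [set w | forall s, mext (ev_tensor T CG s) w = gunit CG s]).
have [gM gU cg] := gunit_hom CG.
have [|||w wP] := @strict_mult R T G CG (gunit CG).
- by move=> d; case: (cg d).
- move=> d; have [_ h] := cg (cs_star d); apply/ncontP => s e e0.
  have /ncontP /(_ s e e0) := h; apply: filterS => t /=.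
  by rewrite -cs_starB cs_rnorm_star.
- move=> s; apply: mnorm_le => // d; rewrite mul1r unitary_isometry//.
by exists w => s; rewrite ev_tensorE.
Qed.

Lemma wG_unitary : is_unitary (wG T CG).
Proof.
have [gM gU cg] := gunit_hom CG.
split; apply: mult_ev_eq => s; have n := @ev_nondeg R T G CG s;
  rewrite (mextM n) (mext_star n) wG_ev (mext1 n); by case: (gU s).
Qed.

Lemma mext_ev_mtensor s (n : mult CG) : mext (evm s) (mtensor T (1 : mult A0) n) = n.
Proof.
apply/ev_mext.
apply: (@total_eq _ _ _ _ _ _ (mnorm (mtensor T (1 : mult A0) n)) (mnorm n) _ _ _ _ (pure_total (T A0 CG))).
- by move=> c u v; rewrite ml_linear ev_linear.
- by move=> c u v; rewrite ev_linear ml_linear.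
- by move=> z; rewrite (le_trans (rnorm_ev _ _))// rnorm_ml.
- by move=> z; rewrite (le_trans (rnorm_ml _ _))// ler_wpM2l ?mnorm_ge0// rnorm_ev.
by move=> _ [f [c ->]]; rewrite mtensorP !ev_pure (linearZf _ _ (ml_linear n)).
Qed.

(** Takes values in multipliers because [hom_tensor] and [mext] expect homomorphisms of that
    form. *)
Definition ltm (r : G) (f : A0) : mult A0 := membed (C0_lt r f : A0).

Lemma ltm_nondeg r : nondeg_hom (ltm r).
Proof.
split.
  split=> [c f g|f g|f]; rewrite /ltm.
  - by rewrite -membed_linear; congr membed; exact: C0_eq.
  - by rewrite -membedM; congr membed; exact: C0_eq.
  - by rewrite -membed_star; congr membed; exact: C0_eq.
apply: totalS (@total_mul R A0) => _ [f [g ->]].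
exists (C0_lt (r^-1)%g f : A0), g; rewrite membedE; congr (_ ** _).
by apply: C0_eq => t /=; rewrite invgK mulVKg.
Qed.

(** Evaluation at [s] after translation by [r] is evaluation at $r^{-1}s$, where $w_G$ has the value
    $r^{-1}s=r^{*}s$. *)
Lemma wG_lt r : mext (hom_tensor T (ltm r) (@membed R CG)) (wG T CG) =
  mtensor T 1 (mstar (gunit CG r)) * wG T CG.
Proof.
have nF := hom_tensor_nondeg T (ltm_nondeg r) (@membed_nondeg R CG).
have [gM gU cg] := gunit_hom CG.
apply: mult_ev_eq => s; have n := @ev_nondeg R T G CG s.
rewrite -mext_comp// (mextM n) wG_ev mext_ev_mtensor.
have -> : mext (evm s) \o hom_tensor T (ltm r) (@membed R CG) = evm (r^-1 * s)%g.
  apply/funext.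
  apply: (hom_total_eq (proj1 (mext_comp_hom nF n)) (@ev_hom R T G CG _) (pure_total (T A0 CG))).
  move=> _ [f [c ->]]; rewrite /= hom_tensor_pure//; [|exact: ltm_nondeg|exact: membed_nondeg].
  by rewrite mtensor_membed (mext_membed n) !ev_pure.
rewrite wG_ev gM; congr (_ * _).
have [h _] := gU r; rewrite -[LHS]mul1r -h -mulrA -gM mulgV.
have [k _] := gU 1%g; have -> : gunit CG 1%g = 1.
  by rewrite -[LHS]mul1r -k -mulrA -gM mulg1.
by rewrite mulr1.
Qed.

End CanonicalUnitary.

Section Slice.
Context {R : realType} (T : forall A B : cstarAlg R, min_tensor A B).
Context {A B : cstarAlg R} {H : hilbert R} (sigma : B -> H -> H) (rs : is_rep sigma).
Local Notation "a [x] b" := (pure (T A B) a b) (at level 35).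

(** In any representation of [A] the slice is the contraction estimated in [tensor_norm2_slice];
    [gelfand_naimark] then bounds it in [A], so slicing by the vector functional of [g] and [h]
    extends to the completed tensor product. *)
Lemma slice_bound (g h : H) n (a : 'I_n -> A) (b : 'I_n -> B) :
  rnorm (\sum_i ip (sigma (b i) g) h *: a i) <=
  rnorm g * rnorm h * rnorm (\sum_i a i [x] b i).
Proof.
apply: gelfand_naimark; first by rewrite !mulr_ge0 ?rnorm_ge0.
move=> K rho rr v; set w := \sum_i _ *: _.
have := @tensor_norm2_le R T A B 'I_n 'I_1 a b K H rho sigma (fun=> v) (fun=> g) rr rs.
have -> : @tensor_norm2 R K H _ (fun _ : 'I_1 => v) (fun=> g) = ((rnorm v * rnorm g) ^+ 2)%:C%C.
  by rewrite /tensor_norm2 !big_ord1 /= !ip_rnorm -realCM exprMn.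
pose q (i : 'I_n) : 'I_n * 'I_1 := (i, ord0).
have bq : bijective q by exists fst => // -[i j] /=; rewrite /q [j]ord1.
rewrite -(tensor_norm2_reindex _ _ bq) => h2.
have := @tensor_norm2_slice R K H 'I_n (fun i => rho (a i) v) (fun i => sigma (b i) g) h.
have -> : \sum_i ip (sigma (b i) g) h *: rho (a i) v = rho w v.
  rewrite /w (linear_sumf _ _ _ (rep_linear_l rr v)).
  by apply: eq_bigr => i _; rewrite (linearZf _ _ (rep_linear_l rr v)).
move=> h1.
have {h2} h2 := ler_wpM2l (_ : 0 <= ((rnorm h ^+ 2)%:C%C : Cx R)) h2.
have {h1 h2} := le_trans h1 (h2 _); rewrite (leCxR 0) sqr_ge0 => /(_ isT).
rewrite -!realCM leCxR -!exprMn ler_pXn2r ?nnegrE ?rnorm_ge0//; last first.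
  by rewrite !mulr_ge0 ?rnorm_ge0.
by move/le_trans; apply; rewrite le_eqVlt; apply/orP; left; apply/eqP; ring.
Qed.

Lemma slice_ex (g h : H) : exists S : T A B -> A, [/\ linear S,
  forall z, rnorm (S z) <= rnorm g * rnorm h * rnorm z &
  forall a b, S (a [x] b) = ip (sigma b g) h *: a].
Proof.
have lF b : linear (fun a : A => ip (sigma b g) h *: a).
  by move=> c x y; rewrite scalerDr !scalerA mulrC.
have [|||S [lS bS SE]] := @extend_by_density _ (T A B) A
    [set (ab.1 [x] ab.2, ip (sigma ab.2 g) h *: ab.1) | ab in [set: A * B]]
    (rnorm g * rnorm h).
- by rewrite mulr_ge0 ?rnorm_ge0.
- move=> p /(@lspan_pure R T A B A (fun a b => ip (sigma b g) h *: a) p lF).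
  by move=> [n [a [b [-> ->]]]]; exact: slice_bound.
- apply: totalS (pure_total (T A B)) => _ [a [b ->]].
  by exists (a [x] b, ip (sigma b g) h *: a) => //; exists (a, b).
by exists S; split => // a b; apply: SE; exists (a, b).
Qed.

Definition slice (g h : H) : T A B -> A := projT1 (cid (slice_ex g h)).

Lemma slice_linear g h : linear (slice g h).
Proof. by rewrite /slice; case: cid => S []. Qed.
Lemma rnorm_slice g h z : rnorm (slice g h z) <= rnorm g * rnorm h * rnorm z.
Proof. by rewrite /slice; case: cid => S []. Qed.
Lemma slice_pure g h a b : slice g h (a [x] b) = ip (sigma b g) h *: a.
Proof. by rewrite /slice; case: cid => S []. Qed.

End Slice.

(** * The regular representation and its coefficients *)

Section L2.
Context {R : realType} {G : lcGroupType} (mu : haar R G).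
Local Notation Rint := (Rint mu).
Implicit Types (f g h : G -> Cx R).

Definition Cc_pred : {pred G -> Cx R} := fun f => `[< Cc f >].

Lemma Cc_submod_closed : submod_closed Cc_pred.
Proof.
split=> [|a f g /asboolP cf /asboolP cg]; apply/asboolP; first exact: Cc0.
exact: Cc_lin.
Qed.

HB.instance Definition _ := GRing.isSubmodClosed.Build _ _ Cc_pred Cc_submod_closed.

Record cc_space := MkCc { cc_fun :> G -> Cx R ; cc_funP : cc_fun \in Cc_pred }.

HB.instance Definition _ := [isSub for cc_fun].
HB.instance Definition _ := [Choice of cc_space by <:].
HB.instance Definition _ := [SubChoice_isSubLmodule of cc_space by <:].

Lemma cc_spaceP (f : cc_space) : Cc f. Proof. exact/asboolP/cc_funP. Qed.
Fact cc_of_subproof f : Cc f -> f \in Cc_pred. Proof. by move=> cf; exact/asboolP. Qed.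
Definition cc_of f (cf : Cc f) : cc_space := MkCc (cc_of_subproof cf).

Lemma Cc_mulconj f g : Cc f -> Cc g -> Cc (fun s => f s * Num.conj (g s)).
Proof. by move=> cf /Cc_conj[cg _]; exact: CcM_l. Qed.

Lemma hint_conj f : Cc f -> hint mu (fun s => Num.conj (f s)) = Num.conj (hint mu f).
Proof.
move=> cf; rewrite !hint_vint//; last exact: Cc_conj.
apply: (@vint_linear R G mu (Cx R) (Cx R) (fun z : Cx R => Num.conj z) 1) => //.
- split=> [x y|r x]; first exact: cconjD.
  by rewrite -[_ *: x]/(_ * x) cconjM conj_realC.
- by move=> x; rewrite !rnormC cabs_conj mul1r.
Qed.

Let l2_form (f g : cc_space) : Cx R := hint mu (fun s => f s * Num.conj (g s)).

Fact l2_lin (a : Cx R) (f g h : cc_space) :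
  l2_form (a *: f + g) h = a * l2_form f h + l2_form g h.
Proof.
have [[cf cg] ch] := (cc_spaceP f, cc_spaceP g, cc_spaceP h).
rewrite /l2_form -hint_linear; [|exact: Cc_mulconj..]; congr hint.
apply/funext => s; rewrite -[(a *: f + g) s]/(a * f s + g s).
by rewrite mulrDl mulrA.
Qed.

Fact l2_conj (f g : cc_space) : l2_form g f = Num.conj (l2_form f g).
Proof.
rewrite /l2_form -hint_conj; last exact: Cc_mulconj (cc_spaceP f) (cc_spaceP g).
by congr hint; apply/funext => s; rewrite cconjM conjCK mulrC.
Qed.

Fact l2_ge0 (f : cc_space) : 0 <= l2_form f f.
Proof.
apply: hint_ge0; first exact: Cc_mulconj (cc_spaceP f) (cc_spaceP f).
by move=> s; exact: mul_conjC_ge0.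
Qed.

Definition l2_pre : prehilbert R := PreHilbert l2_lin l2_conj l2_ge0.
Definition L2 : hilbert R := completion l2_pre.

(** Extended by 0 outside $C_c$ so as to be defined on all functions, as the type of [cc_linear]
    requires. *)
Definition l2 f : L2 :=
  if pselect (Cc f) is left cf then iota (cc_of cf : l2_pre) else 0.

Lemma l2E f (cf : Cc f) : l2 f = iota (cc_of cf : l2_pre).
Proof. by rewrite /l2; case: pselect => // cf'; congr iota; apply: val_inj. Qed.

Lemma ip_l2 f g : Cc f -> Cc g -> ip (l2 f) (l2 g) = hint mu (fun s => f s * Num.conj (g s)).
Proof. by move=> cf cg; rewrite (l2E cf) (l2E cg) ip_iota. Qed.

Lemma l2_linear (a : Cx R) f g : Cc f -> Cc g ->
  l2 (fun s => a * f s + g s) = a *: l2 f + l2 g.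
Proof.
move=> cf cg; rewrite (l2E cf) (l2E cg) (l2E (Cc_lin a cf cg)).
rewrite -(@iota_linear R l2_pre); congr iota; exact: val_inj.
Qed.

Lemma l2_total : total (l2 @` Cc).
Proof.
apply: totalS (iota_total l2_pre) => _ [f _ <-].
exists (f : G -> Cx R); first exact: cc_spaceP.
by rewrite (l2E (cc_spaceP f)); congr iota; exact: val_inj.
Qed.

Lemma rnorm_l2 f : Cc f -> rnorm (l2 f) ^+ 2 = Rint (fun s => cabs (f s) * cabs (f s)).
Proof.
move=> cf; apply: realC_inj; rewrite -ip_rnorm ip_l2// -hint_real.
  by congr hint; apply/funext => s; rewrite conj_mulC expr2.
by apply: RCcM_l; [exact: Cc_cabs|case: (Cc_cabs cf)].
Qed.

Lemma l2_cc_linear : cc_linear l2.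
Proof.
split=> [a f g|k ck]; first exact: l2_linear.
have ckC := RCc_Cc ck.
exists (rnorm (l2 (fun s => (k s)%:C%C))) => h.
have cc : Cc (fun s => h s * (k s)%:C%C) by apply: CcM_cont; [exact: C0_cont|].
rewrite -(@ler_pXn2r _ 2%N)// ?nnegrE ?mulr_ge0 ?rnorm_ge0// exprMn !rnorm_l2//.
have ca := RCcM_l (Cc_cabs ckC) (proj1 (Cc_cabs ckC)).
rewrite mulrC -Rint_scale//; apply: Rint_mono.
- by apply: RCcM_l; [exact: Cc_cabs|case: (Cc_cabs cc)].
- exact: RCc_scale.
move=> s; rewrite cabsM mulrACA -expr2 ler_wpM2r ?mulr_ge0 ?cabs_ge0//.
by rewrite ler_pXn2r ?nnegrE ?cabs_ge0 ?rnorm_ge0// C0_cabs.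
Qed.

Lemma reg_ex (s : G) : exists U : L2 -> L2, [/\ linear U, forall x, rnorm (U x) <= 1 * rnorm x &
  forall f, Cc f -> U (l2 f) = l2 (fun t => f (s^-1 * t)%g)].
Proof.
pose lam f : G -> Cx R := fun t => f (s^-1 * t)%g.
have cl f : Cc f -> Cc (lam f) by exact: Cc_left.
have [||U [lU bU UE]] := @extend_by_density R L2 L2
    [set p | exists f, Cc f /\ p = (l2 f, l2 (lam f))] 1 ler01.
- move=> p pS; have {pS} [f [cf ->]] : exists f, Cc f /\ p = (l2 f, l2 (lam f)).
    move: p pS; apply: lspan_sub => //.
      exists (fun=> 0); split; first exact: Cc0.
      suff -> : l2 (fun=> 0) = 0 by [].
      have := l2_linear 1 (@Cc0 R G) (@Cc0 R G); rewrite scale1r.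
      under eq_fun do rewrite mulr0 addr0.
      by move=> /eqP; rewrite -subr_eq0 opprD addNKr oppr_eq0 => /eqP.
    move=> a _ _ [f [cf ->]] [g [cg ->]]; exists (fun s => a * f s + g s).
    split; first exact: Cc_lin.
    apply: injective_projections; first exact: esym (l2_linear a cf cg).
    exact: esym (l2_linear a (cl _ cf) (cl _ cg)).
  rewrite mul1r -(@ler_pXn2r _ 2%N)// ?nnegrE ?rnorm_ge0//= !rnorm_l2//; last exact: cl.
  have ca := RCcM_l (Cc_cabs cf) (proj1 (Cc_cabs cf)).
  by rewrite -(Rint_left mu (s^-1)%g ca).
- apply: totalS l2_total => _ [f cf <-]; exists (l2 f, l2 (lam f)) => //.
  by exists f.
by exists U; split => // f cf; apply: UE; exists f.
Qed.

Definition reg (s : G) : L2 -> L2 := projT1 (cid (reg_ex s)).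

Lemma reg_linear s : linear (reg s).
Proof. by rewrite /reg; case: cid => U []. Qed.
Lemma rnorm_reg s x : rnorm (reg s x) <= rnorm x.
Proof. by rewrite -[leRHS]mul1r /reg; case: cid => U []. Qed.
Lemma reg_l2 s f : Cc f -> reg s (l2 f) = l2 (fun t => f (s^-1 * t)%g).
Proof. by rewrite /reg; case: cid => U [] /= _ _; exact. Qed.

Lemma regM s t x : reg (s * t)%g x = reg s (reg t x).
Proof.
move: x; apply: (@total_eq _ _ _ _ _ _ 1 1 _ _ _ _ l2_total).
- exact: reg_linear.
- by move=> c x y; rewrite !reg_linear.
- by move=> x; rewrite mul1r rnorm_reg.
- by move=> x; rewrite mul1r (le_trans (rnorm_reg _ _))// rnorm_reg.
move=> _ [f cf <-]; rewrite !reg_l2//; last exact: (Cc_left (t^-1)%g cf).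
by congr l2; apply/funext => r; rewrite invgM mulgA.
Qed.

Lemma reg1 x : reg 1%g x = x.
Proof.
move: x; apply: (@total_eq _ _ _ _ _ _ 1 1 _ _ _ _ l2_total).
- exact: reg_linear.
- by [].
- by move=> x; rewrite mul1r rnorm_reg.
- by move=> x; rewrite mul1r.
move=> _ [f cf <-]; rewrite !reg_l2//.
by congr l2; apply/funext => r; rewrite invg1 mul1g.
Qed.

Lemma reg_adj s x y : ip (reg s x) y = ip x (reg (s^-1)%g y) :> Cx R.
Proof.
have lip (z : L2) : linear (fun x : L2 => ip x z : (Cx R : normedModType (Cx R))).
  by move=> a u v; exact: ip_linear.
have bip (z u : L2) : rnorm (ip u z : (Cx R : normedModType (Cx R))) <= rnorm z * rnorm u.
  by rewrite mulrC; exact: cauchy_schwarz.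
have step f z : Cc f -> ip z (l2 (fun t => f (s^-1 * t)%g)) = ip (reg (s^-1)%g z) (l2 f) :> Cx R.
  move=> cf; have cl := Cc_left (s^-1)%g cf; move: z.
  apply: (@total_eq _ _ (Cx R) (l2 @` Cc) _ _ (rnorm (l2 (fun t => f (s^-1 * t)%g))) (rnorm (l2 f))) => //.
  - by move=> c u v; rewrite reg_linear; exact: ip_linear.
  - by move=> u; rewrite (le_trans (bip _ _))// ler_wpM2l ?rnorm_ge0// rnorm_reg.
  - exact: l2_total.
  move=> _ [g cg <-]; rewrite reg_l2// !ip_l2//; last exact: (Cc_left (s^-1^-1)%g cg).
  rewrite -(hint_left mu s (Cc_mulconj cg cl)); congr hint.
  by apply/funext => r; rewrite invgK mulKg.
move: x; apply: (@total_eq _ _ (Cx R) (l2 @` Cc) _ _ (rnorm y) (rnorm (reg (s^-1)%g y))) => //.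
- by move=> c u v; rewrite reg_linear; exact: ip_linear.
- by move=> u; rewrite (le_trans (bip _ _))// ler_wpM2l ?rnorm_ge0// rnorm_reg.
- exact: l2_total.
by move=> _ [f cf <-]; rewrite reg_l2// ip_conj step// -ip_conj.
Qed.

Fact reg_adjP s x y : hform L2 (reg s x) y = hform L2 x (reg (s^-1)%g y).
Proof. by change (ip y (reg s x) = ip (reg (s^-1)%g y) x); rewrite reg_adj invgK. Qed.
Fact reg_adjP' s x y : hform L2 (reg (s^-1)%g x) y = hform L2 x (reg s y).
Proof. by change (ip y (reg (s^-1)%g x) = ip (reg s y) x); rewrite reg_adj. Qed.
Definition reg_op s : adj (hform L2) := Adj (reg_adjP s) (reg_adjP' s).

Lemma reg_rep : unitary_rep (f := hform L2) reg_op.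
Proof.
split=> [s t|s|x].
- by apply: adj_eq => x; exact: regM.
- by apply: adj_eq => x /=; rewrite -[LHS]/(reg _ (reg s x)) -regM mulVg reg1.
apply: uniform_limit_continuous => e e0.
have [y yl xy] := proj1 (totalP _) l2_total x e e0.
exists (fun s => reg s y); last first.
  move=> s; rewrite -[afun _ x]/(reg s x) -(linearBf _ _ (reg_linear s)).
  by rewrite (le_trans (rnorm_reg _ _))// ltW.
clear xy; move: y yl; apply: lspan_sub.
- under eq_fun do rewrite (linear0f (reg_linear _)); move=> s; exact: cvg_cst.
- move=> a u v cu cv; under eq_fun do rewrite reg_linear.
  by move=> s; apply: cvgD; [apply: cvgZr; exact: cu|exact: cv].
move=> _ [f cf <-].
have -> : (fun s => reg s (l2 f)) = fun s => l2 (fun t => f (s^-1 * t)%g).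
  by apply/funext => s; rewrite reg_l2.
apply: (cc_linear_continuous l2_cc_linear).
exact: (@locsupp_left R G (Cx R)).
Qed.

(** For two vectors from $C_c$ the coefficient has compact support. The local statement [lim] passes
    to uniform limits in one vector and is applied twice, once for each. *)
Lemma reg_coef_C0 (x y : L2) : (fun s => ip (reg s x) y) \in @C0_pred R G.
Proof.
apply/asboolP; split.
  apply/(ncontP (X := Cx R)) => s e e0; have [_ _ /(_ x)/ncontP c] := reg_rep.
  have y1 : 0 < rnorm y + 1 by rewrite ltr_wpDl// rnorm_ge0.
  apply: filterS (c s _ (divr_gt0 e0 y1)) => t /= ts.
  change (cabs (ip (reg t x) y - ip (reg s x) y) < e).
  rewrite -ipBl (le_lt_trans (cauchy_schwarz _ _))//.
  rewrite (@le_lt_trans _ _ (rnorm (reg t x - reg s x) * (rnorm y + 1)))//.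
    by rewrite ler_wpM2l ?rnorm_ge0// lerDl.
  by rewrite -ltr_pdivlMr.
have lim (F : L2 -> G -> Cx R) (z : L2) (M : R) :
    (forall u v s, cabs (F u s - F v s) <= M * rnorm (u - v)) ->
    (forall u, (l2 @` Cc) u -> vanishes (F u)) ->
    (forall a u v s, F (a *: u + v) s = a * F u s + F v s) -> vanishes (F z).
  move=> FM Fc Flin; apply: cx_gt0P => e e0.
  have M1 : 0 < `|M| + 1 by rewrite ltr_wpDl.
  have e1 : 0 < e / 2 / (`|M| + 1) by rewrite !divr_gt0.
  have [w wl zw] := proj1 (totalP _) l2_total z _ e1.
  have vw : rvanish (X := Cx R) (F w).
    clear zw; move: w wl; apply: lspan_sub.
    - move=> d d0; exists set0; split => [|s _]; first exact: compact0.
      have := Flin 1 0 0 s; rewrite scale1r addr0 mul1r => /eqP.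
      by rewrite -subr_eq0 opprD addNKr oppr_eq0 => /eqP ->; rewrite rnorm0 ltW.
    - move=> a u v vu vv; have := rvanishD a vu vv; congr rvanish.
      by apply/funext => s; rewrite Flin.
    - move=> u /Fc vu d d0; have d1 : 0 < (d%:C%C : Cx R) by rewrite (ltCxR 0).
      have [K [cK uK]] := vu _ d1.
      by exists K; split => // s /uK; rewrite cabs_lt => /ltW.
  have e2 : 0 < e / 4 by rewrite divr_gt0.
  have [K [cK wK]] := vw _ e2; exists K; split => // s /wK hs.
  rewrite cabs_lt; have := FM z w s.
  have h1 : M * rnorm (z - w) <= e / 2.
    rewrite (@le_trans _ _ ((`|M| + 1) * rnorm (z - w)))//.
      by rewrite ler_wpM2r ?rnorm_ge0//; have := ler_norm M; lra.
    by rewrite mulrC -ler_pdivlMr// ltW.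
  have := cabsD (F w s) (F z s - F w s); rewrite addrC subrK; move: hs; rewrite rnormC; lra.
apply: (lim (fun x s => ip (reg s x) y) x (rnorm y)).
- move=> u v s; rewrite -ipBl -(linearBf _ _ (reg_linear s)).
  by rewrite (le_trans (cauchy_schwarz _ _))// mulrC ler_wpM2l ?rnorm_ge0// rnorm_reg.
- move=> _ [f cf <-].
  (* Moving the translation to the other vector, up to conjugation, lets [lim] be reused for [y]. *)
  have -> : (fun s => ip (reg s (l2 f)) y) = (fun s => Num.conj (ip (reg (s^-1)%g y) (l2 f))).
    by apply/funext => s; rewrite reg_adj; exact: ip_conj.
  have v2 : vanishes (fun s => ip (reg (s^-1)%g y) (l2 f) : Cx R).
    apply: (lim (fun y s => ip (reg (s^-1)%g y) (l2 f)) y (rnorm (l2 f))).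
    + move=> u v s; rewrite -ipBl -(linearBf _ _ (reg_linear _)).
      by rewrite (le_trans (cauchy_schwarz _ _))// mulrC ler_wpM2l ?rnorm_ge0// rnorm_reg.
    + move=> _ [g cg <-] e e0; have [_ [Kf [cKf Kf0]]] := cf; have [_ [Kg [cKg Kg0]]] := cg.
      have cKi : compact ((fun s => s^-1)%g @` Kg).
        by apply: continuous_compact cKg; apply: continuous_subspaceT; exact: invg_continuous.
      have cKj : compact ((fun s => s^-1)%g @` [set (p.1 * p.2)%g | p in Kf `*` ((fun s => s^-1)%g @` Kg)]).
        apply: continuous_compact (mul_compact cKf cKi); apply: continuous_subspaceT.
        exact: invg_continuous.
      eexists; split; first exact: cKj.
      move=> s nK; rewrite reg_l2// ip_l2//; last exact: (Cc_left _ cg).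
      rewrite (_ : (fun t => _) = fun=> 0) ?hint0 ?normr0//.
      apply/funext => t; have [Kt|/Kf0 ->] := pselect (Kf t); last by rewrite conjC0 mulr0.
      rewrite invgK Kg0 ?mul0r// => Ks; apply: nK; exists (s^-1)%g; rewrite ?invgK//.
      exists (t, (s * t)^-1)%g => /=; last by rewrite invgM mulVKg.
      by split => //; exists (s * t)%g.
    + by move=> a u v s; rewrite reg_linear; exact: ip_linear.
  by move=> e /v2[K [cK vK]]; exists K; split => // s /vK; rewrite norm_conjC.
- by move=> a u v s; rewrite reg_linear; exact: ip_linear.
Qed.

Definition reg_coef (y x : L2) : C0 R G := MkC0 (reg_coef_C0 x y).

Lemma reg_coef_linear y : linear (reg_coef y).
Proof.
move=> a u v; apply: C0_eq => s; rewrite C0_lin.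
change (ip (reg s (a *: u + v)) y = a * ip (reg s u) y + ip (reg s v) y).
by rewrite reg_linear; exact: ip_linear.
Qed.

Lemma rnorm_reg_coef y x : rnorm (reg_coef y x) <= rnorm y * rnorm x.
Proof.
apply: rnorm_C0_le => s; change (cabs (ip (reg s x) y) <= rnorm y * rnorm x).
rewrite (le_trans (cauchy_schwarz _ _))// mulrC.
by rewrite ler_wpM2l ?rnorm_ge0// rnorm_reg.
Qed.

Lemma C0_approx_Cc (f : C0 R G) (e : R) : 0 < e -> exists g : C0 R G, Cc g /\ rnorm (f - g) <= e.
Proof.
move=> e0; have [|||m [phi [p [h1 h2 h3 h4]]]] :=
    @vanish_partition R G (Cx R) 1 (fun=> (f : G -> Cx R)) (e / 3).
- by move=> _; exact: C0_cont.
- by move=> _; exact: C0_rvanish.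
- by rewrite divr_gt0.
have cg : Cc (fun t => \sum_j ((phi j t)%:C%C : Cx R) * f (p j)).
  elim: (index_enum _) => [|j r IH].
    by under eq_fun do rewrite big_nil; exact: Cc0.
  under eq_fun do rewrite big_cons mulrC; exact: (Cc_lin _ (RCc_Cc (h1 j)) IH).
exists (MkC0 (Cc_C0 cg)); split => //; apply: rnorm_C0_le => t.
rewrite C0_subE /=; have := h4 ord0 t.
by rewrite mulrC divfK ?pnatr_eq0.
Qed.

Let tri (X : normedModType (Cx R)) (x y z : X) (e : R) : 0 < e ->
  rnorm (x - y) <= e / 4 -> rnorm (z - y) <= e / 4 -> rnorm (x - z) < e.
Proof. by move=> e0 h1 h2; have := rnorm_tri y x z; rewrite (rnormB y); lra. Qed.

(** If [b] has integral 1 and is supported near the identity, then $\langle\lambda_sb,\overline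
    g\rangle=\int b(t)g(st)\,dt$ is uniformly close to $g(s)$. *)
Lemma reg_coef_total : total [set k | exists f g, Cc f /\ Cc g /\ k = reg_coef (l2 g) (l2 f)].
Proof.
apply/totalP => f e e0; have e2 : 0 < e / 4 by rewrite divr_gt0.
have [g [cg fg]] := C0_approx_Cc f e2.
have lF := @locsupp_right R G (Cx R) g cg.
pose P t : C0 R G := MkC0 (Cc_C0 (locsupp_XCc t lF)).
have PE t s : P t s = g (s * t)%g by [].
have cP : continuous P.
  apply/ncontP => t d d0; have d2 : 0 < d / 2 by rewrite divr_gt0.
  apply: filterS (locsupp_unif t lF d2) => r /= h.
  suff : rnorm (P r - P t) <= d / 2 by lra.
  by apply: rnorm_C0_le => s; rewrite C0_subE; exact/ltW/h.
have /ncontP /(_ 1%g _ e2) nN := cP.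
have [b [cb b0 b1 bN]] := approx_unit mu nN.
have cbC := RCc_Cc cb; have ch := Cc_conj cg.
exists (reg_coef (l2 (fun s => Num.conj (g s))) (l2 (fun s => (b s)%:C%C))).
  by apply: lspan_in; exists (fun s => (b s)%:C%C), (fun s => Num.conj (g s)).
have h : rnorm (vint mu (fun t => ((b t)%:C%C : Cx R) *: P t) - g) <= e / 4.
  apply: (vint_near cb b0 b1 cP) => t /bN /=; have -> : P 1%g = g.
    by apply: C0_eq => s; rewrite PE mulg1.
  exact: ltW.
suff -> : reg_coef (l2 (fun s => Num.conj (g s))) (l2 (fun s => (b s)%:C%C)) =
    vint mu (fun t => ((b t)%:C%C : Cx R) *: P t).
  exact: (tri e0 fg h).
apply: C0_eq => s.
change (ip (reg s (l2 (fun s => (b s)%:C%C))) (l2 (fun s => Num.conj (g s))) =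
  vint mu (fun t => ((b t)%:C%C : Cx R) *: P t) s).
rewrite reg_l2// ip_l2//; last exact: (Cc_left (s^-1)%g cbC).
have cc := Cc_mulconj (Cc_left (s^-1)%g cbC) ch.
rewrite -(hint_left mu s cc) hint_vint; last exact: (Cc_left s cc).
have [cb1 [K [cK K0]]] := cb.
have cG : XCc (fun t => ((b t)%:C%C : Cx R) *: P t).
  split; last by exists K; split => // t /K0 ->; rewrite scale0r.
  by move=> t; apply: cvgZ; [exact: (proj1 (realC_continuous b) cb1 t)|exact: cP].
rewrite -[RHS](@vint_linear R G mu (C0 R G) (Cx R) (fun h : C0 R G => h s) 1 _)//.
  by congr vint; apply/funext => t; rewrite mulKg conjCK.
by move=> x; rewrite mul1r; exact: C0_cabs.
Qed.

End L2.

Section RegularRepresentation.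
Context {R : realType} {G : lcGroupType} {mu : haar R G} (CG : group_cstar mu).
Local Notation L2 := (L2 mu).
Local Notation gc := (gc_map CG).

Lemma regrep_ex : exists rho : CG -> L2 -> L2, is_rep rho /\
  forall s c x, rho (ml (gunit CG s) c) x = reg s (rho c x).
Proof.
have hU := reg_rep mu.
have [r [r1 r2 r3 r4 r5]] := act_extend CG hU.
pose rho (c : CG) (x : L2) : L2 := (r c : adj (hform L2)) x.
have rM c x : rnorm (rho c x) <= rnorm c * rnorm x.
  by rewrite (le_trans (rnorm_afun _ _))// ler_wpM2r ?rnorm_ge0.
have rl x : linear (fun c => rho c x).
  by move=> a u v; rewrite /rho r1.
exists rho; split.
  split.
  - by move=> c a b x; rewrite /rho r1.
  - move=> a; split; first exact: afun_linear.
    by exists (rnorm a)%:C%C => x; rewrite !rnormE -realCM leCxR.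
  - by move=> a b x; rewrite /rho r2.
  - move=> a x y; rewrite /rho r3.
    exact: esym (adjP' (r a : adj (hform L2)) y x).
  - apply/totalP => x e e0; have e2 : 0 < e / 2 by rewrite divr_gt0.
    have [h [ch hx]] := act_approx mu hU x e2.
    exists (rho (gc h) x); last by rewrite /rho r5// rnormB; lra.
    by apply: lspan_in; exists (gc h), x.
move=> s c x; move: c.
apply: (@total_eq _ _ _ _ _ _ (rnorm x) (rnorm x) _ _ _ _ (gc_total CG)).
- by move=> a u v; rewrite ml_linear rl.
- by move=> a u v; rewrite rl reg_linear.
- move=> c; rewrite (le_trans (rM _ _))// mulrC unitary_isometry//.
  by case: (gunit_hom CG).
- by move=> c; rewrite (le_trans (rnorm_reg _ _))// mulrC.
move=> _ [f cf <-]; rewrite gunitP// /rho !r5//; last exact: (Cc_left (s^-1)%g cf).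
exact: (act_translate mu hU).
Qed.

End RegularRepresentation.

Section Recovery.
Context {R : realType} (T : forall A B : cstarAlg R, min_tensor A B).
Context {G : lcGroupType} {mu : haar R G} (CG : group_cstar mu) {E : cstarAlg R}.
Local Notation A0 := (C0_cstar R G).
Local Notation L2 := (L2 mu).
Local Notation W nu := (mext (hom_tensor T nu (@membed R CG)) (wG T CG)).

Context (rho : CG -> L2 -> L2) (rr : is_rep rho)
  (rU : forall s c x, rho (ml (gunit CG s) c) x = reg s (rho c x)).

Let rM c x : rnorm (rho c x) <= rnorm c * rnorm x. Proof. exact: rep_contract. Qed.
Let rl x : linear (fun c => rho c x). Proof. exact: rep_linear_l rr x. Qed.

Let slice_ev (g h : L2) (y : T A0 CG) s :
  (slice rr g h y : C0 R G) s = ip (rho (ev s y) g) h.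
Proof.
move: y; apply: (@total_eq _ _ (Cx R) _ _ _ (rnorm g * rnorm h) (rnorm g * rnorm h) _ _ _ _ (pure_total (T A0 CG))).
- by move=> c u v; rewrite slice_linear C0_lin.
- by move=> c u v; rewrite ev_linear rl; exact: ip_linear.
- move=> z; apply: le_trans (C0_cabs _ _) _. have h0 := @rnorm_slice R T A0 CG L2 rho rr g h z. exact h0.
- move=> z; rewrite rnormC (le_trans (cauchy_schwarz _ _))// mulrAC ler_wpM2r ?rnorm_ge0//.
  by rewrite (le_trans (rM _ _))// mulrC ler_wpM2l ?rnorm_ge0// rnorm_ev.
move=> _ [f [c ->]]; rewrite slice_pure ev_pure (linearZf _ _ (rl g)) ipZl mulrC.
by have := C0_lin (ip (rho c g) h) f (0 : C0 R G) s; rewrite addr0 => ->; rewrite addr0.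
Qed.

Section OneHom.
Context (nu : A0 -> mult E) (nnu : nondeg_hom nu).
Let hnu : is_hom nu := proj1 nnu.
Let nF := hom_tensor_nondeg T nnu (@membed_nondeg R CG).
Local Notation F := (hom_tensor T nu (@membed R CG)).

Let slice_hom (g h : L2) (y : T A0 CG) e b :
  slice rr g h (ml (F y) (pure (T E CG) e b)) = ml (nu (slice rr (rho b g) h y)) e.
Proof.
move: y; apply: (@total_eq _ _ _ _ _ _ (rnorm g * rnorm h * rnorm (pure (T E CG) e b))
    (rnorm (rho b g) * rnorm h * rnorm e) _ _ _ _ (pure_total (T A0 CG))).
- by move=> c u v; rewrite (hom_eval_linear _ (proj1 nF)) slice_linear.
- by move=> c u v; rewrite slice_linear (hom_eval_linear _ hnu).
- move=> y; rewrite (le_trans (rnorm_slice _ _ _ _))// -[leRHS]mulrA.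
  by rewrite ler_wpM2l ?mulr_ge0 ?rnorm_ge0// mulrC (rnorm_hom _ _ (proj1 nF)).
- move=> y; rewrite (le_trans (rnorm_hom _ _ hnu))// mulrAC ler_wpM2r ?rnorm_ge0//.
  exact: rnorm_slice.
move=> _ [f [c ->]]; rewrite hom_tensor_pure//; last exact: membed_nondeg.
rewrite mtensorP !slice_pure membedE.
have -> : rho (c ** b) g = rho c (rho b g) by case: rr => _ _ -> .
by rewrite (linearZf _ _ (hom_eval_linear e hnu)).
Qed.

(** Since $w_G$ has the value $s$ at $s$, its slice is a coefficient
    $s\mapsto\langle\lambda_s\rho(c)g,h\rangle$, and $\nu$ carries this over to $W$. *)
Lemma slice_wG (g h : L2) (c : CG) (d : E) :
  slice rr g h (ml (W nu) (pure (T E CG) d c)) = ml (nu (reg_coef h (rho c g))) d.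
Proof.
pose M := rnorm g * rnorm h * mnorm (W nu).
have M0 : 0 <= M by rewrite !mulr_ge0 ?rnorm_ge0 ?mnorm_ge0.
have bS z : rnorm (slice rr g h (ml (W nu) z)) <= M * rnorm z.
  rewrite (le_trans (rnorm_slice _ _ _ _))// -[leRHS]mulrA ler_wpM2l ?mulr_ge0 ?rnorm_ge0//.
  exact: rnorm_ml.
have bK c' d' : rnorm (ml (nu (reg_coef h (rho c' g))) d') <= rnorm h * rnorm g * (rnorm c' * rnorm d').
  rewrite (le_trans (rnorm_hom _ _ hnu))// mulrA ler_wpM2r ?rnorm_ge0//.
  rewrite (le_trans (rnorm_reg_coef _ _))// -mulrA ler_wpM2l ?rnorm_ge0// mulrC.
  exact: rM.
move: d; apply: (@total_eq _ _ _ _ _ _ (M * rnorm c) (rnorm h * rnorm g * rnorm c) _ _ _ _ (proj2 nnu)).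
- by move=> a u v; rewrite pure_lin_l ml_linear slice_linear.
- by move=> a u v; rewrite ml_linear.
- move=> u; rewrite (le_trans (bS _))// -mulrA ler_wpM2l// mulrC; exact: rnorm_pure.
- by move=> u; rewrite -mulrA.
move=> _ [f [e ->]]; set d := ml (nu f) e; move: c.
apply: (@total_eq _ _ _ _ _ _ (M * rnorm d) (rnorm h * rnorm g * rnorm d) _ _ _ _ (@total_mul R CG)).
- by move=> a u v; rewrite pure_lin_r ml_linear slice_linear.
- move=> a u v; rewrite rl reg_coef_linear.
  exact: (hom_eval_linear d hnu).
- move=> u; rewrite (le_trans (bS _))// -mulrA ler_wpM2l//; exact: rnorm_pure.
- by move=> u; rewrite -mulrA [rnorm d * _]mulrC.
move=> _ [c [b ->]].
(* The vector $\nu(f)e\otimes cb$ lies in the range of the homomorphism [F] that is extended to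
   $w_G$, so $w_G$ can be moved inside to act on $f\otimes c$. *)
have -> : pure (T E CG) d (c ** b) = ml (F (pure (T A0 CG) f c)) (pure (T E CG) e b).
  by rewrite hom_tensor_pure ?mtensorP//; exact: membed_nondeg.
rewrite -mmulE (mextP nF) slice_hom.
have -> : rho (c ** b) g = rho c (rho b g) by case: rr => _ _ -> .
set v := rho b g.
have -> : slice rr v h (ml (wG T CG) (pure (T A0 CG) f c)) = (reg_coef h (rho c v) : A0) ** f.
  apply: C0_eq => s; rewrite slice_ev.
  rewrite (proj2 (ev_mext s _ _) (wG_ev T CG s)) ev_pure.
  rewrite (linearZf _ _ (ml_linear _)) (linearZf _ _ (rl v)) rU ipZl.
  by rewrite mulrC.
by case: hnu => _ -> _.
Qed.

End OneHom.

(* The slices of W by coefficients of the regular representation recover nu on a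
   total subset of C_0(G). *)
Lemma hom_wG_inj (nu nu' : A0 -> mult E) : nondeg_hom nu -> nondeg_hom nu' ->
  W nu = W nu' -> nu =1 nu'.
Proof.
move=> n n' WW.
apply: (hom_total_eq (proj1 n) (proj1 n') (reg_coef_total mu)).
move=> _ [f [g [cf [cg ->]]]]; apply: mult_eqml => d.
have tr : total [set y | exists a x, y = rho a x] by case: rr.
move: (l2 mu f); apply: (@total_eq _ _ _ _ _ _ (rnorm (l2 mu g) * rnorm d) (rnorm (l2 mu g) * rnorm d) _ _ _ _ tr).
- by move=> a u v; rewrite reg_coef_linear (hom_eval_linear d (proj1 n)).
- by move=> a u v; rewrite reg_coef_linear (hom_eval_linear d (proj1 n')).
- move=> u; rewrite (le_trans (rnorm_hom _ _ (proj1 n)))// mulrAC ler_wpM2r ?rnorm_ge0//.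
  exact: rnorm_reg_coef.
- move=> u; rewrite (le_trans (rnorm_hom _ _ (proj1 n')))// mulrAC ler_wpM2r ?rnorm_ge0//.
  exact: rnorm_reg_coef.
by move=> _ [c [x ->]]; rewrite -(slice_wG n) -(slice_wG n') WW.
Qed.

End Recovery.

Lemma nondeg_wG_inj {R : realType} (T : forall A B : cstarAlg R, min_tensor A B)
    {G : lcGroupType} {mu : haar R G} (CG : group_cstar mu) {E : cstarAlg R}
    (nu nu' : C0_cstar R G -> mult E) : nondeg_hom nu -> nondeg_hom nu' ->
  mext (hom_tensor T nu (@membed R CG)) (wG T CG) =
  mext (hom_tensor T nu' (@membed R CG)) (wG T CG) -> nu =1 nu'.
Proof.
by have [rho [rr rU]] := regrep_ex CG; exact: (hom_wG_inj rr rU).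
Qed.

(** * Covariant homomorphisms *)

Section HomRange.
Context {R : realType} {A D : cstarAlg R}.

(** [generates] quantifies over closed subsets; closedness here lets values in [D], rather than only
    in $M(D)$, be checked on generators. *)
Lemma hom_range_closed (pi : A -> mult D) : is_hom pi -> closed [set a | exists d, pi a = membed d].
Proof.
move=> hpi; have [lp _ _] := hpi; apply: closedP => a ah.
have pB x y : mnorm (pi x - pi y) <= rnorm (x - y).
  by rewrite -(linearBf _ _ lp); exact: hom_contract.
have [||d dP] := @approx_limit R D (fun e d => exists2 x, pi x = membed d & rnorm (a - x) < e) 1.
- by move=> e /ah[x [d xd] ax]; exists d, x.
- move=> e r v w e0 r0 [x xv ax] [y yw ay]; rewrite -mnorm_membed (linearBf _ _ (@membed_linear R D)).
  rewrite -xv -yw (le_trans (pB _ _))// mul1r.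
  by have := rnorm_tri a x y; rewrite (rnormB x a); lra.
exists d; apply: mult_eqml => u; apply: (@eps_eq _ _ (2 * rnorm u)) => e e0.
have [x [v xv] ax] := ah e e0.
have h1 : rnorm (v - d) <= 1 * e by apply: dP => //; exists x.
have h2 : rnorm (ml (pi a) u - ml (pi x) u) <= e * rnorm u.
  have -> : ml (pi a) u - ml (pi x) u = ml (pi a - pi x) u.
    by rewrite -[RHS]/(ml (pi a) u + -1 *: ml (pi x) u) scaleN1r.
  by rewrite (le_trans (rnorm_ml _ _))// ler_wpM2r ?rnorm_ge0// (le_trans (pB _ _))// ltW.
have h3 : rnorm (ml (pi x) u - d ** u) <= e * rnorm u.
  rewrite xv membedE -cs_mulBx (le_trans (cs_rnormM _ _))// ler_wpM2r ?rnorm_ge0//; lra.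
by rewrite membedE (le_trans (rnorm_tri (ml (pi x) u) _ _))// mulrA; lra.
Qed.

Lemma hom_eq_closed (pi rho : A -> mult D) : is_hom pi -> is_hom rho ->
  closed [set a | pi a = rho a].
Proof.
move=> hpi hrho; apply: closedP => a ah; apply: mult_eqml => u.
apply: (@eps_eq _ _ (2 * rnorm u)) => e e0; have [x /= xE ax] := ah e e0.
have d1 (nu : A -> mult D) : is_hom nu -> rnorm (ml (nu a) u - ml (nu x) u) <= e * rnorm u.
  move=> hnu; rewrite -(linearBf _ _ (hom_eval_linear u hnu)) (le_trans (rnorm_hom _ _ hnu))//.
  by rewrite ler_wpM2r ?rnorm_ge0// ltW.
have := rnorm_tri (ml (pi x) u) (ml (pi a) u) (ml (rho a) u).
have := d1 _ hpi; have := d1 _ hrho; rewrite -xE (rnormB (ml (pi x) u)); lra.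
Qed.

Lemma hom_generates_eq (S : set A) (pi rho : A -> mult D) : is_hom pi -> is_hom rho ->
  generates S -> (forall a, S a -> pi a = rho a) -> pi =1 rho.
Proof.
move=> hpi hrho gS h a; have [lp mp sp] := hpi; have [lr mr sr] := hrho.
suff : [set a | pi a = rho a] a by [].
rewrite (gS [set a | pi a = rho a])//.
- exact: hom_eq_closed.
- by move=> c x y /= xE yE; rewrite lp lr xE yE.
- by move=> x y /= xE yE; rewrite mp mr xE yE.
- by move=> x /= xE; rewrite sp sr xE.
Qed.

Lemma hom_range_generates (S : set A) (pi : A -> mult D) : is_hom pi ->
  generates S -> (forall a, S a -> exists d, pi a = membed d) ->
  forall a, exists d, pi a = membed d.
Proof.
move=> hpi gS h a; have [lp mp sp] := hpi.
suff : [set a | exists d, pi a = membed d] a by [].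
rewrite (gS [set a | exists d, pi a = membed d])//.
- exact: hom_range_closed.
- by move=> c x y /= [d xE] [d' yE]; exists (c *: d + d'); rewrite lp xE yE membed_linear.
- by move=> x y /= [d xE] [d' yE]; exists (d ** d'); rewrite mp xE yE membedM.
- by move=> x /= [d xE]; exists (cs_star d); rewrite sp xE membed_star.
Qed.

Lemma total_generates (S : set A) : total S -> S 0 -> generates S.
Proof.
move=> tS S0 B cB lB _ _ SB; apply/seteqP; split => // a _.
have : closure (lspan S) a by rewrite tS.
rewrite (iffLR (closure_id B) cB); by apply: closureS; apply: lspan_sub => //; exact: SB.
Qed.

Lemma ad_nondeg (w : mult D) (pi : A -> mult D) : is_unitary w -> nondeg_hom pi ->
  nondeg_hom (fun a => w * pi a * mstar w).
Proof.
move=> [uw wu] [[lp mp sp] tp]; split.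
  split=> [c x y|x y|x].
  - by rewrite lp mulrDr mulrDl; congr (_ + _); apply: mult_eqml => d;
      rewrite /= !(linearZf _ _ (ml_linear _)).
  - by rewrite mp !mulrA -[w * pi x * _ * w]mulrA uw mulr1.
  - by rewrite sp !mstarM mstarK mulrA.
apply: (total_trans (S := [set x | exists a d, x = ml w (ml (pi a) d)])).
  apply/totalP => x e e0.
  have [y yl xy] := proj1 (totalP _) tp (ml (mstar w) x) e e0.
  exists (ml w y).
    apply: (lspan_map (ml_linear w)) yl => _ [a [d ->]].
    by apply: lspan_in; exists a, d.
  have -> : x - ml w y = ml w (ml (mstar w) x - y).
    by rewrite (linearBf _ _ (ml_linear w)) -mmulE wu.
  by rewrite unitary_isometry.
move=> _ [a [d ->]] e e0; exists (ml w (ml (pi a) d)); last by rewrite subrr rnorm0.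
apply: lspan_in; exists a, (ml w d).
by rewrite !mmulE -[ml (mstar w) (ml w d)]mmulE uw.
Qed.

Lemma mext_ad (w : mult D) (pi : A -> mult D) (m : mult A) : is_unitary w -> nondeg_hom pi ->
  mext (fun a => w * pi a * mstar w) m = w * mext pi m * mstar w.
Proof.
move=> uw npi; apply: mext_uniq => [|a]; first exact: ad_nondeg.
have [h _] := uw; rewrite !mulrA -[_ * mstar w * w]mulrA h mulr1.
by rewrite -[w * mext pi m * pi a]mulrA mextP.
Qed.

End HomRange.

Section UnitaryHoms.
Context {R : realType} (T : forall A B : cstarAlg R, min_tensor A B).
Context {H : lcGroupType}.

(** Unitaries are isometric, so continuity of orbits passes from combinations of elementary tensors
    to uniform limits. *)
Lemma unitary_hom_tensor (A D : cstarAlg R) (U : H -> mult A) (V : H -> mult D) :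
  unitary_hom U -> unitary_hom V -> unitary_hom (fun t => mtensor T (U t) (V t)).
Proof.
move=> [UM uU cU] [VM uV cV].
have uT t : is_unitary (mtensor T (U t) (V t)) by exact: mtensor_unitary.
apply: unitary_hom_mr => // [s t|z]; first by rewrite mtensorM UM VM.
apply: uniform_limit_continuous => e e0.
have [y yl zy] := proj1 (totalP _) (pure_total (T A D)) z e e0.
exists (fun s => ml (mtensor T (U s) (V s)) y); last first.
  by move=> s; rewrite -(linearBf _ _ (ml_linear _)) unitary_isometry// ltW.
clear zy; move: y yl; apply: lspan_sub.
- under eq_fun do rewrite (linear0f (ml_linear _)); move=> s; exact: cvg_cst.
- move=> a x y cx cy; under eq_fun do rewrite ml_linear.
  by move=> s; apply: cvgD; [apply: cvgZr; exact: cx|exact: cy].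
move=> _ [a [d ->]]; under eq_fun do rewrite mtensorP.
apply/ncontP => s e' e'0.
have [/ncontP ca _] := cU a; have [/ncontP cd _] := cV d.
have d1 : 0 < rnorm d + 1 by rewrite ltr_wpDl// rnorm_ge0.
have a1 : 0 < rnorm a + 1 by rewrite ltr_wpDl// rnorm_ge0.
have e2 : 0 < e' / 2 by rewrite divr_gt0.
apply: filterS (filterI (ca s _ (divr_gt0 e2 d1)) (cd s _ (divr_gt0 e2 a1))) => t [/= h1 h2].
rewrite (le_lt_trans (rnorm_tri (pure (T A D) (ml (U s) a) (ml (V t) d)) _ _))//.
rewrite -pureBl -pureBr [ltRHS]splitr ltrD//.
  rewrite (le_lt_trans (rnorm_pure _ _ _))// unitary_isometry//.
  rewrite (@le_lt_trans _ _ (rnorm (ml (U t) a - ml (U s) a) * (rnorm d + 1)))//.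
    by rewrite ler_wpM2l ?rnorm_ge0// lerDl.
  by rewrite -ltr_pdivlMr.
rewrite (le_lt_trans (rnorm_pure _ _ _))// unitary_isometry// mulrC.
rewrite (@le_lt_trans _ _ (rnorm (ml (V t) d - ml (V s) d) * (rnorm a + 1)))//.
  by rewrite ler_wpM2l ?rnorm_ge0// lerDl.
by rewrite -ltr_pdivlMr.
Qed.

Lemma unitary_hom_mext (A D : cstarAlg R) (pi : A -> mult D) (U : H -> mult A) :
  nondeg_hom pi -> unitary_hom U -> unitary_hom (fun t => mext pi (U t)).
Proof.
move=> npi [UM uU cU]; have hpi := proj1 npi.
have uT t : is_unitary (mext pi (U t)) by exact: mext_unitary.
apply: unitary_hom_mr => // [s t|z]; first by rewrite UM mextM.
apply: uniform_limit_continuous => e e0.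
have [y yl zy] := proj1 (totalP _) (proj2 npi) z e e0.
exists (fun s => ml (mext pi (U s)) y); last first.
  by move=> s; rewrite -(linearBf _ _ (ml_linear _)) unitary_isometry// ltW.
clear zy; move: y yl; apply: lspan_sub.
- under eq_fun do rewrite (linear0f (ml_linear _)); move=> s; exact: cvg_cst.
- move=> a x y cx cy; under eq_fun do rewrite ml_linear.
  by move=> s; apply: cvgD; [apply: cvgZr; exact: cx|exact: cy].
move=> _ [a [d ->]].
have -> : (fun s => ml (mext pi (U s)) (ml (pi a) d)) = fun s => ml (pi (ml (U s) a)) d.
  by apply/funext => s; rewrite -mmulE mextP.
apply/ncontP => s e' e'0; have [/ncontP ca _] := cU a.
have d1 : 0 < rnorm d + 1 by rewrite ltr_wpDl// rnorm_ge0.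
apply: filterS (ca s _ (divr_gt0 e'0 d1)) => t /= h.
rewrite -(linearBf _ _ (hom_eval_linear d hpi)) (le_lt_trans (rnorm_hom _ _ hpi))//.
rewrite (@le_lt_trans _ _ (rnorm (ml (U t) a - ml (U s) a) * (rnorm d + 1)))//.
  by rewrite ler_wpM2l ?rnorm_ge0// lerDl.
by rewrite -ltr_pdivlMr.
Qed.

Lemma unitary_hom_comp (G : lcGroupType) (D : cstarAlg R) (U : G -> mult D) (phi : H -> G) :
  (forall s t, phi (s * t)%g = (phi s * phi t)%g) -> continuous phi ->
  unitary_hom U -> unitary_hom (fun t => U (phi t)).
Proof.
move=> phiM cphi [UM uU cU]; apply: unitary_hom_mr => // [s t|d].
  by rewrite phiM UM.
move=> s; apply: (@continuous_comp _ _ _ phi (fun s => ml (U s) d)); first exact: cphi.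
by have [c _] := cU d; exact: c.
Qed.

End UnitaryHoms.

(** * Covariance for the action and for the coaction *)

Section Covariance.
Context {R : realType} (T : forall A B : cstarAlg R, min_tensor A B).
Context {H G : lcGroupType} {muH : haar R H} {muG : haar R G}.
Context (CH : group_cstar muH) (CG : group_cstar muG) (phi : H -> G).
Hypotheses (phiM : forall s t : H, phi (s * t)%g = (phi s * phi t)%g)
  (phi_continuous : continuous phi).
Local Notation A0 := (C0_cstar R G).
Local Notation delta := (assoc_coaction T CH CG phi).

Let phiU : unitary_hom (fun t => gunit CG (phi t)).
Proof. exact: unitary_hom_comp (gunit_hom CG). Qed.

Lemma assoc_coaction_nondeg : nondeg_hom delta /\
  forall t, mext delta (gunit CH t) = mtensor T (gunit CH t) (gunit CG (phi t)).
Proof.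
have [nd dE] := integratedP CH (unitary_hom_tensor T (gunit_hom CH) (gunit_hom CH)).
have [np pE] := integratedP CH phiU.
have nG := hom_tensor_nondeg T (@membed_nondeg R CH) np.
split=> [|t]; first exact: (mext_comp_hom nd nG).
have -> : mext delta (gunit CH t) =
    mext (hom_tensor T (@membed R CH) (pi_phi CH CG phi)) (mext (delta_group T CH) (gunit CH t)).
  exact: (mext_comp (gunit CH t) nd nG).
by rewrite dE mext_hom_tensor//; [rewrite mext_id pE|exact: membed_nondeg].
Qed.

Context {D : cstarAlg R} (nu : A0 -> mult D) (nnu : nondeg_hom nu).
Local Notation F := (hom_tensor T nu (@membed R CG)).
Local Notation W := (mext F (wG T CG)).

Let nF : nondeg_hom F := hom_tensor_nondeg T nnu (@membed_nondeg R CG).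

Let W_unitary : is_unitary W.
Proof. exact: (mext_unitary nF (wG_unitary T CG)). Qed.

(* Both homomorphisms in the covariance condition are nondegenerate, hence
   determined by their values on the group elements. *)
Lemma coaction_covariantP (pi : CH -> mult D) : nondeg_hom pi ->
  coaction_covariant T CG delta pi nu <->
  forall t, W * mtensor T (mext pi (gunit CH t)) 1 * mstar W =
    mtensor T (mext pi (gunit CH t)) (gunit CG (phi t)).
Proof.
move=> npi; have [nd dE] := assoc_coaction_nondeg.
have nP := hom_tensor_nondeg T npi (@membed_nondeg R CG).
have n1 := ad_nondeg W_unitary (mtensorl_nondeg T (B := CG) npi).
have n2 := mext_comp_hom nd nP.
have E1 t : mext (fun c => W * mtensor T (pi c) 1 * mstar W) (gunit CH t) =
    W * mtensor T (mext pi (gunit CH t)) 1 * mstar W.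
  rewrite (mext_ad (gunit CH t) W_unitary (mtensorl_nondeg T (B := CG) npi)).
  by rewrite mext_mtensorl.
have E2 t : mext (mext (hom_tensor T pi (@membed R CG)) \o delta) (gunit CH t) =
    mtensor T (mext pi (gunit CH t)) (gunit CG (phi t)).
  rewrite mext_comp// dE mext_hom_tensor//; last exact: membed_nondeg.
  by rewrite mext_id.
split=> [[_ _ cov] t|h].
  rewrite -E1 -E2; congr (mext _ _); apply/funext => c; exact: cov.
split=> // c.
have hU := unitary_hom_tensor T (unitary_hom_mext npi (gunit_hom CH)) phiU.
apply: (@nondeg_gunit_uniq _ _ _ CH _ _ hU _ _ n1 n2) => // t.
by rewrite E1 h.
Qed.

(** Stated for one [t] and an arbitrary unitary [u], so as to apply both to [iH t] and to the
    unitaries obtained from [jCH]. Both directions rearrange $VWV^{*}=(1\otimes\phi(t)^{*})W$; only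
    the passage from this back to $\nu$ uses [nondeg_wG_inj]. *)
Lemma wG_covariant (t : H) (u : mult D) : is_unitary u ->
  W * mtensor T u 1 * mstar W = mtensor T u (gunit CG (phi t)) <->
  forall f, nu (assoc_action phi t f) = u * nu f * mstar u.
Proof.
move=> uu; have [[h1 h2] [gM gU _]] := (uu, gunit_hom CG).
set r := phi t; have [g1 g2] := gU r; have [w1 w2] := W_unitary.
pose V := mtensor T u (1 : mult CG).
have uV : is_unitary V.
  by apply: mtensor_unitary => //; split; rewrite mstar1 mulr1.
have [v1 v2] := uV.
have n1 := ad_nondeg uu nnu.
have n2 := mext_comp_hom (ltm_nondeg r) nnu.
have W1 : mext (hom_tensor T (fun f => u * nu f * mstar u) (@membed R CG)) (wG T CG) =
    V * W * mstar V.
  rewrite -(mext_ad (wG T CG) uV nF); congr (mext _ _); apply/esym.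
  apply: (hom_tensor_uniq n1 (@membed_nondeg R CG)); first by case: (ad_nondeg uV nF).
  move=> f c; rewrite hom_tensor_pure//; last exact: membed_nondeg.
  by rewrite /V mtensor_star !mtensorM mstar1 mul1r mulr1.
have W2 : mext (hom_tensor T (mext nu \o ltm r) (@membed R CG)) (wG T CG) =
    mtensor T 1 (mstar (gunit CG r)) * W.
  have nL := hom_tensor_nondeg T (ltm_nondeg r) (@membed_nondeg R CG).
  have -> : hom_tensor T (mext nu \o ltm r) (@membed R CG) =
      mext F \o hom_tensor T (ltm r) (@membed R CG).
    apply/esym/(hom_tensor_uniq n2 (@membed_nondeg R CG)).
      by case: (mext_comp_hom nL nF).
    move=> f c /=; rewrite hom_tensor_pure; [|exact: ltm_nondeg|exact: membed_nondeg].
    by rewrite mext_hom_tensor ?mext_id//; exact: membed_nondeg.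
  rewrite mext_comp// wG_lt (mextM nF) mext_hom_tensor//; last exact: membed_nondeg.
  by rewrite (mext1 nnu) mext_id.
have g1' : mtensor T (1 : mult D) (mstar (gunit CG r)) * mtensor T u (gunit CG r) = V.
  by rewrite mtensorM mul1r g1.
have g2' : mtensor T (1 : mult D) (gunit CG r) * mtensor T 1 (mstar (gunit CG r)) = 1.
  by rewrite mtensorM mul1r g2 mtensor1.
have g3' : mtensor T (1 : mult D) (gunit CG r) * V = mtensor T u (gunit CG r).
  by rewrite mtensorM mul1r mulr1.
split=> [h f|h].
  have WW : V * W * mstar V = mtensor T 1 (mstar (gunit CG r)) * W.
    have {}h : W * V = mtensor T u (gunit CG r) * W.
      by rewrite -h -!mulrA w1 mulr1.
    have -> : V * W = mtensor T 1 (mstar (gunit CG r)) * (W * V) by rewrite h mulrA g1'.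
    by rewrite -!mulrA v2 mulr1.
  rewrite -[RHS](@nondeg_wG_inj _ T _ _ CG _ (mext nu \o ltm r) _ n2 n1) ?W1 ?W2//=.
  by rewrite /ltm mext_membed.
have E : (fun f => u * nu f * mstar u) = mext nu \o ltm r.
  by apply/funext => f; rewrite /= /ltm mext_membed// -h.
have WW : V * W * mstar V = mtensor T 1 (mstar (gunit CG r)) * W by rewrite -W1 -W2 E.
have {}WW : mtensor T u (gunit CG r) * W = W * V.
  rewrite -g3' -mulrA.
  have -> : V * W = mtensor T 1 (mstar (gunit CG r)) * W * V by rewrite -WW -!mulrA v1 mulr1.
  by rewrite !mulrA g2' mul1r.
by rewrite -[mtensor T u 1]/V -WW -mulrA w2 mulr1.
Qed.

End Covariance.

Theorem theoremA1 (R : realType) (T : forall A B : cstarAlg R, min_tensor A B)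
    (H G : lcGroupType) (muH : haar R H) (muG : haar R G)
    (CH : group_cstar muH) (CG : group_cstar muG)
    (phi : H -> G)
    (phiM : forall s t : H, phi (s * t)%g = (phi s * phi t)%g)
    (phi_continuous : continuous phi)
    (B : cstarAlg R) (iC0 : C0_cstar R G -> mult B) (iH : H -> mult B)
    (B_crossed : is_crossed_product CH (assoc_action phi) iC0 iH)
    (E : cstarAlg R) (jCH : CH -> mult E) (jG : C0_cstar R G -> mult E)
    (E_crossed : is_coaction_crossed_product T CG (assoc_coaction T CH CG phi) jCH jG) :
  exists theta : B -> E,
    [/\ star_iso theta,
        forall f : C0_cstar R G, mext (@membed R E \o theta) (iC0 f) = jG f &
        forall c : CH, mext (@membed R E \o theta) (integrated CH iH c) = jCH c].
Proof.
have [[niC0 uiH icov] Buniv Bprod Btotal] := B_crossed.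
have [jcov Euniv Eprod Egen] := E_crossed.
have [njCH njG _] := jcov.
have [nI IE] := integratedP CH uiH.
have [Phi [nPhi [PhiCH PhiG]]] : exists Phi : E -> mult B, nondeg_hom Phi /\
    (forall c, mext Phi (jCH c) = integrated CH iH c) /\ (forall f, mext Phi (jG f) = iC0 f).
  apply: Euniv; apply: (proj2 (coaction_covariantP T CG phiM phi_continuous niC0 nI)) => t.
  rewrite IE; apply: (proj2 (wG_covariant T CG phi niC0 t _)); first by case: uiH.
  by move=> f; exact: icov.
(* Totality is weakened to generation so that both crossed products can be handled by the same
   lemmas. *)
have Bgen : generates [set b | exists a c, membed b = iC0 a * integrated CH iH c].
  apply: total_generates Btotal _; exists 0, 0; have [lC0 _ _] := proj1 niC0.
  by rewrite (linear0f lC0) mul0r (linear0f (@membed_linear R B)).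
have uU := unitary_hom_mext njCH (gunit_hom CH).
have [Psi [nPsi [PsiC0 PsiH]]] : exists Psi : B -> mult E, nondeg_hom Psi /\
    (forall f, mext Psi (iC0 f) = jG f) /\
    (forall t, mext Psi (iH t) = mext jCH (gunit CH t)).
  apply: Buniv; split=> // t f; have [_ uU' _] := uU.
  apply: (proj1 (wG_covariant T CG phi njG t (uU' t))).
  exact: (proj1 (coaction_covariantP T CG phiM phi_continuous njG njCH) jcov).
(* Universality of [B] gives values on group elements only; uniqueness of integrated forms upgrades
   them to $C^*(H)$. *)
have PsiCH c : mext Psi (integrated CH iH c) = jCH c.
  apply: (@nondeg_gunit_uniq _ _ _ CH _ _ uU _ _ (mext_comp_hom nI nPsi) njCH) => // t.
  by rewrite mext_comp// IE.
have hPhi := proj1 nPhi; have hPsi := proj1 nPsi.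
(* Universality yields a map into $M(E)$; that it lands in [E] is checked on the generators of
   [B]. *)
have /choice[theta thetaE] : forall b, exists e, Psi b = membed e.
  apply: (hom_range_generates hPsi Bgen) => b [f [c bE]].
  rewrite -(mext_membed nPsi) bE (mextM nPsi) PsiC0 PsiCH.
  have [_ _ sG] := proj1 njG; have [_ _ sC] := proj1 njCH.
  (* The image of a generator is $j_G(f)$ times the image of $c$, while [Eprod] covers the opposite
     order; passing to adjoints exchanges the factors. *)
  have [e eE] := Eprod (cs_star c) (cs_star f); exists (cs_star e).
  by rewrite membed_star -eE sG sC mstarM !mstarK.
have /choice[theta' thetaE'] : forall e, exists b, Phi e = membed b.
  apply: (hom_range_generates hPhi Egen) => e [c [f eE]].
  rewrite -(mext_membed nPhi) eE (mextM nPhi) PhiG PhiCH.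
  have [_ _ sG] := proj1 niC0; have [_ _ sC] := proj1 nI.
  have [b bE] := Bprod (cs_star f) (cs_star c); exists (cs_star b).
  by rewrite membed_star -bE sG sC mstarM !mstarK.
have PsiE : @membed R E \o theta = Psi by apply/funext => b; rewrite /= thetaE.
have [lPsi mPsi sPsi] := hPsi.
exists theta; rewrite PsiE; split => //; split.
- by move=> a x y; apply: membed_inj; rewrite membed_linear -!thetaE lPsi.
- by move=> x y; apply: membed_inj; rewrite membedM -!thetaE mPsi.
- by move=> x; apply: membed_inj; rewrite membed_star -!thetaE sPsi.
(* Each composite is compared with the canonical embedding into multipliers, as two homomorphisms
   that agree on generators. *)
exists theta' => [b|e]; apply: membed_inj.
- rewrite -thetaE' -(mext_membed nPhi) -thetaE; move: b.
  apply: (hom_generates_eq (proj1 (mext_comp_hom nPsi nPhi)) (proj1 (@membed_nondeg R B))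
    Bgen) => b [f [c bE]] /=.
  by rewrite -(mext_membed nPsi) bE (mextM nPsi) (mextM nPhi) PsiC0 PsiCH PhiG PhiCH.
- rewrite -thetaE -(mext_membed nPsi) -thetaE'; move: e.
  apply: (hom_generates_eq (proj1 (mext_comp_hom nPhi nPsi)) (proj1 (@membed_nondeg R E))
    Egen) => e [c [f eE]] /=.
  by rewrite -(mext_membed nPhi) eE (mextM nPhi) (mextM nPsi) PhiG PhiCH PsiC0 PsiCH.
Qed.
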